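(* Let $(M,g,K)$ be a smooth physical initial data set in a spacetime, satisfying the dominant energy condition, and let $\Omega\subset M$ be compact, diffeomorphic to a closed $3$-ball, with boundary $\Sigma=\partial\Omega$. Let $\tau$ be an admissible Wang--Yau time function on $\Sigma$ which is minimizing, i.e. $E_{\rm WY}(\Sigma,\tau)=\inf_{\tau'\in\mathcal A(\Sigma)}E_{\rm WY}(\Sigma,\tau')$, and let $(\widehat\Omega,\widehat g)$ be the corresponding Jang fill-in over $\Omega$. Let $U$ be the unique positive solution of $$-8\Delta_{\widehat g}U+R_{\widehat g}U=0\ \text{ in }\widehat\Omega,\qquad U=1\ \text{ on }\partial\widehat\Omega,$$ and define $g_{\rm sf}:=U^4\widehat g$. Then $R_{g_{\rm sf}}=0$ and $$E_{\rm WY}(\Sigma,\tau)\ \ge\ m_{\rm BY}(\partial\widehat\Omega;\widehat\Omega,g_{\rm sf}).$$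
   Context: **Spacetime and initial data.** $(\mathcal M,\mathbf g)$ is a smooth time-oriented Lorentzian $4$-manifold of signature $(-,+,+,+)$ with Levi-Civita connection $\nabla^{\mathbf g}$. A physical initial data set $(M,g,K)$ is a spacelike hypersurface $M\subset\mathcal M$ with induced metric $g$ and second fundamental form $K(Y,Z)=\mathbf g(\nabla^{\mathbf g}_Yn,Z)$, $n$ the future unit normal. Define $\mu,J$ by $R(g)-|K|_g^2+(\mathrm{tr}_gK)^2=2\mu$ and $\operatorname{div}_gK-d(\mathrm{tr}_gK)=J$ (the constraint equations); the dominant energy condition is $\mu\ge|J|_g$. $\sigma$ is the induced metric on $\Sigma$, with Gauss curvature $K_\sigma$ and area form $d\mu_\sigma$. $\mathbf H=\sum_a(\nabla^{\mathbf g}_{e_a}e_a)^\perp$ is the mean curvature vector of $\Sigma$ in $\mathcal M$ ($\{e_a\}$ a tangent orthonormal frame), assumed spacelike. Mean curvatures of boundaries are traces of $A(Y,Z)=\langle\nabla_Y\nu,Z\rangle$, $\nu$ the outward unit normal. **Jang fill-in.** Given $\tau\in C^\infty(\Sigma)$, let $f\in C^\infty(\Omega)$ with $f|_\Sigma=\tau$ solve Jang's equation $$\Big(g^{ij}-\frac{f^if^j}{1+|\nabla f|_g^2}\Big)\Big(\frac{\nabla_i\nabla_jf}{\sqrt{1+|\nabla f|_g^2}}-K_{ij}\Big)=0\quad\text{in }\Omega.$$ The Jang fill-in $\widehat\Omega$ is the graph of $f$ in $(\Omega\times\mathbb R,g+dt^2)$, with induced metric $\widehat g=g+df\otimes df$;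 $\widehat\Sigma=\partial\widehat\Omega$ has induced metric $\widehat\sigma=\sigma+d\tau\otimes d\tau$. **Gauges.** Set $a=\sqrt{1+|\nabla\tau|_\sigma^2}$. Let $e_3$ be the outward unit normal of $\Sigma$ in $\Omega$ and $e_4=n|_\Sigma$. For $\varphi\in C^\infty(\Sigma)$ the boosted frame is $e_3'=\cosh\varphi\,e_3+\sinh\varphi\,e_4$, $e_4'=\sinh\varphi\,e_3+\cosh\varphi\,e_4$. Put $\alpha_{e_3'}(Y)=\mathbf g(\nabla^{\mathbf g}_Ye_3',e_4')$ and $$h(\tau,e_3')=-a\,\mathbf g(\mathbf H,e_3')-\alpha_{e_3'}(\nabla\tau).$$ The Jang gauge is the boost with $\sinh\varphi=-e_3(f)/a$. The canonical gauge $e_3^{\rm can}$ is the boosted frame minimizing $\int_\Sigma h(\tau,e_3')\,d\mu_\sigma$ over all $\varphi$; its existence is part of the standing framework. **Admissible time functions.** $\tau\in C^\infty(\Sigma)$ is admissible ($\tau\in\mathcal A(\Sigma)$) if: (1) $K_\sigma+\det_\sigma(\nabla^2_\sigma\tau)/(1+|\nabla\tau|_\sigma^2)>0$ on $\Sigma$ (equivalently $\widehat\sigma$ has positive Gauss curvature); (2) $\Sigma$ bounds a compact spacelike hypersurface $\Omega$ for which Jang's equation with boundary value $\tau$ has a smooth solution; (3) $h(\tau,e_3')>0$ for the Jang gauge $e_3'$. **Wang--Yau energy.** Let $T_0\in\mathbb R^{1,3}$ be a constant future unit timelike vector. For admissible $\tau$ let $\widehat i_0:(\Sigma,\widehat\sigma)\to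 T_0^\perp\simeq\mathbb R^3$ be the isometric embedding (unique up to rigid motion) and $i_0=\widehat i_0+\tau T_0$, an isometric embedding of $(\Sigma,\sigma)$ in $\mathbb R^{1,3}$ with mean curvature vector $\mathbf H_0$. Its canonical normal frame is $e_{30}$ = outward Euclidean unit normal of $\widehat i_0(\Sigma)$, $e_{40}=(T_0+\nabla\tau)/a$. Then $$8\pi E_{\rm WY}(\Sigma,\tau)=\int_\Sigma\big(-a\langle\mathbf H_0,e_{30}\rangle_\eta-\langle\nabla^\eta_{\nabla\tau}e_{30},e_{40}\rangle_\eta\big)d\mu_\sigma-\int_\Sigma h(\tau,e_3^{\rm can})\,d\mu_\sigma .$$ **Brown--York mass.** For a compact Riemannian $3$-manifold $(N,\bar g)$ whose boundary metric $\bar\sigma$ is a sphere metric of positive Gauss curvature, $m_{\rm BY}(\partial N;N,\bar g)=\frac1{8\pi}\int_{\partial N}(k_0-k)\,dA_{\bar\sigma}$, where $k$ is the mean curvature of $\partial N$ in $(N,\bar g)$ and $k_0$ the mean curvature of the isometric embedding of $(\partial N,\bar\sigma)$ in $\mathbb R^3$, both with respect to outward normals. *)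

(* Defs.v *)
From HB Require Import structures.
From mathcomp Require Import all_boot all_order all_algebra.
From mathcomp Require Import all_classical all_reals all_analysis.
Set Implicit Arguments.
Unset Strict Implicit.
Unset Printing Implicit Defensive.
Import Order.TTheory GRing.Theory Num.Theory.
Import numFieldNormedType.Exports.
Local Open Scope classical_set_scope.
Local Open Scope ring_scope.

(* Tensor fields are given by their components in coordinates.  A metric on
   (a part of) R^n is a field of Gram matrices G : 'rV_n -> 'M_n; vectors are
   row vectors, and 'J F x has as rows the coordinate vector fields
   d_1 F, ..., d_m F of a map F : R^m -> R^n. *)

Section Calculus.
Context {R : realType}.

Definition pd n (j : 'I_n) (f : 'rV[R]_n -> R) : 'rV[R]_n -> R :=
  fun x => 'D_(delta_mx 0 j) f x.

Definition drow n (f : 'rV[R]_n -> R) (x : 'rV[R]_n) : 'rV[R]_n :=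
  \row_j pd j f x.

Fixpoint Ck (k n : nat) (U : set 'rV[R]_n) (f : 'rV[R]_n -> R) : Prop :=
  (forall x, U x -> {for x, continuous f}) /\
  match k with
  | 0%N => True
  | k'.+1 => forall j : 'I_n,
      (forall x, U x -> derivable f x (delta_mx 0 j)) /\ Ck k' U (pd j f)
  end.

(* C^infinity on an open set U *)
Definition smooth n (U : set 'rV[R]_n) (f : 'rV[R]_n -> R) : Prop :=
  forall k, Ck k U f.

(* For A the closed ball this is smoothness up to the boundary: every function
   smooth up to the boundary has a smooth extension, whose derivatives on A do
   not depend on the extension. *)
Definition smooth_near n (A : set 'rV[R]_n) (f : 'rV[R]_n -> R) : Prop :=
  exists U, [/\ open U, A `<=` U & smooth U f].

Definition coshR (x : R) : R := (expR x + expR (- x)) / 2.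
Definition sinhR (x : R) : R := (expR x - expR (- x)) / 2.

Definition sqn n (x : 'rV[R]_n) : R := \sum_j x 0 j ^+ 2.
Definition sphere : set 'rV[R]_3 := [set x | sqn x = 1].
Definition cball : set 'rV[R]_3 := [set x | sqn x <= 1].

End Calculus.

Section Metrics.
Context {R : realType}.

Definition posdef n (A : 'M[R]_n) : Prop :=
  A^T = A /\ forall v : 'rV[R]_n, v != 0 -> 0 < (v *m A *m v^T) 0 0.

Definition ip n (A : 'M[R]_n) (v w : 'rV[R]_n) : R := (v *m A *m w^T) 0 0.

Variables (n : nat) (G : 'rV[R]_n -> 'M[R]_n).

Definition ginv (x : 'rV[R]_n) : 'M[R]_n := invmx (G x).

(* Gamma^k_{ij} *)
Definition christoffel (k i j : 'I_n) (x : 'rV[R]_n) : R :=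
  2^-1 * \sum_l ginv x k l *
    (pd i (fun y => G y j l) x + pd j (fun y => G y i l) x
     - pd l (fun y => G y i j) x).

(* R^l_{kij}, where R(d_i, d_j) d_k = R^l_{kij} d_l *)
Definition riemann (l k i j : 'I_n) (x : 'rV[R]_n) : R :=
  pd i (christoffel l j k) x - pd j (christoffel l i k) x
  + \sum_m (christoffel l i m x * christoffel m j k x
            - christoffel l j m x * christoffel m i k x).

Definition ricci (k j : 'I_n) (x : 'rV[R]_n) : R := \sum_i riemann i k i j x.

Definition scal (x : 'rV[R]_n) : R :=
  \sum_k \sum_j ginv x k j * ricci k j x.

Definition grad (f : 'rV[R]_n -> R) (x : 'rV[R]_n) : 'rV[R]_n :=
  drow f x *m ginv x.

Definition gradsq (f : 'rV[R]_n -> R) (x : 'rV[R]_n) : R :=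
  ip (ginv x) (drow f x) (drow f x).

Definition hess (f : 'rV[R]_n -> R) (x : 'rV[R]_n) : 'M[R]_n :=
  \matrix_(i, j) (pd i (pd j f) x - \sum_k christoffel k i j x * pd k f x).

Definition laplacian (f : 'rV[R]_n -> R) (x : 'rV[R]_n) : R :=
  \tr (ginv x *m hess f x).

Definition trg (A : 'rV[R]_n -> 'M[R]_n) (x : 'rV[R]_n) : R :=
  \tr (ginv x *m A x).

(* (nabla_k A)_{ij} *)
Definition covT (A : 'rV[R]_n -> 'M[R]_n) (k i j : 'I_n) (x : 'rV[R]_n) : R :=
  pd k (fun y => A y i j) x
  - \sum_l (christoffel l k i x * A x l j + christoffel l k j x * A x i l).

Definition divT (A : 'rV[R]_n -> 'M[R]_n) (x : 'rV[R]_n) : 'rV[R]_n :=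
  \row_j \sum_k \sum_i ginv x k i * covT A k i j x.

(* covariant derivative of a vector field V along F : R^m -> (R^n, G);
   row a is nabla_{d_a} V *)
Definition cov m (F V : 'rV[R]_m -> 'rV[R]_n) (x : 'rV[R]_m) : 'M[R]_(m, n) :=
  \matrix_(a, k) ('J V x a k
    + \sum_i \sum_j christoffel k i j (F x) * 'J F x a i * V x 0 j).

Definition induced m (F : 'rV[R]_m -> 'rV[R]_n) (x : 'rV[R]_m) : 'M[R]_m :=
  'J F x *m G (F x) *m ('J F x)^T.

Definition normal_part m (F : 'rV[R]_m -> 'rV[R]_n) (x : 'rV[R]_m)
    (v : 'rV[R]_n) : 'rV[R]_n :=
  v - v *m G (F x) *m ('J F x)^T *m invmx (induced F x) *m 'J F x.

(* A(d_a, d_b) = < nabla_{d_a} N, d_b F > *)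
Definition second_form m (F N : 'rV[R]_m -> 'rV[R]_n) (x : 'rV[R]_m) :
    'M[R]_m :=
  cov F N x *m G (F x) *m ('J F x)^T.

Definition mean_curv m (F N : 'rV[R]_m -> 'rV[R]_n) (x : 'rV[R]_m) : R :=
  \tr (invmx (induced F x) *m second_form F N x).

Definition mean_curv_vec m (F : 'rV[R]_m -> 'rV[R]_n) (x : 'rV[R]_m) :
    'rV[R]_n :=
  \sum_a \sum_b invmx (induced F x) a b *:
    normal_part F x (row a (cov F (fun y => row b ('J F y)) x)).

(* unit normal of a level set of rho, on the side where rho increases *)
Definition conormal (rho : 'rV[R]_n -> R) (x : 'rV[R]_n) : 'rV[R]_n :=
  (Num.sqrt (gradsq rho x))^-1 *: grad rho x.

(* mu and J of the constraint equations, for (G, K) *)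
Definition energy_density (K : 'rV[R]_n -> 'M[R]_n) (x : 'rV[R]_n) : R :=
  2^-1 * (scal x - \tr (ginv x *m K x *m ginv x *m (K x)^T) + trg K x ^+ 2).

Definition momentum_density (K : 'rV[R]_n -> 'M[R]_n) (x : 'rV[R]_n) :
    'rV[R]_n :=
  divT K x - drow (trg K) x.

Definition dominant_energy (K : 'rV[R]_n -> 'M[R]_n) (x : 'rV[R]_n) : Prop :=
  Num.sqrt (ip (ginv x) (momentum_density K x) (momentum_density K x))
    <= energy_density K x.

Definition jang_lhs (K : 'rV[R]_n -> 'M[R]_n) (f : 'rV[R]_n -> R)
    (x : 'rV[R]_n) : R :=
  let W := 1 + gradsq f x in
  \sum_i \sum_j (ginv x i j - grad f x 0 i * grad f x 0 j / W) *
    (hess f x i j / Num.sqrt W - K x i j).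

(* metric of the graph of f in (R^n x R, G + dt^2) *)
Definition graph_metric (f : 'rV[R]_n -> R) (x : 'rV[R]_n) : 'M[R]_n :=
  G x + (drow f x)^T *m drow f x.

(* For a spacelike surface F in (R^n, G), a function t on it and a normal frame
   (E3, E4): - sqrt (1 + |grad t|^2) <H, E3> - < nabla_{grad t} E3, E4 > *)
Definition h_density m (F : 'rV[R]_m -> 'rV[R]_n) (t : 'rV[R]_m -> R)
    (E3 E4 : 'rV[R]_m -> 'rV[R]_n) (u : 'rV[R]_m) : R :=
  let dt := drow t u in
  let si := invmx (induced F u) in
  - Num.sqrt (1 + ip si dt dt) * ip (G (F u)) (mean_curv_vec F u) (E3 u)
  - ip (G (F u)) (dt *m si *m cov F E3 u) (E4 u).

End Metrics.

(* Gauss curvature <R(d_1, d_2) d_2, d_1> / det G of a metric on R^2 *)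
Definition gauss_curv {R : realType} (G : 'rV[R]_2 -> 'M[R]_2)
    (u : 'rV[R]_2) : R :=
  (\sum_l riemann G l 1 0 1 u * G u l 0) / \det (G u).

Section Spacetime.
Context {R : realType}.

Definition minkowski : 'M[R]_4 :=
  diag_mx (\row_(i < 4) (if i == 0 then -1 else 1)).

(* Smooth time-oriented Lorentzian 4-manifold.  metric i p and tvec i p are the
   components at p, in chart i, of the metric and of a smooth timelike vector
   field defining the time orientation.  chart_at selects a chart around each
   point; the quantities evaluated in it below do not depend on the choice. *)
Record spacetime := Spacetime {
  pt :> topologicalType;
  chart : Type;
  dom : chart -> set pt;
  coord : chart -> pt -> 'rV[R]_4;
  uncoord : chart -> 'rV[R]_4 -> pt;
  chart_at : pt -> chart;
  metric : chart -> pt -> 'M[R]_4;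
  tvec : chart -> pt -> 'rV[R]_4;
  st_hausdorff : hausdorff_space pt;
  st_second_countable : @second_countable pt;
  chart_atP : forall p, dom (chart_at p) p;
  dom_open : forall i, open (dom i);
  coord_open : forall i, open (coord i @` dom i);
  coordK : forall i p, dom i p -> uncoord i (coord i p) = p;
  coord_continuous : forall i p, dom i p -> {for p, continuous (coord i)};
  uncoord_continuous : forall i x, (coord i @` dom i) x -> {for x, continuous (uncoord i)};
  transition_smooth : forall i j (A : 'I_4),
        smooth (coord i @` (dom i `&` dom j))
               (fun x => coord j (uncoord i x) 0 A);
  metric_lorentz : forall i p, dom i p ->
        exists2 P, P \in unitmx & P *m metric i p *m P^T = minkowski;
  metric_smooth : forall i (A B : 'I_4),
        smooth (coord i @` dom i) (fun x => metric i (uncoord i x) A B);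
  metric_transition : forall i j p, dom i p -> dom j p ->
        let D := 'J (coord j \o uncoord i) (coord i p) in
        metric i p = D *m metric j p *m D^T;
  tvec_timelike : forall i p, dom i p -> ip (metric i p) (tvec i p) (tvec i p) < 0;
  tvec_smooth : forall i (A : 'I_4),
        smooth (coord i @` dom i) (fun x => tvec i (uncoord i x) 0 A);
  tvec_transition : forall i j p, dom i p -> dom j p ->
        tvec j p = tvec i p *m 'J (coord j \o uncoord i) (coord i p)
}.

End Spacetime.
Arguments spacetime R : clear implicits.

Section Submanifolds.
Context {R : realType} (S : spacetime R).

Definition met (i : chart S) (x : 'rV[R]_4) : 'M[R]_4 := metric i (uncoord i x).

Definition smooth_map m (U : set 'rV[R]_m) (X : 'rV[R]_m -> S) : Prop :=
  (forall x, U x -> {for x, continuous X}) /\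
  forall i (A : 'I_4),
    smooth (U `&` X @^-1` dom i) (fun x => coord i (X x) 0 A).

Definition smooth_function (f : S -> R) : Prop :=
  forall i, smooth (coord i @` dom i) (f \o uncoord i).

Definition ind_metric m (X : 'rV[R]_m -> S) (x : 'rV[R]_m) : 'M[R]_m :=
  let i := chart_at (X x) in induced (met i) (coord i \o X) x.

Definition future_normal (X : 'rV[R]_3 -> S) (i : chart S) (x : 'rV[R]_3) :
    'rV[R]_4 :=
  let N := normal_part (met i) (coord i \o X) x (tvec i (X x)) in
  (Num.sqrt (- ip (metric i (X x)) N N))^-1 *: N.

Definition ind_second (X : 'rV[R]_3 -> S) (x : 'rV[R]_3) : 'M[R]_3 :=
  let i := chart_at (X x) in
  second_form (met i) (coord i \o X) (future_normal X i) x.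

Definition spacelike_immersion m (U : set 'rV[R]_m) (X : 'rV[R]_m -> S) :=
  [/\ open U, smooth_map U X & forall x, U x -> posdef (ind_metric X x)].

Definition halfspace : set 'rV[R]_3 := [set x | x 0 0 <= 0].

(* local parametrization, over U `&` [x_0 <= 0], of a spacelike hypersurface N
   with boundary B; interior points are covered by U inside [x_0 < 0] *)
Definition patch (N B : set S) (U : set 'rV[R]_3) (X : 'rV[R]_3 -> S) : Prop :=
  [/\ spacelike_immersion U X,
      {in U `&` halfspace &, injective X},
      (forall W, open W -> W `<=` U ->
         exists2 V, open V & X @` (W `&` halfspace) = N `&` V) &
      (forall x, U x -> halfspace x -> (B (X x) <-> x 0 0 = 0))].

Definition hypersurface (N B : set S) : Prop :=
  B `<=` N /\ forall p, N p ->
    exists U X x, [/\ patch N B U X, U x, halfspace x & X x = p].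

Definition dominant_energy_on (N : set S) : Prop :=
  forall U (X : 'rV[R]_3 -> S), spacelike_immersion U X -> X @` U `<=` N ->
  forall x, U x -> dominant_energy (ind_metric X) (ind_second X) x.

(* X restricts to a diffeomorphism of the closed unit ball onto X @` cball,
   a compact domain of N with boundary X @` sphere *)
Definition ball_in (N : set S) (X : 'rV[R]_3 -> S) : Prop :=
  [/\ exists U, cball `<=` U /\ spacelike_immersion U X,
      {in cball &, injective X} & X @` cball `<=` N].

End Submanifolds.

Section Sphere.
Context {R : realType}.

Definition rv2 (z : R * R) : 'rV[R]_2 :=
  \row_(i < 2) (if i == 0 then z.1 else z.2).

(* inverse stereographic projection from the north (c = true) or the south
   pole; the two charts cover the unit sphere *)
Definition stereo (c : bool) (u : 'rV[R]_2) : 'rV[R]_3 :=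
  \row_(k < 3)
    ((if k == 0 then 2 * u 0 0
      else if k == 1 then 2 * u 0 1
      else if c then sqn u - 1 else 1 - sqn u) / (sqn u + 1)).

(* Functions on the sphere are functions on R^3 of which only the restriction
   to the sphere is used. *)
Definition smooth_sphere (t : 'rV[R]_3 -> R) : Prop :=
  forall c, smooth setT (t \o stereo c).

Definition sphere_metric := bool -> 'rV[R]_2 -> 'M[R]_2.

(* integral over the sphere with respect to the area form of gam: one
   stereographic chart omits a single point *)
Definition sphere_int (gam : sphere_metric) (F : bool -> 'rV[R]_2 -> R) : R :=
  Rintegral (lebesgue_measure \x lebesgue_measure)%E setT
    (fun z : R * R => F true (rv2 z) * Num.sqrt (\det (gam true (rv2 z)))).

Definition euclid n : 'rV[R]_n -> 'M[R]_n := fun=> 1%:M.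

(* an isometric embedding of (S^2, gam) in R^3 together with its outward unit
   normal, the one pointing into the unbounded complementary component *)
Definition isometric_embedding (gam : sphere_metric)
    (e : ('rV[R]_3 -> 'rV[R]_3) * ('rV[R]_3 -> 'rV[R]_3)) : Prop :=
  let: (j, N) := e in
  [/\ (forall k : 'I_3, smooth_sphere (fun x => j x 0 k) /\
                        smooth_sphere (fun x => N x 0 k)),
      {in sphere &, injective j},
      (forall c u, induced (@euclid 3) (j \o stereo c) u = gam c u),
      (forall c u, sqn (N (stereo c u)) = 1 /\
         N (stereo c u) *m ('J (j \o stereo c) u)^T = 0) &
      (forall x, sphere x -> \forall t \near (0 : R)^'+,
         ~ bounded_set (connected_component (~` (j @` sphere))
                                            (j x + t *: N x)))].

(* the isometric embedding, with its outward normal *)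
Definition the_embedding (gam : sphere_metric) :
    ('rV[R]_3 -> 'rV[R]_3) * ('rV[R]_3 -> 'rV[R]_3) :=
  xget (fun=> 0, fun=> 0) [set e | isometric_embedding gam e].

(* Brown-York mass of the closed unit ball with the metric gb *)
Definition brown_york (gb : 'rV[R]_3 -> 'M[R]_3) : R :=
  let gam : sphere_metric := fun c => induced gb (stereo c) in
  let j := (the_embedding gam).1 in
  let N := (the_embedding gam).2 in
  (8 * pi)^-1 * sphere_int gam (fun c u =>
    mean_curv (@euclid 3) (j \o stereo c) (N \o stereo c) u
    - mean_curv gb (stereo c) (conormal gb (@sqn R 3) \o stereo c) u).

End Sphere.
Arguments sphere_metric R : clear implicits.

Section WangYau.
Context {R : realType} (S : spacetime R).

(* Vector field along Sigma: components in the ambient chart i at the point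
   with coordinate u in the stereographic chart c. *)
Definition sfield := bool -> chart S -> 'rV[R]_2 -> 'rV[R]_4.

(* Omega = X @` cball, Sigma = X @` sphere *)
Variable X : 'rV[R]_3 -> S.

Definition surf (c : bool) : 'rV[R]_2 -> S := X \o stereo c.

Definition sigma : sphere_metric R := fun c => ind_metric (surf c).

Definition mean_curvature_spacelike : Prop := forall c u,
  let i := chart_at (surf c u) in
  let H := mean_curv_vec (met i) (coord i \o surf c) u in
  0 < ip (metric i (surf c u)) H H.

Definition frame3 : sfield := fun c i u =>
  conormal (ind_metric X) (@sqn R 3) (stereo c u) *m 'J (coord i \o X) (stereo c u).
Definition frame4 : sfield := fun c i u => future_normal X i (stereo c u).

Definition boost3 (phi : 'rV[R]_3 -> R) (e3 e4 : sfield) : sfield :=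
  fun c i u => coshR (phi (stereo c u)) *: e3 c i u
             + sinhR (phi (stereo c u)) *: e4 c i u.
Definition boost4 (phi : 'rV[R]_3 -> R) (e3 e4 : sfield) : sfield :=
  fun c i u => sinhR (phi (stereo c u)) *: e3 c i u
             + coshR (phi (stereo c u)) *: e4 c i u.

(* h(tau, e3'), with e3', e4' the boost by phi of e3, e4 *)
Definition hfun (tau : 'rV[R]_3 -> R) (e3 e4 : sfield) (phi : 'rV[R]_3 -> R)
    (c : bool) (u : 'rV[R]_2) : R :=
  let i := chart_at (surf c u) in
  h_density (met i) (coord i \o surf c) (tau \o stereo c)
    (boost3 phi e3 e4 c i) (boost4 phi e3 e4 c i) u.

(* sigma + d tau (x) d tau *)
Definition sigma_hat (tau : 'rV[R]_3 -> R) : sphere_metric R :=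
  fun c => graph_metric (sigma c) (tau \o stereo c).

Definition slope (tau : 'rV[R]_3 -> R) (c : bool) (u : 'rV[R]_2) : R :=
  Num.sqrt (1 + gradsq (sigma c) (tau \o stereo c) u).

(* At each point of Sigma, (e3, e4) is the frame given by the hypersurface N
   bounded by Sigma: e3 outward normal of Sigma in N, e4 future normal of N. *)
Definition adapted_frame (N : set S) (e3 e4 : sfield) : Prop :=
  forall U (Z : 'rV[R]_3 -> S) z c u i,
    patch N (X @` sphere) U Z -> U z -> halfspace z ->
    Z z = surf c u -> dom i (Z z) ->
    e3 c i u = conormal (ind_metric Z) (fun x => x 0 0) z
                 *m 'J (coord i \o Z) z /\
    e4 c i u = future_normal Z i z.

(* sinh phi = - e3(f) / a on Sigma, e3 being the outward normal in N *)
Definition jang_gauge (N : set S) (f : S -> R) (tau phi : 'rV[R]_3 -> R) :=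
  forall U (Z : 'rV[R]_3 -> S) z c u,
    patch N (X @` sphere) U Z -> U z -> halfspace z -> Z z = surf c u ->
    sinhR (phi (stereo c u)) =
      - (conormal (ind_metric Z) (fun x => x 0 0) z *m (drow (f \o Z) z)^T) 0 0
      / slope tau c u.

(* Condition (2) allows any compact spacelike N bounded by Sigma.  A smooth
   function on the compact submanifold N is the restriction of a smooth
   function on the spacetime. *)
Definition admissible (tau : 'rV[R]_3 -> R) : Prop :=
  [/\ smooth_sphere tau,
      (forall c u, let t := tau \o stereo c in
         0 < gauss_curv (sigma c) u
             + \det (hess (sigma c) t u) / \det (sigma c u)
               / (1 + gradsq (sigma c) t u)) &
      exists (N : set S) (f : S -> R) (e3 e4 : sfield) (phi : 'rV[R]_3 -> R),
        [/\ compact N /\ hypersurface N (X @` sphere),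
            smooth_function f /\
              (forall c u, f (surf c u) = tau (stereo c u)),
            (forall U Z z, patch N (X @` sphere) U Z -> U z -> halfspace z ->
               jang_lhs (ind_metric Z) (ind_second Z) (f \o Z) z = 0),
            adapted_frame N e3 e4 /\ jang_gauge N f tau phi &
            forall c u, 0 < hfun tau e3 e4 phi c u]].

Definition h_integral (tau phi : 'rV[R]_3 -> R) : R :=
  sphere_int sigma (hfun tau frame3 frame4 phi).

Definition canonical_gauge (tau phi : 'rV[R]_3 -> R) : Prop :=
  smooth_sphere phi /\
  forall psi, smooth_sphere psi -> h_integral tau phi <= h_integral tau psi.

Definition the_canonical_gauge (tau : 'rV[R]_3 -> R) : 'rV[R]_3 -> R :=
  xget (fun=> 0) [set phi | canonical_gauge tau phi].

(* T0 is future unit timelike in R^{1,3} and the rows of L, an orthonormal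
   basis of its orthogonal complement, identify R^3 with it *)
Definition observer (T0 : 'rV[R]_4) (L : 'M[R]_(3, 4)) : Prop :=
  [/\ ip minkowski T0 T0 = -1, 0 < T0 0 0,
      L *m minkowski *m L^T = 1%:M & L *m minkowski *m T0^T = 0].

Definition reference_density (T0 : 'rV[R]_4) (L : 'M[R]_(3, 4))
    (tau : 'rV[R]_3 -> R) (c : bool) (u : 'rV[R]_2) : R :=
  let j := (the_embedding (sigma_hat tau)).1 in
  let N := (the_embedding (sigma_hat tau)).2 in
  let i0 := fun v => j (stereo c v) *m L + tau (stereo c v) *: T0 in
  let e30 := fun v => N (stereo c v) *m L in
  let e40 := fun v => (slope tau c v)^-1 *:
    (T0 + grad (sigma c) (tau \o stereo c) v *m 'J i0 v) in
  h_density (fun=> minkowski) i0 (tau \o stereo c) e30 e40 u.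

Definition wang_yau (T0 : 'rV[R]_4) (L : 'M[R]_(3, 4))
    (tau : 'rV[R]_3 -> R) : R :=
  (8 * pi)^-1 * (sphere_int sigma (reference_density T0 L tau)
                 - h_integral tau (the_canonical_gauge tau)).

(* f solves Jang's equation on Omega with boundary value tau *)
Definition jang_solution (tau f : 'rV[R]_3 -> R) : Prop :=
  [/\ smooth_near cball f, (forall x, sphere x -> f x = tau x) &
      forall x, cball x -> jang_lhs (ind_metric X) (ind_second X) f x = 0].

End WangYau.

(* Main.v *)
Require Import Defs.
From HB Require Import structures.
From mathcomp Require Import all_boot all_order all_algebra.
From mathcomp Require Import all_classical all_reals all_analysis measurable_realfun.
From mathcomp Require Import ring lra.
Set Implicit Arguments.
Unset Strict Implicit.
Unset Printing Implicit Defensive.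
Import Order.TTheory GRing.Theory Num.Theory.
Import numFieldNormedType.Exports.
Local Open Scope classical_set_scope.
Local Open Scope ring_scope.
Local Notation coord := Defs.coord.

(** The energy of [tau] is a reference integral minus the integral of the
    boundary density in the canonical gauge.  That gauge minimises the density
    integral, so it may be replaced by any other smooth gauge at the cost of
    lowering the energy, and the Jang gauge of the fill-in is the one in which
    the density is computable ([gauge_integral_le]).

    The hyperbolic functions of the Jang boost are the coefficients of the
    outward normal of the boundary of the graph, projected to the initial data,
    on the normal of the sphere and on the projected normal of the graph
    ([conormal_graph]).  In this gauge the density times the area element is the
    mean curvature of the boundary of the graph, minus the normal component of
    the Schoen--Yau one-form [Y], times the area element of the graph
    ([graph_mean_curv]).  The conformal factor [u] is [1] on the boundary, so
    the mean curvature in the metric [u ^+ 4 *: ghat] differs from the one in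
    [ghat] by four times the normal derivative of [u] ([mean_curv_conf]).
    Together ([jang_density]): the density is the mean curvature that enters the
    Brown--York mass minus the normal component of the field [4 u grad u + u^2
    Y].

    That field has nonnegative divergence ([div_flux_ge0]).  Half the scalar
    curvature of the graph plus the divergence of [Y] is at least the square
    norm of [Y]: this is the Schoen--Yau identity ([schoen_yau]) with the
    dominant energy condition, since the projected unit normal of the graph is
    shorter than one.  The equation of [u] replaces its Laplacian by the scalar
    curvature, and what remains is [|u Y + grad u|^2] plus nonnegative terms.
    Hence the flux through the sphere is nonnegative, by the divergence theorem
    on the ball in stereographic coordinates: the flux through concentric
    spheres starts from zero and grows with the radius ([sphere_flux_ge0]).  So
    the integral of the density is at most the integral of the conformal mean
    curvature.

    The reference integral is the one of the Brown--York mass: lifting the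
    Euclidean embedding of the graph metric by [tau] in the time direction
    multiplies its mean curvature by the slope factor, which is also the ratio
    of the area elements ([reference_densityE]), and the conformal metric
    induces the graph metric on the boundary ([conformal_boundary]).
    Subtracting gives [brown_york_le_wang_yau].  The scalar flatness is the
    conformal change of scalar curvature ([scal_conformal]).

    Tensor identities are proved as polynomial identities in the entries of
    matrices over an abstract commutative ring with commuting derivations, and
    carried to metrics by taking the ring of smooth functions on an open set. *)

(** * Smooth functions of several variables *)

Section Calculus.
Context {R : realType}.

(** A derivative that is [e]-close to the constant [c] keeps the function
    within [e * `|t|] of its line of slope [c].  Both the differentiability of [C^1]
    functions and the symmetry of second derivatives come from this estimate. *)
Lemma mvt_bound (g dg : R -> R) (t c e : R) :
  (forall s : R, `|s| <= `|t| -> is_derive s 1 g (dg s)) ->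
  (forall s, `|s| <= `|t| -> `|dg s - c| <= e) ->
  `|g t - g 0 - c * t| <= e * `|t|.
Proof.
move=> hd hb.
pose k := fun s : R => g (s * t) - c * (s * t).
have ht (s : R) : s \in `[0, 1] -> `|s * t| <= `|t|.
  rewrite in_itv /= => /andP[s0 s1]; rewrite normrM ger0_norm //.
  by rewrite ler_piMl.
have hk (s : R) : s \in `[0, 1] -> is_derive s 1 k ((dg (s * t) - c) * t).
  move=> hs; have h1 := hd _ (ht _ hs).
  have h2 : is_derive s 1 (fun s : R => s * t) t.
    rewrite (_ : (fun s : R => s * t) = id * cst t) //.
    by apply: is_derive_eq; rewrite scaler0 add0r [LHS]mulr1.
  have h3 : is_derive s 1 (g \o (fun s : R => s * t)) (dg (s * t) * t).
    exact: is_derive1_comp.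
  have h4 : is_derive s 1 (fun s : R => c * (s * t)) (c * t).
    rewrite (_ : (fun s : R => c * (s * t)) = cst c * (fun s : R => s * t)) //.
    by apply: is_derive_eq; rewrite scaler0 addr0.
  have -> : k = (g \o (fun s : R => s * t)) - (fun s : R => c * (s * t)) by [].
  by apply: is_derive_eq; rewrite mulrBl mulrC.
have hs01 (s : R) : s \in `]0, 1[ -> s \in `[0, 1].
  by rewrite !in_itv /= => /andP[/ltW -> /ltW ->].
have kc : {within `[0, 1], continuous k}.
  by apply: derivable_within_continuous => x hx; have [] := hk x hx.
have [s hs] := MVT ltr01 (fun x hx => hk x (hs01 x hx)) kc.
rewrite /k !mul1r !mul0r mulr0 subr0 subr0 mulr1.
have -> : g t - c * t - g 0 = g t - g 0 - c * t by ring.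
move=> ->; rewrite normrM ler_wpM2r //; apply: hb; apply: ht; exact: hs01.
Qed.

Lemma line_derive n (f : 'rV[R]_n -> R) (y v : 'rV[R]_n) (s : R) :
  derivable f (s *: v + y) v ->
  is_derive s 1 (fun s : R => f (s *: v + y)) ('D_v f (s *: v + y)).
Proof.
move=> hd.
have E : (fun h : R => h^-1 *: (f ((h *: 1 + s) *: v + y) - f (s *: v + y))) =
         (fun h : R => h^-1 *: (f (h *: v + (s *: v + y)) - f (s *: v + y))).
  by apply/funext => h; rewrite [h *: 1]mulr1 scalerDl addrA.
split; first by rewrite /derivable /= E.
by rewrite /derive /= E.
Qed.

Lemma normr_coord m n (x : 'M[R]_(m, n)) i j : `|x i j| <= `|x|.
Proof.
have := @le_bigmax _ _ _ 0 (fun k : 'I_m * 'I_n => `|x k.1 k.2|) (i, j).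
by move=> h; rewrite [leRHS]/Num.Def.normr /= mx_normrE.
Qed.

Lemma normr_le_coord m n (x : 'M[R]_(m, n)) (e : R) :
  0 <= e -> (forall i j, `|x i j| <= e) -> `|x| <= e.
Proof.
move=> e0 h; rewrite [leLHS]/Num.Def.normr /= mx_normrE.
by apply: bigmax_le => // -[i j] _; exact: h.
Qed.

Lemma normr_delta n (j : 'I_n) : `|delta_mx 0 j : 'rV[R]_n| <= 1.
Proof.
apply: normr_le_coord => // i k; rewrite mxE.
by case: (_ && _); rewrite ?normr1 ?normr0.
Qed.

Lemma cvg_sumr (T : Type) (F : set_system T) {FF : Filter F} (I : Type)
    (r : seq I) (f : I -> T -> R) (l : I -> R) :
  (forall i, f i t @[t --> F] --> l i) ->
  \sum_(i <- r) f i t @[t --> F] --> \sum_(i <- r) l i.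
Proof.
move=> h; elim: r => [|i r IH].
  rewrite big_nil; under eq_cvg do rewrite big_nil; exact: cvg_cst.
by rewrite big_cons; under eq_cvg do rewrite big_cons; exact: cvgD.
Qed.

Lemma near_close (T : topologicalType) (f : T -> R) x e :
  {for x, continuous f} -> 0 < e -> \forall y \near x, `|f y - f x| <= e.
Proof.
by move=> /cvgrPdist_le h /h; apply: filterS => y; rewrite distrC.
Qed.

(** The increment along [h] is a sum of increments that change one coordinate at a
    time, and the mean value theorem compares each of them with a partial
    derivative at [x]. *)
Lemma C1_differentiable n (f : 'rV[R]_n -> R) (x : 'rV[R]_n) :
  (\forall y \near x, forall j, derivable f y (delta_mx 0 j)) ->
  (forall j, {for x, continuous (pd j f)}) ->
  differentiable f x /\
  (forall v, 'd f x v = \sum_j v 0 j * pd j f x).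
Proof.
move=> hd hc.
pose L (v : 'rV[R]_n) := \sum_j v 0 j * pd j f x.
have Llin : linear L.
  move=> a u v; rewrite /L scaler_sumr -big_split /=; apply: eq_bigr => j _.
  by rewrite !mxE mulrDl -mulrA.
pose M := GRing.isLinear.Build _ _ _ _ L Llin.
pose Ll : {linear 'rV[R]_n -> R} := HB.pack L M.
have Lc : continuous Ll.
  move=> v; rewrite /continuous_at /=.
  apply: (@cvg_sumr _ (nbhs v) (nbhs_filter v)) => j.
  apply: cvgMr_tmp; exact: coord_continuous.
have dLP := @diff_unique R 'rV[R]_n R f Ll x Lc.
match type of dLP with (?P -> _) => have key : P end.
  apply/eqaddoP => e e0 /=.
  have e'0 : 0 < e / (n%:R + 1) by rewrite divr_gt0 // ltr_wpDl.
  set e' := e / (n%:R + 1) in e'0.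
  have hc' : \forall y \near x, forall j, `|pd j f y - pd j f x| <= e'.
    apply: (@filter_forall _ _ (fun j y => `|pd j f y - pd j f x| <= e') _
      (nbhs_filter x)) => j.
    exact: (near_close (hc j) e'0).
  have [r /= r0 hr] : nbhs_ball x
      [set y | (forall j, derivable f y (delta_mx 0 j)) /\
               forall j, `|pd j f y - pd j f x| <= e'].
    by apply/nbhs_ballP; near=> y; split; near: y.
  have hlt : \forall h \near (0 : 'rV[R]_n), `|h| < r by exact: nbhs0_lt.
  near=> h.
  rewrite !fctE /=.
  (* [hk k] keeps the first [k] coordinates of [h]: a path from [0] to [h] along
     the axes. *)
  pose hk (k : nat) : 'rV[R]_n := \row_j (if (j < k)%N then h 0 j else 0).
  have hr0 : `|h| < r.
    by near: h.
  have hn : hk n = h.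
    by apply/rowP => j; rewrite mxE ltn_ord.
  have h0 : hk 0 = 0 by apply/rowP => j; rewrite !mxE.
  have step (j : 'I_n) :
     `|f (hk j.+1 + x) - f (hk j + x) - pd j f x * h 0 j| <= e' * `|h 0 j|.
    have hS : hk j.+1 = h 0 j *: delta_mx 0 j + hk j.
      apply/rowP => k; rewrite !mxE eqxx /=.
      case: (ltngtP k j) => [kj|kj|/val_inj ->].
      - by rewrite ltnS (ltnW kj) (_ : k == j = false) ?mulr0 ?add0r //;
          apply/negP => /eqP E; rewrite E ltnn in kj.
      - rewrite ltnS leqNgt kj /= (_ : k == j = false) ?mulr0 ?add0r //.
        by apply/negP => /eqP E; rewrite E ltnn in kj.
      - by rewrite ltnSn eqxx mulr1 addr0.
    have inb (s : R) : `|s| <= `|h 0 j| -> ball x r (s *: delta_mx 0 j + (hk j + x)).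
      move=> hs; rewrite -ball_normE /= opprD addrA addrC.
      have -> : - (hk j + x) + (x - s *: delta_mx 0 j) = - (s *: delta_mx 0 j + hk j).
        by apply/rowP => k; rewrite !mxE; ring.
      rewrite normrN; apply: le_lt_trans hr0.
      apply: normr_le_coord => // i k; rewrite !mxE !ord1 eqxx /=.
      have [->|kj] := eqVneq k j.
        by rewrite ltnn mulr1 addr0 (le_trans hs) // normr_coord.
      rewrite mulr0 add0r; case: ifP => _; rewrite ?normr0 //.
      exact: normr_coord.
    have := @mvt_bound (fun s => f (s *: delta_mx 0 j + (hk j + x)))
       (fun s => pd j f (s *: delta_mx 0 j + (hk j + x))) (h 0 j) (pd j f x) e'.
    rewrite scale0r add0r addrA -hS; apply => s hs.
      apply: line_derive; exact: (hr _ (inb _ hs)).1.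
    exact: (hr _ (inb _ hs)).2.
  have -> : f (h + x) - (f x + L h) =
     \sum_(j < n) (f (hk j.+1 + x) - f (hk j + x) - pd j f x * h 0 j).
    rewrite sumrB; have -> : \sum_(j < n) (f (hk j.+1 + x) - f (hk j + x)) = f (h + x) - f x.
      rewrite -(big_mkord xpredT (fun j => f (hk j.+1 + x) - f (hk j + x))).
      by rewrite telescope_sumr // hn h0 add0r.
    rewrite /L opprD addrA; congr (_ - _).
    by apply: eq_bigr => j _; rewrite mulrC.
  apply: (le_trans (ler_norm_sum _ _ _)).
  have : \sum_(j < n) `|f (hk j.+1 + x) - f (hk j + x) - pd j f x * h 0 j|
     <= \sum_(j < n) e' * `|h|.
    apply: ler_sum => j _; apply: (le_trans (step j)).
    by rewrite ler_wpM2l ?normr_coord // ltW.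
  move=> /le_trans; apply.
  rewrite sumr_const card_ord -mulr_natl mulrA ler_wpM2r //.
  rewrite /e' mulrA ler_pdivrMr; last by rewrite ltr_wpDl.
  by rewrite mulrC ler_pM2l // lerDl.
have dL := dLP key.
split; last by move=> v; rewrite dL.
by apply/diff_locallyP; split; rewrite dL.
Unshelve. all: by end_near. Qed.

Section CkTheory.
Variables (n : nat).
Implicit Types (U : set 'rV[R]_n) (f g : 'rV[R]_n -> R) (k : nat).

Lemma CkS k U f : Ck k.+1 U f <-> (forall x, U x -> {for x, continuous f}) /\
  forall j : 'I_n, (forall x, U x -> derivable f x (delta_mx 0 j)) /\ Ck k U (pd j f).
Proof. by []. Qed.

Lemma Ck_cont k U f x : Ck k U f -> U x -> {for x, continuous f}.
Proof. by case: k => [|k] [h _] /h. Qed.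

Lemma CkW k U f : Ck k.+1 U f -> Ck k U f.
Proof.
elim: k f => [|k IH] f; first by case.
move=> /CkS [hc hd]; apply/CkS; split => // j; have [h1 h2] := hd j.
by split => //; apply: IH.
Qed.

Lemma Ck_sub k U V f : V `<=` U -> Ck k U f -> Ck k V f.
Proof.
move=> VU; elim: k f => [|k IH] f.
  by case=> h _; split => // x /VU /h.
move=> /CkS [hc hd]; apply/CkS; split => [x /VU /hc //|j]; have [h1 h2] := hd j.
by split => [x /VU /h1 //|]; apply: IH.
Qed.

Lemma near_open U x (P : 'rV[R]_n -> Prop) : open U -> U x ->
  (forall y, U y -> P y) -> \forall y \near x, P y.
Proof. by move=> oU Ux h; apply: filterS h _; apply: open_nbhs_nbhs. Qed.

Lemma pd_eq U f g x j : open U -> U x -> (forall y, U y -> f y = g y) ->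
  pd j f x = pd j g x.
Proof. by move=> oU Ux h; apply: near_eq_derive; apply: near_open h. Qed.

Lemma Ck_eq k U f g : open U -> (forall x, U x -> f x = g x) -> Ck k U f -> Ck k U g.
Proof.
move=> oU; elim: k f g => [|k IH] f g fg.
  case=> h _; split => // x Ux; have hc := h x Ux.
  rewrite /prop_for /continuous_at -(fg x Ux); apply: cvg_trans hc.
  by apply: (@near_eq_cvg _ _ (nbhs x) (nbhs_filter x)); apply: (near_open oU Ux).
move=> /CkS [hc hd]; apply/CkS; split.
  move=> x Ux; have h := hc x Ux.
  rewrite /prop_for /continuous_at -(fg x Ux); apply: cvg_trans h.
  by apply: (@near_eq_cvg _ _ (nbhs x) (nbhs_filter x)); apply: (near_open oU Ux).
move=> j; have [h1 h2] := hd j; split.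
  move=> x Ux; apply: near_eq_derivable (h1 x Ux).
  exact: near_open Ux _.
by apply: IH h2 => x Ux; apply: pd_eq oU Ux fg.
Qed.

Lemma Ck_cst k U (c : R) : Ck k U (fun=> c).
Proof.
elim: k c => [|k IH] c; first by split => // x _; exact: cst_continuous.
apply/CkS; split => [x _|j]; first exact: cst_continuous.
split => [x _|]; first exact: derivable_cst.
have -> : pd j (fun=> c) = fun=> 0 by apply/funext => x; rewrite /pd derive_cst.
exact: IH.
Qed.

Lemma Ck_coord k U i : Ck k U (fun x => x 0 i).
Proof.
have dc x : differentiable (fun y : 'rV[R]_n => y 0 i) x by exact: differentiable_coord.
have pc j : pd j (fun y : 'rV[R]_n => y 0 i) = fun=> (i == j)%:R.
  apply/funext => x; rewrite /pd.
  have := @derive_mx R 'rV[R]_n 1 n id x (delta_mx 0 j) (@derivable_id _ _ _ _).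
  by rewrite derive_id => /rowP /(_ i); rewrite !mxE eqxx.
case: k => [|k]; first by split => // x _; exact: coord_continuous.
apply/CkS; split => [x _|j]; first exact: coord_continuous.
split => [x _|]; first exact: diff_derivable.
rewrite pc; exact: Ck_cst.
Qed.

Lemma CkD k U f g : open U -> Ck k U f -> Ck k U g -> Ck k U (fun x => f x + g x).
Proof.
move=> oU; elim: k f g => [|k IH] f g.
  by case=> h1 _ [h2 _]; split => // x Ux; apply: continuousD; [exact: h1|exact: h2].
move=> /CkS [fc fd] /CkS [gc gd]; apply/CkS; split.
  by move=> x Ux; apply: continuousD; [exact: fc|exact: gc].
move=> j; have [f1 f2] := fd j; have [g1 g2] := gd j; split.
  by move=> x Ux; apply: derivableD; [exact: f1|exact: g1].
apply: Ck_eq (IH _ _ f2 g2) => // x Ux.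
by rewrite /pd -[RHS]/('D_(delta_mx 0 j) (f + g) x) deriveD; [|exact: f1|exact: g1].
Qed.

Lemma CkM k U f g : open U -> Ck k U f -> Ck k U g -> Ck k U (fun x => f x * g x).
Proof.
move=> oU; elim: k f g => [|k IH] f g.
  by case=> h1 _ [h2 _]; split => // x Ux; apply: continuousM; [exact: h1|exact: h2].
move=> hf hg; have hf' := CkW hf; have hg' := CkW hg.
move: hf hg => /CkS [fc fd] /CkS [gc gd]; apply/CkS; split.
  by move=> x Ux; apply: continuousM; [exact: fc|exact: gc].
move=> j; have [f1 f2] := fd j; have [g1 g2] := gd j; split.
  by move=> x Ux; apply: derivableM; [exact: f1|exact: g1].
apply: Ck_eq (CkD oU (IH _ _ hf' g2) (IH _ _ f2 hg')) => // x Ux.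
rewrite /pd -[RHS]/('D_(delta_mx 0 j) (f * g) x) deriveM; [|exact: f1|exact: g1].
by rewrite /GRing.scale /= [in RHS]mulrC addrC [in RHS]addrC mulrC [g x * _]mulrC addrC.
Qed.

Lemma CkN k U f : open U -> Ck k U f -> Ck k U (fun x => - f x).
Proof.
move=> oU hf; apply: Ck_eq (CkM oU (Ck_cst k U (-1)) hf) => // x _.
by rewrite mulN1r.
Qed.

Lemma Ck_sum k U (I : Type) (r : seq I) (P : pred I) (F : I -> 'rV[R]_n -> R) :
  open U -> (forall i, Ck k U (F i)) -> Ck k U (fun x => \sum_(i <- r | P i) F i x).
Proof.
move=> oU h; elim: r => [|i r IH].
  by apply: Ck_eq (Ck_cst k U 0) => // x _; rewrite big_nil.
have [Pi|Pi] := boolP (P i).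
  by apply: Ck_eq (CkD oU (h i) IH) => // x _; rewrite big_cons Pi.
by apply: Ck_eq IH => // x _; rewrite big_cons (negbTE Pi).
Qed.

Lemma CkV k U f : open U -> (forall x, U x -> f x != 0) -> Ck k U f ->
  Ck k U (fun x => (f x)^-1).
Proof.
move=> oU f0; elim: k => [|k IH] hf.
  by case: hf => h _; split => // x Ux; apply: continuousV; [exact: f0|exact: h].
have IH' := IH (CkW hf).
move: hf => /CkS [fc fd]; apply/CkS; split.
  by move=> x Ux; apply: continuousV; [exact: f0|exact: fc].
move=> j; have [f1 f2] := fd j; split.
  by move=> x Ux; apply: derivableV; [exact: f0|exact: f1].
apply: Ck_eq (CkN oU (CkM oU f2 (CkM oU IH' IH'))) => // x Ux.
rewrite /pd deriveV; [|exact: f0|exact: f1].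
by rewrite /GRing.scale /= -exprVn expr2 mulNr mulrC.
Qed.

(** One step of an induction on the order: by the chain rule the partial
    derivatives of [phi \o f] are those of [f] times [dphi \o f], so one more
    derivative of [phi \o f] costs one derivative less of [dphi \o f]. *)
Lemma Ck_post k U (phi dphi : R -> R) f : open U ->
  (forall x, U x -> is_derive (f x) 1 phi (dphi (f x))) ->
  Ck k.+1 U f -> Ck k U (fun x => dphi (f x)) -> Ck k.+1 U (fun x => phi (f x)).
Proof.
move=> oU hphi /CkS [fc fd] hd.
have dline x j : U x -> is_derive x (delta_mx 0 j) (phi \o f) (dphi (f x) * pd j f x).
  move=> Ux; have [f1 f2] := fd j.
  have /derivable1P h1 := f1 x Ux.
  have hp := hphi x Ux.
  pose v : 'rV[R]_n := delta_mx 0 j.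
  have e0 : 0 *: v + x = x by rewrite scale0r add0r.
  have h2 : is_derive (0 : R) 1 (fun h : R => f (h *: v + x)) (pd j f x).
    by have := @line_derive n f x v 0; rewrite e0; apply; exact: f1.
  have h3 : is_derive (0:R) 1 (phi \o (fun h : R => f (h *: v + x))) (dphi (f x) * pd j f x).
    by apply: is_derive1_comp; rewrite e0.
  split; first by apply/derivable1P; have [] := h3.
  have [_ <-] := h3.
  rewrite /derive; congr (lim (_ @ 0^')); apply/funext => h /=.
  by rewrite addr0 e0 [h%:A]mulr1.
apply/CkS; split.
  move=> x Ux; have hp := hphi x Ux.
  apply: continuous_comp; first exact: fc.
  by apply/differentiable_continuous/derivable1_diffP.
move=> j; have [f1 f2] := fd j; split.
  by move=> x Ux; have [] := dline x j Ux.
apply: Ck_eq (CkM oU hd f2) => // x Ux.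
by have [_ <-] := dline x j Ux.
Qed.

Lemma Ck_cont_post U (phi dphi : R -> R) f :
  (forall x, U x -> is_derive (f x) 1 phi (dphi (f x))) ->
  Ck 0 U f -> Ck 0 U (fun x => phi (f x)).
Proof.
move=> hphi [fc _]; split => // x Ux; have hp := hphi x Ux.
apply: continuous_comp; first exact: fc.
by apply/differentiable_continuous/derivable1_diffP.
Qed.

Lemma Ck_sqrt k U f : open U -> (forall x, U x -> 0 < f x) -> Ck k U f ->
  Ck k U (fun x => Num.sqrt (f x)).
Proof.
move=> oU f0.
have hd x : U x -> is_derive (f x) 1 Num.sqrt ((2 * Num.sqrt (f x))^-1).
  by move=> Ux; apply: is_derive1_sqrt; exact: f0.
elim: k => [|k IH] hf; first exact: (Ck_cont_post (dphi := fun t => (2 * Num.sqrt t)^-1)).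
apply: (Ck_post (dphi := fun t => (2 * Num.sqrt t)^-1)) => //.
apply: CkV => // [x Ux|].
  by rewrite mulf_neq0 // gt_eqF // sqrtr_gt0 f0.
by apply: CkM => //; [exact: Ck_cst|exact: IH (CkW hf)].
Qed.

Lemma Ck_ln k U f : open U -> (forall x, U x -> 0 < f x) -> Ck k U f ->
  Ck k U (fun x => ln (f x)).
Proof.
move=> oU f0.
have hd x : U x -> is_derive (f x) 1 (@ln R) (f x)^-1.
  by move=> Ux; apply: is_derive1_ln; exact: f0.
case: k => [|k] hf; first exact: (Ck_cont_post (dphi := fun t => t^-1)).
apply: (Ck_post (dphi := fun t => t^-1)) => //.
apply: CkV => // [x Ux|]; last exact: CkW.
by rewrite gt_eqF // f0.
Qed.

Lemma Ck1_diff U f x : open U -> Ck 1 U f -> U x -> differentiable f x.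
Proof.
move=> oU /CkS [fc fd] Ux; apply: (C1_differentiable _ _).1 => [|j].
  by apply: near_open oU Ux _ => y Uy j; apply: (fd j).1.
exact: (fd j).2.1.
Qed.

Lemma diff_pdE f x v : differentiable f x -> 'd f x v = \sum_j v 0 j * pd j f x.
Proof.
move=> df; rewrite {1}[v]row_sum_delta linear_sum; apply: eq_bigr => j _.
by rewrite linearZ /= /pd deriveE.
Qed.

End CkTheory.

Lemma continuous_rV (T : topologicalType) n (g : T -> 'rV[R]_n) x :
  (forall i, {for x, continuous (fun y => g y 0 i)}) -> {for x, continuous g}.
Proof.
move=> h; apply/cvgrPdist_le => e e0.
have : \forall y \near x, forall i, `|g x 0 i - g y 0 i| <= e.
  apply: (@filter_forall _ _ (fun i y => `|g x 0 i - g y 0 i| <= e) _ (nbhs_filter x)) => i.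
  by have /cvgrPdist_le /(_ _ e0) := h i.
apply: filterS => y hy; apply: normr_le_coord; first exact: ltW.
by move=> i j; rewrite !mxE !ord1.
Qed.

Lemma differentiable_rV m n (g : 'rV[R]_m -> 'rV[R]_n) x :
  (forall i, differentiable (fun y => g y 0 i) x) -> differentiable g x.
Proof.
move=> h.
have -> : g = \sum_(i < n) (fun y => g y 0 i *: (delta_mx 0 i : 'rV[R]_n)).
  by apply/funext => y; rewrite fct_sumE {1}[g y]row_sum_delta.
by apply: differentiable_sum => i; apply: differentiableZl.
Qed.

Lemma jacobianE m n (F : 'rV[R]_m -> 'rV[R]_n) x a k :
  (forall i, differentiable (fun y => F y 0 i) x) ->
  'J F x a k = pd a (fun y => F y 0 k) x.
Proof.
move=> h; have dF := differentiable_rV h.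
rewrite /jacobian mxE -deriveE // derive_mx; last exact: diff_derivable.
by rewrite mxE.
Qed.

Lemma pd_comp m n (f : 'rV[R]_n -> R) (g : 'rV[R]_m -> 'rV[R]_n) x j :
  (forall i, differentiable (fun y => g y 0 i) x) -> differentiable f (g x) ->
  pd j (f \o g) x = \sum_i pd i f (g x) * pd j (fun y => g y 0 i) x.
Proof.
move=> hg hf; have dg := differentiable_rV hg.
rewrite /pd deriveE; last exact: differentiable_comp.
rewrite diff_comp //= diff_pdE //; apply: eq_bigr => i _.
rewrite mulrC; congr (_ * _).
by rewrite -deriveE // derive_mx ?mxE //; exact: diff_derivable.
Qed.

Lemma Ck_comp m n k (U : set 'rV[R]_m) (V : set 'rV[R]_n) (f : 'rV[R]_n -> R)
    (g : 'rV[R]_m -> 'rV[R]_n) :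
  open U -> open V -> (forall x, U x -> V (g x)) ->
  (forall i, Ck k U (fun x => g x 0 i)) -> Ck k V f -> Ck k U (f \o g).
Proof.
move=> oU oV gUV; elim: k f => [|k IH] f hg.
  move=> [fc _]; split => // x Ux; apply: continuous_comp.
    by apply: continuous_rV => i; exact: Ck_cont (hg i) Ux.
  exact/fc/gUV.
move=> hf.
have hg1 i x : U x -> differentiable (fun y => g y 0 i) x.
  by move=> Ux; apply: Ck1_diff oU _ Ux; elim: (k) (hg i) => [//|k' IHk /CkW].
have hf1 x : V x -> differentiable f x.
  by move=> Vx; apply: Ck1_diff oV _ Vx; elim: (k) hf => [//|k' IHk /CkW].
have hg' i : Ck k U (fun x => g x 0 i) by exact: CkW.
move: hf => /CkS [fc fd]; apply/CkS; split.
  move=> x Ux; apply: continuous_comp.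
    by apply: continuous_rV => i; exact: Ck_cont (hg i) Ux.
  exact/fc/gUV.
move=> j; split.
  move=> x Ux; apply: diff_derivable; apply: differentiable_comp.
    by apply: differentiable_rV => i; exact: hg1.
  exact/hf1/gUV.
apply: Ck_eq (@Ck_sum _ k U _ (index_enum 'I_n) xpredT _ oU (fun i : 'I_n =>
    CkM oU (IH (pd i f) hg' (fd i).2) ((hg i).2 j).2)) => // x Ux.
rewrite pd_comp // => [i|]; first exact: hg1.
exact/hf1/gUV.
Qed.

(** ** Symmetry of second derivatives *)

Lemma second_difference_gap (A B C D p q e t : R) :
  `|A - B - (C - D) - p * t * t| <= e / 2 * `|t| * `|t| ->
  `|A - C - (B - D) - q * t * t| <= e / 2 * `|t| * `|t| ->
  `|q - p| * (`|t| * `|t|) <= e * `|t| * `|t|.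
Proof.
move=> h1 h2; rewrite -!normrM.
have -> : (q - p) * (t * t) = (A - B - (C - D) - p * t * t) -
   (A - C - (B - D) - q * t * t) by ring.
apply: (le_trans (ler_normB _ _)); apply: (le_trans (lerD h1 h2)).
by rewrite -mulrDl -mulrDl -splitr.
Qed.

(** The second difference of [f] over a square of side [t] is symmetric in the two
    directions, and two applications of the mean value theorem show that it is
    [t ^+ 2] times either mixed derivative up to [o(t ^+ 2)]. *)
Lemma pd_comm n (U : set 'rV[R]_n) (f : 'rV[R]_n -> R) i j x :
  open U -> Ck 2 U f -> U x -> pd i (pd j f) x = pd j (pd i f) x.
Proof.
move=> oU hf Ux.
wlog suff H : i j / forall e, 0 < e -> \forall t \near (0 : R),
    `|f (t *: delta_mx 0 i + (t *: delta_mx 0 j + x)) - f (t *: delta_mx 0 j + x)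
      - (f (t *: delta_mx 0 i + x) - f x) - pd j (pd i f) x * t * t| <= e * `|t| * `|t|.
  apply/eqP; rewrite -subr_eq0 -normr_eq0; apply/eqP/le_anti/andP; split => //.
  apply/ler_addgt0Pl => e e0; rewrite addr0.
  have e2 : 0 < e / 2 by rewrite divr_gt0.
  have Hij := nbhs_dnbhs (@filterI _ _ (nbhs_filter (0 : R)) _ _ (H i j _ e2) (H j i _ e2)).
  have [t [[h1 h2] t0]] := filter_ex (filterI Hij (nbhs_dnbhs_neq (0 : R))).
  rewrite addrCA in h2.
  have tt : 0 < `|t| * `|t| by rewrite mulr_gt0 ?normr_gt0.
  by rewrite -(ler_pM2r tt) [leRHS]mulrA; apply: second_difference_gap h1 h2.
move=> e e0.
have hfi : Ck 1 U (pd i f) by exact: (hf.2 i).2.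
have hji : {for x, continuous (pd j (pd i f))} by exact: (@Ck_cont _ 0 _ _ _ (hfi.2 j).2 Ux).
have [r /= r0 hr] : nbhs_ball x [set y | U y /\ `|pd j (pd i f) y - pd j (pd i f) x| <= e].
  apply/nbhs_ballP; near=> y; split; near: y; first exact: open_nbhs_nbhs.
  exact: (near_close hji e0).
have htr : \forall t \near (0 : R), `|t| < r / 2 by apply: nbhs0_lt; rewrite divr_gt0.
near=> t.
have tr : `|t| < r / 2 by near: t.
have inb (s s' : R) : `|s| <= `|t| -> `|s'| <= `|t| ->
   ball x r (s *: delta_mx 0 i + (s' *: delta_mx 0 j + x)).
  move=> hs hs'; rewrite -ball_normE /=.
  have -> : x - (s *: (delta_mx 0 i : 'rV[R]_n) + (s' *: delta_mx 0 j + x)) =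
     - (s *: (delta_mx 0 i : 'rV[R]_n) + s' *: delta_mx 0 j).
    by apply/rowP => k; rewrite !mxE; ring.
  rewrite normrN; apply: le_lt_trans (ler_normD _ _) _; rewrite [r]splitr.
  have hle (c : R) k : `|c| <= `|t| -> `|c *: (delta_mx 0 k : 'rV[R]_n)| < r / 2.
    move=> hc; rewrite normrZ; apply: le_lt_trans tr; apply: le_trans hc.
    by rewrite ler_piMr // normr_delta.
  by apply: ltrD; exact: hle.
have in0 (s : R) : `|s| <= `|t| -> ball x r (s *: delta_mx 0 i + x).
  by move=> hs; have := inb s 0 hs; rewrite normr0 scale0r add0r; apply.
pose g (s : R) := f (s *: delta_mx 0 i + (t *: delta_mx 0 j + x)) - f (s *: delta_mx 0 i + x).
pose dg (s : R) := pd i f (s *: delta_mx 0 i + (t *: delta_mx 0 j + x)) - pd i f (s *: delta_mx 0 i + x).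
have hdg (s : R) : `|s| <= `|t| -> is_derive s 1 g (dg s).
  move=> hs; have [U1 _] := hr _ (inb s t hs (lexx _)); have [U2 _] := hr _ (in0 s hs).
  by apply: is_deriveB; apply: line_derive; apply: (hf.2 i).1.
have hdg2 (s : R) : `|s| <= `|t| -> `|dg s - pd j (pd i f) x * t| <= e * `|t|.
  move=> hs.
  have := @mvt_bound (fun s' => pd i f (s' *: delta_mx 0 j + (s *: delta_mx 0 i + x)))
    (fun s' => pd j (pd i f) (s' *: delta_mx 0 j + (s *: delta_mx 0 i + x))) t
    (pd j (pd i f) x) e.
  rewrite scale0r add0r /dg [s *: _ + (t *: _ + x)]addrCA; apply => s' hs'.
    apply: line_derive; apply: (hfi.2 j).1.
    by rewrite addrCA; have [] := hr _ (inb s s' hs hs').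
  by rewrite addrCA; have [] := hr _ (inb s s' hs hs').
have := @mvt_bound g dg t (pd j (pd i f) x * t) (e * `|t|) hdg hdg2.
rewrite /g scale0r !add0r.
by congr (`|_| <= _); ring.
Unshelve. all: by end_near. Qed.

(** ** The smooth class *)

Section Smooth.
Variables (n : nat).
Implicit Types (U : set 'rV[R]_n) (f g : 'rV[R]_n -> R).

Lemma smooth_pd U f j : smooth U f -> smooth U (pd j f).
Proof. by move=> h k; exact: ((h k.+1).2 j).2. Qed.

Lemma smooth_cont U f x : smooth U f -> U x -> {for x, continuous f}.
Proof. by move=> h Ux; exact: Ck_cont (h 0%N) Ux. Qed.

Lemma smooth_diff U f x : open U -> smooth U f -> U x -> differentiable f x.
Proof. by move=> oU h Ux; exact: Ck1_diff oU (h 1%N) Ux. Qed.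

Lemma smooth_sub U V f : V `<=` U -> smooth U f -> smooth V f.
Proof. by move=> VU h k; exact: Ck_sub VU (h k). Qed.

Lemma smooth_eq U f g : open U -> (forall x, U x -> f x = g x) -> smooth U f -> smooth U g.
Proof. by move=> oU fg h k; exact: Ck_eq oU fg (h k). Qed.

Lemma smooth_cst U (c : R) : smooth U (fun=> c).
Proof. by move=> k; exact: Ck_cst. Qed.

Lemma smooth_coord U i : smooth U (fun x => x 0 i).
Proof. by move=> k; exact: Ck_coord. Qed.

Lemma smoothD U f g : open U -> smooth U f -> smooth U g -> smooth U (fun x => f x + g x).
Proof. by move=> oU hf hg k; exact: CkD. Qed.

Lemma smoothM U f g : open U -> smooth U f -> smooth U g -> smooth U (fun x => f x * g x).
Proof. by move=> oU hf hg k; exact: CkM. Qed.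

Lemma smoothN U f : open U -> smooth U f -> smooth U (fun x => - f x).
Proof. by move=> oU hf k; exact: CkN. Qed.

Lemma smooth_sum U (I : Type) (r : seq I) (P : pred I) (F : I -> 'rV[R]_n -> R) :
  open U -> (forall i, smooth U (F i)) -> smooth U (fun x => \sum_(i <- r | P i) F i x).
Proof. by move=> oU h k; apply: Ck_sum => // i; exact: h. Qed.

Lemma smoothV U f : open U -> (forall x, U x -> f x != 0) -> smooth U f ->
  smooth U (fun x => (f x)^-1).
Proof. by move=> oU f0 h k; exact: CkV. Qed.

Lemma smooth_sqrt U f : open U -> (forall x, U x -> 0 < f x) -> smooth U f ->
  smooth U (fun x => Num.sqrt (f x)).
Proof. by move=> oU f0 h k; exact: Ck_sqrt. Qed.

Lemma smooth_ln U f : open U -> (forall x, U x -> 0 < f x) -> smooth U f ->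
  smooth U (fun x => ln (f x)).
Proof. by move=> oU f0 h k; exact: Ck_ln. Qed.

Lemma pdD U f g x j : smooth U f -> smooth U g -> U x ->
  pd j (fun y => f y + g y) x = pd j f x + pd j g x.
Proof.
move=> hf hg Ux; rewrite /pd -[LHS]/('D_(delta_mx 0 j) (f + g) x) deriveD //.
  exact: ((hf 1%N).2 j).1.
exact: ((hg 1%N).2 j).1.
Qed.

Lemma pdM U f g x j : smooth U f -> smooth U g -> U x ->
  pd j (fun y => f y * g y) x = pd j f x * g x + f x * pd j g x.
Proof.
move=> hf hg Ux; rewrite /pd -[LHS]/('D_(delta_mx 0 j) (f * g) x) deriveM.
- by rewrite /GRing.scale /= addrC; congr (_ + _); rewrite mulrC.
- exact: ((hf 1%N).2 j).1.
- exact: ((hg 1%N).2 j).1.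
Qed.

Lemma pdN U f x j : smooth U f -> U x ->
  pd j (fun y => - f y) x = - pd j f x.
Proof.
move=> hf Ux; rewrite /pd -[LHS]/('D_(delta_mx 0 j) (- f) x) deriveN //.
exact: ((hf 1%N).2 j).1.
Qed.

Lemma pd_cst (c : R) x (j : 'I_n) : pd j (fun=> c) x = 0.
Proof. by rewrite /pd derive_cst. Qed.

Lemma smooth_pd_comm U f x i j : open U -> smooth U f -> U x ->
  pd i (pd j f) x = pd j (pd i f) x.
Proof. by move=> oU hf Ux; exact: pd_comm oU (hf 2%N) Ux. Qed.

End Smooth.

Lemma smooth_comp m n (U : set 'rV[R]_m) (V : set 'rV[R]_n) (f : 'rV[R]_n -> R)
    (g : 'rV[R]_m -> 'rV[R]_n) :
  open U -> open V -> (forall x, U x -> V (g x)) ->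
  (forall i, smooth U (fun x => g x 0 i)) -> smooth V f -> smooth U (f \o g).
Proof. by move=> oU oV gUV hg hf k; apply: Ck_comp (hf k) => // i; exact: hg. Qed.

Lemma pd_smooth_comp m n (U : set 'rV[R]_m) (V : set 'rV[R]_n) (f : 'rV[R]_n -> R)
    (g : 'rV[R]_m -> 'rV[R]_n) x j :
  open U -> open V -> (forall x, U x -> V (g x)) ->
  (forall i, smooth U (fun x => g x 0 i)) -> smooth V f -> U x ->
  pd j (f \o g) x = \sum_i pd i f (g x) * pd j (fun y => g y 0 i) x.
Proof.
move=> oU oV gUV hg hf Ux; apply: pd_comp => [i|].
  exact: smooth_diff (hg i) Ux.
exact: smooth_diff hf (gUV _ Ux).
Qed.

End Calculus.

(** * Tensor calculus over a ring with commuting derivations *)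

Section MatrixEntries.
Variables (A : pzRingType) (m n : nat).
Implicit Types M N : 'M[A]_(m, n).
Lemma mxaddE M N i j : (M + N) i j = M i j + N i j. Proof. by rewrite mxE. Qed.
Lemma mxoppE M i j : (- M) i j = - M i j. Proof. by rewrite mxE. Qed.
Lemma mxscaleE a M i j : (a *: M) i j = a * M i j. Proof. by rewrite mxE. Qed.
Lemma mx0E i j : (0 : 'M[A]_(m, n)) i j = 0. Proof. by rewrite mxE. Qed.
Definition mxlinE := (mxaddE, mxoppE, mxscaleE, mx0E).
End MatrixEntries.

(* Closes identities between linear combinations of matrices. *)
Ltac mxlin := apply/matrixP => ? ?; rewrite !mxlinE; ring.

Lemma scale11 (A : comNzRingType) p (M : 'M[A]_(p, 1)) (s : 'M[A]_1) :
  s 0 0 *: M = M *m s.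
Proof. by rewrite {2}[s]mx11_scalar mul_mx_scalar. Qed.

Lemma scale11l (A : comNzRingType) p (M : 'M[A]_(1, p)) (s : 'M[A]_1) :
  s 0 0 *: M = s *m M.
Proof. by rewrite {2}[s]mx11_scalar mul_scalar_mx. Qed.

Lemma trZ (A : comNzRingType) m n (a : A) (M : 'M[A]_(m, n)) : (a *: M)^T = a *: M^T.
Proof. by rewrite linearZ. Qed.

Lemma trD (A : comNzRingType) m n (M N : 'M[A]_(m, n)) : (M + N)^T = M^T + N^T.
Proof. by rewrite linearD. Qed.

Lemma trB (A : comNzRingType) m n (M N : 'M[A]_(m, n)) : (M - N)^T = M^T - N^T.
Proof. by rewrite linearB. Qed.

Lemma tr11 (A : comNzRingType) (s : 'M[A]_1) : s^T = s.
Proof. by apply/matrixP => i j; rewrite mxE !ord1. Qed.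

(** Over an abstract ring every tensor identity becomes an identity of polynomials
    in matrix entries and their derivatives, with no smoothness side conditions. *)
Record derivations (n : nat) (A : comNzRingType) := Derivations {
  dd :> 'I_n -> A -> A;
  ddD : forall i a b, dd i (a + b) = dd i a + dd i b;
  ddM : forall i a b, dd i (a * b) = dd i a * b + a * dd i b;
  ddC : forall i j a, dd i (dd j a) = dd j (dd i a) }.

Section DerivationTheory.
Variables (n : nat) (A : comNzRingType) (d : derivations n A).

Lemma dd0 i : d i 0 = 0.
Proof. by apply: (addrI (d i 0)); rewrite -ddD !addr0. Qed.

Lemma dd1 i : d i 1 = 0.
Proof. by apply: (addrI (d i 1)); rewrite addr0 -[in RHS](mulr1 1) ddM mulr1 mul1r. Qed.

Lemma ddN i a : d i (- a) = - d i a.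
Proof. by apply/eqP; rewrite -addr_eq0 -ddD addNr dd0. Qed.

Lemma ddB i a b : d i (a - b) = d i a - d i b.
Proof. by rewrite ddD ddN. Qed.

Lemma dd_sum i (I : Type) (r : seq I) (P : pred I) (F : I -> A) :
  d i (\sum_(k <- r | P k) F k) = \sum_(k <- r | P k) d i (F k).
Proof. by apply: (big_morph (d i)); [exact: ddD|exact: dd0]. Qed.

Lemma ddn i m : d i m%:R = 0.
Proof. by elim: m => [|m IH]; rewrite ?dd0 // -natr1 ddD IH dd1 addr0. Qed.

Definition dmx p q i (M : 'M[A]_(p, q)) : 'M[A]_(p, q) := map_mx (d i) M.

Lemma dmxD p q i (M N : 'M[A]_(p, q)) : dmx i (M + N) = dmx i M + dmx i N.
Proof. by apply/matrixP => k l; rewrite !mxE ddD. Qed.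

Lemma dmxN p q i (M : 'M[A]_(p, q)) : dmx i (- M) = - dmx i M.
Proof. by apply/matrixP => k l; rewrite !mxE ddN. Qed.

Lemma dmxB p q i (M N : 'M[A]_(p, q)) : dmx i (M - N) = dmx i M - dmx i N.
Proof. by rewrite dmxD dmxN. Qed.

Lemma dmxM p q r i (M : 'M[A]_(p, q)) (N : 'M[A]_(q, r)) :
  dmx i (M *m N) = dmx i M *m N + M *m dmx i N.
Proof.
apply/matrixP => k l; rewrite !mxE dd_sum -big_split /=; apply: eq_bigr => j _.
by rewrite !mxE ddM.
Qed.

Lemma dmxZ p q i a (M : 'M[A]_(p, q)) : dmx i (a *: M) = d i a *: M + a *: dmx i M.
Proof. by apply/matrixP => k l; rewrite !mxE ddM. Qed.

Lemma dmx_tr p q i (M : 'M[A]_(p, q)) : dmx i M^T = (dmx i M)^T.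
Proof. by apply/matrixP => k l; rewrite !mxE. Qed.

Lemma dmx_scalar p i : dmx i (1%:M : 'M[A]_p) = 0.
Proof. by apply/matrixP => k l; rewrite !mxE; case: eqP => _; rewrite /= ?dd1 ?dd0. Qed.

Lemma dmxC p q i j (M : 'M[A]_(p, q)) : dmx i (dmx j M) = dmx j (dmx i M).
Proof. by apply/matrixP => k l; rewrite !mxE ddC. Qed.

(** A connection is a family of matrices: [Gam i k l] is the [l]-th component of
    the derivative of the [k]-th coordinate field in the direction [i], so that
    the covariant derivative of a row vector [v] is [dmx i v + v *m Gam i]. *)
Definition levi_civita (G : 'M[A]_n) (Gam : 'I_n -> 'M[A]_n) : Prop :=
  (forall i k l, Gam i k l = Gam k i l) /\
  (forall i, dmx i G = Gam i *m G + G *m (Gam i)^T).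

Definition curv (Gam : 'I_n -> 'M[A]_n) i j : 'M[A]_n :=
  dmx i (Gam j) - dmx j (Gam i) + Gam j *m Gam i - Gam i *m Gam j.

Definition scalar_curv (Q : 'M[A]_n) (Gam : 'I_n -> 'M[A]_n) : A :=
  \sum_i \sum_j (Q *m curv Gam i j) j i.

Definition divg (Gam : 'I_n -> 'M[A]_n) (v : 'rV[A]_n) : A :=
  \sum_i (dmx i v + v *m Gam i) 0 i.

Definition low_chr (G : 'M[A]_n) i : 'M[A]_n :=
  \matrix_(k, p) (d i (G k p) + d k (G i p) - d p (G i k)).

Definition chr (half : A) (G Q : 'M[A]_n) i : 'M[A]_n :=
  (half *: low_chr G i) *m Q.

Lemma chr_lc half G Q : half * 2 = 1 -> G^T = G -> Q^T = Q -> Q *m G = 1%:M ->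
  levi_civita G (chr half G Q).
Proof.
move=> h2 GT QT QG; have GE k l : G k l = G l k by rewrite -{1}GT mxE.
have GQ : G *m Q = 1%:M by rewrite -GT -QT -trmx_mul QG trmx1.
split=> [i k l|i].
  rewrite !mxE; apply: eq_bigr => p _; rewrite !mxE (GE k i); ring.
have E : chr half G Q i *m G = half *: low_chr G i by rewrite -mulmxA QG mulmx1.
rewrite -[X in X *m (chr _ _ _ _)^T]GT -trmx_mul E; apply/matrixP => k l; rewrite !mxE.
rewrite -[LHS]mul1r -h2 (GE l k) (GE i k) (GE i l); ring.
Qed.

(** Koszul's argument: the lowered difference of two such connections is symmetric
    in the first two indices and antisymmetric in the last two, and a cyclic
    permutation of the indices makes it equal to its opposite. *)
Lemma lc_unique (half : A) G Q Gam Gam' : half * 2 = 1 -> G^T = G -> G *m Q = 1%:M ->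
  levi_civita G Gam -> levi_civita G Gam' -> forall i, Gam i = Gam' i.
Proof.
move=> h2 GT GQ [s1 c1] [s2 c2] i.
pose e i : 'M[A]_n := (Gam i - Gam' i) *m G.
have e1 i' k l : e i' k l = - e i' l k.
  have : e i' + (e i')^T = 0.
    rewrite /e trmx_mul trB GT mulmxBl mulmxBr.
    have := c1 i'; rewrite c2 => /eqP; rewrite -subr_eq0 => /eqP H.
    rewrite -[RHS]oppr0 -H; apply/matrixP => a b; rewrite ![in LHS]mxE ![in RHS]mxE.
    ring.
  by move=> /matrixP /(_ k l); rewrite !mxE => /eqP; rewrite addr_eq0 => /eqP.
have e2 i' k l : e i' k l = e k i' l.
  by rewrite !mxE; apply: eq_bigr => p _; rewrite !mxE s1 s2.
have e0 : e i = 0.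
  apply/matrixP => k l.
  have h : e i k l = - e i k l.
    by rewrite {1}e1 e2 e1 e2 e1 e2 !opprK.
  rewrite -[e i k l]mul1r -h2 [RHS]mxE -mulrA (_ : 2 * _ = 0) ?mulr0 //.
  by rewrite mulr_natl mulr2n {1}h addNr.
apply/eqP; rewrite -subr_eq0; apply/eqP.
by rewrite -[LHS]mulmx1 -GQ mulmxA -/(e i) e0 mul0mx.
Qed.

Lemma lc_inv G Q Gam : Q *m G = 1%:M -> G *m Q = 1%:M -> levi_civita G Gam ->
  forall i, dmx i Q = - (Q *m Gam i) - (Gam i)^T *m Q.
Proof.
move=> QG GQ [_ c] i.
have : dmx i (Q *m G) = 0 by rewrite QG dmx_scalar.
rewrite dmxM c => /eqP; rewrite addr_eq0 => /eqP H.
rewrite -[LHS]mulmx1 -GQ mulmxA H mulNmx mulmxDr mulmxDl opprD.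
by rewrite -!mulmxA GQ mulmx1 (mulmxA Q G) QG mul1mx.
Qed.

Lemma curv_anti Gam i j : curv Gam i j = - curv Gam j i.
Proof. by rewrite /curv; apply/matrixP => k l; rewrite ![in LHS]mxE ![in RHS]mxE; ring. Qed.

(** The lowered curvature is antisymmetric in its two bundle indices, because
    second derivatives of the metric commute. *)
Lemma curv_low_anti G Gam i j : G^T = G -> levi_civita G Gam ->
  curv Gam i j *m G = - (curv Gam i j *m G)^T.
Proof.
move=> GT [_ c].
have E i' j' : dmx i' (dmx j' G) = dmx i' (Gam j') *m G + Gam j' *m (Gam i' *m G)
   + (dmx i' (Gam j') *m G)^T + (Gam j' *m (Gam i' *m G))^T
   + Gam j' *m G *m (Gam i')^T + Gam i' *m G *m (Gam j')^T.
  rewrite c dmxD !dmxM c dmx_tr !trmx_mul GT !mulmxDl !mulmxDr !mulmxA.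
  by apply/matrixP => k l; rewrite ![in LHS]mxE ![in RHS]mxE; ring.
have := dmxC i j G; rewrite !E => H.
rewrite /curv !mulmxDl !mulNmx -!mulmxA.
apply/eqP; rewrite -subr_eq0; apply/eqP/matrixP => k l.
move/matrixP/(_ k l): H; rewrite ![in X in X -> _]mxE => /eqP; rewrite -subr_eq0 => /eqP H.
by rewrite ![in RHS]mxE -[RHS]H ![in LHS]mxE; ring.
Qed.

Section Divergence.
Variable Gam : 'I_n -> 'M[A]_n.

Lemma divgD v v' : divg Gam (v + v') = divg Gam v + divg Gam v'.
Proof.
by rewrite /divg -big_split; apply: eq_bigr => i _; rewrite dmxD mulmxDl !mxlinE addrACA.
Qed.

Lemma divgN v : divg Gam (- v) = - divg Gam v.
Proof.
rewrite /divg -sumrN; apply: eq_bigr => i _.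
by rewrite dmxN mulNmx !mxlinE opprD.
Qed.

Lemma divgZ a v : divg Gam (a *: v) = \sum_i v 0 i * d i a + a * divg Gam v.
Proof.
rewrite /divg big_distrr -big_split; apply: eq_bigr => i _ /=.
by rewrite dmxZ -scalemxAl !mxlinE; ring.
Qed.

Lemma divg_grad (f : 'rV[A]_n) G Q : G *m Q = 1%:M -> Q *m G = 1%:M -> levi_civita G Gam ->
  divg Gam (f *m Q) = \sum_i ((dmx i f - f *m (Gam i)^T) *m Q) 0 i.
Proof.
move=> GQ QG lcG.
have E i : dmx i (f *m Q) + f *m Q *m Gam i = (dmx i f - f *m (Gam i)^T) *m Q.
  rewrite dmxM (lc_inv QG GQ lcG) mulmxBr mulmxN mulmxBl !mulmxA; mxlin.
by apply: eq_bigr => i _; rewrite E.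
Qed.
End Divergence.

(** Differentiating the square norm [1], both factors contribute the same term. *)
Lemma unit_derivative_orth (half : A) G Gam (v : 'rV[A]_n) i : half * 2 = 1 -> G^T = G ->
  levi_civita G Gam -> v *m G *m v^T = 1%:M ->
  (dmx i v + v *m Gam i) *m G *m v^T = 0.
Proof.
move=> h2 GT lcG v1; set s := _ *m v^T.
have : dmx i (v *m G *m v^T) = 0 by rewrite v1 dmx_scalar.
have -> : dmx i (v *m G *m v^T) = s + s.
  have sT : s = v *m G *m (dmx i v + v *m Gam i)^T.
    by rewrite -[LHS]tr11 /s !trmx_mul trmxK GT mulmxA.
  rewrite {2}sT /s !dmxM lcG.2 dmx_tr trD trmx_mul !(mulmxDl, mulmxDr) !mulmxA; mxlin.
move=> e; apply/matrixP => a b; move/matrixP/(_ a b): e; rewrite !mxlinE => e.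
by rewrite -[LHS]mul1r -h2 -mulrA mulr_natl mulr2n e mulr0.
Qed.

End DerivationTheory.

(** The graph of a function with differential [f] over the metric [G] with inverse
    [Q]: [r] is the inverse of the slope factor, [w] the horizontal part of the unit
    normal, [hr i] the [i]-th row of the second fundamental form and [P] the inverse
    of the graph metric. *)
Section GraphCurvature.
Variables (n : nat) (A : comNzRingType) (d : derivations n A) (half : A).
Variables (G Q P : 'M[A]_n) (Gam : 'I_n -> 'M[A]_n) (f w : 'rV[A]_n) (r : A).
Variables (hess hr : 'I_n -> 'rV[A]_n).
Hypothesis half2 : half * 2 = 1.
Hypotheses (GT : G^T = G) (QT : Q^T = Q) (GQ : G *m Q = 1%:M) (QG : Q *m G = 1%:M).
Hypothesis lcG : levi_civita d G Gam.
Hypothesis f_closed : forall i j, d i (f 0 j) = d j (f 0 i).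
Hypothesis rW : r * r * (1 + (f *m Q *m f^T) 0 0) = 1.
Hypothesis wE : w = r *: (f *m Q).
Hypothesis hessE : forall i, hess i = dmx d i f - f *m (Gam i)^T.
Hypothesis hrE : forall i, hr i = r *: hess i.
Hypothesis PE : P = Q - w^T *m w.

Lemma graph_wG : w *m G = r *: f.
Proof. by rewrite wE -scalemxAl -mulmxA QG mulmx1. Qed.

Lemma graph_h_sym i j : hr i 0 j = hr j 0 i.
Proof.
rewrite !hrE !hessE !mxE f_closed; congr (_ * (_ - _)); apply: eq_bigr => k _.
by rewrite !mxE lcG.1.
Qed.

Lemma graph_df i : dmx d i (f *m Q) = hess i *m Q - f *m Q *m Gam i.
Proof.
rewrite dmxM (lc_inv QG GQ lcG) hessE mulmxBr mulmxN mulmxBl !mulmxA.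
mxlin.
Qed.

Lemma graph_dr i : d i r = - r * (hr i *m w^T) 0 0.
Proof.
have rW' := rW.
set s := (f *m Q *m f^T) 0 0 in rW'.
have h0 : (f *m Q *m (hess i)^T) 0 0 = (hess i *m Q *m f^T) 0 0.
  by rewrite -[_ *m Q *m f^T]tr11 !trmx_mul trmxK QT mulmxA.
have ds : d i s = 2 * (hess i *m Q *m f^T) 0 0.
  have -> : d i s = (dmx d i (f *m Q *m f^T)) 0 0 by rewrite mxE.
  have h1 : dmx d i f = hess i + f *m (Gam i)^T by rewrite hessE subrK.
  rewrite dmxM graph_df dmx_tr h1 trD trmx_mul trmxK mulmxBl mulmxDr !mulmxA.
  by rewrite !mxlinE h0; ring.
have d0 : d i (r * r * (1 + s)) = 0 by rewrite rW' dd1.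
have -> : (hr i *m w^T) 0 0 = r * r * (hess i *m Q *m f^T) 0 0.
  by rewrite hrE wE trZ trmx_mul QT -scalemxAl -scalemxAr scalerA mxE mulmxA.
set t := (hess i *m Q *m f^T) 0 0 in ds *.
move: d0; rewrite !ddM ddD dd1 ds => d0.
have e2 : 2 * (d i r + r * (r * r * t)) = 0.
  have -> : 2 * (d i r + r * (r * r * t)) =
     (r * ((d i r * r + r * d i r) * (1 + s) + r * r * (0 + 2 * t))
      + 2 * (1 - r * r * (1 + s)) * d i r) by ring.
  by rewrite d0 rW'; ring.
apply/eqP; rewrite -subr_eq0; apply/eqP.
have -> : d i r - - r * (r * r * t) = (half * 2) * (d i r + r * (r * r * t)).
  by rewrite half2; ring.
by rewrite -mulrA e2 mulr0.
Qed.

(** The Weingarten equation, projected to the base. *)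
Lemma graph_dw i : dmx d i w + w *m Gam i = hr i *m P.
Proof.
rewrite {1 2}wE dmxZ graph_df graph_dr PE mulmxBr [hr i *m (w^T *m w)]mulmxA.
rewrite -[hr i *m w^T *m w]scale11l; set s := (hr i *m w^T) 0 0.
rewrite hrE wE -!scalemxAl; mxlin.
Qed.

(** Codazzi's equation for the graph: differentiating the second form brings out
    the curvature applied to the gradient. *)
Lemma graph_codazzi i j :
  (dmx d i (hr j)^T - Gam i *m (hr j)^T) - (dmx d j (hr i)^T - Gam j *m (hr i)^T)
  = - (curv d Gam i j *m (w *m G)^T)
    - (hr j)^T *m (hr i *m w^T) + (hr i)^T *m (hr j *m w^T).
Proof.
have E i' j' : dmx d i' (hr j')^T - Gam i' *m (hr j')^T =
    r *: (dmx d i' (dmx d j' f^T) - dmx d i' (Gam j') *m f^T - Gam j' *m dmx d i' f^T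
          - Gam i' *m dmx d j' f^T + Gam i' *m Gam j' *m f^T)
    - (hr j')^T *m (hr i' *m w^T).
  rewrite -scale11; set s := (hr i' *m w^T) 0 0.
  rewrite hrE trZ dmxZ graph_dr -/s.
  rewrite hessE trB trmx_mul trmxK dmxB dmxM -!dmx_tr.
  rewrite -scalemxAr mulmxBr !mulmxA; mxlin.
rewrite !E graph_wG /curv trZ -[X in _ = - X - _ + _]scalemxAr (dmxC d i j).
rewrite !mulmxDl !mulNmx; mxlin.
Qed.

Definition graph_gam i := Gam i + (hr i)^T *m w.

(** The Gauss equation: the ambient space is the Riemannian product with a line, so
    the ambient curvature is the curvature of the base. *)
Lemma graph_curv i j : curv d graph_gam i j =
  (curv d Gam i j *m G + (hr j)^T *m hr i - (hr i)^T *m hr j) *m P.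
Proof.
have GP : G *m P = 1%:M - (w *m G)^T *m w.
  by rewrite PE mulmxBr GQ mulmxA trmx_mul GT.
have C := graph_codazzi i j.
have Ti := graph_dw i; have Tj := graph_dw j.
have -> : curv d graph_gam i j = curv d Gam i j
   + ((dmx d i (hr j)^T - Gam i *m (hr j)^T) - (dmx d j (hr i)^T - Gam j *m (hr i)^T)) *m w
   + (hr j)^T *m (dmx d i w + w *m Gam i) - (hr i)^T *m (dmx d j w + w *m Gam j)
   + (hr j)^T *m (w *m (hr i)^T) *m w - (hr i)^T *m (w *m (hr j)^T) *m w.
  rewrite /curv /graph_gam !dmxD !dmxM !mulmxDl !mulmxDr !mulNmx !mulmxA.
  rewrite ![(_ - _) *m w]mulmxBl; mxlin.
rewrite C Ti Tj.
have X i' : w *m (hr i')^T = hr i' *m w^T.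
  by rewrite -[RHS]tr11 trmx_mul trmxK.
have EG : curv d Gam i j *m G *m P = curv d Gam i j - curv d Gam i j *m ((w *m G)^T *m w).
  by rewrite -mulmxA GP mulmxBr mulmx1.
rewrite !X; move: EG; clear C; move: (curv d Gam i j) => RR EG.
rewrite [RHS]mulmxBl [X in _ = X - _]mulmxDl EG !mulmxDl !mulNmx !mulmxA; mxlin.
Qed.

Lemma graph_PG : P *m (G + f^T *m f) = 1%:M.
Proof.
have e1 : w^T *m w *m G = (r * r) *: (Q *m f^T *m f).
  by rewrite -mulmxA graph_wG wE trZ trmx_mul QT -scalemxAl -scalemxAr scalerA.
have e2 : w^T *m w *m (f^T *m f) = (r * r * (f *m Q *m f^T) 0 0) *: (Q *m f^T *m f).
  rewrite wE trZ trmx_mul QT -scalemxAl -scalemxAr scalerA -scalemxAl -[RHS]scalerA.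
  by congr (_ *: _); rewrite scalemxAl scale11 !mulmxA.
rewrite PE mulmxBl !mulmxDr QG e1 e2 mulmxA.
have := rW; set s := (f *m Q *m f^T) 0 0 => rW'.
rewrite -scalerDl -[X in X + (r * r * s)]mulr1 -mulrDr rW' scale1r addrK //.
Qed.

(** The graph connection is guessed from the base connection and the second
    fundamental form; [lc_unique] makes it the Levi-Civita connection. *)
Lemma graph_lc : levi_civita d (G + f^T *m f) graph_gam.
Proof.
split=> [i k l|i].
  by rewrite /graph_gam !mxE lcG.1 !big_ord1 !mxE graph_h_sym.
have h1 : dmx d i f = hess i + f *m (Gam i)^T by rewrite hessE subrK.
have h2 : w *m (G + f^T *m f) = (r * (1 + (f *m Q *m f^T) 0 0)) *: f.
  rewrite mulmxDr graph_wG wE -scalemxAl mulmxA -scale11l; mxlin.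
have h3 : (hr i)^T *m w *m (G + f^T *m f) = (hess i)^T *m f.
  rewrite -mulmxA h2 hrE trZ -scalemxAl -scalemxAr scalerA mulrA rW.
  by rewrite scale1r.
have h4 : (G + f^T *m f) *m ((hr i)^T *m w)^T = ((hess i)^T *m f)^T.
  by rewrite -h3 [RHS]trmx_mul; congr (_ *m _); rewrite trD GT trmx_mul trmxK.
rewrite /graph_gam mulmxDl h3 [(_ + _)^T in RHS]trD [(G + _) *m _]mulmxDr h4 dmxD dmxM.
rewrite lcG.2 dmx_tr h1 trD !trmx_mul !trmxK !mulmxDl !mulmxDr !mulmxA.
mxlin.
Qed.

End GraphCurvature.

Definition o0 : 'I_3 := @Ordinal 3 0 isT.
Definition o1 : 'I_3 := @Ordinal 3 1 isT.
Definition o2 : 'I_3 := @Ordinal 3 2 isT.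

Lemma ind3 (P : 'I_3 -> Prop) : P o0 -> P o1 -> P o2 -> forall i, P i.
Proof.
move=> h0 h1 h2 [[|[|[|//]]] hi].
- by rewrite (_ : Ordinal hi = o0) //; exact/val_inj.
- by rewrite (_ : Ordinal hi = o1) //; exact/val_inj.
- by rewrite (_ : Ordinal hi = o2) //; exact/val_inj.
Qed.

Lemma sum3 (V : nmodType) (F : 'I_3 -> V) : \sum_i F i = F o0 + F o1 + F o2.
Proof.
rewrite !big_ord_recl big_ord0 addr0 addrA.
by congr (F _ + F _ + F _); exact/val_inj.
Qed.
Lemma sum2 (V : nmodType) (F : 'I_2 -> V) : \sum_i F i = F 0 + F 1.
Proof. by rewrite big_ord_recl big_ord1; congr (F _ + F _); exact/val_inj. Qed.

Lemma ind2 (P : 'I_2 -> Prop) : P 0 -> P 1 -> forall i, P i.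
Proof.
move=> h0 h1 [[|[|//]] hi].
- by rewrite (_ : Ordinal hi = 0) //; exact/val_inj.
- by rewrite (_ : Ordinal hi = 1) //; exact/val_inj.
Qed.

Section SchoenYau.
Variables (A : comNzRingType) (d : derivations 3 A) (half : A).
Variables (G Q P K h T : 'M[A]_3) (Gam : 'I_3 -> 'M[A]_3) (f w : 'rV[A]_3) (r : A).
Variables (hess hr : 'I_3 -> 'rV[A]_3).
Hypothesis half2 : half * 2 = 1.
Hypotheses (GT : G^T = G) (QT : Q^T = Q) (GQ : G *m Q = 1%:M) (QG : Q *m G = 1%:M).
Hypothesis lcG : levi_civita d G Gam.
Hypothesis f_closed : forall i j, d i (f 0 j) = d j (f 0 i).
Hypothesis rW : r * r * (1 + (f *m Q *m f^T) 0 0) = 1.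
Hypothesis wE : w = r *: (f *m Q).
Hypothesis hessE : forall i, hess i = dmx d i f - f *m (Gam i)^T.
Hypothesis hrE : forall i, hr i = r *: hess i.
Hypothesis PE : P = Q - w^T *m w.
Hypothesis hE : h = \matrix_(i, j) hr i 0 j.
Hypothesis TE : T = h *m P.

Let grow := graph_dw half2 QT GQ QG lcG rW wE hessE hrE PE.
Let gcurv := graph_curv half2 GT QT GQ QG lcG rW wE hessE hrE PE.

Lemma sy_hT : h^T = h.
Proof. by apply/matrixP => i j; rewrite hE !mxE (graph_h_sym lcG f_closed hessE hrE). Qed.

Lemma sy_PT : P^T = P.
Proof. by rewrite PE trB trmx_mul trmxK QT. Qed.

Lemma sy_hrow i : hr i = row i h.
Proof. by apply/rowP => j; rewrite hE !mxE. Qed.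

Lemma sy_Trow i : dmx d i w + w *m Gam i = row i T.
Proof. by rewrite grow TE row_mul sy_hrow. Qed.

(** The Ricci curvature of [w] in its own direction. *)
Definition sy_rho : A := \sum_j w 0 j * \sum_i (w *m curv d Gam i j) 0 i.

(** The twice traced Gauss equation.  The inverse graph metric differs from [Q] by
    the square of [w], and this is where the Ricci curvature of [w] enters. *)
Lemma sy_scal :
  scalar_curv d P (graph_gam Gam w hr) =
  scalar_curv d Q Gam - sy_rho - sy_rho + \tr T * \tr T - \tr (T *m T).
Proof.
have anti i j : curv d Gam i j *m G = - (curv d Gam i j *m G)^T.
  exact: curv_low_anti.
have E i j : (P *m curv d (graph_gam Gam w hr) i j) j i =
   (P *m (curv d Gam i j *m G) *m P) j i + (P *m ((hr j)^T *m hr i - (hr i)^T *m hr j) *m P) j i.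
  by rewrite gcurv mulmxA -mxaddE -mulmxDl -mulmxDr addrA.
have S1 : \sum_i \sum_j (P *m ((hr j)^T *m hr i - (hr i)^T *m hr j) *m P) j i =
    \tr T * \tr T - \tr (T *m T).
  have tT i j : T i j = (P *m h) j i.
    by rewrite TE -[h *m P]trmxK trmx_mul sy_PT sy_hT mxE.
  have -> : \tr (T *m T) = \sum_i \sum_j T j i * (P *m h) j i.
    rewrite /mxtrace exchange_big; apply: eq_bigr => j _; rewrite mxE.
    by apply: eq_bigr => i _; rewrite [T i j]tT.
  have hP i j : (P *m ((hr j)^T *m hr i - (hr i)^T *m hr j) *m P) j i =
     T i i * T j j - T j i * (P *m h) j i.
    rewrite mulmxBr mulmxBl mxaddE mxoppE !mulmxA.
    have Y a b : (P *m (hr a)^T *m hr b *m P) j i = (P *m h) j a * T b i.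
      rewrite -mulmxA -[X in X j i]/(_) mxE big_ord1; congr (_ * _).
        by rewrite sy_hrow tr_row sy_hT !mxE; apply: eq_bigr => p _; rewrite mxE.
      by rewrite sy_hrow -row_mul -TE mxE.
    by rewrite !Y -tT mulrC [X in _ - X]mulrC.
  under eq_bigr do under eq_bigr do rewrite hP.
  rewrite /mxtrace big_distrl /= -sumrB; apply: eq_bigr => i _.
  by rewrite big_distrr /= -sumrB.
have S2 : \sum_i \sum_j (P *m (curv d Gam i j *m G) *m P) j i =
    scalar_curv d Q Gam - sy_rho - sy_rho.
  have anti' i j : w *m (curv d Gam i j *m G) *m w^T = 0.
    have BT := anti i j; move: (curv d Gam i j *m G) BT => B BT.
    have BT' : B^T = - B by rewrite [X in _ = - X]BT opprK.
    set s := _ *m w^T; have e : s = - s.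
      by rewrite -[in LHS](tr11 s) /s trmx_mul trmxK trmx_mul BT' mulNmx mulmxN mulmxA.
    apply/matrixP => a b; rewrite !ord1 mx0E -[LHS]mul1r -half2 -mulrA mulr_natl mulr2n.
    by rewrite {1}e mxoppE addNr mulr0.
  have F i j : (P *m (curv d Gam i j *m G) *m P) j i = (Q *m curv d Gam i j) j i
      + (w *m curv d Gam i j) 0 j * w 0 i - w 0 j * (w *m curv d Gam i j) 0 i.
    have X1 : Q *m (curv d Gam i j *m G) *m Q = Q *m curv d Gam i j.
      by rewrite -!mulmxA GQ mulmx1.
    have X2 : w *m (curv d Gam i j *m G) *m Q = w *m curv d Gam i j.
      by rewrite -!mulmxA GQ mulmx1.
    have X3 : Q *m (curv d Gam i j *m G) *m w^T = - (w *m curv d Gam i j)^T.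
      have BT' : (curv d Gam i j *m G)^T = - (curv d Gam i j *m G).
        by rewrite [X in _ = - X]anti opprK.
      by rewrite -X2 trmx_mul QT (trmx_mul w) BT' mulNmx mulmxN opprK [RHS]mulmxA.
    have -> : P *m (curv d Gam i j *m G) *m P = Q *m (curv d Gam i j *m G) *m Q
      - (Q *m (curv d Gam i j *m G) *m w^T) *m w - w^T *m (w *m (curv d Gam i j *m G) *m Q)
      + w^T *m (w *m (curv d Gam i j *m G) *m w^T) *m w.
      rewrite PE; move: (curv d Gam i j *m G) => B.
      rewrite !(mulmxBl, mulmxBr) !mulmxA; mxlin.
    rewrite anti' mulmx0 mul0mx addr0 X1 X2 X3 mulNmx opprK !mxaddE mxoppE.
    congr (_ + _ - _).
      by rewrite [LHS]mxE big_ord1 mxE.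
    by rewrite [LHS]mxE big_ord1 mxE.
  under eq_bigr do under eq_bigr do rewrite F.
  under eq_bigr do rewrite sumrB big_split /=.
  rewrite sumrB big_split /= -/(scalar_curv d Q Gam); congr (_ + _ - _).
    rewrite /sy_rho -sumrN; apply: eq_bigr => j _.
    rewrite big_distrr /= -sumrN; apply: eq_bigr => i _.
    by rewrite curv_anti mulmxN mxoppE mulNr; congr (- _); exact: mulrC.
  by rewrite exchange_big; apply: eq_bigr => j _; rewrite big_distrr.
rewrite /scalar_curv; under eq_bigr do under eq_bigr do rewrite E.
under eq_bigr do rewrite big_split /=.
by rewrite big_split /= S1 S2 addrA.
Qed.

(** The curvature applied to [w] is the antisymmetrised second derivative of [w],
    and [T] is its first derivative. *)
Lemma sy_ricci i j : w *m curv d Gam i j =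
  (dmx d i (row j T) + row j T *m Gam i) - (dmx d j (row i T) + row i T *m Gam j).
Proof.
rewrite -!sy_Trow /curv !dmxD !dmxM !mulmxDl (dmxC d i j) !mulmxDr !mulmxN !mulmxA.
mxlin.
Qed.

Lemma divg_w : divg d Gam w = \tr T.
Proof. by apply: eq_bigr => i _; rewrite sy_Trow mxE. Qed.

(** A Bochner formula: the Ricci term cancels against the one of [sy_scal] once
    the divergence is doubled. *)
Lemma divg_wT : divg d Gam (w *m T) =
  \tr (T *m T) + sy_rho + \sum_j w 0 j * d j (\tr T).
Proof.
have swap : \sum_i (w *m Gam i *m T) 0 i = \sum_j w 0 j * \sum_i (T *m Gam j) i i.
  rewrite !sum3 !mxE !sum3 !mxE !sum3.
  rewrite !(lcG.1 o1 o0) !(lcG.1 o2 o0) !(lcG.1 o2 o1); ring.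
have E i : (dmx d i (w *m T) + w *m T *m Gam i) 0 i =
   (T *m T) i i - (w *m Gam i *m T) 0 i
   + \sum_j w 0 j * ((dmx d i (row j T) + row j T *m Gam i) 0 i).
  have -> : \sum_j w 0 j * ((dmx d i (row j T) + row j T *m Gam i) 0 i) =
     (w *m dmx d i T + w *m T *m Gam i) 0 i.
    rewrite -mulmxA -mulmxDr mxE; apply: eq_bigr => j _; congr (_ * _).
    by rewrite -row_mul !mxE.
  rewrite dmxM.
  have -> : dmx d i w = row i T - w *m Gam i by rewrite -sy_Trow addrK.
  rewrite mulmxBl -row_mul !mxlinE [(row _ _) _ _]mxE; ring.
rewrite /divg; under eq_bigr do rewrite E.
rewrite big_split sumrB /= swap -/(\tr (T *m T)).
have -> : sy_rho = \sum_j w 0 j * \sum_i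
   ((dmx d i (row j T) + row j T *m Gam i) 0 i - (dmx d j (row i T) + row i T *m Gam j) 0 i).
  by apply: eq_bigr => j _; congr (_ * _); apply: eq_bigr => i _; rewrite sy_ricci !mxlinE.
have tr' j : \sum_i (dmx d j (row i T) + row i T *m Gam j) 0 i =
   d j (\tr T) + \sum_i (T *m Gam j) i i.
  rewrite /mxtrace dd_sum -big_split; apply: eq_bigr => i _.
  by rewrite mxaddE -row_mul !mxE.
have -> : \sum_j w 0 j * \sum_i
   ((dmx d i (row j T) + row j T *m Gam i) 0 i - (dmx d j (row i T) + row i T *m Gam j) 0 i)
  = \sum_i \sum_j w 0 j * ((dmx d i (row j T) + row j T *m Gam i) 0 i)
    - \sum_j w 0 j * d j (\tr T) - \sum_j w 0 j * \sum_i (T *m Gam j) i i.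
  rewrite exchange_big /= -!sumrB; apply: eq_bigr => j _.
  rewrite sumrB tr' mulrBr big_distrr /=; ring.
ring.
Qed.

Lemma divg_graph v : divg d (graph_gam Gam w hr) v = divg d Gam v + (w *m h *m v^T) 0 0.
Proof.
rewrite /divg /graph_gam; under eq_bigr do rewrite mulmxDr addrA mxaddE.
rewrite big_split; congr (_ + _).
rewrite -[w *m h *m v^T]tr11 !trmx_mul trmxK sy_hT mulmxA mxE; apply: eq_bigr => i _.
rewrite [w^T _ _]mxE mulmxA mxE big_ord1; congr (_ * _).
by rewrite sy_hrow tr_row sy_hT !mxE; apply: eq_bigr => p _; rewrite mxE.
Qed.

(** [momentum] is the divergence of [K] minus the differential of its trace. *)
Definition covK i := dmx d i K - Gam i *m K - K *m (Gam i)^T.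
Definition momentum j := \sum_k \sum_i Q k i * covK k i j - d j (\tr (Q *m K)).

Hypothesis KT : K^T = K.

Lemma divg_wKQ : divg d Gam (w *m K *m Q) =
  \tr (T *m K *m Q) + \sum_j w 0 j * \sum_k \sum_i Q k i * covK k i j.
Proof.
have E i : dmx d i (w *m K *m Q) + w *m K *m Q *m Gam i =
   row i T *m K *m Q + w *m covK i *m Q.
  rewrite !dmxM (lc_inv QG GQ lcG) -sy_Trow /covK !mulmxDl !mulmxDr !mulmxN !mulmxDl.
  rewrite !mulNmx !mulmxA; mxlin.
have CT k i j : covK k i j = covK k j i.
  have : (covK k)^T = covK k.
    by rewrite /covK !trB !trmx_mul trmxK KT -dmx_tr KT addrAC.
  by move=> e; rewrite -{1}e mxE.
rewrite /divg; under eq_bigr do rewrite E mxaddE.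
rewrite big_split; congr (_ + _).
  by apply: eq_bigr => i _; rewrite -!row_mul mxE.
transitivity (\sum_i \sum_j w 0 j * (covK i *m Q) j i).
  by apply: eq_bigr => i _; rewrite -mulmxA mxE.
rewrite exchange_big /=; apply: eq_bigr => j _; rewrite -big_distrr; congr (_ * _).
apply: eq_bigr => k _ /=; rewrite mxE; apply: eq_bigr => i _.
by rewrite CT mulrC -{1}QT mxE.
Qed.

Lemma tr_rank1 (M : 'M[A]_3) (u v : 'rV[A]_3) : \tr (M *m (u^T *m v)) = (v *m M *m u^T) 0 0.
Proof. by rewrite mulmxA mxtrace_mulC mulmxA trace_mx11. Qed.

Hypothesis jang : \tr (P *m h) = \tr (P *m K).

Let Y := w *m (h - K) *m P.

(** The Ricci terms of the twice traced Gauss equation and of the divergence of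
    [w *m T] cancel.  Jang's equation identifies the trace of [T] with a trace of
    [K], which turns the derivative of the mean curvature along [w] into the one in
    the momentum of [K]; the remaining terms in [h] and [K] complete to squares of
    [h - K]. *)
Lemma schoen_yau :
  scalar_curv d P (graph_gam Gam w hr) + 2 * divg d (graph_gam Gam w hr) Y =
  scalar_curv d Q Gam - \tr (Q *m K *m Q *m K) + \tr (Q *m K) ^+ 2
  - 2 * \sum_j w 0 j * momentum j
  + \tr (P *m (h - K) *m P *m (h - K))
  + 2 * (w *m (h - K) *m P *m (h - K) *m w^T) 0 0.
Proof.
pose k := (w *m K *m w^T) 0 0; pose H := \tr T.
have hk : \tr (P *m K) = \tr (Q *m K) - k.
  by rewrite PE mulmxBl linearB /= mxtrace_mulC -[w^T *m w *m K]mulmxA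
     [\tr (w^T *m _)]mxtrace_mulC trace_mx11 [\tr (K *m Q)]mxtrace_mulC.
have HK : H + k = \tr (Q *m K).
  by rewrite /H TE mxtrace_mulC jang hk subrK.
have YE : Y = w *m T - (w *m K *m Q - k *: w).
  rewrite /Y mulmxBr mulmxBl TE mulmxA {2}PE mulmxBr [_ *m (w^T *m w)]mulmxA.
  by rewrite /k scale11l.
rewrite divg_graph {1}YE !(divgD, divgN) divg_wT divg_wKQ divgZ divg_w sy_scal.
have Jsum : \sum_j w 0 j * momentum j =
   \sum_j w 0 j * (\sum_k \sum_i Q k i * covK k i j) - \sum_j w 0 j * d j H - \sum_j w 0 j * d j k.
  rewrite -!sumrB; apply: eq_bigr => j _; rewrite /momentum -HK ddD; ring.
rewrite Jsum -HK -/H.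
have QE : Q = P + w^T *m w by rewrite PE subrK.
have tTKQ : \tr (T *m K *m Q) = \tr (P *m h *m P *m K) + (w *m h *m P *m K *m w^T) 0 0.
  rewrite {1}QE mulmxDr mxtraceD tr_rank1 TE !mulmxA; congr (_ + _).
  by rewrite mxtrace_mulC !mulmxA.
have tr1 (u v : 'rV[A]_3) : \tr (u^T *m v) = (v *m u^T) 0 0.
  by rewrite mxtrace_mulC trace_mx11.
have tQKQK : \tr (Q *m K *m Q *m K) =
    \tr (P *m K *m P *m K) + 2 * (w *m K *m P *m K *m w^T) 0 0 + k * k.
  have -> : Q *m K *m Q *m K = P *m K *m P *m K + P *m K *m (w^T *m (w *m K))
      + w^T *m (w *m K *m P *m K) + w^T *m (w *m K *m w^T *m (w *m K)).
    by rewrite QE !mulmxDl !mulmxDr !mulmxDl !mulmxA; mxlin.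
  rewrite !mxtraceD tr_rank1 !tr1 !mulmxA -[_ *m w *m K *m w^T]mulmxA.
  have -> : (w *m K *m w^T *m w *m (K *m w^T)) 0 0 = k * k.
    by rewrite -mulmxA (mulmxA w) mxE big_ord1.
  ring.
have tTT : \tr (T *m T) = \tr (P *m h *m P *m h).
  by rewrite TE -[h *m P *m _]mulmxA mxtrace_mulC !mulmxA.
have wh : w *m h *m Y^T = w *m h *m P *m h *m w^T - w *m h *m P *m K *m w^T.
  rewrite /Y !trmx_mul trB sy_hT KT sy_PT mulmxBl !mulmxBr !mulmxA; mxlin.
have sq1 : \tr (P *m (h - K) *m P *m (h - K)) = \tr (P *m h *m P *m h)
    - 2 * \tr (P *m h *m P *m K) + \tr (P *m K *m P *m K).
  have e : \tr (P *m K *m P *m h) = \tr (P *m h *m P *m K).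
    by rewrite -[P *m K *m P *m h]mulmxA mxtrace_mulC !mulmxA.
  rewrite !(mulmxBr, mulmxBl) !(mxtraceD, raddfN) /= e; ring.
have sq2 : (w *m (h - K) *m P *m (h - K) *m w^T) 0 0 = (w *m h *m P *m h *m w^T) 0 0
    - 2 * (w *m h *m P *m K *m w^T) 0 0 + (w *m K *m P *m K *m w^T) 0 0.
  have e : w *m K *m P *m h *m w^T = w *m h *m P *m K *m w^T.
    by rewrite -[LHS]tr11 !trmx_mul trmxK KT sy_hT sy_PT !mulmxA.
  rewrite !(mulmxBr, mulmxBl) e !mxlinE; ring.
rewrite tTKQ tQKQK tTT wh sq1 sq2 mxaddE mxoppE.
ring.
Qed.

End SchoenYau.

Section Conformal.
Variables (A : comNzRingType) (d : derivations 3 A).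
Variables (G Q : 'M[A]_3) (Gam : 'I_3 -> 'M[A]_3) (u v : A).
Hypotheses (GT : G^T = G) (QT : Q^T = Q) (GQ : G *m Q = 1%:M) (QG : Q *m G = 1%:M).
Hypothesis lcG : levi_civita d G Gam.
Hypothesis uv : u * v = 1.

Variables (du phi b : 'rV[A]_3) (e hessu Phi : 'I_3 -> 'rV[A]_3) (C : 'I_3 -> 'M[A]_3).
Hypothesis duE : forall i, du 0 i = d i u.
Hypothesis phiE : phi = v *: du.
Hypothesis bE : b = phi *m Q.
Hypothesis eE : forall i, e i = delta_mx 0 i.
Hypothesis CE : forall i,
  C i = 2 *: (phi^T *m e i + phi 0 i *: 1%:M - (G *m (e i)^T) *m b).
Hypothesis hessuE : forall i, hessu i = dmx d i du - du *m (Gam i)^T.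
Hypothesis PhiE : forall i, Phi i = dmx d i phi - phi *m (Gam i)^T.

Lemma conf_e i j : e i 0 j = (j == i)%:R.
Proof. by rewrite eE mxE eqxx. Qed.

Lemma conf_Ge i j : (G *m (e i)^T) j 0 = G j i.
Proof. by rewrite eE trmx_delta -colE mxE. Qed.

Definition conf_gam i := Gam i + C i.

(** [C] is the difference of the connections of [u ^+ 4 *: G] and [G], with [phi]
    the logarithmic differential of [u]. *)
Lemma conf_lc : levi_civita d (u ^+ 4 *: G) conf_gam.
Proof.
split=> [i k l|i].
  rewrite /conf_gam !CE !mxlinE lcG.1; congr (_ + 2 * _).
  rewrite ![(_ *m b) _ _]mxE ![(_^T *m e _) _ _]mxE !big_ord1 !conf_e !conf_Ge.
  rewrite -{1}GT ![_^T _ _]mxE ![1%:M _ _]mxE [l == i]eq_sym [l == k]eq_sym.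
  by congr (_ - _); exact: addrC.
have CG : C i *m G + G *m (C i)^T = (4 * phi 0 i) *: G.
  have h1 : C i *m G = 2 *: (phi^T *m e i *m G + phi 0 i *: G - G *m (e i)^T *m phi).
    rewrite CE -scalemxAl; congr (_ *: _).
    rewrite mulmxBl mulmxDl -scalemxAl mul1mx -[_ *m b *m G]mulmxA.
    by rewrite bE -[phi *m Q *m G]mulmxA QG mulmx1.
  have h2 : G *m (C i)^T = (C i *m G)^T by rewrite trmx_mul GT.
  rewrite h2 h1 trZ trB trD trZ !trmx_mul !trmxK GT !mulmxA; mxlin.
rewrite /conf_gam mulmxDl trD mulmxDr addrACA -!scalemxAr -!scalemxAl.
rewrite -scalerDr -lcG.2 -scalerDr CG dmxZ addrC; congr (_ + _).
rewrite scalerA; congr (_ *: _).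
rewrite phiE mxscaleE duE (_ : u ^+ 4 = u * (u * (u * u))); last by ring.
rewrite !ddM; transitivity (4 * (u * u * u) * d i u * (u * v)); last by ring.
by rewrite uv; ring.
Qed.

Lemma conf_dv i : d i v = - (v * phi 0 i).
Proof.
have : d i (u * v) = 0 by rewrite uv dd1.
rewrite ddM => /eqP; rewrite addrC addr_eq0 => /eqP h.
transitivity (v * (u * d i v)); first by rewrite mulrA [v * u]mulrC uv mul1r.
by rewrite h phiE mxscaleE duE; ring.
Qed.

Lemma conf_PhiE i : Phi i = v *: hessu i - phi 0 i *: phi.
Proof.
rewrite PhiE hessuE {1 2 4}phiE dmxZ conf_dv -scalemxAl; mxlin.
Qed.

Lemma conf_dphi i j : d i (phi 0 j) = d j (phi 0 i).
Proof.
by rewrite phiE !mxscaleE !duE !ddM !conf_dv phiE !mxscaleE !duE ddC; ring.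
Qed.

(** Changing a connection by [C] changes the curvature by the exterior covariant
    derivative of [C] and its commutators. *)
Lemma conf_curv i j : curv d conf_gam i j = curv d Gam i j
  + 2 *: ((Phi i)^T *m e j - (Phi j)^T *m e i
          - (G *m (e j)^T) *m (Phi i *m Q) + (G *m (e i)^T) *m (Phi j *m Q))
  + (C j *m C i - C i *m C j).
Proof.
have db i' : dmx d i' b = Phi i' *m Q - b *m Gam i'.
  rewrite bE PhiE dmxM (lc_inv QG GQ lcG) mulmxBl mulmxBr mulmxN !mulmxA; mxlin.
have de i' j' : dmx d i' (e j') = 0.
  by apply/matrixP => a c; rewrite eE !mxE; case: (_ && _); rewrite /= ?dd1 ?dd0.
have E i' j' : dmx d i' (C j') + C j' *m Gam i' - Gam i' *m C j' =
  2 *: ((Phi i')^T *m e j' + phi^T *m (e j' *m Gam i') + d i' (phi 0 j') *: 1%:M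
   - G *m (e j' *m Gam i')^T *m b - (G *m (e j')^T) *m (Phi i' *m Q)).
  have dphi : dmx d i' phi^T = (Phi i')^T + Gam i' *m phi^T.
    by rewrite PhiE trB trmx_mul trmxK -dmx_tr subrK.
  have dC : dmx d i' (C j') = 2 *: (dmx d i' phi^T *m e j' + d i' (phi 0 j') *: 1%:M
     - (dmx d i' G *m (e j')^T *m b + G *m (e j')^T *m dmx d i' b)).
    rewrite CE dmxZ (_ : d i' 2 = 0) ?scale0r ?add0r; last by rewrite ddn.
    rewrite dmxB dmxD !dmxM dmxZ dmx_scalar [dmx d i' (e j')^T]dmx_tr !de trmx0 !mulmx0 scaler0.
    by rewrite !addr0.
  rewrite dC dphi db lcG.2 !CE -scalemxAl -scalemxAr mulmxBl mulmxDl mulmxBr mulmxDr.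
  rewrite trmx_mul !(mulmxDl, mulmxDr, mulmxN) -[(phi 0 j' *: 1%:M) *m _]scalemxAl.
  rewrite -[Gam i' *m (phi 0 j' *: _)]scalemxAr mul1mx mulmx1 !mulmxA; mxlin.
have eG : e j *m Gam i = e i *m Gam j.
  by rewrite !eE -!rowE; apply/rowP => k; rewrite !mxE lcG.1.
have -> : curv d conf_gam i j = curv d Gam i j
  + ((dmx d i (C j) + C j *m Gam i - Gam i *m C j) - (dmx d j (C i) + C i *m Gam j - Gam j *m C i))
  + (C j *m C i - C i *m C j).
  rewrite /curv /conf_gam !dmxD !mulmxDl !mulmxDr; mxlin.
by rewrite !E eG conf_dphi; congr (_ + _ + _); mxlin.
Qed.

(** The exponent [4] is the one for which the terms quadratic in [phi] cancel in
    dimension three, once the derivatives of [phi] are written with the Hessian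
    of [u]. *)
Lemma conf_scal : scalar_curv d (v ^+ 4 *: Q) conf_gam =
  v ^+ 5 * (u * scalar_curv d Q Gam - 8 * \sum_i (hessu i *m Q) 0 i).
Proof.
pose t i j := (Phi i *m Q) 0 j.
pose N := (b *m phi^T) 0 0.
have colQ (y : 'rV[A]_3) j : (Q *m y^T) j 0 = (y *m Q) 0 j.
  by rewrite -{1}QT -trmx_mul mxE.
have QPhi i j : (Q *m (Phi i)^T) j 0 = t i j.
  exact: colQ.
have Qphi j : (Q *m phi^T) j 0 = b 0 j.
  by rewrite colQ bE.
have QGe i j : (Q *m (G *m (e i)^T)) j 0 = (j == i)%:R.
  by rewrite mulmxA QG mul1mx mxE conf_e.
have r1 (x : 'cV[A]_3) (y : 'rV[A]_3) i j : (Q *m (x *m y)) j i = (Q *m x) j 0 * y 0 i.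
  by rewrite mulmxA mxE big_ord1.
have CC i j : C j *m C i - C i *m C j =
   4 *: ((phi 0 j *: phi^T) *m e i - (phi 0 i *: phi^T) *m e j
     - (phi 0 j *: (G *m (e i)^T)) *m b + (phi 0 i *: (G *m (e j)^T)) *m b
     - (N *: (G *m (e j)^T)) *m e i + (N *: (G *m (e i)^T)) *m e j).
  have Cprod i' j' : C j' *m C i' = 4 *: ((2 * phi 0 j') *: (phi^T *m e i')
      + phi 0 i' *: (phi^T *m e j') - G j' i' *: (phi^T *m b)
      + (phi 0 j' * phi 0 i') *: 1%:M - phi 0 j' *: (G *m (e i')^T *m b)
      - N *: (G *m (e j')^T *m e i')).
    have r4 (x x' : 'cV[A]_3) (y y' : 'rV[A]_3) :
        (x *m y) *m (x' *m y') = (y *m x') 0 0 *: (x *m y').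
      by rewrite mulmxA -(mulmxA x y x') -(scale11 x (y *m x')) -scalemxAl.
    have ea k : (e k *m phi^T) 0 0 = phi 0 k by rewrite eE -rowE !mxE.
    have bg k : (b *m (G *m (e k)^T)) 0 0 = phi 0 k.
      by rewrite bE mulmxA -[phi *m Q *m G]mulmxA QG mulmx1 -[_ *m _]tr11 trmx_mul trmxK ea.
    have eg k l : (e k *m (G *m (e l)^T)) 0 0 = G k l.
      by rewrite [e k]eE -rowE mxE conf_Ge.
    have expand (X X' Z Z' : 'M[A]_3) (p p' : A) :
      (2 *: (X + p *: 1%:M - Z)) *m (2 *: (X' + p' *: 1%:M - Z')) =
      4 *: (X *m X' + p' *: X - X *m Z' + p *: X' + (p * p') *: 1%:M - p *: Z'
            - Z *m X' - p' *: Z + Z *m Z').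
      rewrite -scalemxAl -scalemxAr scalerA !(mulmxBl, mulmxDl, mulmxBr, mulmxDr).
      rewrite -!scalemxAl -!scalemxAr !mul1mx !mulmx1; mxlin.
    rewrite !CE expand !r4 !ea !bg eg -/N; mxlin.
  rewrite !Cprod (_ : G j i = G i j); last by rewrite -{1}GT mxE.
  rewrite -!scalemxAl; mxlin.
have E i j : (Q *m curv d conf_gam i j) j i = (Q *m curv d Gam i j) j i +
   2 * (t i j * (i == j)%:R - t j j * (i == i)%:R - (j == j)%:R * t i i + (j == i)%:R * t j i)
   + 4 * (phi 0 j * b 0 j * (i == i)%:R - phi 0 i * b 0 j * (i == j)%:R
          - phi 0 j * (j == i)%:R * b 0 i + phi 0 i * (j == j)%:R * b 0 i
          - N * (j == j)%:R * (i == i)%:R + N * (j == i)%:R * (i == j)%:R).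
  rewrite conf_curv CC !mulmxDr !mxlinE -!scalemxAr !mulmxDr !mulmxN.
  rewrite !mxlinE !r1 -!scalemxAr !mxlinE !QPhi !Qphi !QGe !conf_e /t; ring.
have trPhi : \sum_i t i i = v * (\sum_i (hessu i *m Q) 0 i) - N.
  rewrite /t; under eq_bigr do rewrite conf_PhiE mulmxBl -!scalemxAl !mxlinE.
  rewrite sumrB -big_distrr; congr (_ - _).
  by rewrite /N mxE; apply: eq_bigr => i _; rewrite [phi^T _ _]mxE bE; exact: mulrC.
have NE : N = \sum_i phi 0 i * b 0 i.
  by rewrite /N mxE; apply: eq_bigr => i _; rewrite [phi^T _ _]mxE; exact: mulrC.
have -> : scalar_curv d (v ^+ 4 *: Q) conf_gam = v ^+ 4 * \sum_i \sum_j (Q *m curv d conf_gam i j) j i.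
  rewrite /scalar_curv big_distrr; apply: eq_bigr => i _; rewrite big_distrr.
  by apply: eq_bigr => j _; rewrite -scalemxAl mxlinE.
have -> : \sum_i \sum_j (Q *m curv d conf_gam i j) j i =
   scalar_curv d Q Gam - 8 * (\sum_i t i i) - 8 * N.
  under eq_bigr do under eq_bigr do rewrite E.
  rewrite /scalar_curv NE.
  under eq_bigr do rewrite 2!big_split /=.
  rewrite 2!big_split /= -[in RHS]addrA -[LHS]addrA; congr (_ + _).
  rewrite !sum3 /=; ring.
rewrite trPhi.
transitivity (v ^+ 4 * ((u * v) * scalar_curv d Q Gam - 8 * (v * \sum_i (hessu i *m Q) 0 i))).
  by rewrite uv; ring.
ring.
Qed.

Lemma conf_divg x : divg d conf_gam x = divg d Gam x + 6 * \sum_i phi 0 i * x 0 i.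
Proof.
have xC i : (x *m C i) 0 i = 2 * ((x *m phi^T) 0 0 * (i == i)%:R + phi 0 i * x 0 i
    - (x *m G) 0 i * b 0 i).
  rewrite CE -scalemxAr !(mulmxBr, mulmxDr) -scalemxAr mulmx1 !mulmxA !mxlinE.
  rewrite ![(_ *m e i) _ _]mxE ![(_ *m b) _ _]mxE !big_ord1 conf_e.
  by rewrite eE trmx_delta -colE ![col _ _ _ _]mxE.
rewrite /divg /conf_gam; under eq_bigr do rewrite mulmxDr addrA mxaddE xC.
rewrite big_split; congr (_ + _).
have n1 : (x *m phi^T) 0 0 = \sum_i phi 0 i * x 0 i.
  by rewrite mxE; apply: eq_bigr => i _; rewrite [phi^T _ _]mxE; exact: mulrC.
have n2 : \sum_i (x *m G) 0 i * b 0 i = \sum_i phi 0 i * x 0 i.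
  rewrite -n1; transitivity ((x *m G *m b^T) 0 0).
    by rewrite mxE; apply: eq_bigr => i _; rewrite [b^T _ _]mxE.
  by rewrite bE trmx_mul QT mulmxA -(mulmxA x) GQ mulmx1.
rewrite -big_distrr sumrB big_split n2 n1 sum3 /=; ring.
Qed.

End Conformal.

Section BoundaryDensity.
Variables (A : comNzRingType) (d : derivations 3 A) (half : A).
Variables (G Q P K h T : 'M[A]_3) (Gam : 'I_3 -> 'M[A]_3) (f w : 'rV[A]_3) (r : A).
Variables (hess hr : 'I_3 -> 'rV[A]_3).
Hypothesis half2 : half * 2 = 1.
Hypotheses (GT : G^T = G) (QT : Q^T = Q) (GQ : G *m Q = 1%:M) (QG : Q *m G = 1%:M).
Hypothesis lcG : levi_civita d G Gam.
Hypothesis f_closed : forall i j, d i (f 0 j) = d j (f 0 i).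
Hypothesis rW : r * r * (1 + (f *m Q *m f^T) 0 0) = 1.
Hypothesis wE : w = r *: (f *m Q).
Hypothesis hessE : forall i, hess i = dmx d i f - f *m (Gam i)^T.
Hypothesis hrE : forall i, hr i = r *: hess i.
Hypothesis PE : P = Q - w^T *m w.
Hypothesis hE : h = \matrix_(i, j) hr i 0 j.
Hypothesis TE : T = h *m P.
Hypothesis KT : K^T = K.
Variables (nu : 'rV[A]_3) (c s : A).
Hypothesis cs : c * c - s * s = 1.

(** The normal of the boundary in the graph projects to [c *: nu + s *: w], with [c]
    and [s] the hyperbolic functions of the boost.  Its divergence, corrected by the
    Schoen--Yau form, consists of the terms of the boosted density: the mean
    curvature, the trace of [K] over the boundary, the gauge term in the derivatives
    of [c] and [s], and the connection one-form.  The second form [h] of the graph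
    cancels except through its trace. *)
Lemma boundary_density :
  divg d (graph_gam Gam w hr) (c *: nu + s *: w)
    - (w *m (h - K) *m (c *: nu + s *: w)^T) 0 0 =
  c * divg d Gam nu + s * (\tr T + (w *m K *m w^T) 0 0 - (nu *m K *m nu^T) 0 0)
  + \sum_i (s *: nu + c *: w) 0 i * (c * d i s - s * d i c)
  + ((s *: nu + c *: w) *m K *m nu^T) 0 0.
Proof.
have hw : divg d Gam w = \tr T.
  exact: (divg_w half2 QT GQ QG lcG rW wE hessE hrE PE hE TE).
have -> : divg d (graph_gam Gam w hr) (c *: nu + s *: w) =
   divg d Gam (c *: nu + s *: w) + (w *m h *m (c *: nu + s *: w)^T) 0 0.
  by apply: divg_graph; eassumption.
rewrite divgD !divgZ hw mulmxBr mulmxBl mxaddE mxoppE.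
have dcs i : c * d i c = s * d i s.
  have : d i (c * c - s * s) = 0 by rewrite cs dd1.
  rewrite ddB !ddM => e.
  have e2 : 2 * (c * d i c - s * d i s) = 0 by rewrite -[RHS]e; ring.
  apply/eqP; rewrite -subr_eq0 -[X in X == 0]mul1r -half2 -mulrA e2 mulr0 //.
have -> : \sum_i (s *: nu + c *: w) 0 i * (c * d i s - s * d i c) =
   \sum_i nu 0 i * d i c + \sum_i w 0 i * d i s.
  rewrite -big_split; apply: eq_bigr => i _; rewrite !mxlinE.
  transitivity ((c * c - s * s) * (nu 0 i * d i c + w 0 i * d i s)
     + (nu 0 i * c + w 0 i * s) * (s * d i s - c * d i c)); first by ring.
  by rewrite cs dcs subrr mulr0 addr0 mul1r.
have wKn : (w *m K *m nu^T) 0 0 = (nu *m K *m w^T) 0 0.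
  by rewrite -[in LHS](tr11 (w *m K *m nu^T)) !trmx_mul trmxK KT mulmxA.
rewrite !trD !trZ !(mulmxDr, mulmxDl) -!scalemxAr -!scalemxAl !mxlinE wKn.
ring.
Qed.
End BoundaryDensity.

Section VolumeElement.
Variables (A : comNzRingType) (d : derivations 3 A).

Lemma det2E (R : comNzRingType) (M : 'M[R]_2) : \det M = M 0 0 * M 1 1 - M 0 1 * M 1 0.
Proof.
rewrite (expand_det_row _ 0) !big_ord_recl big_ord0 addr0 /cofactor !det_mx11 !mxE /=.
rewrite expr0 expr1 mul1r mulN1r mulrN.
by congr (M _ _ * M _ _ - M _ _ * M _ _); exact/val_inj.
Qed.

Lemma det3E (R : comNzRingType) (M : 'M[R]_3) : \det M =
  M o0 o0 * (M o1 o1 * M o2 o2 - M o1 o2 * M o2 o1)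
  - M o0 o1 * (M o1 o0 * M o2 o2 - M o1 o2 * M o2 o0)
  + M o0 o2 * (M o1 o0 * M o2 o1 - M o1 o1 * M o2 o0).
Proof.
rewrite (expand_det_row _ o0) sum3 /cofactor !det2E !mxE.
have l (i : 'I_3) (k : 'I_2) (j : 'I_3) : lift i k = j :> nat -> lift i k = j by move/val_inj.
rewrite (l o0 0 o1) // (l o0 1 o2) // (l o1 0 o0) // (l o1 1 o2) // (l o2 0 o0) // (l o2 1 o1) //=.
ring.
Qed.

(** Jacobi's formula. *)
Lemma d_det G Gam i : levi_civita d G Gam -> d i (\det G) = 2 * \tr (Gam i) * \det G.
Proof.
move=> [_ c]; have dG k l : d i (G k l) =
   \sum_p Gam i k p * G p l + \sum_p G k p * Gam i l p.
  have := congr1 (fun M : 'M[_]_3 => M k l) (c i); rewrite !mxE => ->.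
  by congr (_ + _); apply: eq_bigr => p _; rewrite !mxE.
rewrite !det3E /mxtrace !(ddD, ddN, ddM) !dG !sum3; ring.
Qed.

(** The coordinate divergence of a vector density is the covariant divergence: this
    brings the divergence theorem down to partial derivatives. *)
Lemma divg_volume (half : A) G Gam (v : 'rV[A]_3) (sd sdV : A) :
  half * 2 = 1 -> levi_civita d G Gam -> sd * sd = \det G -> sd * sdV = 1 ->
  \sum_i d i (sd * v 0 i) = sd * divg d Gam v.
Proof.
move=> h2 lcG sE sV.
have ds i : d i sd = sd * \tr (Gam i).
  have e : 2 * (sd * (d i sd - sd * \tr (Gam i))) = 0.
    have := d_det i lcG; rewrite -sE ddM => h.
    transitivity ((d i sd * sd + sd * d i sd) - 2 * \tr (Gam i) * (sd * sd)); first by ring.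
    by rewrite h subrr.
  apply/eqP; rewrite -subr_eq0; apply/eqP.
  transitivity ((half * 2) * (sd * sdV) * (d i sd - sd * \tr (Gam i))).
    by rewrite h2 sV !mul1r.
  transitivity (half * sdV * (2 * (sd * (d i sd - sd * \tr (Gam i))))); first by ring.
  by rewrite e mulr0.
rewrite /divg !sum3 !ddM !ds /mxtrace !sum3 !mxlinE ![(_ *m _) _ _]mxE ![dmx _ _ _ _ _]mxE !sum3.
rewrite !(lcG.1 o1 o0) !(lcG.1 o2 o0) !(lcG.1 o2 o1); ring.
Qed.
End VolumeElement.

(** * The ring of smooth functions on an open set *)

(** The point makes the ring of functions nontrivial. *)
Record opendom (R : realType) (n : nat) := OpenDom {
  odset :> 'rV[R]_n -> Prop;
  od_open : open (odset : set 'rV[R]_n);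
  od_pt : 'rV[R]_n;
  od_in : odset od_pt }.

Arguments od_open {R n} o.
Arguments od_pt {R n} o.
Arguments od_in {R n} o.

(** Smooth functions on [U], extended by zero outside so that functions that
    agree on [U] are equal. *)
Record smfun (R : realType) (n : nat) (U : opendom R n) := SFun {
  sfv :> 'rV[R]_n -> R;
  sfvP : `[< smooth (odset U) sfv /\ forall x, ~ U x -> sfv x = 0 >] }.

Section SmoothRing.
Context (R : realType) (n : nat) (U : opendom R n).
Local Notation A := (smfun U).
Implicit Types a b c : A.

HB.instance Definition _ := [isSub for @sfv R n U].
HB.instance Definition _ := [Choice of smfun U by <:].

Lemma sf_smooth a : smooth (odset U) a.
Proof. by have /asboolP[] := sfvP a. Qed.

Lemma sf_out a x : ~ U x -> a x = 0.
Proof. by have /asboolP[_] := sfvP a; apply. Qed.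

Lemma sf_eq a b : (forall x, U x -> a x = b x) -> a = b.
Proof.
move=> h; apply: val_inj; apply/funext => x /=.
by have [/h //|Ux] := pselect (U x); rewrite !sf_out.
Qed.

Definition mask (f : 'rV[R]_n -> R) x := if `[< U x >] then f x else 0.

Lemma maskE f x : U x -> mask f x = f x.
Proof. by move=> Ux; rewrite /mask asboolT. Qed.

Lemma mask_smooth f : smooth (odset U) f -> `[< smooth (odset U) (mask f) /\ forall x, ~ U x -> mask f x = 0 >].
Proof.
move=> hf; apply/asboolP; split; last by move=> x Ux; rewrite /mask asboolF.
by apply: smooth_eq hf; [exact: od_open|move=> x Ux; rewrite maskE].
Qed.

Definition tosf f (hf : smooth (odset U) f) : A := SFun (mask_smooth hf).

Lemma tosfE f (hf : smooth (odset U) f) x : U x -> tosf hf x = f x.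
Proof. exact: maskE. Qed.

Let oU := od_open U.
Definition sf0 : A := tosf (smooth_cst (odset U) 0).
Definition sf1 : A := tosf (smooth_cst (odset U) 1).
Definition sfadd a b : A := tosf (smoothD oU (sf_smooth a) (sf_smooth b)).
Definition sfmul a b : A := tosf (smoothM oU (sf_smooth a) (sf_smooth b)).
Definition sfopp a : A := tosf (smoothN oU (sf_smooth a)).

Lemma sfaddA : associative sfadd.
Proof. by move=> a b c; apply: sf_eq => x Ux; rewrite !tosfE // addrA. Qed.
Lemma sfaddC : commutative sfadd.
Proof. by move=> a b; apply: sf_eq => x Ux; rewrite !tosfE // addrC. Qed.
Lemma sfadd0 : left_id sf0 sfadd.
Proof. by move=> a; apply: sf_eq => x Ux; rewrite !tosfE // add0r. Qed.
Lemma sfaddN : left_inverse sf0 sfopp sfadd.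
Proof. by move=> a; apply: sf_eq => x Ux; rewrite !tosfE // addNr. Qed.

HB.instance Definition _ := GRing.isZmodule.Build (smfun U) sfaddA sfaddC sfadd0 sfaddN.

Lemma sfmulA : associative sfmul.
Proof. by move=> a b c; apply: sf_eq => x Ux; rewrite !tosfE // mulrA. Qed.
Lemma sfmulC : commutative sfmul.
Proof. by move=> a b; apply: sf_eq => x Ux; rewrite !tosfE // mulrC. Qed.
Lemma sfmul1 : left_id sf1 sfmul.
Proof. by move=> a; apply: sf_eq => x Ux; rewrite !tosfE // mul1r. Qed.
Lemma sfmulDl : left_distributive sfmul sfadd.
Proof. by move=> a b c; apply: sf_eq => x Ux; rewrite !tosfE // mulrDl. Qed.
Lemma sf1_neq0 : sf1 != 0.
Proof.
apply/eqP => /(congr1 (fun a : A => a (od_pt U))).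
rewrite !tosfE; [|exact: od_in|exact: od_in].
by move/eqP; rewrite oner_eq0.
Qed.

HB.instance Definition _ := GRing.Zmodule_isComNzRing.Build (smfun U)
  sfmulA sfmulC sfmul1 sfmulDl sf1_neq0.

Definition sfd i a : A := tosf (smooth_pd i (sf_smooth a)).

Lemma sfd_add i a b : sfd i (a + b) = sfd i a + sfd i b.
Proof.
apply: sf_eq => x Ux; rewrite !tosfE // -(pdD i (sf_smooth a) (sf_smooth b) Ux).
by apply: (pd_eq i oU Ux) => y Uy; rewrite tosfE.
Qed.

Lemma sfd_mul i a b : sfd i (a * b) = sfd i a * b + a * sfd i b.
Proof.
apply: sf_eq => x Ux; rewrite !tosfE // -(pdM i (sf_smooth a) (sf_smooth b) Ux).
by apply: (pd_eq i oU Ux) => y Uy; rewrite tosfE.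
Qed.

Lemma sfdE i a x : U x -> sfd i a x = pd i a x.
Proof. by move=> Ux; rewrite tosfE. Qed.

Lemma sfd_comm i j a : sfd i (sfd j a) = sfd j (sfd i a).
Proof.
apply: sf_eq => x Ux; rewrite (sfdE i (sfd j a) Ux) (sfdE j (sfd i a) Ux).
rewrite (pd_eq i oU Ux (sfdE j a)) (pd_eq j oU Ux (sfdE i a)).
exact: smooth_pd_comm oU (sf_smooth a) Ux.
Qed.

Definition sfder : derivations n (smfun U) := Derivations sfd_add sfd_mul sfd_comm.

Lemma sfder_tosf i f (hf : smooth (odset U) f) x : U x -> sfder i (tosf hf) x = pd i f x.
Proof.
by move=> Ux; rewrite -[LHS]/(sfd i (tosf hf) x) (sfdE i _ Ux); apply: (pd_eq i oU Ux) => y Uy; rewrite tosfE.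
Qed.

Section Evaluation.
Variables (x : 'rV[R]_n) (hx : U x).
Definition ev a : R := a x.

Lemma ev_add : {morph ev : a b / a + b}.
Proof. by move=> a b; rewrite /ev tosfE. Qed.
Lemma ev0 : ev 0 = 0.
Proof. by rewrite /ev tosfE. Qed.
Lemma ev_mul : {morph ev : a b / a * b}.
Proof. by move=> a b; rewrite /ev tosfE. Qed.
Lemma ev1 : ev 1 = 1.
Proof. by rewrite /ev tosfE. Qed.
End Evaluation.
End SmoothRing.

(* The proof that the point is in [U] is an argument, so that evaluation is a ring
   morphism. *)
Definition evm (R : realType) (n : nat) (U : opendom R n) (x : 'rV[R]_n) (hx : U x)
  (a : smfun U) : R := a x.
HB.instance Definition _ (R : realType) (n : nat) (U : opendom R n) (x : 'rV[R]_n)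
  (hx : U x) := GRing.isNmodMorphism.Build (smfun U) R (@evm R n U x hx)
    (conj (ev0 hx) (ev_add hx)).
HB.instance Definition _ (R : realType) (n : nat) (U : opendom R n) (x : 'rV[R]_n)
  (hx : U x) := GRing.isMonoidMorphism.Build (smfun U) R (@evm R n U x hx)
    (conj (ev1 hx) (ev_mul hx)).

Section EvaluationRules.
Context (R : realType) (n : nat) (U : opendom R n) (x : 'rV[R]_n) (Ux : U x).
Local Notation A := (smfun U).
Implicit Types a b : A.

Lemma sfDE a b : (a + b) x = a x + b x. Proof. exact: (ev_add Ux). Qed.
Lemma sfME a b : (a * b) x = a x * b x. Proof. exact: (ev_mul Ux). Qed.
Lemma sfNE a : (- a) x = - a x. Proof. exact: (rmorphN (evm Ux)). Qed.
Lemma sfBE a b : (a - b) x = a x - b x. Proof. by rewrite sfDE sfNE. Qed.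
Lemma sf1E : (1 : A) x = 1. Proof. exact: (ev1 Ux). Qed.
Lemma sf0E : (0 : A) x = 0. Proof. exact: (ev0 Ux). Qed.
Lemma sfnatE k : (k%:R : A) x = k%:R. Proof. exact: (rmorph_nat (evm Ux)). Qed.
Lemma sfXE a k : (a ^+ k) x = a x ^+ k. Proof. exact: (rmorphXn (evm Ux)). Qed.
Lemma sf_sumE (I : Type) (r : seq I) (P : pred I) (F : I -> A) :
  (\sum_(i <- r | P i) F i) x = \sum_(i <- r | P i) F i x.
Proof. exact: (rmorph_sum (evm Ux)). Qed.
Lemma sf_mulmxE p q r (M : 'M[A]_(p, q)) (N : 'M[A]_(q, r)) i j :
  (M *m N) i j x = \sum_k M i k x * N k j x.
Proof. by rewrite mxE sf_sumE; apply: eq_bigr => k _; rewrite sfME. Qed.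
Lemma sf_dmxE p q i (M : 'M[A]_(p, q)) k l : dmx (sfder U) i M k l x = sfder U i (M k l) x.
Proof. by rewrite mxE. Qed.
Lemma sf_trE p (M : 'M[A]_p) : (\tr M) x = \sum_i M i i x.
Proof. by rewrite /mxtrace sf_sumE. Qed.
Definition evmx p q (M : 'M[A]_(p, q)) : 'M[R]_(p, q) := \matrix_(i, j) M i j x.
Lemma evmxM p q r (M : 'M[A]_(p, q)) (N : 'M[A]_(q, r)) : evmx (M *m N) = evmx M *m evmx N.
Proof.
by apply/matrixP => i j; rewrite !mxE sf_sumE; apply: eq_bigr => k _; rewrite sfME !mxE.
Qed.
Lemma evmxD p q (M N : 'M[A]_(p, q)) : evmx (M + N) = evmx M + evmx N.
Proof. by apply/matrixP => i j; rewrite !mxE sfDE. Qed.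
Lemma evmxN p q (M : 'M[A]_(p, q)) : evmx (- M) = - evmx M.
Proof. by apply/matrixP => i j; rewrite !mxE sfNE. Qed.
Lemma evmxB p q (M N : 'M[A]_(p, q)) : evmx (M - N) = evmx M - evmx N.
Proof. by rewrite evmxD evmxN. Qed.
Lemma evmxZ p q a (M : 'M[A]_(p, q)) : evmx (a *: M) = a x *: evmx M.
Proof. by apply/matrixP => i j; rewrite !mxE sfME. Qed.
Lemma evmx_tr p q (M : 'M[A]_(p, q)) : evmx M^T = (evmx M)^T.
Proof. by apply/matrixP => i j; rewrite !mxE. Qed.
Lemma sf_curvE (gam : 'I_n -> 'M[A]_n) i j k l :
  curv (sfder U) gam i j k l x = sfder U i (gam j k l) x - sfder U j (gam i k l) x
   + \sum_m (gam j k m x * gam i m l x - gam i k m x * gam j m l x).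
Proof.
rewrite /curv !mxaddE !mxoppE !sfDE !sfNE !sf_mulmxE !sf_dmxE.
by rewrite -[LHS]addrA -sumrB.
Qed.
Lemma evmx1 p : evmx (1%:M : 'M[A]_p) = 1%:M.
Proof. by apply/matrixP => i j; rewrite !mxE; case: (i == j); [exact: sf1E|exact: sf0E]. Qed.
Lemma evmxtr p (M : 'M[A]_p) : (\tr M) x = \tr (evmx M).
Proof. by rewrite sf_trE; apply: eq_bigr => i _; rewrite mxE. Qed.
Lemma evmxE p q (M : 'M[A]_(p, q)) i j : M i j x = evmx M i j.
Proof. by rewrite mxE. Qed.
Lemma evmx_det p (M : 'M[A]_p) : (\det M) x = \det (evmx M).
Proof.
rewrite -[LHS]/(evm Ux _) -det_map_mx; congr (\det _).
by apply/matrixP => i j; rewrite !mxE.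
Qed.
End EvaluationRules.

Section SmoothMatrices.
Context {R : realType} (n : nat).
Variables (U : set 'rV[R]_n) (oU : open U).

Definition smooth_mx p q (M : 'rV[R]_n -> 'M[R]_(p, q)) :=
  forall i j, smooth U (fun x => M x i j).

Lemma smooth_prod (I : Type) (r : seq I) (P : pred I) (F : I -> 'rV[R]_n -> R) :
  (forall i, smooth U (F i)) -> smooth U (fun x => \prod_(i <- r | P i) F i x).
Proof.
move=> h; elim: r => [|i r IH].
  by apply: (smooth_eq oU _ (smooth_cst U 1)) => x _; rewrite big_nil.
have [Pi|Pi] := boolP (P i).
  by apply: (smooth_eq oU _ (smoothM oU (h i) IH)) => x _; rewrite big_cons Pi.
by apply: (smooth_eq oU _ IH) => x _; rewrite big_cons (negbTE Pi).
Qed.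

Lemma smooth_det p (M : 'rV[R]_n -> 'M[R]_p) : smooth_mx M -> smooth U (fun x => \det (M x)).
Proof.
move=> h; apply: smooth_sum => // s; apply: smoothM => //; first exact: smooth_cst.
apply: smooth_prod => i; exact: h.
Qed.

Lemma smooth_invmx p (M : 'rV[R]_n -> 'M[R]_p) : smooth_mx M ->
  (forall x, U x -> M x \in unitmx) -> smooth_mx (fun x => invmx (M x)).
Proof.
move=> h hu i j.
have h1 : smooth U (fun x => (\det (M x))^-1 * ((-1) ^+ (j + i) * \det (row' j (col' i (M x))))).
  apply: smoothM => //.
    apply: smoothV => // [x Ux|]; last exact: smooth_det.
    by have := hu x Ux; rewrite unitmxE unitfE.
  apply: smoothM => //; first exact: smooth_cst.
  apply: smooth_det => k l; apply: (smooth_eq oU _ (h (lift j k) (lift i l))) => x _.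
  by rewrite !mxE.
apply: (smooth_eq oU _ h1) => x Ux.
by rewrite /invmx (hu x Ux) !mxE.
Qed.

Lemma smooth_mulmx p q r (M : 'rV[R]_n -> 'M[R]_(p, q)) (N : 'rV[R]_n -> 'M[R]_(q, r)) :
  smooth_mx M -> smooth_mx N -> smooth_mx (fun x => M x *m N x).
Proof.
move=> hM hN i j.
have h : smooth U (fun x => \sum_k M x i k * N x k j).
  by apply: smooth_sum => // k; apply: smoothM.
by apply: (smooth_eq oU _ h) => x _; rewrite mxE.
Qed.

Lemma smooth_trmx p q (M : 'rV[R]_n -> 'M[R]_(p, q)) : smooth_mx M -> smooth_mx (fun x => (M x)^T).
Proof. by move=> h i j; apply: (smooth_eq oU _ (h j i)) => x _; rewrite mxE. Qed.

Lemma smooth_addmx p q (M N : 'rV[R]_n -> 'M[R]_(p, q)) :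
  smooth_mx M -> smooth_mx N -> smooth_mx (fun x => M x + N x).
Proof.
move=> hM hN i j; apply: (smooth_eq oU _ (smoothD oU (hM i j) (hN i j))) => x _.
by rewrite mxE.
Qed.

Lemma smooth_oppmx p q (M : 'rV[R]_n -> 'M[R]_(p, q)) :
  smooth_mx M -> smooth_mx (fun x => - M x).
Proof.
by move=> hM i j; apply: (smooth_eq oU _ (smoothN oU (hM i j))) => x _; rewrite mxE.
Qed.

Lemma smooth_scalemx p q (a : 'rV[R]_n -> R) (M : 'rV[R]_n -> 'M[R]_(p, q)) :
  smooth U a -> smooth_mx M -> smooth_mx (fun x => a x *: M x).
Proof.
by move=> ha hM i j; apply: (smooth_eq oU _ (smoothM oU ha (hM i j))) => x _; rewrite mxE.
Qed.

Lemma smooth_drow (f : 'rV[R]_n -> R) : smooth U f -> smooth_mx (drow f).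
Proof.
by move=> hf i j; apply: (smooth_eq oU _ (smooth_pd j hf)) => x _; rewrite mxE.
Qed.

Lemma smooth_mx_eq p q (M N : 'rV[R]_n -> 'M[R]_(p, q)) :
  (forall x, U x -> M x = N x) -> smooth_mx M -> smooth_mx N.
Proof. by move=> h hM i j; apply: (smooth_eq oU _ (hM i j)) => x Ux; rewrite h. Qed.
End SmoothMatrices.

(** * The tensor calculus of a metric given in coordinates *)

Section Bridge.
Context {R : realType} (n : nat) (U : opendom R n).
Local Notation A := (smfun U).
Let oU := od_open U.

Definition tomx p q (M : 'rV[R]_n -> 'M[R]_(p, q)) (hM : smooth_mx (odset U) M) : 'M[A]_(p, q) :=
  \matrix_(i, j) tosf (hM i j).

Lemma tomxE p q (M : 'rV[R]_n -> 'M[R]_(p, q)) (hM : smooth_mx (odset U) M) x i j : U x ->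
  tomx hM i j x = M x i j.
Proof. by move=> Ux; rewrite mxE tosfE. Qed.

Lemma ev_tomx p q (M : 'rV[R]_n -> 'M[R]_(p, q)) (hM : smooth_mx (odset U) M) x : U x ->
  evmx x (tomx hM) = M x.
Proof. by move=> Ux; apply/matrixP => i j; rewrite mxE tomxE. Qed.

Lemma sfder_pd k (a : A) (f : 'rV[R]_n -> R) x : (forall y, U y -> a y = f y) -> U x ->
  sfder U k a x = pd k f x.
Proof.
move=> h Ux; rewrite -[LHS]/(sfd k a x) (sfdE k _ Ux).
exact: (pd_eq k oU Ux).
Qed.

Lemma d_tomx p q (M : 'rV[R]_n -> 'M[R]_(p, q)) (hM : smooth_mx (odset U) M) x k i j : U x ->
  sfder U k (tomx hM i j) x = pd k (fun y => M y i j) x.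
Proof. by move=> Ux; apply: sfder_pd => // y; exact: tomxE. Qed.

Definition half : A := tosf (smooth_cst (odset U) 2^-1).
Lemma halfE x : U x -> half x = 2^-1.
Proof. by move=> Ux; rewrite tosfE. Qed.
Lemma half2 : half * 2 = 1.
Proof.
by apply: sf_eq => x Ux; rewrite (sfME Ux) (sf1E Ux) (sfnatE Ux) halfE // mulVf.
Qed.

Lemma mxA_eq p q (M N : 'M[A]_(p, q)) :
  (forall x, U x -> evmx x M = evmx x N) -> M = N.
Proof.
move=> h; apply/matrixP => i j; apply: sf_eq => x Ux.
by rewrite !evmxE h.
Qed.

Variables (G : 'rV[R]_n -> 'M[R]_n).
Hypothesis sG : smooth_mx (odset U) G.
Hypothesis GT : forall x, U x -> (G x)^T = G x.
Hypothesis Gu : forall x, U x -> G x \in unitmx.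

Definition sQ : smooth_mx (odset U) (ginv G) := smooth_invmx oU sG Gu.
Definition GA : 'M[A]_n := tomx sG.
Definition QA : 'M[A]_n := tomx sQ.
Definition gamA := chr (sfder U) half GA QA.

Lemma ginv_sym x : U x -> (ginv G x)^T = ginv G x.
Proof. by move=> Ux; rewrite /ginv trmx_inv GT. Qed.

Lemma ginv_symE i j x : U x -> ginv G x i j = ginv G x j i.
Proof. by move=> Ux; rewrite -{1}(ginv_sym Ux) mxE. Qed.

Lemma GA_sym : GA^T = GA.
Proof. by apply: mxA_eq => x Ux; rewrite evmx_tr !ev_tomx // GT. Qed.

Lemma QA_GA : QA *m GA = 1%:M.
Proof.
by apply: mxA_eq => x Ux; rewrite (evmxM Ux) (evmx1 Ux) !ev_tomx // mulVmx // Gu.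
Qed.

Lemma GA_QA : GA *m QA = 1%:M.
Proof.
by apply: mxA_eq => x Ux; rewrite (evmxM Ux) (evmx1 Ux) !ev_tomx // mulmxV // Gu.
Qed.

Lemma QA_sym : QA^T = QA.
Proof. by apply: mxA_eq => x Ux; rewrite evmx_tr !ev_tomx // ginv_sym. Qed.

Lemma gamA_lc : levi_civita (sfder U) GA gamA.
Proof. exact: chr_lc half2 GA_sym QA_sym QA_GA. Qed.

Lemma christoffelE k i j x : U x -> christoffel G k i j x = gamA i j k x.
Proof.
move=> Ux; rewrite /gamA /chr (sf_mulmxE Ux) /christoffel mulr_sumr.
apply: eq_bigr => l _; rewrite mxscaleE (sfME Ux) halfE // [low_chr _ _ _ _ _]mxE.
rewrite (sfBE Ux) (sfDE Ux) !(d_tomx _ _ _ _ Ux) (tomxE _ _ _ Ux).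
by rewrite (ginv_symE _ _ Ux) -mulrA; congr (_ * _); exact: mulrC.
Qed.

Lemma smooth_christoffel k i j : smooth (odset U) (christoffel G k i j).
Proof.
by apply: (smooth_eq oU _ (sf_smooth (gamA i j k))) => x Ux; rewrite christoffelE.
Qed.

Lemma pd_christoffelE m k i j x : U x ->
  pd m (christoffel G k i j) x = sfder U m (gamA i j k) x.
Proof. by move=> Ux; symmetry; apply: sfder_pd => // y Uy; rewrite christoffelE. Qed.

Lemma riemannE l k i j x : U x ->
  riemann G l k i j x = curv (sfder U) gamA i j k l x.
Proof.
move=> Ux; rewrite /riemann !(pd_christoffelE _ _ _ _ Ux) (sf_curvE Ux).
congr (_ + _); apply: eq_bigr => m _.
by rewrite !(christoffelE _ _ _ Ux); congr (_ - _); exact: mulrC.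
Qed.

Lemma scalE x : U x -> scal G x = scalar_curv (sfder U) QA gamA x.
Proof.
move=> Ux; rewrite /scal /scalar_curv (sf_sumE Ux).
under [RHS]eq_bigr do rewrite (sf_sumE Ux).
rewrite [RHS]exchange_big /=.
transitivity (\sum_j \sum_i \sum_k ginv G x k j * riemann G i k i j x).
  rewrite exchange_big; apply: eq_bigr => j _.
  by rewrite exchange_big; apply: eq_bigr => k _; rewrite /ricci mulr_sumr.
apply: eq_bigr => j _; apply: eq_bigr => i _.
rewrite (sf_mulmxE Ux); apply: eq_bigr => k _; rewrite (riemannE _ _ _ _ Ux).
by rewrite /QA (tomxE _ _ _ Ux) ginv_symE.
Qed.

Section Functions.
Variables (f : 'rV[R]_n -> R) (sf : smooth (odset U) f).
Definition dA : 'rV[A]_n := \row_i sfder U i (tosf sf).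

Lemma dA_closed i j : sfder U i (dA 0 j) = sfder U j (dA 0 i).
Proof. by rewrite !mxE ddC. Qed.

Lemma dAE i x : U x -> dA 0 i x = pd i f x.
Proof. by move=> Ux; rewrite mxE sfder_tosf. Qed.

Lemma ev_dA x : U x -> evmx x dA = drow f x.
Proof. by move=> Ux; apply/rowP => i; rewrite !mxE sfder_tosf. Qed.

Definition hessA i : 'rV[A]_n := dmx (sfder U) i dA - dA *m (gamA i)^T.

Lemma hessE i j x : U x -> hess G f x i j = hessA i 0 j x.
Proof.
move=> Ux; rewrite /hess mxE /hessA mxaddE mxoppE (sfBE Ux) sf_dmxE (sf_mulmxE Ux).
congr (_ - _).
  by symmetry; apply: sfder_pd => // y Uy; rewrite dAE.
apply: eq_bigr => k _; rewrite (dAE _ Ux) [_^T _ _]mxE (christoffelE _ _ _ Ux).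
exact: mulrC.
Qed.

Lemma laplacianE x : U x -> laplacian G f x = (\sum_i (hessA i *m QA) 0 i) x.
Proof.
move=> Ux; rewrite /laplacian mxtrace_mulC /mxtrace (sf_sumE Ux); apply: eq_bigr => i _.
rewrite mxE (sf_mulmxE Ux); apply: eq_bigr => k _.
by rewrite (hessE _ _ Ux) (tomxE _ _ _ Ux).
Qed.
End Functions.

Section Tensors.
Variables (K : 'rV[R]_n -> 'M[R]_n) (sK : smooth_mx (odset U) K).
Local Notation KA := (tomx sK).

Lemma trgE x : U x -> trg G K x = (\tr (QA *m KA)) x.
Proof. by move=> Ux; rewrite /trg (evmxtr Ux) (evmxM Ux) !ev_tomx. Qed.
End Tensors.
End Bridge.

Lemma momentumE (R : realType) (U : opendom R 3) (G : 'rV[R]_3 -> 'M[R]_3)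
    (sG : smooth_mx (odset U) G) (GT : forall x, U x -> (G x)^T = G x)
    (Gu : forall x, U x -> G x \in unitmx)
    (K : 'rV[R]_3 -> 'M[R]_3) (sK : smooth_mx (odset U) K) j x : U x ->
  momentum_density G K x 0 j =
  momentum (sfder U) (QA sG Gu) (tomx sK) (gamA sG Gu) j x.
Proof.
move=> Ux; rewrite /momentum_density mxaddE mxoppE ![(_ : 'rV_3) 0 j]mxE.
rewrite /momentum (sfBE Ux); congr (_ - _); last first.
  by symmetry; apply: sfder_pd => // y Uy; rewrite (trgE sG Gu).
rewrite (sf_sumE Ux); apply: eq_bigr => k _; rewrite (sf_sumE Ux); apply: eq_bigr => i _.
rewrite (sfME Ux); congr (_ * _); first by rewrite tomxE.
rewrite /covT /covK !mxaddE !mxoppE !(sfBE Ux) sf_dmxE !(sf_mulmxE Ux) -addrA.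
rewrite (d_tomx _ _ _ _ Ux) -opprD; congr (_ - _); rewrite big_split /=.
congr (_ + _); apply: eq_bigr => l _.
  by rewrite (christoffelE sG GT Gu _ _ _ Ux) (tomxE _ _ _ Ux).
by rewrite [_^T _ _]mxE (christoffelE sG GT Gu _ _ _ Ux) (tomxE _ _ _ Ux) mulrC.
Qed.

(** * Positive definite matrices *)

Section PosDef.
Context {R : realType}.

Lemma posdef_sym n (M : 'M[R]_n) i j : posdef M -> M i j = M j i.
Proof. by case=> MT _; rewrite -{1}MT mxE. Qed.

Lemma posdef_unit n (M : 'M[R]_n) : posdef M -> M \in unitmx.
Proof.
move=> [_ h]; rewrite -row_free_unit -kermx_eq0; apply/negPn/negP => /rowV0Pn[v].
move=> /sub_kermxP vM v0; have := h v v0.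
by rewrite vM mul0mx mxE ltxx.
Qed.

Lemma ip_sym n (M : 'M[R]_n) (v w : 'rV[R]_n) : M^T = M -> ip M v w = ip M w v.
Proof. by move=> MT; rewrite /ip -[in LHS](tr11 (v *m M *m w^T)) !trmx_mul trmxK MT mulmxA. Qed.

Lemma ipDl n (M : 'M[R]_n) (v v' w : 'rV[R]_n) : ip M (v + v') w = ip M v w + ip M v' w.
Proof. by rewrite /ip !mulmxDl mxE. Qed.
Lemma ipDr n (M : 'M[R]_n) (v w w' : 'rV[R]_n) : ip M v (w + w') = ip M v w + ip M v w'.
Proof. by rewrite /ip trD mulmxDr mxE. Qed.
Lemma ipZl n (M : 'M[R]_n) a (v w : 'rV[R]_n) : ip M (a *: v) w = a * ip M v w.
Proof. by rewrite /ip -!scalemxAl mxE. Qed.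
Lemma ipZr n (M : 'M[R]_n) a (v w : 'rV[R]_n) : ip M v (a *: w) = a * ip M v w.
Proof. by rewrite /ip trZ -scalemxAr mxE. Qed.

Lemma posdef_ge0 n (M : 'M[R]_n) (v : 'rV[R]_n) : posdef M -> 0 <= ip M v v.
Proof.
move=> [_ h]; have [->|v0] := eqVneq v 0; first by rewrite /ip mul0mx mul0mx mxE.
by apply: ltW; exact: h.
Qed.

Lemma posdef_inv n (M : 'M[R]_n) : posdef M -> posdef (invmx M).
Proof.
move=> hM; have Mu := posdef_unit hM; have [MT h] := hM; split.
  by rewrite trmx_inv MT.
move=> v v0; have -> : v *m invmx M *m v^T = (v *m invmx M) *m M *m (v *m invmx M)^T.
  by rewrite trmx_mul trmx_inv MT mulmxKV // mulmxA.
apply: h; apply: contraNneq v0 => e.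
by rewrite -[v](mulmxKV Mu) e mul0mx.
Qed.

Lemma cauchy_schwarz n (M : 'M[R]_n) (v w : 'rV[R]_n) : posdef M ->
  ip M v w ^+ 2 <= ip M v v * ip M w w.
Proof.
move=> hM; have [MT _] := hM.
have [->|v0] := eqVneq v 0.
  by rewrite /ip !mul0mx !mxE expr0n mul0r.
have vv : 0 < ip M v v by exact: hM.2.
have := posdef_ge0 (w - (ip M v w / ip M v v) *: v) hM.
rewrite -scaleNr !(ipDl, ipDr, ipZl, ipZr) (ip_sym w v MT).
set a := ip M v v in vv *; set b := ip M v w; set c := ip M w w => h.
have e : c + - (b / a) * b + - (b / a) * (b + - (b / a) * a) = c - b ^+ 2 / a.
  by field; rewrite gt_eqF.
have {}h : 0 <= c - b ^+ 2 / a by rewrite -e; move: h; rewrite mulrDr addrA addrAC.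
by move: h; rewrite subr_ge0 ler_pdivrMr // mulrC.
Qed.

(** With first row [(a, b)], the value of the form at [(- b, a)] is [a] times the
    determinant. *)
Lemma posdef_det2 (M : 'M[R]_2) : posdef M -> 0 < \det M.
Proof.
move=> hM; rewrite det2E.
have s10 : M 1 0 = M 0 1 by exact: posdef_sym.
pose v : 'rV[R]_2 := delta_mx 0 0.
have a0 : 0 < M 0 0.
  have := hM.2 v; rewrite /v trmx_delta -rowE -colE !mxE; apply.
  by apply/eqP => /matrixP/(_ 0 0); rewrite !mxE eqxx => /eqP; rewrite oner_eq0.
pose u : 'rV[R]_2 := \row_i (if i == 0 then - M 0 1 else M 0 0).
have := hM.2 u; rewrite /u !mxE !sum2 !mxE !sum2 !mxE /= s10 => h.
have : 0 < M 0 0 * (M 0 0 * M 1 1 - M 0 1 * M 0 1).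
  have := h; set X := (X in 0 < X) => hX.
  have -> : M 0 0 * (M 0 0 * M 1 1 - M 0 1 * M 0 1) = X by rewrite /X; ring.
  apply: hX; apply/eqP => /matrixP/(_ 0 1); rewrite !mxE /= => e.
  by rewrite e ltxx in a0.
by rewrite pmulr_rgt0.
Qed.

(** Completing squares.  The determinant is positive because it is a value of the
    form divided by the positive second minor; the factorisation reduces traces
    against a positive definite matrix to weighted sums of squares. *)
Lemma posdef3_ldl (M : 'M[R]_3) : posdef M -> exists (L : 'M[R]_3) (D : 'rV[R]_3),
  [/\ (forall i, 0 < D 0 i), M = L^T *m diag_mx D *m L & 0 < \det M].
Proof.
move=> hM.
pose vec (x y z : R) : 'rV[R]_3 := \row_i (if i == o0 then x else if i == o1 then y else z).
have qf x y z : ip M (vec x y z) (vec x y z) =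
   M o0 o0 * x ^+ 2 + M o1 o1 * y ^+ 2 + M o2 o2 * z ^+ 2
   + 2 * (M o0 o1 * x * y + M o0 o2 * x * z + M o1 o2 * y * z).
  rewrite /ip /vec !mxE !sum3 !mxE !sum3 !mxE /=.
  rewrite (posdef_sym o1 o0 hM) (posdef_sym o2 o0 hM) (posdef_sym o2 o1 hM); ring.
have pos x y z : (x != 0) || (y != 0) || (z != 0) -> 0 < ip M (vec x y z) (vec x y z).
  move=> nz; apply: hM.2; apply: contraTneq nz => /matrixP e.
  have := e 0 o0; have := e 0 o1; have := e 0 o2; rewrite !mxE /= => -> -> ->.
  by rewrite eqxx.
have a0 : 0 < M o0 o0.
  have := pos 1 0 0; rewrite oner_eq0 qf => /(_ isT).
  by move=> h; have <- : M o0 o0 * 1 ^+ 2 + M o1 o1 * 0 ^+ 2 + M o2 o2 * 0 ^+ 2 +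
    2 * (M o0 o1 * 1 * 0 + M o0 o2 * 1 * 0 + M o1 o2 * 0 * 0) = M o0 o0 by ring.
pose d2 := M o0 o0 * M o1 o1 - M o0 o1 ^+ 2.
have d20 : 0 < d2.
  have := pos (- M o0 o1) (M o0 o0) 0; rewrite (gt_eqF a0) orbT qf => /(_ isT).
  have -> : M o0 o0 * (- M o0 o1) ^+ 2 + M o1 o1 * M o0 o0 ^+ 2 + M o2 o2 * 0 ^+ 2 +
    2 * (M o0 o1 * - M o0 o1 * M o0 o0 + M o0 o2 * - M o0 o1 * 0 + M o1 o2 * M o0 o0 * 0)
    = M o0 o0 * d2 by rewrite /d2; ring.
  by rewrite pmulr_rgt0.
have detE : \det M = M o0 o0 * M o1 o1 * M o2 o2 + 2 * M o0 o1 * M o0 o2 * M o1 o2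
   - M o0 o0 * M o1 o2 ^+ 2 - M o1 o1 * M o0 o2 ^+ 2 - M o2 o2 * M o0 o1 ^+ 2.
  rewrite det3E (posdef_sym o1 o0 hM) (posdef_sym o2 o0 hM) (posdef_sym o2 o1 hM); ring.
have det0 : 0 < \det M.
  have := pos (M o0 o1 * M o1 o2 - M o0 o2 * M o1 o1)
      (M o0 o1 * M o0 o2 - M o0 o0 * M o1 o2) d2.
  rewrite (gt_eqF d20) !orbT qf => /(_ isT).
  have -> : M o0 o0 * (M o0 o1 * M o1 o2 - M o0 o2 * M o1 o1) ^+ 2 +
    M o1 o1 * (M o0 o1 * M o0 o2 - M o0 o0 * M o1 o2) ^+ 2 + M o2 o2 * d2 ^+ 2 +
    2 * (M o0 o1 * (M o0 o1 * M o1 o2 - M o0 o2 * M o1 o1) *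
            (M o0 o1 * M o0 o2 - M o0 o0 * M o1 o2) +
         M o0 o2 * (M o0 o1 * M o1 o2 - M o0 o2 * M o1 o1) * d2 +
         M o1 o2 * (M o0 o1 * M o0 o2 - M o0 o0 * M o1 o2) * d2) = d2 * \det M.
    by rewrite detE /d2; ring.
  by rewrite pmulr_rgt0.
pose D := vec (M o0 o0) (d2 / M o0 o0) (\det M / d2).
pose e21 := (M o1 o2 - M o0 o1 * M o0 o2 / M o0 o0) / (d2 / M o0 o0).
pose L : 'M[R]_3 := \matrix_(i, j)
  (if i == j then 1 else if i == o0 then (if j == o1 then M o0 o1 / M o0 o0 else M o0 o2 / M o0 o0)
   else if (i == o1) && (j == o2) then e21 else 0).
exists L, D; split => //.
  by apply: ind3; rewrite mxE /= ?divr_gt0.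
have a00 : M o0 o0 != 0 by rewrite gt_eqF.
have d200 : d2 != 0 by rewrite gt_eqF.
have LE i j : (L^T *m diag_mx D *m L) i j =
   L o0 i * D 0 o0 * L o0 j + L o1 i * D 0 o1 * L o1 j + L o2 i * D 0 o2 * L o2 j.
  by rewrite mul_mx_diag !mxE sum3 ![(\matrix_(_, _) _) _ _]mxE !mxE.
have dd2 : M o0 o0 * M o1 o1 - M o0 o1 * M o0 o1 != 0.
  by move: d200; rewrite /d2 expr2.
apply/matrixP; apply: ind3; apply: ind3; rewrite LE !mxE /=;
  rewrite ?(posdef_sym o1 o0 hM) ?(posdef_sym o2 o0 hM) ?(posdef_sym o2 o1 hM)
   ?detE /e21 /d2; field; rewrite ?a00 ?dd2 //.
Qed.

Lemma posdef_det3 (M : 'M[R]_3) : posdef M -> 0 < \det M.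
Proof. by move=> /posdef3_ldl[L [D []]]. Qed.

(** In the factorisation of [P] this is a sum of squares of the entries of
    [L *m X *m L^T] with positive weights. *)
Lemma trace_square_ge0 (P X : 'M[R]_3) : posdef P -> X^T = X ->
  0 <= \tr (P *m X *m P *m X).
Proof.
move=> /posdef3_ldl[L [D [D0 -> _]]] XT.
pose Z := L *m X *m L^T.
have -> : \tr (L^T *m diag_mx D *m L *m X *m (L^T *m diag_mx D *m L) *m X) =
  \tr (diag_mx D *m Z *m (diag_mx D *m Z)).
  rewrite -!mulmxA mxtrace_mulC /Z !mulmxA; congr (\tr _).
have ZT i j : Z i j = Z j i.
  have : Z^T = Z by rewrite /Z !trmx_mul trmxK XT mulmxA.
  by move=> e; rewrite -{1}e mxE.
have DZ a b : (diag_mx D *m Z) a b = D 0 a * Z a b by rewrite mul_diag_mx mxE.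
rewrite /mxtrace sumr_ge0 // => i _; rewrite mxE sumr_ge0 // => j _.
rewrite !DZ (ZT j i) mulrACA -expr2.
by rewrite mulr_ge0 ?sqr_ge0 // mulr_ge0 // ltW.
Qed.

End PosDef.

(** * The conformal metric of zero scalar curvature *)

Section ConformalMetric.
Context {R : realType} (U : opendom R 3).
Variables (g : 'rV[R]_3 -> 'M[R]_3) (u : 'rV[R]_3 -> R).
Hypothesis sg : smooth_mx (odset U) g.
Hypothesis pg : forall x, U x -> posdef (g x).
Hypothesis su : smooth (odset U) u.
Hypothesis u0 : forall x, U x -> 0 < u x.
Let oU := od_open U.
Let gs x := u x ^+ 4 *: g x.

Let gT x : U x -> (g x)^T = g x. Proof. by move=> /pg []. Qed.
Let gu x : U x -> g x \in unitmx. Proof. by move=> /pg /posdef_unit. Qed.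
Let un0 x : U x -> u x != 0. Proof. by move=> /u0; rewrite lt0r => /andP[]. Qed.

Lemma smooth_exp k : smooth (odset U) (fun x => u x ^+ k).
Proof.
elim: k => [|k IH]; first by apply: (smooth_eq oU _ (smooth_cst _ 1)).
by apply: (smooth_eq oU _ (smoothM oU su IH)) => x _; rewrite exprS.
Qed.

Let sgs : smooth_mx (odset U) gs := smooth_scalemx oU (smooth_exp 4) sg.
Let gsT x : U x -> (gs x)^T = gs x. Proof. by move=> Ux; rewrite /gs trZ gT. Qed.
Let gsu x : U x -> gs x \in unitmx.
Proof. by move=> Ux; rewrite /gs unitmxZ ?gu // unitfE expf_neq0 // un0. Qed.

Let uA : smfun U := tosf su.
Let vA : smfun U := tosf (smoothV oU un0 su).
Lemma conf_uv : uA * vA = 1.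
Proof.
by apply: sf_eq => x Ux; rewrite (sfME Ux) (sf1E Ux) !tosfE // mulfV // un0.
Qed.

Lemma conf_GA : GA sgs = uA ^+ 4 *: GA sg.
Proof.
apply: mxA_eq => x Ux; rewrite (evmxZ Ux) !ev_tomx // (sfXE Ux).
by rewrite /uA tosfE.
Qed.

Lemma conf_QA : QA sgs gsu = vA ^+ 4 *: QA sg gu.
Proof.
have e : GA sgs *m (vA ^+ 4 *: QA sg gu) = 1%:M.
  by rewrite conf_GA -scalemxAl -scalemxAr scalerA -exprMn conf_uv expr1n scale1r GA_QA.
by rewrite -[LHS]mulmx1 -e mulmxA QA_GA mul1mx.
Qed.

Let phi : 'rV[smfun U]_3 := vA *: dA su.
Let CA i : 'M[smfun U]_3 := 2 *: (phi^T *m delta_mx 0 i + phi 0 i *: 1%:M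
   - (GA sg *m (delta_mx 0 i : 'rV[smfun U]_3)^T) *m (phi *m QA sg gu)).

Let phiE : phi = vA *: dA su := erefl.
Let duE i : (dA su) 0 i = sfder U i uA. Proof. by rewrite mxE. Qed.
Let bb := phi *m QA sg gu.
Let bE : bb = phi *m QA sg gu := erefl.
Let ee (i : 'I_3) : 'rV[smfun U]_3 := delta_mx 0 i.
Let eeE i : ee i = delta_mx 0 i := erefl.
Let CAE i : CA i = 2 *: (phi^T *m ee i + phi 0 i *: 1%:M - (GA sg *m (ee i)^T) *m bb) := erefl.

Lemma conf_gamA_lc : levi_civita (sfder U) (uA ^+ 4 *: GA sg) (conf_gam (gamA sg gu) CA).
Proof.
exact: (conf_lc (GA_sym sg gT) (QA_GA sg gu) (gamA_lc sg gT gu) conf_uv duE phiE bE eeE CAE).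
Qed.

Lemma conf_gamA i : gamA sgs gsu i = conf_gam (gamA sg gu) CA i.
Proof.
apply: (lc_unique (half2 U) (GA_sym sgs gsT) (GA_QA sgs gsu) (gamA_lc sgs gsT gsu)).
by rewrite conf_GA; exact: conf_gamA_lc.
Qed.

Let hu := hessA sg gu su.
Let huE i : hu i = dmx (sfder U) i (dA su) - dA su *m (gamA sg gu i)^T := erefl.
Let Ph i := dmx (sfder U) i phi - phi *m (gamA sg gu i)^T.
Let PhE i : Ph i = dmx (sfder U) i phi - phi *m (gamA sg gu i)^T := erefl.

(** The conformal Laplacian of [u] is the scalar curvature of [u ^+ 4 *: g] up to a
    power of [u]: solutions of its equation give scalar flat metrics. *)
Lemma scal_conformal x : U x ->
  scal gs x = (u x)^-1 ^+ 5 * (- 8 * laplacian g u x + scal g x * u x).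
Proof.
move=> Ux; rewrite (scalE sgs gsT gsu Ux) (scalE sg gT gu Ux) (laplacianE sg gT gu su Ux).
have -> : scalar_curv (sfder U) (QA sgs gsu) (gamA sgs gsu) =
   scalar_curv (sfder U) (vA ^+ 4 *: QA sg gu) (conf_gam (gamA sg gu) CA).
  by rewrite conf_QA; congr (scalar_curv _ _ _); apply/funext => i; exact: conf_gamA.
have -> := conf_scal (GA_sym sg gT) (QA_sym sg gT gu) (GA_QA sg gu) (QA_GA sg gu)
  (gamA_lc sg gT gu) conf_uv duE phiE bE eeE CAE huE PhE.
rewrite (sfME Ux) (sfXE Ux) (sfBE Ux) !(sfME Ux) (sfnatE Ux) /uA /vA !tosfE //.
rewrite /hu; move: (scalar_curv (sfder U) (QA sg gu) (gamA sg gu) x) => a.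
move: ((\sum_i (hessA sg gu su i *m QA sg gu) 0 i) x) => b; ring.
Qed.

(** The divergence changes by the derivative of the conformal factor of the
    volume element, [u ^+ 6]. *)
Lemma divg_conformal (sgs' : smooth_mx (odset U) gs) (gsu' : forall x, U x -> gs x \in unitmx)
    (gu' : forall x, U x -> g x \in unitmx) (v : 'rV[smfun U]_3) x : U x ->
  divg (sfder U) (gamA sgs' gsu') v x =
  divg (sfder U) (gamA sg gu') v x + 6 * ((u x)^-1 * \sum_i pd i u x * v 0 i x).
Proof.
move=> Ux; rewrite (Prop_irrelevance sgs' sgs) (Prop_irrelevance gsu' gsu) (Prop_irrelevance gu' gu).
have -> : gamA sgs gsu = conf_gam (gamA sg gu) CA by apply/funext => i; exact: conf_gamA.
have -> := conf_divg (sfder U) (gamA sg gu) (QA_sym sg gT gu) (GA_QA sg gu) bE eeE CAE v.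
rewrite (sfDE Ux) (sfME Ux) (sfnatE Ux); congr (_ + _ * _).
rewrite (sf_sumE Ux) mulr_sumr.
apply: eq_bigr => i _; rewrite (sfME Ux) /phi mxscaleE (sfME Ux) (dAE su i Ux).
by rewrite /vA tosfE // mulrA.
Qed.
End ConformalMetric.

(** * The flux of the Jang graph *)

Section JangFields.
Context {R : realType}.
Variables (g K : 'rV[R]_3 -> 'M[R]_3) (f u : 'rV[R]_3 -> R).

(* [jw] is the horizontal part of the unit normal of the graph, [jP] the inverse of
   the graph metric, [jh] the second fundamental form and [jY] the Schoen--Yau
   one-form; [volflux] is [flux] as a vector density of the graph metric. *)
Definition jslope x : R := (Num.sqrt (1 + gradsq g f x))^-1.
Definition jw x : 'rV[R]_3 := jslope x *: grad g f x.
Definition jP x : 'M[R]_3 := ginv g x - (jw x)^T *m jw x.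
Definition jh x : 'M[R]_3 := jslope x *: hess g f x.
Definition jY x : 'rV[R]_3 := jw x *m (jh x - K x).

Definition flux x : 'rV[R]_3 :=
  (4 * u x) *: (drow u x *m jP x) + u x ^+ 2 *: (jY x *m jP x).
Definition volflux x : 'rV[R]_3 :=
  Num.sqrt (\det (graph_metric g f x)) *: flux x.
End JangFields.

Lemma posdef_graph {R : realType} n (g : 'rV[R]_n -> 'M[R]_n) f x :
  posdef (g x) -> posdef (graph_metric g f x).
Proof.
move=> hg; split; first by rewrite /graph_metric trD trmx_mul trmxK hg.1.
move=> v v0; rewrite /graph_metric mulmxDr mulmxDl mxaddE ltr_pwDl ?hg.2 //.
rewrite !mulmxA -[_ *m _ *m v^T]mulmxA mxE big_ord1.
rewrite (_ : (drow f x *m v^T) 0 0 = (v *m (drow f x)^T) 0 0) -?expr2 ?sqr_ge0 //.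
by rewrite -[in RHS](tr11 (v *m _)) trmx_mul trmxK.
Qed.

Lemma smooth_graph {R : realType} n (U : set 'rV[R]_n) (g : 'rV[R]_n -> 'M[R]_n) f :
  open U -> smooth_mx U g -> smooth U f -> smooth_mx U (graph_metric g f).
Proof.
move=> oU sg sf; apply: smooth_addmx => //; apply: smooth_mulmx => //.
  by apply: smooth_trmx => //; exact: smooth_drow.
exact: smooth_drow.
Qed.

(** Here [v] is the conformal factor, [L] its Laplacian, [D] the divergence of the
    Schoen--Yau form [Y], [Rs] the scalar curvature; [a], [b], [c] are the products of
    [Y] and [grad v] with each other, [e] and [m] the energy and the momentum along
    the normal, and [t] the square norm of [h - K].  Twice the right-hand side is
    [2 |v Y + grad v|^2 + 6 |grad v|^2 + v^2 (2 (e - m) + t)]: the scalar curvature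
    cancels between the Laplacian and [D]. *)
Lemma completed_square {R : realType} (a b c e m t v D L Rs : R) :
  0 < v -> 8 * L = Rs * v -> 2 * D = 2 * e - 2 * m + t + 2 * a - Rs ->
  0 <= v * (v * a + b) + (v * b + c) -> 0 <= c -> m <= e -> 0 <= t ->
  0 <= 4 * c + 4 * v * L + 2 * v * b + v ^+ 2 * D.
Proof.
move=> v0 eq8 DE sq1 sq2 em t0.
have key : 2 * (4 * c + 4 * v * L + 2 * v * b + v ^+ 2 * D) =
   2 * (v * (v * a + b) + (v * b + c)) + 6 * c + v ^+ 2 * (2 * (e - m) + t).
  transitivity (8 * c + v * (8 * L) + 4 * v * b + v ^+ 2 * (2 * D)); first by ring.
  rewrite eq8 DE; ring.
have : 0 <= v ^+ 2 * (2 * (e - m) + t).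
  by rewrite mulr_ge0 ?sqr_ge0 // addr_ge0 // mulr_ge0 // subr_ge0.
move=> h; rewrite -(pmulr_rge0 _ (ltr0n R 2)) key.
by rewrite addr_ge0 // addr_ge0 // mulr_ge0.
Qed.

Section JangRing.
Context {R : realType} (U : opendom R 3).
Variables (g K : 'rV[R]_3 -> 'M[R]_3) (f : 'rV[R]_3 -> R).
Hypothesis sg : smooth_mx (odset U) g.
Hypothesis pg : forall x, U x -> posdef (g x).
Hypothesis sK : smooth_mx (odset U) K.
Hypothesis KT : forall x, U x -> (K x)^T = K x.
Hypothesis sf : smooth (odset U) f.
Let oU := od_open U.

Lemma jgT x : U x -> (g x)^T = g x. Proof. by move=> /pg []. Qed.
Lemma jgu x : U x -> g x \in unitmx. Proof. by move=> /pg /posdef_unit. Qed.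

Lemma gradsq_ge0 x : U x -> 0 <= gradsq g f x.
Proof. by move=> /pg /posdef_inv h; exact: posdef_ge0. Qed.

Lemma smooth_gradsq : smooth (odset U) (gradsq g f).
Proof.
have h : smooth_mx (odset U) (fun x => drow f x *m ginv g x *m (drow f x)^T).
  apply: smooth_mulmx => //; first apply: smooth_mulmx => //.
  - exact: smooth_drow.
  - by apply: smooth_invmx => //; exact: jgu.
  - by apply: smooth_trmx => //; exact: smooth_drow.
exact: h 0 0.
Qed.

Lemma smooth_jslope : smooth (odset U) (jslope g f).
Proof.
have W0 x : U x -> 0 < 1 + gradsq g f x by move=> Ux; rewrite ltr_pwDl ?gradsq_ge0.
apply: smoothV => //; first by move=> x Ux; rewrite gt_eqF // sqrtr_gt0 W0.
apply: smooth_sqrt => //; apply: smoothD => //; first exact: smooth_cst.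
exact: smooth_gradsq.
Qed.

Definition fA := dA sf.
Definition QgA := QA sg jgu.
Definition rA : smfun U := tosf smooth_jslope.
Definition wA := rA *: (fA *m QgA).
Definition hessfA := hessA sg jgu sf.
Definition hrA i := rA *: hessfA i.
Definition PA := QgA - wA^T *m wA.
Definition hA := \matrix_(i, j) hrA i 0 j.
Definition TA := hA *m PA.
Definition KA := tomx sK.
Definition YA := wA *m (hA - KA).
Definition ggA := graph_gam (gamA sg jgu) wA hrA.

Lemma rWA : rA * rA * (1 + (fA *m QgA *m fA^T) 0 0) = 1.
Proof.
apply: sf_eq => x Ux; rewrite (sfME Ux) (sfDE Ux) (sfME Ux) !(sf1E Ux).
rewrite evmxE !(evmxM Ux) (evmx_tr) ev_tomx // (ev_dA _ Ux) /rA tosfE // /jslope.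
rewrite -/(gradsq g f x); set W := 1 + gradsq g f x.
have W0 : 0 < W by rewrite ltr_pwDl ?gradsq_ge0.
by rewrite -invfM -expr2 sqr_sqrtr ?ltW // mulVf // gt_eqF.
Qed.

Lemma KTA : KA^T = KA.
Proof. by apply: mxA_eq => x Ux; rewrite evmx_tr !ev_tomx // KT. Qed.

Let wE : wA = rA *: (fA *m QgA) := erefl.
Let hsE i : hessfA i = dmx (sfder U) i fA - fA *m (gamA sg jgu i)^T := erefl.
Let hrsE i : hrA i = rA *: hessfA i := erefl.
Let PE : PA = QgA - wA^T *m wA := erefl.
Let hE : hA = \matrix_(i, j) hrA i 0 j := erefl.
Let TE : TA = hA *m PA := erefl.

Let sgh := smooth_graph oU sg sf.
Let ghT x : U x -> (graph_metric g f x)^T = graph_metric g f x.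
Proof. by move=> /pg /(posdef_graph f) []. Qed.
Let ghu x : U x -> graph_metric g f x \in unitmx.
Proof. by move=> /pg /(posdef_graph f) /posdef_unit. Qed.

Lemma graph_GA : GA sgh = GA sg + fA^T *m fA.
Proof.
apply: mxA_eq => x Ux; rewrite (evmxD Ux) (evmxM Ux) evmx_tr !ev_tomx //.
by rewrite (ev_dA _ Ux).
Qed.

Lemma graph_gamA i : gamA sgh ghu i = ggA i.
Proof.
apply: (lc_unique (half2 U) (GA_sym sgh ghT) (GA_QA sgh ghu) (gamA_lc sgh ghT ghu)).
rewrite graph_GA.
exact: (graph_lc (GA_sym sg jgT) (QA_GA sg jgu)
  (gamA_lc sg jgT jgu) (dA_closed sf) rWA wE hsE hrsE).
Qed.

Lemma graph_gamAE : gamA sgh ghu = ggA.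
Proof. by apply/funext => i; exact: graph_gamA. Qed.

Lemma graph_QA : QA sgh ghu = PA.
Proof.
have e := graph_PG (QA_sym sg jgT jgu) (QA_GA sg jgu) rWA wE PE.
rewrite -graph_GA in e.
by rewrite -[LHS]mul1mx -e -mulmxA GA_QA mulmx1.
Qed.

Lemma ev_wA x : U x -> evmx x wA = jw g f x.
Proof.
by move=> Ux; rewrite (evmxZ Ux) (evmxM Ux) ev_tomx // (ev_dA _ Ux) /rA tosfE.
Qed.

Lemma ev_PA x : U x -> evmx x PA = jP g f x.
Proof.
by move=> Ux; rewrite (evmxB Ux) (evmxM Ux) evmx_tr ev_wA // ev_tomx.
Qed.

Lemma ginv_graph x : U x -> ginv (graph_metric g f) x = jP g f x.
Proof. by move=> Ux; rewrite -ev_PA // -graph_QA ev_tomx. Qed.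

Lemma ev_hA x : U x -> evmx x hA = jh g f x.
Proof.
move=> Ux; apply/matrixP => i j; rewrite [LHS]mxE /hA [(\matrix_(_, _) _) i j]mxE /hrA mxscaleE.
by rewrite (sfME Ux) /rA tosfE // /jh mxscaleE (hessE sg jgT jgu sf i j Ux).
Qed.

Lemma jh_sym x : U x -> (jh g f x)^T = jh g f x.
Proof.
move=> Ux; rewrite -ev_hA // -evmx_tr.
by rewrite (sy_hT (gamA_lc sg jgT jgu) (dA_closed sf) hsE hrsE hE).
Qed.

Lemma ev_KA x : U x -> evmx x KA = K x. Proof. exact: ev_tomx. Qed.

Lemma ev_YA x : U x -> evmx x YA = jY g K f x.
Proof. by move=> Ux; rewrite (evmxM Ux) (evmxB Ux) ev_wA // ev_hA // ev_KA. Qed.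

Lemma scal_graph x : U x ->
  scal (graph_metric g f) x = scalar_curv (sfder U) PA ggA x.
Proof.
move=> Ux; rewrite (scalE sgh ghT ghu Ux) graph_QA.
by rewrite graph_gamAE.
Qed.

(** The matrix in Jang's equation is the inverse of the graph metric. *)
Lemma jang_lhsE x : U x -> jang_lhs g K f x = \tr (jP g f x *m (jh g f x - K x)).
Proof.
move=> Ux; rewrite /jang_lhs mxtrace_mulC /mxtrace exchange_big; apply: eq_bigr => j _ /=.
rewrite [RHS]mxE; apply: eq_bigr => i _; rewrite mulrC /jh /jP !(mxaddE, mxoppE, mxscaleE) [(_^T *m _) _ _]mxE big_ord1.
rewrite [_^T _ _]mxE /jw !mxscaleE.
rewrite -/(jslope g f x) [_ / Num.sqrt _]mulrC.
have W0 : 0 < 1 + gradsq g f x by rewrite ltr_pwDl ?gradsq_ge0.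
have hT : hess g f x i j = hess g f x j i.
  rewrite !mxE (smooth_pd_comm i j oU sf Ux); congr (_ - _); apply: eq_bigr => k _.
  rewrite !(christoffelE sg jgT jgu _ _ _ Ux).
  by rewrite ((gamA_lc sg jgT jgu).1 i j k).
have KTE : K x i j = K x j i by rewrite -{1}(KT Ux) mxE.
rewrite hT KTE; congr (_ * (_ - _)).
rewrite -(sqr_sqrtr (ltW W0)) /jslope; field.
by rewrite sqrtr_eq0 -ltNge.
Qed.

Variable u : 'rV[R]_3 -> R.
Hypothesis su : smooth (odset U) u.
Definition uA : smfun U := tosf su.
Definition duA := dA su.
Definition VA := (4 * uA) *: (duA *m PA) + (uA ^+ 2) *: (YA *m PA).

Lemma ev_VA x : U x -> evmx x VA = flux g K f u x.
Proof.
move=> Ux; rewrite /VA (evmxD Ux) !(evmxZ Ux) (evmxM Ux duA) (evmxM Ux YA) ev_PA // ev_YA // (ev_dA _ Ux).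
by rewrite (sfME Ux) (sfnatE Ux) (sfXE Ux) /uA tosfE.
Qed.

Lemma smooth_vol : smooth (odset U) (fun x => Num.sqrt (\det (graph_metric g f x))).
Proof.
apply: smooth_sqrt => //; last exact: smooth_det.
by move=> x /pg /(posdef_graph f) /posdef_det3.
Qed.

Lemma smooth_volflux i : smooth (odset U) (fun x => volflux g K f u x 0 i).
Proof.
have h : smooth (odset U) (fun x => Num.sqrt (\det (graph_metric g f x)) * VA 0 i x).
  by apply: smoothM smooth_vol (sf_smooth _).
by apply: (smooth_eq oU _ h) => x Ux; rewrite /volflux mxscaleE -ev_VA // [in RHS]mxE.
Qed.

Lemma div_volflux x : U x ->
  \sum_i pd i (fun y => volflux g K f u y 0 i) x =
  Num.sqrt (\det (graph_metric g f x)) * divg (sfder U) ggA VA x.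
Proof.
move=> Ux.
pose sd : smfun U := tosf smooth_vol.
have det0 y : U y -> 0 < \det (graph_metric g f y) by move=> /pg /(posdef_graph f) /posdef_det3.
have vol0 y : U y -> Num.sqrt (\det (graph_metric g f y)) != 0.
  by move=> Uy; rewrite gt_eqF // sqrtr_gt0 det0.
pose sdV : smfun U := tosf (smoothV oU vol0 smooth_vol).
have sE : sd * sd = \det (GA sgh).
  apply: sf_eq => y Uy; rewrite (sfME Uy) (evmx_det Uy) ev_tomx // /sd tosfE //.
  by rewrite -expr2 sqr_sqrtr // ltW // det0.
have sV : sd * sdV = 1.
  by apply: sf_eq => y Uy; rewrite (sfME Uy) (sf1E Uy) !tosfE // mulfV // vol0.
have E := divg_volume VA (half2 U) (gamA_lc sgh ghT ghu) sE sV.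
have -> : divg (sfder U) ggA VA = divg (sfder U) (gamA sgh ghu) VA.
  by rewrite graph_gamAE.
transitivity ((sd * divg (sfder U) (gamA sgh ghu) VA) x); last first.
  by rewrite (sfME Ux) /sd tosfE.
rewrite -E (sf_sumE Ux); apply: eq_bigr => i _.
symmetry; apply: sfder_pd => // y Uy; rewrite (sfME Uy) /sd tosfE // /volflux mxscaleE.
by rewrite -ev_VA // [in RHS]mxE.
Qed.

Hypothesis jang : forall x, U x -> jang_lhs g K f x = 0.
Hypothesis dec : forall x, U x -> dominant_energy g K x.
Hypothesis u_gt0 : forall x, U x -> 0 < u x.
Hypothesis u_eq : forall x, U x ->
  - 8 * laplacian (graph_metric g f) u x + scal (graph_metric g f) x * u x = 0.

Lemma jangA : \tr (PA *m hA) = \tr (PA *m KA).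
Proof.
apply: sf_eq => x Ux; rewrite !(evmxtr Ux) !(evmxM Ux) ev_PA // ev_hA // ev_KA //.
have := jang Ux; rewrite (jang_lhsE Ux) mulmxBr raddfB => /eqP.
by rewrite subr_eq0 => /eqP.
Qed.

(** The vector [jw] is shorter than one, so the momentum density along it is bounded
    by its length. *)
Lemma energy_momentum x : U x ->
  (jw g f x *m (momentum_density g K x)^T) 0 0 <= energy_density g K x.
Proof.
move=> Ux; have := dec Ux; rewrite /dominant_energy; apply: le_trans.
set J := momentum_density g K x.
have pQ := posdef_inv (pg Ux).
have -> : (jw g f x *m J^T) 0 0 = ip (ginv g x) J (jw g f x *m g x).
  rewrite (ip_sym _ _ (pQ.1)) /ip; congr ((_ *m _) _ _).
  by rewrite /ginv mulmxK ?jgu.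
have := cauchy_schwarz J (jw g f x *m g x) pQ; rewrite -/(ginv g x).
set c := ip _ J _; set a := ip _ J J.
have -> : ip (ginv g x) (jw g f x *m g x) (jw g f x *m g x) =
    gradsq g f x / (1 + gradsq g f x).
  rewrite /ip /ginv mulmxK ?jgu // trmx_mul jgT // /jw /grad trZ trmx_mul.
  rewrite (ginv_sym jgT Ux) -!scalemxAl -!scalemxAr !mulmxA /gradsq /ip /ginv.
  rewrite !mulmxKV ?jgu // scalerA -expr2 mxE /jslope exprVn sqr_sqrtr.
    by rewrite mulrC; congr (_ * _); rewrite -[drow f x *m _ *m _ *m _]mulmxA mulmxV ?jgu // mulmx1.
  by rewrite addr_ge0 ?gradsq_ge0.
have a0 : 0 <= a by exact: posdef_ge0.
have q0 := gradsq_ge0 Ux; set q := gradsq g f x in q0 *.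
have q1 : q / (1 + q) <= 1 by rewrite ler_pdivrMr ?mul1r ?lerDr ?ltr_pwDl.
move=> h; apply: le_trans (ler_norm _) _; rewrite -sqrtr_sqr ler_wsqrtr //.
by apply: le_trans h _; rewrite ler_piMr.
Qed.

(** The equation of [u] trades its Laplacian for the scalar curvature of the graph,
    and the Schoen--Yau identity for the divergence of [Y]; the dominant energy
    condition and [completed_square] give the sign. *)
Lemma div_flux_ge0 x : U x ->
  0 <= \sum_i pd i (fun y => volflux g K f u y 0 i) x.
Proof.
move=> Ux; rewrite div_volflux // mulr_ge0 ?sqrtr_ge0 //.
have pP : posdef (jP g f x).
  by rewrite -ginv_graph //; apply: posdef_inv; exact: posdef_graph (pg Ux).
have lapE : divg (sfder U) ggA (duA *m PA) x = laplacian (graph_metric g f) u x.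
  rewrite (laplacianE sgh ghT ghu su Ux) -graph_QA.
  rewrite -graph_gamAE.
  by rewrite (divg_grad duA (GA_QA sgh ghu) (QA_GA sgh ghu) (gamA_lc sgh ghT ghu)).
have ev4 (a b c e r : smfun U) : (a + 4 * r * b + (c + r ^+ 2 * e)) x =
    a x + 4 * r x * b x + (c x + r x ^+ 2 * e x).
  by rewrite !expr2 !(sfDE Ux) !(sfME Ux) (sfnatE Ux).
have ev5 (a b c e t q : smfun U) : (a - b + c ^+ 2 - 2 * e + t + 2 * q) x =
    a x - b x + c x ^+ 2 - 2 * e x + t x + 2 * q x.
  by rewrite !expr2 !(sfDE Ux) !(sfNE Ux) !(sfME Ux) !(sfnatE Ux).
have SY := congr1 (fun a : smfun U => a x) (schoen_yau (half2 U) (GA_sym sg jgT)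
  (QA_sym sg jgT jgu) (GA_QA sg jgu) (QA_GA sg jgu) (gamA_lc sg jgT jgu) (dA_closed sf)
  rWA wE hsE hrsE PE hE TE KTA jangA).
have sumE (V : 'rV[smfun U]_3) (a : smfun U) :
    (\sum_i V 0 i * sfder U i a) x = (\sum_i V 0 i x * sfder U i a x).
  by rewrite (sf_sumE Ux); apply: eq_bigr => i _; rewrite (sfME Ux).
have dE : divg (sfder U) ggA VA x =
   4 * (drow u x *m jP g f x *m (drow u x)^T) 0 0 + 4 * u x * laplacian (graph_metric g f) u x
   + 2 * u x * (jY g K f x *m jP g f x *m (drow u x)^T) 0 0
   + u x ^+ 2 * divg (sfder U) ggA (YA *m PA) x.
  have du i : sfder U i (4 * uA) x = 4 * pd i u x.
    by rewrite ddM ddn mul0r add0r (sfME Ux) (sfnatE Ux) (sfder_tosf _ _ Ux).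
  have du2 i : sfder U i (uA ^+ 2) x = 2 * u x * pd i u x.
    rewrite expr2 ddM (sfDE Ux) !(sfME Ux) (sfder_tosf _ _ Ux) /uA tosfE //; ring.
  have e1 : \sum_i (duA *m PA) 0 i x * sfder U i (4 * uA) x =
      4 * (drow u x *m jP g f x *m (drow u x)^T) 0 0.
    rewrite [(_ *m (drow u x)^T) 0 0]mxE mulr_sumr; apply: eq_bigr => i _.
    by rewrite du evmxE (evmxM Ux) ev_PA // (ev_dA _ Ux) [_^T _ _]mxE [drow u x 0 i]mxE mulrCA.
  have e2 : \sum_i (YA *m PA) 0 i x * sfder U i (uA ^+ 2) x =
      2 * u x * (jY g K f x *m jP g f x *m (drow u x)^T) 0 0.
    rewrite [(_ *m (drow u x)^T) 0 0]mxE mulr_sumr; apply: eq_bigr => i _.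
    by rewrite du2 evmxE (evmxM Ux YA) ev_PA // ev_YA // [_^T _ _]mxE [drow u x 0 i]mxE mulrCA.
  have uE : uA x = u x by rewrite /uA tosfE.
  rewrite -e1 -e2 -addrA /VA [divg _ _ (_ + _)]divgD [divg _ _ ((4 * uA) *: _)]divgZ.
  rewrite [divg _ _ (uA ^+ 2 *: _)]divgZ ev4 -lapE uE.
  by congr (_ + _ + (_ + _)); [exact: sumE|exact: sumE].
have {}SY : scal (graph_metric g f) x + 2 * divg (sfder U) ggA (YA *m PA) x =
   2 * energy_density g K x - 2 * (jw g f x *m (momentum_density g K x)^T) 0 0
   + \tr (jP g f x *m (jh g f x - K x) *m jP g f x *m (jh g f x - K x))
   + 2 * (jY g K f x *m jP g f x *m (jY g K f x)^T) 0 0.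
  rewrite (scal_graph Ux).
  have -> : 2 * divg (sfder U) ggA (YA *m PA) x = (2 * divg (sfder U) ggA (YA *m PA)) x.
    by rewrite (sfME Ux) (sfnatE Ux).
  rewrite -(sfDE Ux); move: SY; rewrite -/ggA -/YA => ->.
  rewrite ev5.
  rewrite (evmxtr Ux (QA sg jgu *m KA)) (evmxtr Ux (QA sg jgu *m KA *m QA sg jgu *m KA)).
  rewrite (evmxtr Ux (PA *m (hA - KA) *m PA *m (hA - KA))).
  rewrite !(evmxM Ux _ KA) !(evmxM Ux _ (QA sg jgu)) !(evmxM Ux _ KA) !(evmxM Ux _ (hA - KA)) !(evmxM Ux _ PA) (evmxM Ux PA (hA - KA)).
  rewrite !(evmxB Ux hA KA) !ev_PA // ev_hA // ev_KA // ev_tomx //.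
  rewrite [(_ *m wA^T) 0 0 x]evmxE (evmxM Ux _ wA^T) (evmxM Ux _ (hA - KA)) (evmxM Ux YA PA).
  rewrite (evmxB Ux hA KA) evmx_tr ev_PA // ev_hA // ev_KA // ev_YA //.
  rewrite ev_wA // /energy_density (scalE sg jgT jgu Ux) KT //.
  rewrite mulrA mulfV // mul1r; congr (_ - 2 * _ + _ + 2 * _).
    rewrite (sf_sumE Ux) [RHS]mxE; apply: eq_bigr => j _.
    rewrite (sfME Ux) [_^T _ _]mxE (momentumE sg jgT jgu sK j Ux); congr (_ * _).
    by rewrite evmxE ev_wA.
  rewrite /jY trmx_mul -!mulmxA; congr ((_ *m (_ *m (_ *m _))) 0 0).
  rewrite trB KT //; congr (_ *m _); congr (_ - _).
  by rewrite jh_sym.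
rewrite dE; set L := laplacian _ _ _ in dE *; set Rs := scal _ _ in SY.
have eq8 : 8 * L = Rs * u x.
  by have := u_eq Ux; rewrite -/L -/Rs mulNr => /eqP; rewrite addrC subr_eq0 => /eqP ->.
set Y := jY g K f x in SY *; set P := jP g f x in SY pP *; set du := drow u x.
set D := sfv (divg (sfder U) ggA (YA *m PA)) x in SY *.
have DE : 2 * D = 2 * energy_density g K x - 2 * (jw g f x *m (momentum_density g K x)^T) 0 0
   + \tr (P *m (jh g f x - K x) *m P *m (jh g f x - K x))
   + 2 * (Y *m P *m Y^T) 0 0 - Rs by rewrite -SY addrAC subrr add0r.
have tr0 : 0 <= \tr (P *m (jh g f x - K x) *m P *m (jh g f x - K x)).
  apply: trace_square_ge0 => //; rewrite trB KT //; congr (_ - _).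
  by rewrite jh_sym.
have em := energy_momentum Ux.
have sq1 : 0 <= ip P (u x *: Y + du) (u x *: Y + du) by exact: posdef_ge0.
have sq2 : 0 <= ip P du du by exact: posdef_ge0.
rewrite !(ipDl, ipDr, ipZl, ipZr) (ip_sym du Y pP.1) in sq1.
rewrite -/(ip P Y Y) in DE; rewrite -/(ip P du du) -/(ip P Y du).
exact: (completed_square (u_gt0 Ux) eq8 DE sq1 sq2 em tr0).
Qed.

End JangRing.

(** * Stereographic coordinates on the unit sphere *)

Section Stereo.
Context {R : realType}.

Lemma pd_coord n (i j : 'I_n) (x : 'rV[R]_n) : pd j (fun y => y 0 i) x = (i == j)%:R.
Proof.
have := @derive_mx R 'rV[R]_n 1 n id x (delta_mx 0 j) (@derivable_id _ _ _ _).
by rewrite /pd derive_id => /rowP /(_ i); rewrite !mxE eqxx.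
Qed.

Lemma smooth_sqn n (U : set 'rV[R]_n) : open U -> smooth U (@sqn R n).
Proof.
move=> oU; apply: smooth_sum => // i.
apply: (smooth_eq oU _ (smoothM oU (smooth_coord U i) (smooth_coord U i))) => x _.
by rewrite expr2.
Qed.

Lemma pd_sum n (U : set 'rV[R]_n) (I : Type) (r : seq I) (F : I -> 'rV[R]_n -> R) x j :
  open U -> (forall i, smooth U (F i)) -> U x ->
  pd j (fun y => \sum_(i <- r) F i y) x = \sum_(i <- r) pd j (F i) x.
Proof.
move=> oU h Ux; elim: r => [|i r IH].
  rewrite big_nil; transitivity (pd j (fun=> 0) x); last exact: pd_cst.
  by congr (pd j _ x); apply/funext => y; rewrite big_nil.
rewrite big_cons -IH -(pdD j (h i) (smooth_sum r xpredT oU h) Ux); congr (pd j _ x).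
by apply/funext => y; rewrite big_cons.
Qed.

Lemma pd_sqn n (x : 'rV[R]_n) j : pd j (@sqn R n) x = 2 * x 0 j.
Proof.
have sc i := smooth_coord (@setT 'rV[R]_n) i.
have e : @sqn R n = fun y => \sum_i y 0 i * y 0 i.
  by apply/funext => y; apply: eq_bigr => i _; rewrite expr2.
rewrite e (@pd_sum _ setT _ _ _ _ _ openT) // => [|i]; last exact: smoothM openT _ _.
rewrite (bigD1 j) //= big1 => [|i ij].
  by rewrite (pdM _ (sc j) (sc j)) // pd_coord eqxx addr0 mul1r mulr1 mulr_natl mulr2n.
by rewrite (pdM _ (sc i) (sc i)) // pd_coord (negbTE ij) mul0r mulr0 addr0.
Qed.

Lemma sqn_ge0 n (x : 'rV[R]_n) : 0 <= sqn x.
Proof. by apply: sumr_ge0 => i _; rewrite sqr_ge0. Qed.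

Lemma sqn0 n : sqn (0 : 'rV[R]_n) = 0.
Proof. by rewrite /sqn big1 // => i _; rewrite mxE expr0n. Qed.

Lemma sqnZ n a (x : 'rV[R]_n) : sqn (a *: x) = a ^+ 2 * sqn x.
Proof. by rewrite /sqn mulr_sumr; apply: eq_bigr => i _; rewrite mxE exprMn. Qed.

Lemma sqn_neq0 n (x : 'rV[R]_n) : x != 0 -> sqn x != 0.
Proof.
apply: contra => /eqP s0; apply/eqP/rowP => i; rewrite mxE; apply/eqP.
rewrite -sqrf_eq0 eq_le sqr_ge0 andbT -s0 /sqn (bigD1 i) //= lerDl sumr_ge0 // => k _.
exact: sqr_ge0.
Qed.

Lemma open_nonzero n : open [set x : 'rV[R]_n | x != 0].
Proof.
rewrite (_ : mkset _ = ~` [set 0]); last by apply/seteqP; split => z /= /eqP.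
by apply: closed_openC; apply: accessible_closed_set1; exact: hausdorff_accessible.
Qed.

Lemma open_unit_ball n : open [set x : 'rV[R]_n | sqn x < 1].
Proof.
rewrite (_ : mkset _ = @sqn R n @^-1` [set t | t < 1]) //.
apply: open_comp; last exact: open_lt.
by move=> x _; exact: (smooth_cont (smooth_sqn openT)).
Qed.
Lemma sqn1_gt0 n (x : 'rV[R]_n) : 0 < sqn x + 1.
Proof. by rewrite ltr_wpDl ?sqn_ge0. Qed.
Lemma sqn1_neq0 n (x : 'rV[R]_n) : sqn x + 1 != 0.
Proof. by rewrite gt_eqF ?sqn1_gt0. Qed.

Definition stereo_num (c : bool) (k : 'I_3) (y : 'rV[R]_2) : R :=
  if k == 0 then 2 * y 0 0 else if k == 1 then 2 * y 0 1
  else if c then sqn y - 1 else 1 - sqn y.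

Lemma stereoE c y k : stereo c y 0 k = stereo_num c k y / (sqn y + 1).
Proof. by rewrite mxE. Qed.

Lemma smooth_stereo_num c k : smooth setT (stereo_num c k).
Proof.
have sq := smooth_sqn (@openT 'rV[R]_2).
have sl i : smooth setT (fun y : 'rV[R]_2 => 2 * y 0 i).
  exact: smoothM openT (smooth_cst _ _) (smooth_coord _ _).
rewrite /stereo_num; case: (k == 0); first exact: sl.
case: (k == 1); first exact: sl.
case: c; first exact: smoothD openT sq (smooth_cst _ _).
exact: smoothD openT (smooth_cst _ _) (smoothN openT sq).
Qed.

Lemma smooth_stereo c k : smooth setT (fun y : 'rV[R]_2 => stereo c y 0 k).
Proof.
have sq := smooth_sqn (@openT 'rV[R]_2).
apply: (smooth_eq openT (f := fun y => stereo_num c k y * (sqn y + 1)^-1)).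
  by move=> y _; rewrite stereoE.
apply: smoothM => //; first exact: openT.
  exact: smooth_stereo_num.
apply: smoothV => //; first exact: openT.
  by move=> y _; exact: sqn1_neq0.
exact: smoothD openT sq (smooth_cst _ _).
Qed.

Lemma stereo_diff c y k : differentiable (fun y : 'rV[R]_2 => stereo c y 0 k) y.
Proof. exact: (smooth_diff openT (smooth_stereo c k)). Qed.

Definition dstereo_num (c : bool) (k : 'I_3) (a : 'I_2) (y : 'rV[R]_2) : R :=
  if k == 0 then 2 * (a == 0)%:R else if k == 1 then 2 * (a == 1)%:R
  else if c then 2 * y 0 a else - (2 * y 0 a).

Lemma pd_stereo_num c k a y : pd a (stereo_num c k) y = dstereo_num c k a y.
Proof.
have sq := smooth_sqn (@openT 'rV[R]_2).
have pl i : pd a (fun y : 'rV[R]_2 => 2 * y 0 i) y = 2 * (a == i)%:R.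
  rewrite (pdM _ (smooth_cst setT 2) (smooth_coord _ _)) // pd_cst pd_coord eq_sym.
  by rewrite mul0r add0r.
rewrite /stereo_num /dstereo_num; case: (k == 0); first exact: pl.
case: (k == 1); first exact: pl.
case: c.
  by rewrite (pdD _ sq (smooth_cst setT (-1))) // pd_cst pd_sqn addr0.
rewrite (pdD _ (smooth_cst setT 1) (smoothN openT sq)) // pd_cst (pdN _ sq) //.
by rewrite pd_sqn add0r.
Qed.

Lemma stereoJ c y a k : 'J (stereo c) y a k =
  (dstereo_num c k a y - 2 * y 0 a * stereo c y 0 k) / (sqn y + 1).
Proof.
rewrite jacobianE; last by move=> i; exact: stereo_diff.
have sq := smooth_sqn (@openT 'rV[R]_2).
have sD : smooth setT (fun y : 'rV[R]_2 => sqn y + 1).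
  exact: smoothD openT sq (smooth_cst _ _).
have : pd a (fun y => stereo c y 0 k * (sqn y + 1)) y = dstereo_num c k a y.
  rewrite -(pd_stereo_num c k a y); congr (pd a _ y); apply/funext => z.
  by rewrite stereoE mulfVK // sqn1_neq0.
rewrite (pdM _ (smooth_stereo c k) sD) // (pdD _ sq (smooth_cst setT 1)) // pd_cst pd_sqn addr0.
move=> <-; field; exact: sqn1_neq0.
Qed.

Lemma stereo_sphere c (y : 'rV[R]_2) : sphere (stereo c y).
Proof.
rewrite /sphere /= /sqn sum3 !stereoE /stereo_num /=.
have := sqn1_neq0 y; rewrite /sqn sum2 => D0.
by case: c; field; rewrite D0 //.
Qed.

Lemma stereoJJ c (y : 'rV[R]_2) : 'J (stereo c) y *m ('J (stereo c) y)^T = (4 / (sqn y + 1) ^+ 2)%:M.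
Proof.
have D0 := sqn1_neq0 y.
apply/matrixP; apply: ind2; apply: ind2; rewrite !mxE !sum3 ![_^T _ _]mxE !stereoJ !stereoE
  /dstereo_num /stereo_num /= ?mulr1n ?mulr0n; rewrite /sqn sum2 in D0 *; case: c; field; rewrite D0 //.
Qed.

Lemma stereoJT c (y : 'rV[R]_2) : 'J (stereo c) y *m (stereo c y)^T = 0.
Proof.
have D0 := sqn1_neq0 y.
apply/matrixP => a b; rewrite (ord1 b) {b}; move: a; apply: ind2; rewrite !mxE !sum3 ![_^T _ _]mxE !stereoJ !stereoE
  /dstereo_num /stereo_num /=; rewrite /sqn sum2 in D0 *; case: c; field; rewrite D0 //.
Qed.

Definition cross (v w : 'rV[R]_3) : 'rV[R]_3 := \row_k
  (if k == o0 then v 0 o1 * w 0 o2 - v 0 o2 * w 0 o1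
   else if k == o1 then v 0 o2 * w 0 o0 - v 0 o0 * w 0 o2
   else v 0 o0 * w 0 o1 - v 0 o1 * w 0 o0).

Lemma stereo_cross c (y : 'rV[R]_2) : cross (row 0 ('J (stereo c) y)) (row 1 ('J (stereo c) y)) =
  ((if c then -1 else 1) * (4 / (sqn y + 1) ^+ 2)) *: stereo c y.
Proof.
have D0 := sqn1_neq0 y.
have := stereoJ c y; move: ('J (stereo c) y) => S SE.
apply/rowP; apply: ind3; rewrite mxscaleE /cross [(\row__ _) _ _]mxE ![row _ _ _ _]mxE !SE !stereoE
  /dstereo_num /stereo_num /=; rewrite /sqn sum2 in D0 *; case: (c) => /=; field; rewrite D0 //.
Qed.

(** The area of a surface element is the length of its conormal covector times
    the volume density. *)
Lemma det_surface (M : 'M[R]_3) (S : 'M[R]_(2, 3)) : M \in unitmx ->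
  \det (S *m M *m S^T) =
  \det M * (cross (row 0 S) (row 1 S) *m invmx M *m (cross (row 0 S) (row 1 S))^T) 0 0.
Proof.
move=> Mu; rewrite /invmx Mu -scalemxAr -scalemxAl mxscaleE mulrA mulfV ?mul1r; last first.
  by move: Mu; rewrite unitmxE unitfE.
have adjE (i j : 'I_3) : (\adj M) i j = cofactor M j i by rewrite mxE.
have l (i : 'I_3) (k : 'I_2) (j : 'I_3) : lift i k = j :> nat -> lift i k = j by move/val_inj.
rewrite det2E !mxE !sum3 !mxE !sum3 !adjE /cofactor !det2E !mxE.
rewrite (l o0 0 o1) // (l o0 1 o2) // (l o1 0 o0) // (l o1 1 o2) // (l o2 0 o0) // (l o2 1 o1) //=.
ring.
Qed.
End Stereo.

(** * Covariant derivatives along maps *)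

Section Along.
Context {R : realType}.

Lemma J_comp m n p (phi : 'rV[R]_m -> 'rV[R]_n) (F : 'rV[R]_n -> 'rV[R]_p) y :
  (forall i, differentiable (fun z => phi z 0 i) y) ->
  (forall i, differentiable (fun z => F z 0 i) (phi y)) ->
  'J (F \o phi) y = 'J phi y *m 'J F (phi y).
Proof.
move=> dphi dF; apply/matrixP => a k.
have dc i : differentiable (fun z => (F \o phi) z 0 i) y.
  by apply: (@differentiable_comp _ _ _ _ phi (fun z => F z 0 i)) => //; exact: differentiable_rV.
rewrite (jacobianE _ _ dc) [RHS]mxE.
rewrite -[LHS]/(pd a ((fun z => F z 0 k) \o phi) y) pd_comp //; apply: eq_bigr => i _.
by rewrite !jacobianE // mulrC.
Qed.

Lemma drow_comp m n (phi : 'rV[R]_m -> 'rV[R]_n) (f : 'rV[R]_n -> R) y :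
  (forall i, differentiable (fun z => phi z 0 i) y) -> differentiable f (phi y) ->
  drow (f \o phi) y = drow f (phi y) *m ('J phi y)^T.
Proof.
move=> dphi df; apply/rowP => a; rewrite mxE pd_comp // mxE; apply: eq_bigr => i _.
by rewrite [drow _ _ _ _]mxE [_^T _ _]mxE jacobianE.
Qed.

Lemma J_id n (y : 'rV[R]_n) : 'J id y = 1%:M.
Proof.
apply/matrixP => a k; rewrite jacobianE => [|i]; last exact: differentiable_coord.
by rewrite pd_coord mxE eq_sym.
Qed.

Lemma covE n (G : 'rV[R]_n -> 'M[R]_n) m (F V : 'rV[R]_m -> 'rV[R]_n) x a k :
  cov G F V x a k = 'J V x a k
    + \sum_i \sum_j christoffel G k i j (F x) * 'J F x a i * V x 0 j.
Proof. by rewrite mxE. Qed.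

Lemma cov_comp m n p (G : 'rV[R]_p -> 'M[R]_p) (phi : 'rV[R]_m -> 'rV[R]_n)
    (F V : 'rV[R]_n -> 'rV[R]_p) y :
  (forall i, differentiable (fun z => phi z 0 i) y) ->
  (forall i, differentiable (fun z => F z 0 i) (phi y)) ->
  (forall i, differentiable (fun z => V z 0 i) (phi y)) ->
  cov G (F \o phi) (V \o phi) y = 'J phi y *m cov G F V (phi y).
Proof.
move=> dphi dF dV; apply/matrixP => a k; rewrite covE (J_comp dphi dV) (J_comp dphi dF).
move: ('J phi y) ('J F (phi y)) ('J V (phi y)) (@covE p G n F V (phi y)) => P JF JV cE.
rewrite [RHS]mxE [(P *m JV) a k]mxE.
have -> : \sum_i \sum_j christoffel G k i j (F (phi y)) * (P *m JF) a i * V (phi y) 0 j =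
   \sum_l P a l * \sum_i \sum_j christoffel G k i j (F (phi y)) * JF l i * V (phi y) 0 j.
  under [RHS]eq_bigr do rewrite mulr_sumr; rewrite [RHS]exchange_big; apply: eq_bigr => i _.
  under [RHS]eq_bigr do rewrite mulr_sumr; rewrite [RHS]exchange_big; apply: eq_bigr => j _.
  by rewrite mxE mulr_sumr mulr_suml; apply: eq_bigr => l _; rewrite /=; ring.
by rewrite -big_split; apply: eq_bigr => l _; rewrite cE mulrDr.
Qed.

End Along.

Lemma opendom_diff {R : realType} n (U : opendom R n) p q (F : 'rV[R]_n -> 'M[R]_(p, q)) x i j :
  smooth_mx (odset U) F -> U x -> differentiable (fun z => F z i j) x.
Proof. by move=> sF Ux; exact: smooth_diff (od_open U) (sF i j) Ux. Qed.

(** The case of the identity map carries [cov] into the ring of smooth functions. *)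
Lemma cov_id {R : realType} n (U : opendom R n) (G : 'rV[R]_n -> 'M[R]_n)
    (sG : smooth_mx (odset U) G) (GT : forall x, U x -> (G x)^T = G x)
    (Gu : forall x, U x -> G x \in unitmx)
    (V : 'rV[R]_n -> 'rV[R]_n) (sV : smooth_mx (odset U) V) x i k : U x ->
  cov G id V x i k = (dmx (sfder U) i (tomx sV) + tomx sV *m gamA sG Gu i) 0 k x.
Proof.
move=> Ux; rewrite covE J_id mxaddE (sfDE Ux) sf_dmxE (d_tomx _ _ _ _ Ux) (sf_mulmxE Ux).
rewrite jacobianE; last by move=> l; exact: opendom_diff sV Ux.
congr (_ + _); rewrite (bigD1 i) //= [X in _ + X]big1 ?addr0 => [|l li].
  apply: eq_bigr => j _; rewrite (tomxE _ _ _ Ux) (christoffelE sG GT Gu _ _ _ Ux) [_%:M i i]mxE eqxx.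
  by rewrite mulr1 mulrC.
by apply: big1 => j _; rewrite mxE eq_sym (negbTE li) mulr0 mul0r.
Qed.

(** * The boundary sphere *)

Section Boundary.
Context {R : realType}.

(** The matrix with rows the tangents and the normal has a block diagonal Gram
    matrix, so it is invertible, and the left-hand side inverts [G] on its rows. *)
Lemma inverse_frame (G : 'M[R]_3) (S : 'M[R]_(2, 3)) (nu : 'rV[R]_3) :
  G^T = G -> G \in unitmx -> S *m G *m S^T \in unitmx ->
  nu *m G *m S^T = 0 -> nu *m G *m nu^T = 1%:M ->
  S^T *m invmx (S *m G *m S^T) *m S + nu^T *m nu = invmx G.
Proof.
move=> GT Gu su nS nn.
have Sn : S *m G *m nu^T = 0.
  by have := congr1 trmx nS; rewrite !trmx_mul trmxK GT trmx0 mulmxA.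
set E := LHS.
have SE : S *m G *m E = S.
  by rewrite /E mulmxDr !mulmxA Sn mul0mx addr0 mulmxV // mul1mx.
have nE : nu *m G *m E = nu.
  by rewrite /E mulmxDr !mulmxA nS !mul0mx add0r nn mul1mx.
pose M : 'M[R]_(2 + 1, 3) := col_mx S nu.
have ME : M *m (G *m E) = M.
  by rewrite /M mul_col_mx !mulmxA SE nE.
pose M3 : 'M[R]_3 := M.
have Mu : M3 \in unitmx.
  have e : M *m G *m M^T = block_mx (S *m G *m S^T) 0 0 1%:M.
    by rewrite /M tr_col_mx !mul_col_mx mul_mx_row mul_mx_row nS nn Sn -block_mxEv.
  have : \det (M *m G *m M^T) != 0.
    by rewrite e det_ublock det1 mulr1 -unitfE -unitmxE.
  have -> : \det (M *m G *m M^T) = \det M3 * \det G * \det M3^T.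
    by rewrite -[LHS]/(\det (M3 *m G *m M3^T)) !det_mulmx.
  by rewrite -mulrA mulf_eq0 negb_or unitmxE unitfE => /andP[].
have GE : G *m E = 1%:M.
  by rewrite -[LHS](mulKmx Mu) [X in _ *m X](ME) mulVmx.
by rewrite -[LHS]mul1mx -(mulVmx Gu) -mulmxA GE mulmx1.
Qed.

Lemma stereo_posdef (M : 'M[R]_3) c (y : 'rV[R]_2) :
  posdef M -> posdef ('J (stereo c) y *m M *m ('J (stereo c) y)^T).
Proof.
move=> hM; split; first by rewrite !trmx_mul trmxK hM.1 mulmxA.
move=> v v0; set S := 'J _ _.
have -> : v *m (S *m M *m S^T) *m v^T = (v *m S) *m M *m (v *m S)^T.
  by rewrite trmx_mul !mulmxA.
apply: hM.2; apply: contraNneq v0 => e.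
have : v *m (S *m S^T) = 0 by rewrite mulmxA e mul0mx.
rewrite stereoJJ mul_mx_scalar => /eqP; rewrite scaler_eq0 => /orP[|//].
by rewrite gt_eqF // divr_gt0 // exprn_gt0 // sqn1_gt0.
Qed.

Lemma drow_sqn (x : 'rV[R]_3) : drow (@sqn R 3) x = 2 *: x.
Proof. by apply/rowP => i; rewrite mxE pd_sqn mxscaleE. Qed.

Variable V : opendom R 3.
Hypothesis V_sphere : forall x, sphere x -> V x.
Hypothesis V0 : forall x, V x -> x != 0.
Let oV := od_open V.

Section OneMetric.
Variable G : 'rV[R]_3 -> 'M[R]_3.
Hypothesis sG : smooth_mx (odset V) G.
Hypothesis pG : forall x, V x -> posdef (G x).

Lemma gradsq_sqn_gt0 x : V x -> 0 < gradsq G (@sqn R 3) x.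
Proof.
move=> Vx; rewrite /gradsq /ip; apply: (posdef_inv (pG Vx)).2.
by rewrite drow_sqn scaler_eq0 negb_or V0 // pnatr_eq0.
Qed.

Lemma smooth_conormal : smooth_mx (odset V) (conormal G (@sqn R 3)).
Proof.
have sq := smooth_sqn oV; have pgr := gradsq_sqn_gt0.
apply: smooth_scalemx => //.
  apply: smoothV => //; first by move=> x Vx; rewrite gt_eqF // sqrtr_gt0 pgr.
  by apply: smooth_sqrt => //; exact: (smooth_gradsq sG pG sq).
apply: smooth_mulmx => //; first exact: smooth_drow.
by apply: smooth_invmx => // x /pG /posdef_unit.
Qed.

Lemma conormal_unit x : V x -> conormal G (@sqn R 3) x *m G x *m (conormal G (@sqn R 3) x)^T = 1%:M.
Proof.
move=> Vx; have gx := gradsq_sqn_gt0 Vx; have Gu := posdef_unit (pG Vx).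
apply/matrixP => i j; rewrite !ord1 /conormal trZ -!scalemxAl -!scalemxAr !mxscaleE /grad /ginv.
rewrite mulmxKV // trmx_mul trmx_inv (pG Vx).1 mulmxA -/(gradsq G (@sqn R 3) x).
rewrite mulrA -invfM -expr2 sqr_sqrtr ?ltW // -/(ginv G x) -[(_ *m _) 0 0]/(gradsq G (@sqn R 3) x).
by rewrite mulVf ?gt_eqF // mxE eqxx.
Qed.

Lemma conormal_tangent c (y : 'rV[R]_2) :
  conormal G (@sqn R 3) (stereo c y) *m G (stereo c y) *m ('J (stereo c) y)^T = 0.
Proof.
have Vx := V_sphere (stereo_sphere c y); have Gu := posdef_unit (pG Vx).
rewrite /conormal /grad /ginv -!scalemxAl mulmxKV // drow_sqn -scalemxAl.
rewrite -[X in 2 *: X]trmxK trmx_mul trmxK stereoJT trmx0 !scaler0 //.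
Qed.

Lemma nuGT x : V x -> (G x)^T = G x. Proof. by move=> /pG []. Qed.
Lemma nuGu x : V x -> G x \in unitmx. Proof. by move=> /pG /posdef_unit. Qed.

Lemma frame_complete c (y : 'rV[R]_2) : let x := stereo c y in let S := 'J (stereo c) y in
  let nu := conormal G (@sqn R 3) x in
  S^T *m invmx (S *m G x *m S^T) *m S + nu^T *m nu = invmx (G x).
Proof.
move=> x S nu; have Vx := V_sphere (stereo_sphere c y).
apply: inverse_frame.
- exact: nuGT.
- exact: nuGu.
- by apply: posdef_unit; apply: stereo_posdef; exact: pG.
- exact: conormal_tangent.
- exact: conormal_unit.
Qed.

(** The derivative of the unit field is orthogonal to the field, so its trace over
    the tangent frame is its full trace.  The mean curvature becomes an element of
    the ring of smooth functions. *)
Lemma mean_curv_divg c (y : 'rV[R]_2) :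
  mean_curv G (stereo c) (conormal G (@sqn R 3) \o stereo c) y =
  divg (sfder V) (gamA sG nuGu) (tomx smooth_conormal) (stereo c y).
Proof.
set x := stereo c y; have Vx : V x := V_sphere (stereo_sphere c y).
set nu := conormal G (@sqn R 3).
have ds i : differentiable (fun z => stereo c z 0 i) y by exact: stereo_diff.
have dn i : differentiable (fun z => nu z 0 i) x by exact: opendom_diff smooth_conormal Vx.
have di i : differentiable (fun z : 'rV[R]_3 => id z 0 i) x by exact: differentiable_coord.
rewrite /mean_curv /second_form /Defs.induced -[stereo c y]/x.
have -> : cov G (stereo c) (nu \o stereo c) y = 'J (stereo c) y *m cov G id nu x.
  by rewrite -(cov_comp G ds di dn).
set S := 'J (stereo c) y; set D := cov G id nu x.
have Dn : D *m G x *m (nu x)^T = 0.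
  apply/row_matrixP => i; rewrite row0 !row_mul.
  have := unit_derivative_orth i (half2 V) (GA_sym sG nuGT) (gamA_lc sG nuGT nuGu)
    (v := tomx smooth_conormal).
  have -> : row i D = evmx x (dmx (sfder V) i (tomx smooth_conormal)
       + tomx smooth_conormal *m gamA sG nuGu i).
    by apply/rowP => k; rewrite mxE (cov_id sG nuGT nuGu smooth_conormal _ _ Vx) [in RHS]mxE.
  move=> h; have {}h := h _; have nn : tomx smooth_conormal *m GA sG *m (tomx smooth_conormal)^T = 1%:M.
    apply: mxA_eq => z Vz; rewrite (evmxM Vz) (evmxM Vz (tomx smooth_conormal)) evmx_tr (evmx1 Vz).
    by rewrite !ev_tomx // conormal_unit.
  have {}h := congr1 (fun M : 'M[smfun V]_(1, 1) => evmx x M) (h nn).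
  move: h; rewrite (evmxM Vx) (evmxM Vx _ (GA sG)) evmx_tr !ev_tomx // => ->.
  by apply/matrixP => a b; rewrite !mxE; exact: (sf0E Vx).
rewrite -/S -/x mxtrace_mulC.
transitivity (\tr (D *m G x *m (S^T *m invmx (S *m G x *m S^T) *m S))).
  rewrite -!mulmxA mxtrace_mulC -!mulmxA; congr (\tr _).
rewrite (_ : S^T *m _ *m S = invmx (G x) - (nu x)^T *m nu x); last first.
  by rewrite -(frame_complete c y) addrK.
rewrite mulmxBr mulmxK ?nuGu // mulmxA Dn mul0mx subr0.
rewrite /divg (sf_sumE Vx) /mxtrace; apply: eq_bigr => i _.
exact: (cov_id sG nuGT nuGu smooth_conormal i i Vx).
Qed.
End OneMetric.

Section GraphBoundary.
Variables (g K : 'rV[R]_3 -> 'M[R]_3) (f u : 'rV[R]_3 -> R).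
Hypothesis sg : smooth_mx (odset V) g.
Hypothesis pg : forall x, V x -> posdef (g x).
Hypothesis sK : smooth_mx (odset V) K.
Hypothesis KT : forall x, V x -> (K x)^T = K x.
Hypothesis sf : smooth (odset V) f.
Hypothesis su : smooth (odset V) u.
Hypothesis u_gt0 : forall x, V x -> 0 < u x.

Local Notation gh := (graph_metric g f).
Local Notation nu := (conormal g (@sqn R 3)).

(* [jfnu] is the normal derivative of [f], [ja] the slope factor of its restriction
   to the sphere (what remains of [1 + |df|^2] without the normal part), [jc] and
   [js] the hyperbolic cosine and sine of the Jang boost. *)
Definition jfnu x : R := (nu x *m (drow f x)^T) 0 0.
Definition ja x : R := Num.sqrt (1 + gradsq g f x - jfnu x ^+ 2).
Definition jc x : R := Num.sqrt (1 + gradsq g f x) / ja x.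
Definition js x : R := - jfnu x / ja x.

Let sgh := smooth_graph oV sg sf.
Let pgh x : V x -> posdef (gh x). Proof. by move=> /pg /(posdef_graph f). Qed.

Lemma jfnu_sq x : V x -> jfnu x ^+ 2 <= gradsq g f x.
Proof.
move=> Vx; have Gu := nuGu pg Vx.
have := cauchy_schwarz (nu x *m g x) (drow f x) (posdef_inv (pg Vx)).
have -> : ip (invmx (g x)) (nu x *m g x) (drow f x) = jfnu x.
  by rewrite /ip mulmxK.
have -> : ip (invmx (g x)) (nu x *m g x) (nu x *m g x) = 1.
  by rewrite /ip mulmxK // trmx_mul (nuGT pg Vx) mulmxA (conormal_unit pg Vx) mxE eqxx.
by rewrite mul1r.
Qed.

Lemma ja_arg_gt0 x : V x -> 0 < 1 + gradsq g f x - jfnu x ^+ 2.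
Proof. by move=> Vx; rewrite -addrA ltr_pwDl // subr_ge0 jfnu_sq. Qed.

Lemma ja_gt0 x : V x -> 0 < ja x.
Proof. by move=> /ja_arg_gt0 h; rewrite sqrtr_gt0. Qed.

Lemma ja_sq x : V x -> ja x ^+ 2 = 1 + gradsq g f x - jfnu x ^+ 2.
Proof. by move=> /ja_arg_gt0 /ltW h; rewrite sqr_sqrtr. Qed.

Lemma W_gt0 x : V x -> 0 < 1 + gradsq g f x.
Proof. by move=> Vx; rewrite ltr_pwDl // (gradsq_ge0 _ pg Vx). Qed.

Lemma jcs x : V x -> jc x * jc x - js x * js x = 1.
Proof.
move=> Vx; have a0 := ja_gt0 Vx; rewrite /jc /js.
have e : Num.sqrt (1 + gradsq g f x) ^+ 2 = ja x ^+ 2 + jfnu x ^+ 2.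
  by rewrite ja_sq // subrK sqr_sqrtr // ltW // W_gt0.
transitivity ((Num.sqrt (1 + gradsq g f x) ^+ 2 - jfnu x ^+ 2) / ja x ^+ 2); first by field; rewrite gt_eqF.
by rewrite e addrK mulfV // expf_neq0 // gt_eqF.
Qed.

Lemma smooth_jfnu : smooth (odset V) jfnu.
Proof.
have h := smooth_mulmx oV (smooth_conormal sg pg) (smooth_trmx oV (smooth_drow oV sf)).
exact: h 0 0.
Qed.

Lemma smooth_ja : smooth (odset V) ja.
Proof.
apply: smooth_sqrt => //; first exact: ja_arg_gt0.
apply: smoothD => //; first apply: smoothD => //.
- exact: smooth_cst.
- exact: smooth_gradsq sg pg sf.
- apply: smoothN => //.
  apply: (smooth_eq oV _ (smoothM oV smooth_jfnu smooth_jfnu)) => x _.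
  by rewrite expr2.
Qed.

Lemma smooth_jaV : smooth (odset V) (fun x => (ja x)^-1).
Proof. by apply: smoothV smooth_ja => // x /ja_gt0 h; rewrite gt_eqF. Qed.

Lemma smooth_jc : smooth (odset V) jc.
Proof.
apply: smoothM smooth_jaV => //; apply: smooth_sqrt => //; first exact: W_gt0.
by apply: smoothD => //; [exact: smooth_cst|exact: smooth_gradsq sg pg sf].
Qed.

Lemma smooth_js : smooth (odset V) js.
Proof. by apply: smoothM smooth_jaV => //; apply: smoothN => //; exact: smooth_jfnu. Qed.

(** The inverse graph metric is the inverse of [g] minus the square of [jw]; applied
    to the differential of the square distance it gives a combination of [nu] and
    [jw], which is then normalised. *)
Lemma conormal_graph x : V x ->
  conormal gh (@sqn R 3) x = jc x *: nu x + js x *: jw g f x.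
Proof.
move=> Vx; have Gu := nuGu pg Vx; have GT := nuGT pg Vx.
have q0 := gradsq_sqn_gt0 pg Vx; have a0 := ja_gt0 Vx; have W0 := W_gt0 Vx.
set l := drow (@sqn R 3) x; set q := gradsq g (@sqn R 3) x in q0.
have nuE : nu x = (Num.sqrt q)^-1 *: (l *m ginv g x) by [].
have sq0 : Num.sqrt q != 0 by rewrite gt_eqF // sqrtr_gt0.
have lQ : l *m ginv g x = Num.sqrt q *: nu x by rewrite nuE scalerA mulfV // scale1r.
have wl : (jw g f x *m l^T) 0 0 = jslope g f x * (Num.sqrt q * jfnu x).
  rewrite /jw -scalemxAl mxscaleE /grad; congr (_ * _).
  have -> : drow f x *m ginv g x *m l^T = (l *m ginv g x *m (drow f x)^T)^T.
    by rewrite !trmx_mul !trmxK (ginv_sym (nuGT pg) Vx) mulmxA.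
  by rewrite tr11 lQ -scalemxAl mxscaleE.
have lP : l *m jP g f x = Num.sqrt q *: nu x - (jslope g f x * (Num.sqrt q * jfnu x)) *: jw g f x.
  rewrite /jP mulmxBr lQ mulmxA; congr (_ - _).
  rewrite -wl scale11l; congr (_ *m _).
  by rewrite -[RHS]tr11 trmx_mul trmxK.
have r0 : 0 < Num.sqrt (1 + gradsq g f x) by rewrite sqrtr_gt0.
have rE : jslope g f x = (Num.sqrt (1 + gradsq g f x))^-1 by [].
have nul : (nu x *m l^T) 0 0 = Num.sqrt q.
  rewrite nuE -scalemxAl mxscaleE -[(l *m _ *m _) 0 0]/q -{2}(sqr_sqrtr (ltW q0)).
  by rewrite expr2 mulrA mulVf // mul1r.
have lPl : gradsq gh (@sqn R 3) x = (Num.sqrt q * jslope g f x * ja x) ^+ 2.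
  rewrite /gradsq /ip (ginv_graph sg pg sf Vx) -/l lP.
  move: (nu x) (jw g f x) nul wl => N w' nul wl; rewrite mulmxBl -!scalemxAl mxaddE mxoppE !mxscaleE nul wl.
  rewrite !exprMn ja_sq // rE; move: r0 (sqr_sqrtr (ltW W0)).
  move: (Num.sqrt (1 + gradsq g f x)) => s s0 <-.
  by field; rewrite gt_eqF.
rewrite {1}/conormal lPl /grad (ginv_graph sg pg sf Vx) -/l lP.
rewrite sqrtr_sqr ger0_norm; last by rewrite !mulr_ge0 ?sqrtr_ge0 // ?rE ?invr_ge0 ?ltW.
rewrite scalerBr !scalerA -scaleNr; congr (_ *: _ + _ *: _); rewrite /jc /js rE; field;
  by rewrite ?sq0 !gt_eqF.
Qed.

Local Notation gs := (fun x => u x ^+ 4 *: gh x).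

Lemma smooth_gs : smooth_mx (odset V) gs.
Proof.
apply: smooth_scalemx => //.
have s2 := smoothM oV su su; apply: (smooth_eq oV _ (smoothM oV s2 s2)) => x _.
by rewrite -!expr2 -exprM.
Qed.

Lemma posdef_gs x : V x -> posdef (gs x).
Proof.
move=> Vx; have [h1 h2] := pgh Vx; split; first by rewrite trZ h1.
move=> v v0; rewrite -scalemxAr -scalemxAl mxscaleE mulr_gt0 ?h2 // exprn_gt0 //.
exact: u_gt0.
Qed.

Lemma conormal_conf x : V x ->
  conormal gs (@sqn R 3) x = (u x)^-1 ^+ 2 *: conormal gh (@sqn R 3) x.
Proof.
move=> Vx; have u0 := u_gt0 Vx; have ghu := nuGu pgh Vx.
have ginvE : ginv gs x = (u x)^-1 ^+ 4 *: ginv gh x.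
  by rewrite /ginv invmxZ ?exprVn // unitmxZ // unitfE expf_neq0 // gt_eqF.
rewrite /conormal /gradsq /ip /grad ginvE -!scalemxAr -scalemxAl mxscaleE.
rewrite sqrtrM ?exprn_ge0 ?invr_ge0 ?ltW // (_ : (u x)^-1 ^+ 4 = ((u x)^-1 ^+ 2) ^+ 2); last by rewrite -exprM.
rewrite sqrtr_sqr ger0_norm ?sqr_ge0 // scalerA scalerA; congr (_ *: _).
have q0 := gradsq_sqn_gt0 pgh Vx; rewrite -/(ginv gh x) -[(_ *m _) 0 0]/(gradsq gh (@sqn R 3) x).
by field; rewrite !gt_eqF // sqrtr_gt0.
Qed.

Section AtPoint.
Variables (c : bool) (y : 'rV[R]_2).
Let p := stereo c y.
Let S := 'J (stereo c) y.
Let Vp : V p := V_sphere (stereo_sphere c y).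
Hypothesis up1 : u p = 1.

(** The conormal of [gs] is [u ^- 2] times the one of the graph metric.  Its
    divergence gains [6] times the derivative of [u] from the volume and loses [2]
    from the factor. *)
Lemma mean_curv_conf :
  mean_curv gs (stereo c) (conormal gs (@sqn R 3) \o stereo c) y =
  mean_curv gh (stereo c) (conormal gh (@sqn R 3) \o stereo c) y
  + 4 * (drow u p *m (conormal gh (@sqn R 3) p)^T) 0 0.
Proof.
rewrite (mean_curv_divg smooth_gs posdef_gs) (mean_curv_divg sgh pgh) -/p.
rewrite (divg_conformal sgh pgh su u_gt0 smooth_gs (nuGu posdef_gs) (nuGu pgh) _ Vp).
rewrite up1 invr1 mul1r.
pose nA : 'rV[smfun V]_3 := tomx (smooth_conormal sgh pgh).
have un0 x : V x -> u x != 0 by move=> /u_gt0 h; rewrite gt_eqF.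
pose vA : smfun V := tosf (smoothV oV un0 su).
have -> : tomx (smooth_conormal smooth_gs posdef_gs) = (vA * vA) *: nA.
  apply: mxA_eq => x Vx; rewrite (evmxZ Vx) (sfME Vx) !ev_tomx // conormal_conf // /vA tosfE //.
have dv i : sfder V i vA p = - pd i u p.
  have e : sfder V i (vA * tosf su) p = 0.
    have -> : vA * tosf su = 1.
      by apply: sf_eq => x Vx; rewrite (sfME Vx) (sf1E Vx) !tosfE // mulVf // un0.
    by rewrite dd1; exact: (sf0E Vp).
  move: e; rewrite ddM (sfDE Vp) !(sfME Vp) (sfder_tosf _ _ Vp) /vA !tosfE // up1 invr1 mulr1 mul1r.
  by move=> /eqP; rewrite addr_eq0 => /eqP.
have vp : vA p = 1 by rewrite /vA tosfE // up1 invr1.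
have nAp i : nA 0 i p = conormal gh (@sqn R 3) p 0 i by rewrite tomxE.
rewrite divgZ (sfDE Vp) (sf_sumE Vp) !(sfME Vp) vp !mul1r.
have -> : \sum_i (nA 0 i * sfder V i (vA * vA)) p =
    - (2 * \sum_i pd i u p * conormal gh (@sqn R 3) p 0 i).
  rewrite mulr_sumr -sumrN; apply: eq_bigr => i _.
  by rewrite (sfME Vp) ddM (sfDE Vp) !(sfME Vp) dv vp nAp; ring.
have -> : \sum_i pd i u p * ((vA * vA) *: nA) 0 i p =
    \sum_i pd i u p * conormal gh (@sqn R 3) p 0 i.
  by apply: eq_bigr => i _; rewrite mxscaleE !(sfME Vp) vp nAp !mul1r.
have -> : (drow u p *m (conormal gh (@sqn R 3) p)^T) 0 0 =
    \sum_i pd i u p * conormal gh (@sqn R 3) p 0 i.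
  by rewrite mxE; apply: eq_bigr => i _; rewrite [drow _ _ _ _]mxE [_^T _ _]mxE.
by ring.
Qed.

Hypothesis jang : jang_lhs g K f p = 0.

(** The identity [boundary_density] at a point of the sphere.  Jang's equation
    replaces the trace of the second form of the graph by a trace of [K], which with
    the two other terms in [K] is the trace of [K] over the tangent plane of the
    sphere. *)
Lemma graph_mean_curv :
  mean_curv gh (stereo c) (conormal gh (@sqn R 3) \o stereo c) y
  - (jY g K f p *m (conormal gh (@sqn R 3) p)^T) 0 0 =
  jc p * mean_curv g (stereo c) (nu \o stereo c) y
  + js p * \tr (invmx (S *m g p *m S^T) *m (S *m K p *m S^T))
  + \sum_i (js p *: nu p + jc p *: jw g f p) 0 i * (jc p * pd i js p - js p * pd i jc p)
  + ((js p *: nu p + jc p *: jw g f p) *m K p *m (nu p)^T) 0 0.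
Proof.
rewrite (mean_curv_divg sgh pgh) (mean_curv_divg sg pg) -/p.
set nA := tomx (smooth_conormal sg pg).
pose cA : smfun V := tosf smooth_jc; pose sA : smfun V := tosf smooth_js.
have cs : cA * cA - sA * sA = 1.
  by apply: sf_eq => x Vx; rewrite (sfDE Vx) (sfNE Vx) !(sfME Vx) (sf1E Vx) !tosfE // jcs.
pose wV := wA sg pg sf; pose hV := hA sg pg sf; pose KV := KA sK.
have nhE : tomx (smooth_conormal sgh pgh) = cA *: nA + sA *: wV.
  apply: mxA_eq => x Vx; rewrite (evmxD Vx) (evmxZ Vx cA) (evmxZ Vx sA wV) !ev_tomx // /wV ev_wA // /cA /sA !tosfE //.
  exact: conormal_graph.
have BD := boundary_density (half2 V) (QA_sym sg (jgT pg) (jgu pg)) (GA_QA sg (jgu pg))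
  (QA_GA sg (jgu pg)) (gamA_lc sg (jgT pg) (jgu pg)) (dA_closed sf) (rWA sg pg sf)
  (erefl : wV = _) (fun i => erefl) (fun i => erefl) (erefl : PA sg pg sf = _) (erefl : hV = _)
  (erefl : TA sg pg sf = _) (KTA sK KT) nA cs.
have {}BD := congr1 (fun a : smfun V => a p) BD.
have gE : gamA sgh (nuGu pgh) = ggA sg pg sf.
  by rewrite -graph_gamAE; congr (gamA _ _); exact: Prop_irrelevance.
rewrite nhE gE (Prop_irrelevance (nuGu pg) (jgu pg)).
move: BD; rewrite -/(ggA sg pg sf) -/wV -/hV -/KV => BD.
have ev3 (a b : smfun V) : (a - b) p = a p - b p by exact: sfBE.
have ev6 (a b e r t q : smfun V) : (cA * a + sA * (b + e - r) + t + q) p =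
    jc p * a p + js p * (b p + e p - r p) + t p + q p.
  by rewrite !(sfDE Vp) !(sfME Vp) !(sfDE Vp) !(sfNE Vp) /cA /sA !tosfE.
move: BD; rewrite ev3 ev6.
have nAp : evmx p nA = nu p by rewrite ev_tomx.
have wVp : evmx p wV = jw g f p by rewrite ev_wA.
have KVp : evmx p KV = K p by rewrite ev_KA.
have hVp : evmx p hV = jh g f p by rewrite ev_hA.
have -> : (wV *m (hV - KV) *m (cA *: nA + sA *: wV)^T) 0 0 p =
    (jY g K f p *m (conormal gh (@sqn R 3) p)^T) 0 0.
  rewrite evmxE (evmxM Vp _ (_ + _)^T) (evmxM Vp wV) (evmxB Vp hV) evmx_tr -nhE ev_tomx //.
  by rewrite wVp hVp KVp.
move=> ->; congr (_ + _ * _ + _ + _).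
- rewrite [(wV *m KV *m wV^T) 0 0 p]evmxE (evmxM Vp _ wV^T) (evmxM Vp wV) evmx_tr wVp KVp.
  rewrite [(nA *m KV *m nA^T) 0 0 p]evmxE (evmxM Vp _ nA^T) (evmxM Vp nA) evmx_tr nAp KVp.
  rewrite (evmxtr Vp) (evmxM Vp hV (PA sg pg sf)) ev_PA // hVp.
  have := jang; rewrite (jang_lhsE sg pg KT sf Vp) mulmxBr raddfB => /eqP.
  rewrite subr_eq0 mxtrace_mulC => /eqP ->.
  have tr1 (M : 'M[R]_3) (v : 'rV[R]_3) : (v *m M *m v^T) 0 0 = \tr ((v^T *m v) *m M).
    by rewrite -[in RHS]mulmxA [RHS]mxtrace_mulC trace_mx11.
  have trK (A B C M : 'M[R]_3) : \tr (A *m M) + \tr (B *m M) - \tr (C *m M) = \tr ((A + B - C) *m M).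
    by rewrite mulmxBl mulmxDl raddfB raddfD.
  rewrite !tr1 trK /jP subrK.
  rewrite /ginv -(frame_complete pg c y) -/S -/p addrK.
  by rewrite -!mulmxA [LHS]mxtrace_mulC -!mulmxA.
- rewrite (sf_sumE Vp); apply: eq_bigr => i _; rewrite (sfME Vp) ev3 !(sfME Vp) !(sfder_tosf _ _ Vp).
  rewrite !tosfE //; congr (_ * _).
  by rewrite evmxE (evmxD Vp) (evmxZ Vp sA nA) (evmxZ Vp cA wV) nAp wVp /cA /sA !tosfE.
- rewrite evmxE (evmxM Vp _ nA^T) (evmxM Vp _ KV) (evmxD Vp) (evmxZ Vp sA nA) (evmxZ Vp cA wV) evmx_tr nAp wVp KVp.
  by rewrite /cA /sA !tosfE.
Qed.

(** The Euclidean normal of the unit sphere is its position vector; its covector,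
    multiplied by the Euclidean area element and the volume density, is the unit
    conormal multiplied by the area element of the graph ([det_surface]). *)
Lemma boundary_flux :
  (volflux g K f u p *m p^T) 0 0 * (4 / (sqn y + 1) ^+ 2) =
  ((jY g K f p + 4 *: drow u p) *m (conormal gh (@sqn R 3) p)^T) 0 0
  * Num.sqrt (\det (S *m gh p *m S^T)).
Proof.
have ghu := nuGu pgh Vp; have det0 := posdef_det3 (pgh Vp).
have PT : (jP g f p)^T = jP g f p.
  by rewrite -(ginv_graph sg pg sf Vp); exact: (ginv_sym (nuGT pgh) Vp).
set J := 4 / _; have J0 : 0 < J by rewrite divr_gt0 // exprn_gt0 // sqn1_gt0.
have q0 := gradsq_sqn_gt0 pgh Vp.
set n2 := (p *m jP g f p *m p^T) 0 0.
have qE : gradsq gh (@sqn R 3) p = 2 ^+ 2 * n2.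
  rewrite /gradsq /ip drow_sqn (ginv_graph sg pg sf Vp) trZ -!scalemxAl -scalemxAr.
  by rewrite !mxscaleE mulrA -expr2.
have n20 : 0 < n2 by move: q0; rewrite qE pmulr_rgt0 // exprn_gt0.
have -> : \det (S *m gh p *m S^T) = \det (gh p) * (J ^+ 2 * n2).
  rewrite det_surface // stereo_cross -/p -/J trZ -!scalemxAl -scalemxAr !mxscaleE.
  rewrite -/(ginv gh p) (ginv_graph sg pg sf Vp) -/n2 !mulrA; congr (_ * _ * _).
  by rewrite -!mulrA; congr (_ * _); case: (c); ring.
rewrite sqrtrM ?ltW // sqrtrM ?sqr_ge0 // sqrtr_sqr gtr0_norm //.
rewrite /conormal qE sqrtrM ?sqr_ge0 // sqrtr_sqr ger0_norm //.
rewrite /grad (ginv_graph sg pg sf Vp) drow_sqn.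
rewrite !trZ trmx_mul PT -!scalemxAr trZ -!scalemxAr !mxscaleE.
rewrite /volflux /flux up1 expr1n mulr1 scale1r; clearbody n2.
move: (jY g K f p) (drow u p) (jP g f p) => Y du P.
rewrite -!scalemxAl mxscaleE !mulmxDl !mulmxA -!scalemxAl.
rewrite !mxaddE !mxscaleE.
move: (Num.sqrt (\det _)) (_ 0 0) (_ 0 0) => d a b.
by field; rewrite gt_eqF // sqrtr_gt0.
Qed.

Lemma det_graph_surface (A : 'M[R]_2) (t : 'rV[R]_2) : posdef A ->
  \det (A + t^T *m t) = \det A * (1 + ip (invmx A) t t).
Proof.
move=> pA; have Au := posdef_unit pA; have d0 := gt_eqF (posdef_det2 pA).
rewrite /ip /invmx Au -scalemxAr -scalemxAl mxscaleE mulrDr mulr1 mulrA mulfV ?d0 // mul1r.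
have l (i : 'I_2) (k : 'I_1) (j : 'I_2) : lift i k = j :> nat -> lift i k = j by move/val_inj.
have adjE (i j : 'I_2) : (\adj A) i j = cofactor A j i by rewrite mxE.
rewrite !det2E !mxE !big_ord1 !sum2 !mxE !sum2 !adjE /cofactor !det_mx11 !mxE.
rewrite (l 0 0 1) // (l 1 0 0) //= (posdef_sym 1 0 pA); ring.
Qed.
End AtPoint.
End GraphBoundary.

End Boundary.

(** * Fields along maps into a pseudo-Riemannian space *)

Section MatrixDerivative.
Context {R : realType}.

Definition pdmx n p q (a : 'I_n) (M : 'rV[R]_n -> 'M[R]_(p, q)) x : 'M[R]_(p, q) :=
  \matrix_(i, j) pd a (fun y => M y i j) x.

Lemma pdmxM n (U : set 'rV[R]_n) p q r a (M : 'rV[R]_n -> 'M[R]_(p, q))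
    (N : 'rV[R]_n -> 'M[R]_(q, r)) x : open U -> smooth_mx U M -> smooth_mx U N -> U x ->
  pdmx a (fun y => M y *m N y) x = pdmx a M x *m N x + M x *m pdmx a N x.
Proof.
move=> oU sM sN Ux; apply/matrixP => i j; rewrite [LHS]mxE mxaddE.
have -> : pd a (fun y => (M y *m N y) i j) x = pd a (fun y => \sum_k M y i k * N y k j) x.
  by congr (pd a _ x); apply/funext => y; rewrite mxE.
rewrite (@pd_sum _ _ U _ _ (fun k y => M y i k * N y k j) _ _ oU) //; last first.
  by move=> k; exact: smoothM oU (sM _ _) (sN _ _).
rewrite !mxE -big_split; apply: eq_bigr => k _ /=.
by rewrite (pdM a (sM i k) (sN k j) Ux) !mxE.
Qed.

Lemma pdmx_tr n p q a (M : 'rV[R]_n -> 'M[R]_(p, q)) x :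
  pdmx a (fun y => (M y)^T) x = (pdmx a M x)^T.
Proof.
by apply/matrixP => i j; rewrite !mxE; congr (pd a _ x); apply/funext => y; rewrite mxE.
Qed.

Lemma pdmx_cst n p q a (C : 'M[R]_(p, q)) (x : 'rV[R]_n) : pdmx a (fun=> C) x = 0.
Proof. by apply/matrixP => i j; rewrite !mxE pd_cst. Qed.

Lemma pdmxZ n (U : set 'rV[R]_n) p q a (c : 'rV[R]_n -> R) (M : 'rV[R]_n -> 'M[R]_(p, q)) x :
  smooth U c -> smooth_mx U M -> U x ->
  pdmx a (fun y => c y *: M y) x = pd a c x *: M x + c x *: pdmx a M x.
Proof.
move=> sc sM Ux; apply/matrixP => i j; rewrite mxaddE !mxscaleE !mxE.
rewrite -(pdM a sc (sM i j) Ux); congr (pd a _ x); apply/funext => y.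
by rewrite mxscaleE.
Qed.

Lemma pdmxD n (U : set 'rV[R]_n) p q a (M N : 'rV[R]_n -> 'M[R]_(p, q)) x :
  smooth_mx U M -> smooth_mx U N -> U x ->
  pdmx a (fun y => M y + N y) x = pdmx a M x + pdmx a N x.
Proof.
move=> sM sN Ux; apply/matrixP => i j; rewrite mxaddE !mxE.
rewrite -(pdD a (sM i j) (sN i j) Ux); congr (pd a _ x); apply/funext => y.
by rewrite mxaddE.
Qed.

Lemma row_J m n (U : set 'rV[R]_m) (F : 'rV[R]_m -> 'rV[R]_n) a x :
  open U -> smooth_mx U F -> U x -> row a ('J F x) = pdmx a F x.
Proof.
move=> oU sF Ux; apply/rowP => k; rewrite mxE jacobianE; last first.
  by move=> i; exact: smooth_diff oU (sF 0 i) Ux.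
by rewrite mxE.
Qed.

Lemma JE m n (U : set 'rV[R]_m) (F : 'rV[R]_m -> 'rV[R]_n) a k x :
  open U -> smooth_mx U F -> U x -> 'J F x a k = pd a (fun y => F y 0 k) x.
Proof. by move=> oU sF Ux; rewrite jacobianE // => i; exact: smooth_diff oU (sF 0 i) Ux. Qed.

Lemma smooth_J m n (U : set 'rV[R]_m) (F : 'rV[R]_m -> 'rV[R]_n) :
  open U -> smooth_mx U F -> smooth_mx U (jacobian F).
Proof.
move=> oU sF a k; apply: (smooth_eq oU _ (smooth_pd a (sF 0 k))) => x Ux.
by rewrite (JE a k oU sF Ux).
Qed.

Lemma J_eq m n (U : set 'rV[R]_m) (F F' : 'rV[R]_m -> 'rV[R]_n) x :
  open U -> smooth_mx U F -> U x -> (forall y, U y -> F y = F' y) -> 'J F x = 'J F' x.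
Proof.
move=> oU sF Ux h.
have sF' : smooth_mx U F' by apply: smooth_mx_eq h sF.
apply/matrixP => a k; rewrite [LHS](JE a k oU sF Ux) [RHS](JE a k oU sF' Ux).
by apply: (pd_eq a oU Ux) => y Uy; rewrite h.
Qed.

Lemma pdmx_comp m n p q (U : set 'rV[R]_m) (U' : set 'rV[R]_n) (F : 'rV[R]_m -> 'rV[R]_n)
    (M : 'rV[R]_n -> 'M[R]_(p, q)) a x :
  open U -> open U' -> (forall y, U y -> U' (F y)) -> smooth_mx U F -> smooth_mx U' M -> U x ->
  pdmx a (M \o F) x = \sum_i 'J F x a i *: pdmx i M (F x).
Proof.
move=> oU oU' FU sF sM Ux; apply/matrixP => k l; rewrite mxE summxE.
rewrite -[LHS]/(pd a ((fun z => M z k l) \o F) x).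
rewrite (pd_smooth_comp a oU oU' FU (sF 0) (sM k l) Ux); apply: eq_bigr => i _.
by rewrite mxscaleE (JE a i oU sF Ux) mxE mulrC.
Qed.

Lemma smooth_mx_comp m n p q (U : set 'rV[R]_m) (U' : set 'rV[R]_n) (F : 'rV[R]_m -> 'rV[R]_n)
    (M : 'rV[R]_n -> 'M[R]_(p, q)) :
  open U -> open U' -> (forall y, U y -> U' (F y)) -> smooth_mx U F -> smooth_mx U' M ->
  smooth_mx U (M \o F).
Proof. by move=> oU oU' FU sF sM i j; exact: (smooth_comp oU oU' FU (sF 0) (sM i j)). Qed.

End MatrixDerivative.

Section Connection.
Context {R : realType}.

Definition chm n (G : 'rV[R]_n -> 'M[R]_n) i (q : 'rV[R]_n) : 'M[R]_n :=
  \matrix_(j, k) christoffel G k i j q.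

Lemma cov_row m n (U : set 'rV[R]_m) (G : 'rV[R]_n -> 'M[R]_n) (F V : 'rV[R]_m -> 'rV[R]_n) a x :
  open U -> smooth_mx U V -> U x ->
  row a (cov G F V x) = pdmx a V x + \sum_i 'J F x a i *: (V x *m chm G i (F x)).
Proof.
move=> oU sV Ux; rewrite -(row_J a oU sV Ux).
apply/rowP => k; rewrite mxE covE mxaddE summxE; congr (_ + _).
  by rewrite [RHS]mxE.
apply: eq_bigr => i _; rewrite mxscaleE [(_ *m _) _ _]mxE mulr_sumr; apply: eq_bigr => j _.
by rewrite [chm _ _ _ _ _]mxE; ring.
Qed.

Variables (n : nat) (U : opendom R n) (G : 'rV[R]_n -> 'M[R]_n).
Hypothesis sG : smooth_mx (odset U) G.
Hypothesis GT : forall x, U x -> (G x)^T = G x.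
Hypothesis Gu : forall x, U x -> G x \in unitmx.

Lemma chm_sym i j k x : U x -> christoffel G k i j x = christoffel G k j i x.
Proof.
by move=> Ux; rewrite !(christoffelE sG GT Gu _ _ _ Ux) ((gamA_lc sG GT Gu).1 i j k).
Qed.

Lemma chm_compat i x : U x -> pdmx i G x = chm G i x *m G x + G x *m (chm G i x)^T.
Proof.
move=> Ux; have := congr1 (fun M : 'M[smfun U]_n => evmx x M) ((gamA_lc sG GT Gu).2 i).
have chE : evmx x (gamA sG Gu i) = chm G i x.
  by apply/matrixP => j k; rewrite [LHS]mxE [RHS]mxE (christoffelE sG GT Gu _ _ _ Ux).
rewrite (evmxD Ux) (evmxM Ux (gamA sG Gu i)) (evmxM Ux (GA sG)) evmx_tr chE ev_tomx // => <-.
by apply/matrixP => j k; rewrite [RHS]mxE sf_dmxE (d_tomx sG _ _ _ Ux) mxE.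
Qed.

(** The chain rule differentiates the metric at the moving point, and the
    Christoffel symbols are compatible with the metric there. *)
Lemma cov_compat m (W : set 'rV[R]_m) (F V V' : 'rV[R]_m -> 'rV[R]_n) a x :
  open W -> (forall y, W y -> U (F y)) -> smooth_mx W F -> smooth_mx W V -> smooth_mx W V' -> W x ->
  pd a (fun y => ip (G (F y)) (V y) (V' y)) x =
  ip (G (F x)) (row a (cov G F V x)) (V' x) + ip (G (F x)) (V x) (row a (cov G F V' x)).
Proof.
move=> oW FU sF sV sV' Wx; have oU := od_open U.
have sGF : smooth_mx W (G \o F) := smooth_mx_comp oW oU FU sF sG.
rewrite !(cov_row G F a oW) // /ip.
transitivity (pdmx a (fun y => V y *m (G \o F) y *m (V' y)^T) x 0 0); first by rewrite mxE.
rewrite (pdmxM a oW (smooth_mulmx oW sV sGF) (smooth_trmx oW sV') Wx).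
rewrite (pdmxM a oW sV sGF Wx) pdmx_tr (pdmx_comp a oW oU FU sF sG Wx) /=.
have -> : \sum_i 'J F x a i *: pdmx i G (F x) =
   (\sum_i 'J F x a i *: chm G i (F x)) *m G (F x)
   + G (F x) *m (\sum_i 'J F x a i *: chm G i (F x))^T.
  rewrite raddf_sum mulmx_suml mulmx_sumr -big_split; apply: eq_bigr => i _ /=.
  by rewrite (chm_compat i (FU _ Wx)) trZ scalerDr -scalemxAl -scalemxAr.
have E (v : 'rV[R]_n) : \sum_i 'J F x a i *: (v *m chm G i (F x)) =
    v *m \sum_i 'J F x a i *: chm G i (F x).
  by rewrite mulmx_sumr; apply: eq_bigr => i _; rewrite -scalemxAr.
rewrite !E; move: (\sum_i _) (pdmx a V x) (pdmx a V' x) (G (F x)) (V x) (V' x) => N dV dV' g v v'.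
rewrite trD trmx_mul !(mulmxDl, mulmxDr) !mulmxA !mxaddE; ring.
Qed.
End Connection.

(** The difference is symmetric in its first two and antisymmetric in its last two
    indices, hence zero. *)
Lemma koszul_unique (R : realType) n (B L : 'I_n -> 'I_n -> 'I_n -> R) (dG : 'I_n -> 'I_n -> 'I_n -> R) :
  (forall b k c, B b k c = B k b c) -> (forall b k c, L b k c = L k b c) ->
  (forall b k c, dG b k c = B b k c + B b c k) -> (forall b k c, dG b k c = L b k c + L b c k) ->
  forall b k c, B b k c = L b k c.
Proof.
move=> Bs Ls dB dL b k c; have e i j l : B i j l - L i j l = - (B i l j - L i l j).
  have := dB i j l; rewrite dL => h; apply/eqP; rewrite -subr_eq0; apply/eqP.
  transitivity ((B i j l + B i l j) - (L i j l + L i l j)); first by ring.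
  by rewrite h subrr.
have s i j l : B i j l - L i j l = B j i l - L j i l by rewrite Bs Ls.
have : B b k c - L b k c = - (B b k c - L b k c).
  by rewrite {1}e {1}s {1}e {1}s {1}e opprK {1}s.
move=> h; apply/eqP; rewrite -subr_eq0.
have : 2 * (B b k c - L b k c) = 0 by rewrite mulr_natl mulr2n {2}h subrr.
by move=> /eqP; rewrite mulf_eq0 pnatr_eq0.
Qed.

Section Frames.
Context {R : realType} (m n : nat) (U : opendom R n) (W : set 'rV[R]_m).
Variables (G : 'rV[R]_n -> 'M[R]_n) (F : 'rV[R]_m -> 'rV[R]_n).
Hypothesis sG : smooth_mx (odset U) G.
Hypothesis GT : forall x, U x -> (G x)^T = G x.
Hypothesis Gu : forall x, U x -> G x \in unitmx.
Hypothesis oW : open W.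
Hypothesis FU : forall x, W x -> U (F x).
Hypothesis sF : smooth_mx W F.

Definition frame k y : 'rV[R]_n := row k ('J F y).
Local Notation E := frame.

Lemma smooth_frame k : smooth_mx W (E k).
Proof.
move=> i j; apply: (smooth_eq oW _ (smooth_J oW sF k j)) => x _.
by rewrite [RHS]mxE.
Qed.

Lemma ip_row (A : 'M[R]_n) (v : 'rV[R]_n) (M : 'M[R]_(m, n)) b :
  ip A v (row b M) = (v *m A *m M^T) 0 b.
Proof. by rewrite /ip ![(_ *m _) _ _]mxE; apply: eq_bigr => j _; rewrite ![_^T _ _]mxE [row _ _ _ _]mxE. Qed.

Lemma frame_torsion_free b k x : W x -> row b (cov G F (E k) x) = row k (cov G F (E b) x).
Proof.
move=> Wx; apply/rowP => l; rewrite ![row _ _ _ _]mxE !covE; congr (_ + _).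
  rewrite [LHS](JE b l oW (smooth_frame k) Wx) [RHS](JE k l oW (smooth_frame b) Wx).
  have h i j : pd i (fun y => E j y 0 l) x = pd i (pd j (fun z => F z 0 l)) x.
    by apply: (pd_eq i oW Wx) => y Wy; rewrite [LHS]mxE (JE j l oW sF Wy).
  by rewrite !h (smooth_pd_comm b k oW (sF 0 l) Wx).
rewrite exchange_big; apply: eq_bigr => i _; apply: eq_bigr => j _.
by rewrite (chm_sym sG GT Gu _ _ _ (FU Wx)) /frame ![row _ _ _ _]mxE; ring.
Qed.

Section Field.
Variable V : 'rV[R]_m -> 'rV[R]_n.
Hypothesis sV : smooth_mx W V.
Hypothesis VN : forall y, W y -> V y *m G (F y) *m ('J F y)^T = 0.

(** Along a normal field, derivatives of tangent fields turn into derivatives of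
    the field itself. *)
Lemma second_form_normal a b x : W x ->
  second_form G F V x a b = - ip (G (F x)) (V x) (row a (cov G F (E b) x)).
Proof.
move=> Wx; have := cov_compat sG GT Gu a oW FU sF sV (smooth_frame b) Wx.
have -> : pd a (fun y => ip (G (F y)) (V y) (E b y)) x = 0.
  rewrite -(pd_cst 0 x a); apply: (pd_eq a oW Wx) => y Wy.
  by rewrite ip_row VN // mxE.
move=> /eqP; rewrite eq_sym addr_eq0 => /eqP <-.
by rewrite ip_row -!row_mul [RHS]mxE.
Qed.

Lemma second_form_sym x : W x -> (second_form G F V x)^T = second_form G F V x.
Proof.
move=> Wx; apply/matrixP => a b; rewrite mxE !second_form_normal //.
by rewrite frame_torsion_free.
Qed.

(** Only the normal part of the second derivative of [F] enters the mean curvature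
    vector, and against a normal field it is minus the second form. *)
Lemma mean_curv_vec_normal x : W x ->
  ip (G (F x)) (mean_curv_vec G F x) (V x) = - mean_curv G F V x.
Proof.
move=> Wx; rewrite /mean_curv_vec /mean_curv.
have ip_sum (I : finType) (f : I -> 'rV[R]_n) w A : ip A (\sum_i f i) w = \sum_i ip A (f i) w.
  by rewrite /ip !mulmx_suml summxE.
have np w : ip (G (F x)) (normal_part G F x w) (V x) = ip (G (F x)) w (V x).
  have VN' : 'J F x *m G (F x) *m (V x)^T = 0.
    by have := congr1 trmx (VN Wx); rewrite !trmx_mul trmxK (GT (FU Wx)) trmx0 mulmxA.
  rewrite /normal_part /ip mulmxBl mulmxBl mxaddE mxoppE.
  move: ('J F x) (invmx _) (G (F x)) (V x) VN' => J I A v VN'.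
  by rewrite -(mulmxA _ J A) -(mulmxA _ (J *m A)) VN' mulmx0 mx0E subr0.
rewrite ip_sum /mxtrace -sumrN; apply: eq_bigr => a _.
rewrite ip_sum [(invmx _ *m _) a a]mxE -sumrN; apply: eq_bigr => b _.
rewrite ipZl np second_form_normal // mulrN opprK; congr (_ * _).
rewrite ip_sym ?GT //; last exact: FU.
by congr (ip _ _ _); exact: frame_torsion_free.
Qed.
End Field.
End Frames.

Section Immersion.
Context {R : realType} (n p : nat) (U : opendom R n) (U' : opendom R p).
Variables (G' : 'rV[R]_p -> 'M[R]_p) (psi : 'rV[R]_n -> 'rV[R]_p).
Hypothesis sG' : smooth_mx (odset U') G'.
Hypothesis GT' : forall x, U' x -> (G' x)^T = G' x.
Hypothesis Gu' : forall x, U' x -> G' x \in unitmx.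
Hypothesis psiU : forall x, U x -> U' (psi x).
Hypothesis spsi : smooth_mx (odset U) psi.
Variable G : 'rV[R]_n -> 'M[R]_n.
Hypothesis GE : forall x, U x -> G x = Defs.induced G' psi x.
Hypothesis Gu : forall x, U x -> G x \in unitmx.
Let oU := od_open U.
Let oU' := od_open U'.

Lemma smooth_induced : smooth_mx (odset U) G.
Proof.
have sJ := smooth_J oU spsi.
have h := smooth_mulmx oU (smooth_mulmx oU sJ (smooth_mx_comp oU oU' psiU spsi sG')) (smooth_trmx oU sJ).
by apply: (smooth_mx_eq oU _ h) => x Ux; rewrite GE.
Qed.

Lemma induced_sym x : U x -> (G x)^T = G x.
Proof. by move=> Ux; rewrite GE // /Defs.induced !trmx_mul trmxK GT' ?mulmxA //; exact: psiU. Qed.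

Local Notation E := (frame psi).
Let sE k : smooth_mx (odset U) (E k) := smooth_frame oU spsi k.

(** Both sides are torsion free and compatible with the induced metric, so that
    [koszul_unique] applies. *)
Lemma frame_christoffel b k c x : U x ->
  ip (G' (psi x)) (row b (cov G' psi (E k) x)) (E c x) = \sum_m christoffel G m b k x * G x m c.
Proof.
move=> Ux; have sG := smooth_induced; have GT := induced_sym.
have GEE j l y : U y -> G y j l = ip (G' (psi y)) (E j y) (E l y).
  move=> Uy; rewrite GE // /Defs.induced /ip /frame -row_mul -!row_mul.
  rewrite [RHS]mxE [LHS]mxE [RHS]mxE; apply: eq_bigr => i _; congr (_ * _).
  by rewrite ![_^T _ _]mxE [row _ _ _ _]mxE.
apply: (@koszul_unique R n (fun b k c => ip (G' (psi x)) (row b (cov G' psi (E k) x)) (E c x))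
  (fun b k c => \sum_m christoffel G m b k x * G x m c)
  (fun b k c => pd b (fun y => G y k c) x)) => {b k c} b k c.
- by rewrite (frame_torsion_free sG' GT' Gu' oU psiU spsi _ _ Ux).
- by apply: eq_bigr => m _; rewrite (chm_sym sG GT Gu _ _ _ Ux).
- rewrite -(ip_sym (E k x)) ?GT' //; last exact: psiU.
  rewrite -(cov_compat sG' GT' Gu' b oU psiU spsi (sE k) (sE c) Ux).
  by apply: (pd_eq b oU Ux) => y Uy; rewrite GEE.
- have := congr1 (fun M : 'M[R]_n => M k c) (chm_compat sG GT Gu b Ux).
  rewrite mxE => ->; rewrite mxaddE !mxE; congr (_ + _); apply: eq_bigr => m _.
    by rewrite mxE.
  by rewrite !mxE mulrC -[in LHS](GT _ Ux) mxE.
Qed.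

(** Differentiating a tangent field by the product rule leaves the derivatives of
    the tangent frame, whose tangential parts are given by [frame_christoffel]. *)
Lemma cov_tangent m (W : set 'rV[R]_m) (F V : 'rV[R]_m -> 'rV[R]_n) y :
  open W -> (forall z, W z -> U (F z)) -> smooth_mx W F -> smooth_mx W V -> W y ->
  cov G' (psi \o F) (fun z => V z *m 'J psi (F z)) y *m G' (psi (F y)) *m ('J psi (F y))^T =
  cov G F V y *m G (F y).
Proof.
move=> oW FU sF sV Wy; have sJ := smooth_J oU spsi.
have sJF : smooth_mx W (jacobian psi \o F) := smooth_mx_comp oW oU FU sF sJ.
have sVJ := smooth_mulmx oW sV sJF.
have Ux := FU _ Wy; set x := F y in Ux *.
apply/row_matrixP => a; rewrite !row_mul (cov_row _ _ _ oW sVJ Wy) (cov_row _ _ _ oW sV Wy).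
rewrite (pdmxM a oW sV sJF Wy) (pdmx_comp a oW oU FU sF sJ Wy) -/x /= -/x.
have JE' : 'J (psi \o F) y = 'J F y *m 'J psi x.
  apply: J_comp => i; first exact: smooth_diff oW (sF 0 i) Wy.
  exact: smooth_diff oU (spsi 0 i) Ux.
have B b : (pdmx b (jacobian psi) x + \sum_i 'J psi x b i *: ('J psi x *m chm G' i (psi x)))
    *m G' (psi x) *m ('J psi x)^T = chm G b x *m G x.
  apply/row_matrixP => k; apply/rowP => c.
  have -> : row k ((pdmx b (jacobian psi) x + \sum_i 'J psi x b i *: ('J psi x *m chm G' i (psi x)))
    *m G' (psi x) *m ('J psi x)^T) 0 c = ip (G' (psi x)) (row b (cov G' psi (E k) x)) (E c x).
    rewrite !row_mul /ip [RHS]mxE [LHS]mxE; apply: eq_bigr => j _.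
    have -> : ('J psi x)^T j c = (E c x)^T j 0 by rewrite !mxE.
    congr ((_ *m _) _ _ * _).
    rewrite (cov_row _ _ _ oU (sE k) Ux) raddfD raddf_sum /=; congr (_ + _).
      apply/rowP => l; rewrite [row _ _ _ _]mxE [pdmx _ _ _ _ _]mxE [RHS]mxE.
      by congr (pd b _ x); apply/funext => z; rewrite [RHS]mxE.
    apply: eq_bigr => i _; rewrite /frame -row_mul.
    by apply/rowP => l; rewrite [row _ _ _ _]mxE !mxscaleE [row _ _ _ _]mxE.
  by rewrite frame_christoffel // !mxE; apply: eq_bigr => l _; rewrite [chm _ _ _ _ _]mxE.
have -> : pdmx a V y *m 'J psi x + V y *m (\sum_i 'J F y a i *: pdmx i (jacobian psi) x) +
   \sum_i 'J (psi \o F) y a i *: (V y *m 'J psi x *m chm G' i (psi x)) =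
   pdmx a V y *m 'J psi x + \sum_b 'J F y a b *: (V y *m
     (pdmx b (jacobian psi) x + \sum_i 'J psi x b i *: ('J psi x *m chm G' i (psi x)))).
  rewrite -addrA; congr (_ + _).
  under [RHS]eq_bigr do rewrite mulmxDr scalerDr; rewrite big_split; congr (_ + _).
    by rewrite mulmx_sumr; apply: eq_bigr => i _; rewrite -scalemxAr.
  have e i : 'J (psi \o F) y a i = \sum_b 'J F y a b * 'J psi x b i by rewrite JE' [LHS]mxE.
  under [LHS]eq_bigr do rewrite e scaler_suml.
  rewrite exchange_big; apply: eq_bigr => b _; rewrite mulmx_sumr scaler_sumr.
  by apply: eq_bigr => i _; rewrite -scalerA -scalemxAr mulmxA.
rewrite -[LHS]mulmxA [LHS]mulmxDl [RHS]mulmxDl !mulmx_suml; congr (_ + _).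
  by rewrite (GE Ux) /Defs.induced !mulmxA.
apply: eq_bigr => b _; rewrite -!scalemxAl; congr (_ *: _).
by rewrite -[RHS]mulmxA -B !mulmxA.
Qed.

End Immersion.

(** * Spacelike hypersurfaces in charts *)

(** The chart at a point depends on the point without any continuity, so tensors
    read in it are smooth only because near each point they agree with their
    expression in one fixed chart. *)
Lemma smooth_local {R : realType} n (U : set 'rV[R]_n) f :
  (forall x, U x -> exists W, [/\ open W, W x & smooth W f]) -> smooth U f.
Proof.
move=> h k; have {}h x : U x -> exists W, [/\ open W, W x & Ck k W f].
  by move=> /h[W [oW Wx sW]]; exists W; split.
elim: k f h => [|k IH] f h.
  by split => // x /h[W [_ Wx [hc _]]]; exact: hc.
apply/CkS; split => [x /h[W [_ Wx]] /CkS [hc _]|j]; first exact: hc.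
split => [x /h[W [_ Wx]] /CkS [_ hd]|]; first exact: (hd j).1.
apply: IH => x /h[W [oW Wx]] /CkS [_ hd]; exists W; split => //; exact: (hd j).2.
Qed.

Lemma cov_eq {R : realType} m n (W : set 'rV[R]_m) (G : 'rV[R]_n -> 'M[R]_n)
    (F F' V V' : 'rV[R]_m -> 'rV[R]_n) x :
  open W -> smooth_mx W F -> smooth_mx W V -> W x ->
  (forall y, W y -> F y = F' y) -> (forall y, W y -> V y = V' y) ->
  cov G F V x = cov G F' V' x.
Proof.
move=> oW sF sV Wx FF VV; apply/matrixP => a k; rewrite !covE.
by rewrite (J_eq oW sF Wx FF) (J_eq oW sV Wx VV) FF // VV.
Qed.

(** The square norm of [t] is the sum of those of its tangential part, which is
    nonnegative, and of its normal part. *)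
Lemma normal_timelike {R : realType} m n (G : 'M[R]_n) (J : 'M[R]_(m, n)) (t : 'rV[R]_n) :
  G^T = G -> posdef (J *m G *m J^T) ->
  let N := t - t *m G *m J^T *m invmx (J *m G *m J^T) *m J in
  N *m G *m J^T = 0 /\ ip G N N <= ip G t t.
Proof.
move=> GT pI; have Iu := posdef_unit pI.
set I := J *m G *m J^T in pI Iu *; set v := t *m G *m J^T *m invmx I; move=> N.
have NE : N = t - v *m J by [].
have NJ : N *m G *m J^T = 0.
  by rewrite NE !mulmxBl -[v *m J *m G]mulmxA -(mulmxA v) -/I /v mulmxKV // subrr.
split => //; have e : ip G N N = ip G N t.
  rewrite {2}NE -[t - _]/(t + - (v *m J)) ipDr -scaleN1r ipZr.
  by rewrite {2}/ip trmx_mul mulmxA NJ mul0mx mx0E mulr0 addr0.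
rewrite e NE -[t - _]/(t + - (v *m J)) ipDl -scaleN1r ipZl mulN1r gerDl oppr_le0.
have -> : ip G (v *m J) t = ip I v v.
  rewrite /ip -[LHS]/((v *m J *m G *m t^T) 0 0); congr (_ 0 0).
  have -> : v *m I *m v^T = t *m G *m J^T *m v^T by rewrite /v mulmxKV.
  by have := tr11 (v *m J *m G *m t^T); rewrite !trmx_mul trmxK GT !mulmxA => ->.
exact: posdef_ge0.
Qed.

Lemma smooth_induced_map {R : realType} m n (W : set 'rV[R]_m) (U : set 'rV[R]_n)
    (G : 'rV[R]_n -> 'M[R]_n) (F : 'rV[R]_m -> 'rV[R]_n) :
  open W -> open U -> (forall y, W y -> U (F y)) -> smooth_mx W F -> smooth_mx U G ->
  smooth_mx W (Defs.induced G F).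
Proof.
move=> oW oU FU sF sG; have sJ := smooth_J oW sF.
have h := smooth_mulmx oW (smooth_mulmx oW sJ (smooth_mx_comp oW oU FU sF sG)) (smooth_trmx oW sJ).
by apply: (smooth_mx_eq oW _ h).
Qed.

Lemma minkowski_unit {R : realType} : @Defs.minkowski R \in unitmx.
Proof.
rewrite unitmxE unitfE /Defs.minkowski det_diag; apply/prodf_neq0 => k _; rewrite mxE.
by case: (k == 0); rewrite ?oppr_eq0 oner_eq0.
Qed.
Section Charts.
Context {R : realType} (S : spacetime R).

Definition cdom (i : chart S) : set 'rV[R]_4 := coord i @` dom i.
Definition cdom2 (i j : chart S) : set 'rV[R]_4 := coord i @` (dom i `&` dom j).
Definition transition (i j : chart S) : 'rV[R]_4 -> 'rV[R]_4 := coord j \o uncoord i.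

Lemma open_cdom i : open (cdom i). Proof. exact: coord_open. Qed.
Arguments open_cdom : clear implicits.

Lemma cdomK i x : cdom i x -> dom i (uncoord i x).
Proof. by case=> p dp <-; rewrite coordK. Qed.

Lemma open_cdom2 i j : open (cdom2 i j).
Proof.
have -> : cdom2 i j = [set x | cdom i x /\ dom j (uncoord i x)].
  apply/seteqP; split => x /=; first by case=> p [di dj] <-; split; [exists p|rewrite coordK].
  by case=> -[p di <-]; rewrite coordK // => dj; exists p.
rewrite openE => x [ci dj]; rewrite /interior.
have h1 : \forall y \near x, cdom i y by apply: open_nbhs_nbhs; split => //; exact: open_cdom.
have h2 : \forall y \near x, dom j (uncoord i y).
  apply: (uncoord_continuous ci); apply: open_nbhs_nbhs; split => //; exact: dom_open.
by apply: filterS2 h1 h2 => y.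
Qed.
Arguments open_cdom2 : clear implicits.

Lemma metric_sym_unit i p : dom i p -> (@metric R S i p)^T = metric i p /\ @metric R S i p \in unitmx.
Proof.
move=> dp; have [P Pu e] := metric_lorentz dp.
have mE : metric i p = invmx P *m Defs.minkowski *m (invmx P)^T.
  by rewrite -e !mulmxA mulVmx // mul1mx -mulmxA trmx_inv mulmxV ?mulmx1 // unitmx_tr.
split.
  by rewrite mE !trmx_mul trmxK /Defs.minkowski tr_diag_mx mulmxA.
rewrite unitmxE unitfE; have : \det (P *m metric i p *m P^T) != 0.
  by rewrite e -unitfE -unitmxE minkowski_unit.
by rewrite !det_mulmx !mulf_eq0 !negb_or => /andP[/andP[]].
Qed.

Lemma met_sym i x : cdom i x -> (met i x)^T = met i x.
Proof. by move=> /cdomK /metric_sym_unit []. Qed.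

Lemma met_unit i x : cdom i x -> met i x \in unitmx.
Proof. by move=> /cdomK /metric_sym_unit []. Qed.

Lemma smooth_met i : smooth_mx (cdom i) (met i).
Proof. exact: metric_smooth. Qed.

Lemma smooth_transition i j : smooth_mx (cdom2 i j) (transition i j).
Proof. by move=> k A; rewrite (ord1 k); exact: transition_smooth. Qed.

Lemma cdom2_sub i j : cdom2 i j `<=` cdom i.
Proof. by move=> x [p [di _] <-]; exists p. Qed.

Lemma transition_cdom i j x : cdom2 i j x -> cdom j (transition i j x).
Proof. by case=> p [di dj] <-; rewrite /transition /= coordK //; exists p. Qed.

Lemma met_transition i j x : cdom2 i j x -> met i x = Defs.induced (met j) (transition i j) x.
Proof.
case=> p [di dj] <-; rewrite /met /Defs.induced /transition /= !coordK //.
exact: metric_transition.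
Qed.

Definition cdomO i p (dp : dom i p) : opendom R 4 :=
  @OpenDom R 4 (cdom i) (open_cdom i) (coord i p) (ex_intro2 _ _ p dp erefl).

Section Map.
Variables (m : nat) (W : set 'rV[R]_m) (X : 'rV[R]_m -> S).
Hypothesis oW : open W.
Hypothesis sX : smooth_map W X.

Definition Wc i : set 'rV[R]_m := W `&` X @^-1` dom i.
Definition Wc2 i j : set 'rV[R]_m := W `&` (X @^-1` dom i `&` X @^-1` dom j).

Lemma open_Wc i : open (Wc i).
Proof.
rewrite openE => x [Wx dx]; rewrite /interior.
have h1 : \forall y \near x, W y by apply: open_nbhs_nbhs; split.
have h2 : \forall y \near x, dom i (X y).
  by apply: (sX.1 x Wx); apply: open_nbhs_nbhs; split => //; exact: dom_open.
by apply: filterS2 h1 h2 => y.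
Qed.
Arguments open_Wc : clear implicits.

Lemma open_Wc2 i j : open (Wc2 i j).
Proof.
have -> : Wc2 i j = Wc i `&` Wc j.
  by apply/seteqP; split => x; [case=> Wx [di dj]|case=> -[Wx di] [_ dj]].
by apply: openI; exact: open_Wc.
Qed.
Arguments open_Wc2 : clear implicits.

Lemma smooth_psi i : smooth_mx (Wc i) (coord i \o X).
Proof. by move=> k A; rewrite (ord1 k); exact: sX.2. Qed.

Lemma psi_cdom i x : Wc i x -> cdom i (coord i (X x)).
Proof. by case=> _ di; exists (X x). Qed.

Lemma psi_cdom2 i j x : Wc2 i j x -> cdom2 i j (coord i (X x)).
Proof. by case=> _ [di dj]; exists (X x). Qed.

Lemma psi_transition i j x : Wc2 i j x -> coord j (X x) = transition i j (coord i (X x)).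
Proof. by case=> _ [di dj]; rewrite /transition /= coordK. Qed.

Lemma met_psi i x : Wc i x -> met i (coord i (X x)) = metric i (X x).
Proof. by case=> _ di; rewrite /met coordK. Qed.

Lemma J_transition i j x : Wc2 i j x ->
  'J (coord j \o X) x = 'J (coord i \o X) x *m 'J (transition i j) (coord i (X x)).
Proof.
move=> Wx; have [W1 [di dj]] := Wx.
have sj : smooth_mx (Wc2 i j) (coord j \o X).
  by move=> k A; apply: (smooth_sub _ (smooth_psi j k A)) => y [Wy [_ dy]].
rewrite (J_eq (F' := transition i j \o (coord i \o X)) (open_Wc2 i j) sj Wx); last first.
  by move=> y Wy; exact: psi_transition.
rewrite J_comp // => k.
  by apply: (smooth_diff (open_Wc i) (smooth_psi i 0 k)).
by apply: (smooth_diff (open_cdom2 i j) (smooth_transition i j 0 k)); exact: psi_cdom2.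
Qed.

Lemma induced_chart i j x : Wc2 i j x ->
  Defs.induced (met j) (coord j \o X) x = Defs.induced (met i) (coord i \o X) x.
Proof.
move=> Wx; have [W1 [di dj]] := Wx.
rewrite /Defs.induced (J_transition Wx) /= !met_psi // trmx_mul !mulmxA.
have := metric_transition di dj; rewrite -/(transition i j) => ->.
by rewrite !mulmxA.
Qed.

Lemma ind_metric_chart i x : Wc i x -> ind_metric X x = Defs.induced (met i) (coord i \o X) x.
Proof.
move=> [Wx di]; rewrite /ind_metric; apply: induced_chart; split => //; split => //.
exact: chart_atP.
Qed.

(** A change of charts is isometric, so [cov_tangent] applies to it. *)
Lemma second_form_chart i j (N N' : 'rV[R]_m -> 'rV[R]_4) x : Wc2 i j x ->
  smooth_mx (Wc i) N -> smooth_mx (Wc j) N' ->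
  (forall z, Wc2 i j z -> N' z = N z *m 'J (transition i j) (coord i (X z))) ->
  second_form (met j) (coord j \o X) N' x = second_form (met i) (coord i \o X) N x.
Proof.
move=> Wx sN sN' NE; have [W1 [di dj]] := Wx.
have sub1 : Wc2 i j `<=` Wc i by move=> y [Wy [? _]].
have sub2 : Wc2 i j `<=` Wc j by move=> y [Wy [_ ?]].
have subs p q (A B : set 'rV[R]_m) (M : 'rV[R]_m -> 'M[R]_(p, q)) :
   A `<=` B -> smooth_mx B M -> smooth_mx A M by move=> AB sM k l; exact: smooth_sub AB (sM k l).
rewrite /second_form.
have -> : cov (met j) (coord j \o X) N' x =
   cov (met j) (transition i j \o (coord i \o X)) (fun z => N z *m 'J (transition i j) ((coord i \o X) z)) x.
  apply: (cov_eq _ (open_Wc2 i j)) => //.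
  - exact: subs sub2 (smooth_psi j).
  - exact: subs sub2 sN'.
  - by move=> y Wy; exact: psi_transition.
rewrite (J_transition Wx) trmx_mul !mulmxA.
pose U := @OpenDom R 4 (cdom2 i j) (open_cdom2 i j) _ (psi_cdom2 Wx).
pose U' := cdomO dj.
have := @cov_tangent R 4 4 U U' (met j) (transition i j) (smooth_met j) (@met_sym j) (@met_unit j)
  (@transition_cdom i j) (smooth_transition i j) (met i) (@met_transition i j)
  (fun z h => met_unit (cdom2_sub h)) m (Wc2 i j) (coord i \o X) N x (open_Wc2 i j)
  (@psi_cdom2 i j) (subs _ _ _ _ _ sub1 (smooth_psi i)) (subs _ _ _ _ _ sub1 sN) Wx.
by rewrite /= -(psi_transition Wx) => ->.
Qed.
End Map.
End Charts.
Arguments open_cdom {R S} i _ _.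
Arguments open_cdom2 {R S} i j _ _.
Arguments open_Wc {R S m W X} oW sX i _ _.
Arguments open_Wc2 {R S m W X} oW sX i j _ _.

Section Hypersurface.
Context {R : realType} (S : spacetime R).
Variables (W : set 'rV[R]_3) (X : 'rV[R]_3 -> S).
Hypothesis hX : spacelike_immersion W X.
Let oW : open W. Proof. by case: hX. Qed.
Let sX : smooth_map W X. Proof. by case: hX. Qed.
Local Notation psi i := (coord i \o X).
Local Notation Wc := (Wc W X).
Local Notation Wc2 := (Wc2 W X).

Lemma posdef_induced i x : Wc i x -> posdef (Defs.induced (met i) (psi i) x).
Proof. by move=> Wx; rewrite -(ind_metric_chart oW sX Wx); case: hX => _ _; apply; case: Wx. Qed.

Definition raw_normal i x := normal_part (met i) (psi i) x (tvec i (X x)).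

Lemma raw_normalP i x : Wc i x ->
  raw_normal i x *m metric i (X x) *m ('J (psi i) x)^T = 0 /\
  ip (metric i (X x)) (raw_normal i x) (raw_normal i x) < 0.
Proof.
move=> Wx; have [W1 di] := Wx; have := posdef_induced Wx.
rewrite /raw_normal /normal_part /Defs.induced (met_psi Wx : met i ((psi i) x) = _) => pI.
have [h1 h2] := normal_timelike (tvec i (X x)) (metric_sym_unit di).1 pI.
by split => //; apply: le_lt_trans h2 _; exact: tvec_timelike.
Qed.

Lemma smooth_raw i : smooth_mx (Wc i) (raw_normal i).
Proof.
have oc := open_Wc oW sX i; have sp := smooth_psi sX i; have sJ := smooth_J oc sp.
have sm : smooth_mx (Wc i) (met i \o psi i).
  exact: smooth_mx_comp oc (open_cdom i) (@psi_cdom _ _ _ _ _ i) sp (smooth_met i).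
have st : smooth_mx (Wc i) (fun x => tvec i (X x)).
  have st' : smooth_mx (cdom i) (fun z => tvec i (uncoord i z)).
    by move=> k A; rewrite (ord1 k); exact: tvec_smooth.
  have h := smooth_mx_comp oc (open_cdom i) (@psi_cdom _ _ _ _ _ i) sp st'.
  by apply: (smooth_mx_eq oc _ h) => x [_ di] /=; rewrite coordK.
have sI : smooth_mx (Wc i) (Defs.induced (met i) (psi i)).
  exact: smooth_induced_map oc (open_cdom i) (@psi_cdom _ _ _ _ _ i) sp (smooth_met i).
apply: smooth_addmx => //; apply: smooth_oppmx => //.
apply: smooth_mulmx => //; apply: smooth_mulmx => //.
  by apply: smooth_mulmx => //; [exact: smooth_mulmx|exact: smooth_trmx].
by apply: smooth_invmx => // x Wx; apply: posdef_unit; exact: posdef_induced.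
Qed.

Lemma future_normalE i x : future_normal X i x =
  (Num.sqrt (- ip (metric i (X x)) (raw_normal i x) (raw_normal i x)))^-1 *: raw_normal i x.
Proof. by []. Qed.

Lemma smooth_future i : smooth_mx (Wc i) (future_normal X i).
Proof.
have oc := open_Wc oW sX i; have sr := smooth_raw i.
have sm : smooth_mx (Wc i) (fun x => metric i (X x)).
  have h := smooth_mx_comp oc (open_cdom i) (@psi_cdom _ _ _ _ _ i) (smooth_psi sX i) (smooth_met i).
  by apply: (smooth_mx_eq oc _ h) => x Wx; rewrite -(met_psi Wx).
have sip : smooth (Wc i) (fun x => - ip (metric i (X x)) (raw_normal i x) (raw_normal i x)).
  apply: smoothN => //.
  exact: (smooth_mulmx oc (smooth_mulmx oc sr sm) (smooth_trmx oc sr) 0 0).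
have pos x : Wc i x -> 0 < - ip (metric i (X x)) (raw_normal i x) (raw_normal i x).
  by move=> /raw_normalP[_]; rewrite oppr_gt0.
apply: smooth_scalemx => //; apply: smoothV => //; last exact: smooth_sqrt.
by move=> x /pos h; rewrite gt_eqF // sqrtr_gt0.
Qed.

Lemma future_unit i x : Wc i x ->
  ip (metric i (X x)) (future_normal X i x) (future_normal X i x) = -1.
Proof.
move=> Wx; have [_ h] := raw_normalP Wx.
rewrite future_normalE ipZl ipZr mulrA -invfM -expr2 sqr_sqrtr ?oppr_ge0 ?ltW //.
by rewrite invrN mulNr mulVf // lt_eqF.
Qed.

Lemma future_orth i x : Wc i x ->
  future_normal X i x *m metric i (X x) *m ('J (psi i) x)^T = 0.
Proof.
by move=> Wx; have [h _] := raw_normalP Wx; rewrite future_normalE -!scalemxAl h scaler0.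
Qed.

(** The time orientation and the metric transform by the Jacobian of the transition
    map, and the normal part is built from them. *)
Lemma future_transition i j x : Wc2 i j x ->
  future_normal X j x = future_normal X i x *m 'J (transition i j) (coord i (X x)).
Proof.
move=> Wx; have [W1 [di dj]] := Wx.
have W1i : Wc i x by split. have W1j : Wc j x by split.
set D := 'J _ _.
have mD : metric i (X x) = D *m metric j (X x) *m D^T.
  exact: metric_transition.
have rE : raw_normal j x = raw_normal i x *m D.
  rewrite /raw_normal /normal_part (induced_chart oW sX Wx) mulmxBl.
  rewrite [tvec j _](tvec_transition di dj) -/D (J_transition oW sX Wx) -/D.
  rewrite [met j _](met_psi W1j) [met i _](met_psi W1i) mD trmx_mul !mulmxA //.
rewrite !future_normalE rE -scalemxAl; congr ((Num.sqrt (- _))^-1 *: _).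
by rewrite /ip trmx_mul mD !mulmxA.
Qed.

Lemma ind_second_chart i x : Wc i x ->
  ind_second X x = second_form (met i) (psi i) (future_normal X i) x.
Proof.
move=> [Wx di]; rewrite /ind_second; symmetry.
have Wx2 : Wc2 (chart_at (X x)) i x by split => //; split => //; exact: chart_atP.
apply: (second_form_chart oW sX Wx2); [exact: smooth_future|exact: smooth_future|].
by move=> z; exact: future_transition.
Qed.

Let Wat x : W x -> Wc (chart_at (X x)) x.
Proof. by move=> Wx; split => //; exact: chart_atP. Qed.

Lemma smooth_ind_metric : smooth_mx W (ind_metric X).
Proof.
move=> a b; apply: smooth_local => x Wx; exists (Wc (chart_at (X x))).
have oc := open_Wc oW sX (chart_at (X x)); split => //; first exact: Wat.
set i := chart_at (X x) in oc *.
have sp := smooth_psi sX i; have sJ := smooth_J oc sp.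
have sm : smooth_mx (Wc i) (met i \o psi i).
  exact: smooth_mx_comp oc (open_cdom i) (@psi_cdom _ _ _ _ _ i) sp (smooth_met i).
have sI : smooth_mx (Wc i) (Defs.induced (met i) (psi i)).
  exact: smooth_induced_map oc (open_cdom i) (@psi_cdom _ _ _ _ _ i) sp (smooth_met i).
by apply: (smooth_mx_eq oc _ sI) => y Wy; rewrite (ind_metric_chart oW sX Wy).
Qed.

Lemma ind_second_sym x : W x -> (ind_second X x)^T = ind_second X x.
Proof.
move=> Wx; have Wx1 := Wat Wx; rewrite (ind_second_chart Wx1).
set i := chart_at (X x) in Wx1 *.
apply: (second_form_sym (U := cdomO (chart_atP (X x))) (smooth_met i) (@met_sym _ _ i) (@met_unit _ _ i)
   (open_Wc oW sX i) (@psi_cdom _ _ _ _ _ i) (smooth_psi sX i) (@smooth_future i) _ Wx1).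
by move=> y Wy /=; rewrite (met_psi Wy) future_orth.
Qed.

Lemma smooth_ind_second : smooth_mx W (ind_second X).
Proof.
move=> a b; apply: smooth_local => x Wx; exists (Wc (chart_at (X x))).
have oc := open_Wc oW sX (chart_at (X x)); split => //; first exact: Wat.
set i := chart_at (X x) in oc *.
have sp := smooth_psi sX i; have sJ := smooth_J oc sp; have sn := @smooth_future i.
have sm : smooth_mx (Wc i) (met i \o psi i).
  exact: smooth_mx_comp oc (open_cdom i) (@psi_cdom _ _ _ _ _ i) sp (smooth_met i).
have sJn := smooth_J oc sn.
have sG k c b' : smooth (Wc i) (christoffel (met i) k c b' \o psi i).
  apply: (smooth_comp oc (open_cdom i) (@psi_cdom _ _ _ _ _ i) (sp 0)).
  exact: (@smooth_christoffel R 4 (cdomO (chart_atP (X x))) _ (smooth_met i) (@met_sym _ _ i) (@met_unit _ _ i)).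
have sc : smooth_mx (Wc i) (cov (met i) (psi i) (future_normal X i)).
  move=> c k; apply: (smooth_eq oc (f := fun y => 'J (future_normal X i) y c k
    + \sum_l \sum_j christoffel (met i) k l j (psi i y) * 'J (psi i) y c l * future_normal X i y 0 j)).
    by move=> y _; rewrite covE.
  apply: (smoothD oc (sJn c k)).
  apply: (smooth_sum _ _ oc) => l; apply: (smooth_sum _ _ oc) => j.
  exact: smoothM oc (smoothM oc (sG k l j) (sJ c l)) (sn 0 j).
have sI := smooth_mulmx oc (smooth_mulmx oc sc sm) (smooth_trmx oc sJ).
by apply: (smooth_mx_eq oc _ sI) => y Wy; rewrite (ind_second_chart Wy).
Qed.

End Hypersurface.

(** * The density of a boosted normal frame *)

Section Boost.
Context {R : realType} (m n : nat) (U : opendom R n) (W : set 'rV[R]_m).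
Variables (G : 'rV[R]_n -> 'M[R]_n) (F : 'rV[R]_m -> 'rV[R]_n).
Hypothesis sG : smooth_mx (odset U) G.
Hypothesis GT : forall x, U x -> (G x)^T = G x.
Hypothesis Gu : forall x, U x -> G x \in unitmx.
Hypothesis oW : open W.
Hypothesis FU : forall x, W x -> U (F x).
Hypothesis sF : smooth_mx W F.
Variables (A B : 'rV[R]_m -> 'rV[R]_n) (C D : 'rV[R]_m -> R).
Hypothesis sA : smooth_mx W A.
Hypothesis sB : smooth_mx W B.
Hypothesis sC : smooth W C.
Hypothesis sD : smooth W D.

Lemma cov_lin x : W x ->
  cov G F (fun y => C y *: A y + D y *: B y) x =
  (drow C x)^T *m A x + C x *: cov G F A x + ((drow D x)^T *m B x + D x *: cov G F B x).
Proof.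
move=> Wx; have sCA := smooth_scalemx oW sC sA; have sDB := smooth_scalemx oW sD sB.
apply/row_matrixP => a; rewrite !raddfD /= !linearZ /= !row_mul.
rewrite [LHS](cov_row G F a oW (smooth_addmx oW sCA sDB) Wx).
have hA := cov_row G F a oW sA Wx; have hB := cov_row G F a oW sB Wx; rewrite hA hB {hA hB}.
rewrite (pdmxD a sCA sDB Wx) (pdmxZ a sC sA Wx) (pdmxZ a sD sB Wx).
have rE (c : 'rV[R]_m -> R) (v : 'rV[R]_n) : row a (drow c x)^T *m v = pd a c x *: v.
  by apply/rowP => k; rewrite !mxE big_ord1 !mxE.
rewrite !rE.
have e (v w : 'rV[R]_n) (s t : R) : \sum_i 'J F x a i *: ((s *: v + t *: w) *m chm G i (F x)) =
    s *: (\sum_i 'J F x a i *: (v *m chm G i (F x))) + t *: (\sum_i 'J F x a i *: (w *m chm G i (F x))).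
  rewrite !scaler_sumr -big_split; apply: eq_bigr => i _ /=.
  by rewrite mulmxDl -!scalemxAl scalerDr !scalerA ![_ * 'J F x a i]mulrC.
rewrite e !scalerDr; move: (\sum_i _) (\sum_i _) => s1 s2; mxlin.
Qed.

Hypothesis AJ : forall y, W y -> A y *m G (F y) *m ('J F y)^T = 0.
Hypothesis BJ : forall y, W y -> B y *m G (F y) *m ('J F y)^T = 0.
Hypothesis AA : forall y, W y -> ip (G (F y)) (A y) (A y) = 1.
Hypothesis BB : forall y, W y -> ip (G (F y)) (B y) (B y) = -1.
Hypothesis AB : forall y, W y -> ip (G (F y)) (A y) (B y) = 0.
Hypothesis CD : forall y, W y -> C y * C y - D y * D y = 1.

Let pd_cst_ip (V V' : 'rV[R]_m -> 'rV[R]_n) (k : R) a x :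
  smooth_mx W V -> smooth_mx W V' -> (forall y, W y -> ip (G (F y)) (V y) (V' y) = k) -> W x ->
  ip (G (F x)) (row a (cov G F V x)) (V' x) + ip (G (F x)) (V x) (row a (cov G F V' x)) = 0.
Proof.
move=> sV sV' h Wx; rewrite -(cov_compat sG GT Gu a oW FU sF sV sV' Wx).
by rewrite -(pd_cst k x a); apply: (pd_eq a oW Wx).
Qed.

Let col_ip (M : 'M[R]_(m, n)) (g : 'M[R]_n) (v : 'rV[R]_n) a : (M *m g *m v^T) a 0 = ip g (row a M) v.
Proof. by rewrite /ip -!row_mul [RHS]mxE. Qed.

Let dbl (a : R) : a + a = 0 -> a = 0.
Proof. by move=> /eqP; rewrite -mulr2n mulrn_eq0 => /eqP. Qed.

Lemma cov_A_A x : W x -> cov G F A x *m G (F x) *m (A x)^T = 0.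
Proof.
move=> Wx; apply/matrixP => a b; rewrite (ord1 b) col_ip mx0E; apply: dbl.
by rewrite -[RHS](pd_cst_ip a sA sA AA Wx) [in RHS](ip_sym (A x)) // GT //; exact: FU.
Qed.

Lemma cov_B_B x : W x -> cov G F B x *m G (F x) *m (B x)^T = 0.
Proof.
move=> Wx; apply/matrixP => a b; rewrite (ord1 b) col_ip mx0E; apply: dbl.
by rewrite -[RHS](pd_cst_ip a sB sB BB Wx) [in RHS](ip_sym (B x)) // GT //; exact: FU.
Qed.

Lemma cov_A_B x : W x -> cov G F A x *m G (F x) *m (B x)^T = - (cov G F B x *m G (F x) *m (A x)^T).
Proof.
move=> Wx; apply/matrixP => a b; rewrite (ord1 b) mxoppE !col_ip; apply/eqP; rewrite -addr_eq0.
by rewrite -[X in _ + X]ip_sym ?GT ?(pd_cst_ip a sA sB AB Wx) //; exact: FU.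
Qed.

Let lin_mul k (dC dD : 'cV[R]_m) (a b : 'rV[R]_n) (r s : R) (M1 M2 : 'M[R]_(m, n)) (g : 'M[R]_n)
    (v : 'M[R]_(n, k)) : (dC *m a + r *: M1 + (dD *m b + s *: M2)) *m g *m v =
  dC *m (a *m g *m v) + r *: (M1 *m g *m v) + (dD *m (b *m g *m v) + s *: (M2 *m g *m v)).
Proof. by rewrite !mulmxDl -!scalemxAl !mulmxA. Qed.

Let E3 y := C y *: A y + D y *: B y.
Let E4 y := D y *: A y + C y *: B y.

(** The boost acts on the mean curvatures linearly and on the connection one-form
    by a gauge transformation. *)
Lemma h_density_boost (t : 'rV[R]_m -> R) x : W x ->
  let s := invmx (Defs.induced G F x) in let z := drow t x *m s in
  h_density G F t E3 E4 x =
  Num.sqrt (1 + ip s (drow t x) (drow t x)) * (C x * mean_curv G F A x + D x * mean_curv G F B x)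
  - (D x * (z *m (drow C x)^T) 0 0 - C x * (z *m (drow D x)^T) 0 0)
  + (z *m cov G F B x *m G (F x) *m (A x)^T) 0 0.
Proof.
move=> Wx s z; rewrite /h_density -/s -/z.
have sE3 : smooth_mx W E3 := smooth_addmx oW (smooth_scalemx oW sC sA) (smooth_scalemx oW sD sB).
have E3J y : W y -> E3 y *m G (F y) *m ('J F y)^T = 0.
  by move=> Wy; rewrite /E3 !mulmxDl -!scalemxAl AJ // BJ // !scaler0 addr0.
rewrite (mean_curv_vec_normal sG GT Gu oW FU sF sE3 E3J Wx) mulrNN -addrA; congr (_ * _ + _).
  rewrite /mean_curv /second_form -/s (cov_lin Wx) lin_mul AJ // BJ // !mulmx0 !add0r.
  by rewrite mulmxDr mxtraceD -!scalemxAr !mxtraceZ.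
have AE4 : (A x *m G (F x) *m (E4 x)^T) = (D x)%:M.
  apply/matrixP => a b; rewrite !ord1 -[LHS]/(ip (G (F x)) (A x) (E4 x)) /E4 ipDr !ipZr AA // AB //.
  by rewrite mulr1 mulr0 addr0 mxE eqxx.
have BE4 : (B x *m G (F x) *m (E4 x)^T) = (- C x)%:M.
  apply/matrixP => a b; rewrite !ord1 -[LHS]/(ip (G (F x)) (B x) (E4 x)) /E4 ipDr !ipZr BB //.
  by rewrite ip_sym ?GT ?AB //; [rewrite mulr0 add0r mulrN1 mxE eqxx|exact: FU].
have E4T : (E4 x)^T = D x *: (A x)^T + C x *: (B x)^T by rewrite /E4 trD !trZ.
have cA : cov G F A x *m G (F x) *m (E4 x)^T = - C x *: (cov G F B x *m G (F x) *m (A x)^T).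
  by rewrite E4T mulmxDr -!scalemxAr cov_A_A // cov_A_B // scaler0 add0r scalerN scaleNr.
have cB : cov G F B x *m G (F x) *m (E4 x)^T = D x *: (cov G F B x *m G (F x) *m (A x)^T).
  by rewrite E4T mulmxDr -!scalemxAr cov_B_B // scaler0 addr0.
rewrite [ip _ _ (E4 x)]/ip (cov_lin Wx) -!(mulmxA z) lin_mul AE4 BE4 cA cB !mul_mx_scalar !scalerA.
rewrite !mulmxDr -!scalemxAr !mulmxA !mxaddE !mxscaleE.
move: ((z *m _ *m _ *m _) 0 0) => q; move: ((z *m _) 0 0) ((z *m _) 0 0) (CD Wx) => a b h.
transitivity (- (D x * b - C x * a) + (C x * C x - D x * D x) * q); first by ring.
by rewrite h mul1r.
Qed.
End Boost.

(** * The boundary of the initial data set *)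

Section SurfaceDensity.
Context {R : realType} (S : spacetime R).
Variables (W : set 'rV[R]_3) (X : 'rV[R]_3 -> S).
Hypothesis hX : spacelike_immersion W X.
Variable V : opendom R 3.
Hypothesis V_sphere : forall x, sphere x -> V x.
Hypothesis V0 : forall x, V x -> x != 0.
Hypothesis VW : forall x, V x -> W x.
Let oW : open W. Proof. by case: hX. Qed.
Let sX : smooth_map W X. Proof. by case: hX. Qed.
Local Notation g := (ind_metric X).
Local Notation K := (ind_second X).
Local Notation nu := (conormal (ind_metric X) (@sqn R 3)).

Let pX x : W x -> posdef (g x). Proof. by case: hX => _ _; exact. Qed.
Lemma pg_V x : V x -> posdef (g x). Proof. by move=> /VW; exact: pX. Qed.
Lemma sg_V : smooth_mx (odset V) g.
Proof. by move=> i j; apply: smooth_sub (smooth_ind_metric hX i j); exact: VW. Qed.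
Lemma sK_V : smooth_mx (odset V) K.
Proof. by move=> i j; apply: smooth_sub (smooth_ind_second hX i j); exact: VW. Qed.
Lemma KT_V x : V x -> (K x)^T = K x.
Proof. by move=> /VW Wx; exact: (ind_second_sym hX Wx). Qed.

Variables (c : bool) (u : 'rV[R]_2).
Let p := stereo c u.
Let Vp : V p := V_sphere (stereo_sphere c u).
Let J := 'J (stereo c) u.
Let i := chart_at (X p).
Let W2 : set 'rV[R]_2 := stereo c @^-1` Wc W X i.
Let Wp : Wc W X i p. Proof. by split; [exact: VW|exact: chart_atP]. Qed.
Local Notation psi := (coord i \o X).

Lemma surface_metric : sigma X c u = J *m g p *m J^T.
Proof.
rewrite /sigma /ind_metric /surf /= -/p -/i /Defs.induced.
rewrite (J_comp (phi := stereo c) (F := psi)); last 2 first.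
- by move=> k; exact: stereo_diff.
- by move=> k; exact: (smooth_diff (open_Wc oW sX i) (smooth_psi sX i 0 k) Wp).
by rewrite -/J -/p /= trmx_mul !mulmxA.
Qed.

Let oW2 : open W2.
Proof.
have cs : continuous (stereo c : 'rV[R]_2 -> 'rV[R]_3).
  by move=> v; apply: continuous_rV => k; exact: (smooth_cont (smooth_stereo c k)).
by move/continuousP: cs; apply; exact: open_Wc.
Qed.

Let sst : smooth_mx setT (stereo c : 'rV[R]_2 -> 'rV[R]_3).
Proof. by move=> k l; rewrite (ord1 k); exact: smooth_stereo. Qed.
Let sst2 : smooth_mx W2 (stereo c).
Proof. by move=> k l; apply: smooth_sub (sst k l). Qed.

(** The frame consists of the images of the conormal [nu] and of the future normal.
    The mean curvature along the first is the one in the initial data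
    ([cov_tangent]), along the second it is a trace of [K], and the connection
    one-form of the frame is [K] applied to [nu]: the density depends on the spacetime only
    through the induced data. *)
Lemma hfun_formula (tau phi : 'rV[R]_3 -> R) :
  smooth setT (coshR \o phi \o stereo c) -> smooth setT (sinhR \o phi \o stereo c) ->
  (forall x, coshR (phi x) * coshR (phi x) - sinhR (phi x) * sinhR (phi x) = 1) ->
  let s := invmx (J *m g p *m J^T) in
  let t := drow (tau \o stereo c) u in let z := t *m s in
  hfun X tau (frame3 X) (frame4 X) phi c u =
  Num.sqrt (1 + ip s t t) * (coshR (phi p) * mean_curv g (stereo c) (nu \o stereo c) u
     + sinhR (phi p) * \tr (s *m (J *m K p *m J^T)))
  - (sinhR (phi p) * (z *m (drow (coshR \o phi \o stereo c) u)^T) 0 0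
     - coshR (phi p) * (z *m (drow (sinhR \o phi \o stereo c) u)^T) 0 0)
  + (z *m J *m K p *m (nu p)^T) 0 0.
Proof.
move=> sC sD CD s t z; rewrite /hfun -/i.
have W2u : W2 u by exact: Wp.
pose A v := nu (stereo c v) *m 'J psi (stereo c v).
pose B v := future_normal X i (stereo c v).
have oc := open_Wc oW sX i; have sp := smooth_psi sX i; have sJ := smooth_J oc sp.
have snu : smooth_mx W2 (nu \o stereo c).
  apply: (smooth_mx_comp oW2 (od_open V) _ sst2 (smooth_conormal V0 sg_V pg_V)).
  by move=> v _; apply: V_sphere; exact: stereo_sphere.
have sJs : smooth_mx W2 (jacobian psi \o stereo c).
  exact: (smooth_mx_comp oW2 oc _ sst2 sJ).
have sA : smooth_mx W2 A := smooth_mulmx oW2 snu sJs.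
have sB : smooth_mx W2 B.
  exact: (smooth_mx_comp oW2 oc _ sst2 (@smooth_future _ _ _ _ hX i)).
have sF : smooth_mx W2 (psi \o stereo c) by exact: (smooth_mx_comp oW2 oc _ sst2 sp).
have FU v : W2 v -> cdom i ((psi \o stereo c) v) by exact: psi_cdom.
have gE v : W2 v -> g (stereo c v) = 'J psi (stereo c v) *m met i (psi (stereo c v)) *m ('J psi (stereo c v))^T.
  by move=> Wv; rewrite (ind_metric_chart oW sX Wv).
have JF v : W2 v -> 'J (psi \o stereo c) v = 'J (stereo c) v *m 'J psi (stereo c v).
  move=> Wv; apply: J_comp => k; first exact: stereo_diff.
  exact: (smooth_diff oc (sp 0 k) Wv).
have Vs v : V (stereo c v) by apply: V_sphere; exact: stereo_sphere.
have nJ v : W2 v -> B v *m met i (psi (stereo c v)) *m ('J psi (stereo c v))^T = 0.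
  by move=> Wv; rewrite /= (met_psi Wv) (future_orth hX Wv).
have AJ v : W2 v -> A v *m met i (psi (stereo c v)) *m ('J (psi \o stereo c) v)^T = 0.
  move=> Wv; rewrite JF // trmx_mul !mulmxA /A -[_ *m _ *m ('J psi _)^T]mulmxA -[nu _ *m _ *m _]mulmxA.
  rewrite [X in _ *m X *m _]mulmxA -(gE v Wv).
  exact: (conormal_tangent V_sphere pg_V).
have BJ v : W2 v -> B v *m met i (psi (stereo c v)) *m ('J (psi \o stereo c) v)^T = 0.
  by move=> Wv; rewrite JF // trmx_mul !mulmxA nJ // mul0mx.
have AA v : W2 v -> ip (met i (psi (stereo c v))) (A v) (A v) = 1.
  move=> Wv; rewrite /ip /A trmx_mul !mulmxA -[_ *m _ *m ('J psi _)^T]mulmxA -[nu _ *m _ *m _]mulmxA.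
  by rewrite [X in _ *m X *m _]mulmxA -(gE v Wv) (conormal_unit V0 pg_V (Vs v)) mxE eqxx.
have BB v : W2 v -> ip (met i (psi (stereo c v))) (B v) (B v) = -1.
  by move=> Wv; rewrite /= (met_psi Wv) (future_unit hX Wv).
have AB v : W2 v -> ip (met i (psi (stereo c v))) (A v) (B v) = 0.
  move=> Wv; rewrite ip_sym; last by apply: met_sym; exact: FU.
  by rewrite /ip /A trmx_mul mulmxA nJ // mul0mx mx0E.
have subs (f : 'rV[R]_2 -> R) : smooth setT f -> smooth W2 f by apply: smooth_sub.
have hb := @h_density_boost R 2 4 (cdomO (chart_atP (X p))) W2 (met i) (psi \o stereo c)
  (smooth_met i) (@met_sym _ _ i) (@met_unit _ _ i) oW2 FU sF A B _ _ sA sB (subs _ sC) (subs _ sD)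
  AJ BJ AA BB AB (fun v _ => CD (stereo c v)) (tau \o stereo c) u W2u.
have sE : Defs.induced (met i) (psi \o stereo c) u = J *m g p *m J^T.
  by rewrite -surface_metric.
move: hb; rewrite /= sE -/s -/t -/z => hb.
transitivity (h_density (met i) (psi \o stereo c) (tau \o stereo c)
  (fun y => coshR (phi (stereo c y)) *: A y + sinhR (phi (stereo c y)) *: B y)
  (fun y => sinhR (phi (stereo c y)) *: A y + coshR (phi (stereo c y)) *: B y) u); first by [].
rewrite {}hb -/p.
have covB : cov (met i) (psi \o stereo c) B u = J *m cov (met i) psi (future_normal X i) p.
  apply: cov_comp => k; first exact: stereo_diff.
    exact: (smooth_diff oc (sp 0 k) Wp).
  exact: (smooth_diff oc (@smooth_future _ _ _ _ hX i 0 k) Wp).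
have KE : K p = cov (met i) psi (future_normal X i) p *m met i (psi p) *m ('J psi p)^T.
  exact: (ind_second_chart hX Wp).
have gu x : Wc W X i x -> g x \in unitmx.
  by move=> Wx; exact: (posdef_unit (pX Wx.1)).
have mA : mean_curv (met i) (psi \o stereo c) A u = mean_curv g (stereo c) (nu \o stereo c) u.
  rewrite /mean_curv sE; congr (\tr (_ *m _)); rewrite /second_form JF // trmx_mul mulmxA.
  pose UO := @OpenDom R 3 (Wc W X i) oc p Wp.
  rewrite (@cov_tangent R 3 4 UO (cdomO (chart_atP (X p))) (met i) psi (smooth_met i)
    (@met_sym _ _ i) (@met_unit _ _ i) (@psi_cdom _ _ _ _ _ i) sp g
    (fun x h => ind_metric_chart oW sX h) gu 2 W2 (stereo c) (nu \o stereo c) u oW2 _ sst2 snu W2u) //.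
have mB : mean_curv (met i) (psi \o stereo c) B u = \tr (s *m (J *m K p *m J^T)).
  rewrite /mean_curv sE; congr (\tr (_ *m _)); rewrite /second_form JF // trmx_mul covB KE.
  by rewrite !mulmxA.
rewrite mA mB; congr (_ + _); rewrite covB /A trmx_mul KE !mulmxA //.
Qed.
End SurfaceDensity.

(** * The Jang gauge *)

Lemma comb_mul (R : realType) n (a s c : R) (v w : 'rV[R]_n) (M : 'cV[R]_n) :
  (a *: (s *: v + c *: w) *m M) 0 0 = a * (s * (v *m M) 0 0 + c * (w *m M) 0 0).
Proof. by rewrite -scalemxAl mulmxDl -!scalemxAl mxscaleE mxaddE !mxscaleE. Qed.

Section JangGauge.
Context {R : realType} (S : spacetime R).
Variables (W : set 'rV[R]_3) (X : 'rV[R]_3 -> S).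
Hypothesis hX : spacelike_immersion W X.
Variable V : opendom R 3.
Hypothesis V_sphere : forall x, sphere x -> V x.
Hypothesis V0 : forall x, V x -> x != 0.
Hypothesis VW : forall x, V x -> W x.
Variables (tau f u : 'rV[R]_3 -> R).
Hypothesis sf : smooth (odset V) f.
Hypothesis su : smooth (odset V) u.
Hypothesis u_gt0 : forall x, V x -> 0 < u x.
Hypothesis u1 : forall x, sphere x -> u x = 1.
Hypothesis f_tau : forall x, sphere x -> f x = tau x.
Local Notation g := (ind_metric X).
Local Notation K := (ind_second X).
Local Notation gh := (graph_metric g f).
Local Notation gs := (fun x => u x ^+ 4 *: gh x).
Hypothesis jang : forall x, sphere x -> jang_lhs g K f x = 0.
Let sg := sg_V hX VW.
Let pg := pg_V hX VW.
Let sK := sK_V hX VW.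
Let KT := KT_V hX VW.

Lemma cosh_sinh (x : R) : coshR x * coshR x - sinhR x * sinhR x = 1.
Proof.
have h : expR x * expR (- x) = 1 by rewrite -expRD subrr expR0.
by rewrite -h /coshR /sinhR; field.
Qed.

(** The boost with hyperbolic functions [jc] and [js]. *)
Definition jphi x := ln (jc g f x + js g f x).

Lemma jcs_gt0 x : V x -> 0 < jc g f x + js g f x.
Proof.
move=> Vx; have a0 := ja_gt0 V0 f pg Vx.
rewrite /jc /js -mulrDl divr_gt0 // subr_gt0.
apply: le_lt_trans (ler_norm _) _; rewrite -sqrtr_sqr ltr_sqrt ?(W_gt0 f pg Vx) //.
by apply: le_lt_trans (jfnu_sq V0 f pg Vx) _; rewrite ltrDr.
Qed.

Lemma jphi_inv x : V x -> expR (- jphi x) = jc g f x - js g f x.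
Proof.
move=> Vx; have h0 := jcs_gt0 Vx; rewrite expRN /jphi lnK ?posrE //.
rewrite -[LHS]mulr1 -(jcs V0 f pg Vx).
by field; rewrite gt_eqF.
Qed.

Lemma cosh_jphi x : V x -> coshR (jphi x) = jc g f x.
Proof. by move=> Vx; rewrite /coshR jphi_inv // /jphi lnK ?posrE ?jcs_gt0 //; field. Qed.

Lemma sinh_jphi x : V x -> sinhR (jphi x) = js g f x.
Proof. by move=> Vx; rewrite /sinhR jphi_inv // /jphi lnK ?posrE ?jcs_gt0 //; field. Qed.

Let Vs c (y : 'rV[R]_2) : V (stereo c y). Proof. by apply: V_sphere; exact: stereo_sphere. Qed.

Lemma smooth_on_sphere (h : 'rV[R]_3 -> R) c : smooth (odset V) h -> smooth setT (h \o stereo c).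
Proof.
move=> sh; apply: (smooth_comp openT (od_open V) _ (smooth_stereo c) sh).
by move=> y _; exact: Vs.
Qed.

Lemma smooth_jphi : smooth_sphere jphi.
Proof.
move=> c; apply: smooth_on_sphere; apply: smooth_ln (od_open V) jcs_gt0 _.
exact: smoothD (od_open V) (smooth_jc V0 sg pg sf) (smooth_js V0 sg pg sf).
Qed.

Section AtPoint.
Variables (c : bool) (y : 'rV[R]_2).
Let p := stereo c y.
Let J := 'J (stereo c) y.
Let Vp : V p := Vs c y.
Let s := invmx (J *m g p *m J^T).
Let t := drow (tau \o stereo c) y.
Local Notation nu := (conormal (ind_metric X) (@sqn R 3)).

Lemma sphere_grad : t = drow f p *m J^T.
Proof.
have -> : t = drow (f \o stereo c) y.
  by rewrite /t; congr (drow _ y); apply/funext => z /=; rewrite f_tau //; exact: stereo_sphere.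
apply: drow_comp => [k|]; first exact: stereo_diff.
exact: smooth_diff (od_open V) sf Vp.
Qed.

(** Both sides are tangent to the sphere.  The gradient of the boundary value is the
    gradient of [f] minus its normal part, both of which are known on [nu] and
    [jw]. *)
Lemma tangential_grad : t *m s *m J = ja g f p *: (js g f p *: nu p + jc g f p *: jw g f p).
Proof.
have -> : t *m s *m J = drow f p *m (J^T *m s *m J) by rewrite sphere_grad !mulmxA.
have -> : J^T *m s *m J = invmx (g p) - (nu p)^T *m nu p.
  by rewrite -(frame_complete V_sphere V0 pg c y) addrK.
have a0 := ja_gt0 V0 f pg Vp; have W0 := W_gt0 f pg Vp.
rewrite mulmxBr mulmxA.
have -> : drow f p *m (nu p)^T *m nu p = jfnu g f p *: nu p.
  by rewrite /jfnu scale11l; congr (_ *m _); rewrite -[RHS]tr11 trmx_mul trmxK.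
have -> : drow f p *m invmx (g p) = Num.sqrt (1 + gradsq g f p) *: jw g f p.
  by rewrite /jw scalerA /jslope mulfV ?scale1r // gt_eqF // sqrtr_gt0.
move: (nu p) (jw g f p) => n w.
rewrite scalerDr !scalerA /jc /js; move: (ja g f p) a0 => a a0.
rewrite addrC -scaleNr; congr (_ *: _ + _ *: _); field; by rewrite gt_eqF.
Qed.

Lemma slope_ja : 1 + ip s t t = ja g f p ^+ 2.
Proof.
have -> : ip s t t = (t *m s *m J *m (drow f p)^T) 0 0.
  by rewrite /ip {2}sphere_grad trmx_mul trmxK !mulmxA.
have a0 := ja_gt0 V0 f pg Vp; have W0 := W_gt0 f pg Vp.
rewrite tangential_grad comb_mul -/(jfnu g f p).
have -> : (jw g f p *m (drow f p)^T) 0 0 = (Num.sqrt (1 + gradsq g f p))^-1 * gradsq g f p.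
  by rewrite /jw -scalemxAl mxscaleE.
rewrite (ja_sq V0 f pg Vp) /jc /js -addrA; congr (_ + _).
have s0 : Num.sqrt (1 + gradsq g f p) != 0 by rewrite gt_eqF // sqrtr_gt0.
by field; rewrite s0 gt_eqF.
Qed.

Lemma sigma_hatE : sigma_hat X tau c y = J *m gh p *m J^T.
Proof.
rewrite /sigma_hat /graph_metric (surface_metric hX V_sphere VW) -/p -/J -/t sphere_grad.
by rewrite mulmxDr mulmxDl trmx_mul trmxK !mulmxA.
Qed.

Lemma conformal_boundary : Defs.induced gs (stereo c) y = sigma_hat X tau c y.
Proof.
by rewrite sigma_hatE /Defs.induced -/p u1 ?expr1n ?scale1r //; exact: stereo_sphere.
Qed.

Lemma posdef_sigma : posdef (sigma X c y).
Proof. by rewrite (surface_metric hX V_sphere VW); apply: stereo_posdef; exact: pg. Qed.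

Lemma posdef_sigma_hat : posdef (sigma_hat X tau c y).
Proof. by rewrite sigma_hatE; apply: stereo_posdef; apply: posdef_graph; exact: pg. Qed.

Lemma sqrt_det_sigma_hat :
  Num.sqrt (\det (sigma_hat X tau c y)) = ja g f p * Num.sqrt (\det (sigma X c y)).
Proof.
have pS := posdef_sigma; rewrite /sigma_hat /graph_metric det_graph_surface // -/t.
rewrite {2}(surface_metric hX V_sphere VW) -/p -/J -/s slope_ja.
rewrite mulrC sqrtrM ?sqr_ge0 // sqrtr_sqr ger0_norm // ltW //.
exact: (ja_gt0 V0 f pg Vp).
Qed.

(** By [tangential_grad] the gauge and connection terms of the density are those of
    [graph_mean_curv], and the slope factor is the ratio of the area elements.  The
    Schoen--Yau form and the normal derivative of [u] that remain are the flux
    density of [boundary_flux]. *)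
Lemma jang_density :
  hfun X tau (frame3 X) (frame4 X) jphi c y * Num.sqrt (\det (sigma X c y)) =
  mean_curv gs (stereo c) (conormal gs (@sqn R 3) \o stereo c) y
    * Num.sqrt (\det (sigma_hat X tau c y))
  - (volflux g K f u p *m p^T) 0 0 * (4 / (sqn y + 1) ^+ 2).
Proof.
have a0 := ja_gt0 V0 f pg Vp.
have eC : coshR \o jphi \o stereo c = jc g f \o stereo c.
  by apply/funext => z /=; rewrite cosh_jphi.
have eS : sinhR \o jphi \o stereo c = js g f \o stereo c.
  by apply/funext => z /=; rewrite sinh_jphi.
have sC := smooth_jc V0 sg pg sf; have sD := smooth_js V0 sg pg sf.
rewrite (hfun_formula hX V_sphere V0 VW); last 3 first.
- by rewrite eC; exact: smooth_on_sphere.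
- by rewrite eS; exact: smooth_on_sphere.
- by move=> x; exact: cosh_sinh.
rewrite -/p -/J -/s -/t cosh_jphi // sinh_jphi // slope_ja sqrtr_sqr ger0_norm ?ltW //.
have dE (h : 'rV[R]_3 -> R) : smooth (odset V) h -> drow (h \o stereo c) y = drow h p *m J^T.
  move=> sh; apply: drow_comp => [k|]; first exact: stereo_diff.
  exact: smooth_diff (od_open V) sh Vp.
rewrite eC eS (dE _ sC) (dE _ sD) !trmx_mul !trmxK !(mulmxA _ J) tangential_grad.
have sp : sphere p := stereo_sphere c y.
have jp := jang sp.
rewrite (boundary_flux V_sphere V0 K sg pg sf (u1 sp)) -/J -sigma_hatE.
rewrite (mean_curv_conf V_sphere V0 sg pg sf su u_gt0 (u1 sp)).
rewrite -mulrBl sqrt_det_sigma_hat mulrA [_ * ja g f p]mulrC; congr (_ * _).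
have GM := graph_mean_curv V_sphere V0 sg pg sK KT sf jp.
set k := mean_curv gh _ _ _ in GM *; set nh := conormal gh _ _ in GM *.
have -> : ((jY g K f p + 4 *: drow u p) *m nh^T) 0 0 =
   (jY g K f p *m nh^T) 0 0 + 4 * (drow u p *m nh^T) 0 0.
  by move: (jY g K f p) (drow u p) => v w; rewrite mulmxDl -scalemxAl mxaddE mxscaleE.
have -> : k + 4 * (drow u p *m nh^T) 0 0 - ((jY g K f p *m nh^T) 0 0 + 4 * (drow u p *m nh^T) 0 0)
  = k - (jY g K f p *m nh^T) 0 0 by ring.
rewrite {}GM -/J -/s; set Z := js g f p *: nu p + _.
have -> : \sum_i Z 0 i * (jc g f p * pd i (js g f) p - js g f p * pd i (jc g f) p) =
   jc g f p * (Z *m (drow (js g f) p)^T) 0 0 - js g f p * (Z *m (drow (jc g f) p)^T) 0 0.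
  rewrite ![(Z *m _) _ _]mxE !mulr_sumr -sumrB; apply: eq_bigr => i _.
  by rewrite ![_^T _ _]mxE ![drow _ _ _ _]mxE; ring.
have zE (M : 'cV[R]_3) : (ja g f p *: Z *m M) 0 0 = ja g f p * (Z *m M) 0 0.
  by rewrite -scalemxAl mxscaleE.
rewrite -(mulmxA (_ *: Z)) !zE mulmxA; ring.
Qed.
End AtPoint.
End JangGauge.

(** * The reference embedding *)

Section Reference.
Context {R : realType}.

Lemma cov_const n m (A : 'M[R]_n) (F V : 'rV[R]_m -> 'rV[R]_n) x :
  cov (fun=> A) F V x = 'J V x.
Proof.
apply/matrixP => a k; rewrite covE big1 ?addr0 // => i _; apply: big1 => j _.
rewrite (_ : christoffel _ _ _ _ _ = 0) ?mul0r //.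
by rewrite /christoffel big1 ?mulr0 // => l _; rewrite /= !pd_cst addr0 subr0 mulr0.
Qed.

Lemma sherman_morrison n (A : 'M[R]_n) (t : 'rV[R]_n) : posdef A ->
  invmx (A + t^T *m t) = invmx A
    - (1 + ip (invmx A) t t)^-1 *: ((t *m invmx A)^T *m (t *m invmx A)).
Proof.
move=> pA; have Au := posdef_unit pA; have AT := pA.1.
set q := 1 + _; set z := t *m invmx A.
have q0 : q != 0 by rewrite gt_eqF // ltr_pwDl // posdef_ge0 //; exact: posdef_inv.
have zA : z *m A = t by rewrite /z mulmxKV.
have Az : A *m z^T = t^T by rewrite -[LHS]trmxK trmx_mul trmxK AT zA.
have tz : t *m z^T = (q - 1)%:M.
  apply/matrixP => a b; rewrite !ord1 [RHS]mxE eqxx mulr1n /q addrAC subrr add0r /ip.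
  by rewrite /z trmx_mul trmx_inv AT mulmxA.
have e : (A + t^T *m t) *m (invmx A - q^-1 *: (z^T *m z)) = 1%:M.
  rewrite mulmxBr !mulmxDl mulmxV // -!scalemxAr -(mulmxA t^T t) !(mulmxA A) Az.
  have e2 : t^T *m t *m (z^T *m z) = (q - 1) *: (t^T *m z).
    by rewrite -(mulmxA t^T t) (mulmxA t) tz mul_scalar_mx -[LHS]scalemxAr.
  rewrite -/z e2 -scalerDr.
  have -> : t^T *m z + (q - 1) *: (t^T *m z) = q *: (t^T *m z).
    by rewrite -[X in X + _]scale1r -scalerDl addrC subrK.
  by rewrite scalerA mulVf // scale1r addrK.
have Bu : A + t^T *m t \in unitmx by case/mulmx1_unit: e.
by rewrite -[LHS]mulmx1 -e mulKmx.
Qed.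

(** Used to compare the two stereographic charts. *)
Lemma mean_curv_reparam m n (G : 'rV[R]_n -> 'M[R]_n) (F N : 'rV[R]_m -> 'rV[R]_n)
    (psi : 'rV[R]_m -> 'rV[R]_m) y :
  (forall i, differentiable (fun z => psi z 0 i) y) ->
  (forall i, differentiable (fun z => F z 0 i) (psi y)) ->
  (forall i, differentiable (fun z => N z 0 i) (psi y)) ->
  'J psi y \in unitmx -> Defs.induced G F (psi y) \in unitmx ->
  mean_curv G (F \o psi) (N \o psi) y = mean_curv G F N (psi y).
Proof.
move=> dp dF dN Ju Iu; rewrite /mean_curv /second_form (cov_comp G dp dF dN).
have JF := J_comp dp dF.
have -> : Defs.induced G (F \o psi) y = 'J psi y *m Defs.induced G F (psi y) *m ('J psi y)^T.
  by rewrite /Defs.induced JF trmx_mul !mulmxA.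
rewrite JF; move: ('J psi y) Ju (Defs.induced G F (psi y)) Iu => P Pu I Iu /=.
move: (cov G F N (psi y)) (G (F (psi y))) ('J F (psi y)) => C A J.
have PTu : P^T \in unitmx by rewrite unitmx_tr.
have -> : invmx (P *m I *m P^T) = invmx P^T *m invmx I *m invmx P.
  have e : P *m I *m P^T *m (invmx P^T *m invmx I *m invmx P) = 1%:M.
    by rewrite !mulmxA mulmxK // mulmxK // mulmxV.
  have Qu : P *m I *m P^T \in unitmx by case/mulmx1_unit: e.
  by rewrite -[LHS]mulmx1 -e mulKmx.
rewrite trmx_mul !mulmxA mxtrace_mulC !mulmxA mulmxV // mul1mx.
by rewrite mulmxKV.
Qed.

Variables (T0 : 'rV[R]_4) (L : 'M[R]_(3, 4)).
Hypothesis obs : observer T0 L.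
Local Notation eta := (@Defs.minkowski R).

Let TT : T0 *m eta *m T0^T = (-1)%:M.
Proof.
by case: obs => h _ _ _; apply/matrixP => a b; rewrite !ord1 [RHS]mxE eqxx mulr1n -h.
Qed.
Let LL : L *m eta *m L^T = 1%:M. Proof. by case: obs. Qed.
Let LT : L *m eta *m T0^T = 0. Proof. by case: obs. Qed.
Let etaT : eta^T = eta. Proof. by rewrite /Defs.minkowski tr_diag_mx. Qed.
Let TL : T0 *m eta *m L^T = 0.
Proof. by have := congr1 trmx LT; rewrite !trmx_mul trmxK etaT trmx0 mulmxA. Qed.

(* A surface in a spacelike hyperplane of Minkowski space, with unit normal [nrm],
   is lifted by [t] in the orthogonal direction. *)
Variables (phi nrm : 'rV[R]_2 -> 'rV[R]_3) (t : 'rV[R]_2 -> R) (sg : 'rV[R]_2 -> 'M[R]_2).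
Hypothesis sphi : smooth_mx setT phi.
Hypothesis snrm : smooth_mx setT nrm.
Hypothesis st : smooth setT t.
Hypothesis phi_isom : forall v, 'J phi v *m ('J phi v)^T = sg v + (drow t v)^T *m drow t v.
Hypothesis nrm_orth : forall v, nrm v *m ('J phi v)^T = 0.
Hypothesis psg : forall v, posdef (sg v).

Let i0 v := phi v *m L + t v *: T0.

Lemma smooth_lift : smooth_mx setT i0.
Proof.
apply: smooth_addmx; first exact: openT.
  apply: smooth_mulmx => //; first exact: openT.
  by move=> i j; exact: smooth_cst.
by apply: smooth_scalemx => //; [exact: openT|move=> i j; exact: smooth_cst].
Qed.

Lemma J_lift v : 'J i0 v = 'J phi v *m L + (drow t v)^T *m T0.
Proof.
have sL : smooth_mx setT (fun _ : 'rV[R]_2 => L) by move=> i j; exact: smooth_cst.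
have sT : smooth_mx setT (fun _ : 'rV[R]_2 => T0) by move=> i j; exact: smooth_cst.
apply/row_matrixP => a; rewrite (row_J a openT smooth_lift) //.
rewrite (pdmxD a (smooth_mulmx openT sphi sL) (smooth_scalemx openT st sT)) //.
rewrite (pdmxM a openT sphi sL) // pdmx_cst mulmx0 addr0.
rewrite (pdmxZ a st sT) // pdmx_cst scaler0 addr0.
rewrite raddfD /= !row_mul (row_J a openT sphi) //; congr (_ + _).
by apply/rowP => k; rewrite !mxE big_ord1 !mxE.
Qed.

Lemma lift_metric v : 'J i0 v *m eta *m ('J i0 v)^T = sg v.
Proof.
rewrite J_lift trD !trmx_mul trmxK.
have -> : sg v = 'J phi v *m ('J phi v)^T - (drow t v)^T *m drow t v.
  by rewrite phi_isom addrK.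
move: ('J phi v) (drow t v) => P d.
have -> : (P *m L + d^T *m T0) *m eta *m (L^T *m P^T + T0^T *m d) =
   P *m (L *m eta *m L^T) *m P^T + P *m (L *m eta *m T0^T) *m d
   + (d^T *m (T0 *m eta *m L^T) *m P^T + d^T *m (T0 *m eta *m T0^T) *m d).
  by rewrite !(mulmxDl, mulmxDr) !mulmxA addrACA.
rewrite LL LT TL TT mulmx1 !mulmx0 !mul0mx add0r addr0.
by rewrite mul_mx_scalar scaleN1r mulNmx.
Qed.

Lemma lift_normal v : L *m eta *m ('J i0 v)^T = ('J phi v)^T.
Proof. by rewrite J_lift trD !trmx_mul trmxK mulmxDr !mulmxA LL LT mul1mx mul0mx addr0. Qed.

Let a v := Num.sqrt (1 + ip (invmx (sg v)) (drow t v) (drow t v)).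

(** The lift shares the spacelike normal of the surface, and the second form along
    it is the Euclidean one.  Its trace is taken with the inverse of [sg] instead of
    the inverse of [sg + dt^2]; the difference is a rank one term
    ([sherman_morrison]), which the connection one-form compensates. *)
Lemma reference_densityE v :
  h_density (fun=> eta) i0 t (fun w => nrm w *m L)
    (fun w => (a w)^-1 *: (T0 + drow t w *m invmx (sg w) *m 'J i0 w)) v =
  a v * mean_curv (@euclid R 3) phi nrm v.
Proof.
have sL : smooth_mx setT (fun _ : 'rV[R]_2 => L) by move=> i j; exact: smooth_cst.
pose U := @OpenDom R 4 setT openT 0 I.
have sc : smooth_mx (odset U) (fun _ : 'rV[R]_4 => eta) by move=> i j; exact: smooth_cst.
have sN := smooth_mulmx openT snrm sL.
have NJ w : setT w -> nrm w *m L *m eta *m ('J i0 w)^T = 0.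
  by move=> _; rewrite -!mulmxA (mulmxA L) lift_normal nrm_orth.
have Hn := mean_curv_vec_normal (U := U) sc (fun x _ => etaT) (fun x _ => minkowski_unit)
  openT (fun x _ => I) smooth_lift sN NJ (I : setT v).
have isE w : Defs.induced (fun=> eta) i0 w = sg w by exact: lift_metric.
have JN : 'J (fun w => nrm w *m L) v = 'J nrm v *m L.
  apply/row_matrixP => i; rewrite (row_J i openT sN) // (pdmxM i openT snrm sL) //.
  by rewrite pdmx_cst mulmx0 addr0 row_mul (row_J i openT snrm).
rewrite /h_density /= Hn mulrNN isE -/(a v) /mean_curv isE /second_form !cov_const JN.
set A0 := 'J nrm v *m ('J phi v)^T.
have -> : 'J nrm v *m L *m eta *m ('J i0 v)^T = A0 by rewrite -!mulmxA (mulmxA L) lift_normal.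
have -> : 'J nrm v *m euclid (phi v) *m ('J phi v)^T = A0 by rewrite /euclid mulmx1.
set s := invmx (sg v); set z := drow t v *m s.
have W0 : 0 < 1 + ip s (drow t v) (drow t v).
  by rewrite ltr_pwDl // posdef_ge0 //; exact: posdef_inv.
have a0 : 0 < a v by rewrite sqrtr_gt0.
have sT : s^T = s by rewrite /s trmx_inv (psg v).1.
have -> : ip eta (z *m ('J nrm v *m L)) ((a v)^-1 *: (T0 + z *m 'J i0 v)) =
    (a v)^-1 * (z *m A0 *m z^T) 0 0.
  rewrite ipZr; congr (_ * _); rewrite /ip trD mulmxDr mxaddE trmx_mul.
  have -> : z *m ('J nrm v *m L) *m eta *m T0^T = 0.
    by rewrite -!mulmxA (mulmxA L) LT !mulmx0.
  rewrite mx0E add0r; congr (_ 0 0).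
  by rewrite /A0 -!mulmxA (mulmxA L) (mulmxA (L *m eta)) lift_normal !mulmxA.
have -> : Defs.induced (@euclid R 3) phi v = sg v + (drow t v)^T *m drow t v.
  by rewrite /Defs.induced /euclid mulmx1 phi_isom.
rewrite sherman_morrison // -/s -/z mulmxBl raddfB -scalemxAl /= mxtraceZ mulrBr.
congr (_ - _).
have -> : \tr (z^T *m z *m A0) = (z *m A0 *m z^T) 0 0.
  by rewrite -[in LHS]mulmxA mxtrace_mulC trace_mx11.
rewrite mulrA; congr (_ * _).
have e : a v ^+ 2 = 1 + ip s (drow t v) (drow t v) by rewrite sqr_sqrtr // ltW.
by rewrite -e; field; rewrite gt_eqF.
Qed.
End Reference.

(** * Integration over the plane *)

Section Plane.
Context {R : realType}.
Local Notation mu := (@lebesgue_measure R).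
Local Notation mu2 := (mu \x mu)%E.

Definition rat_box (q : (rat * rat) * (rat * rat)) : set (R * R) :=
  (`](ratr q.1.1 : R), (ratr q.1.2 : R)[%classic) `*` (`](ratr q.2.1 : R), (ratr q.2.2 : R)[%classic).

(** The rational boxes form a countable base of the plane. *)
Lemma open_plane_measurable (O : set (R * R)) : open O -> measurable O.
Proof.
move=> oO.
have -> : O = \bigcup_n (if @unpickle ((rat * rat) * (rat * rat))%type n is Some q
    then [set z | rat_box q z /\ rat_box q `<=` O] else set0).
  apply/seteqP; split => [[x y] Oxy|z [n _]]; last by case: unpickle => // q [qz]; apply.
  have : nbhs (x, y) O by apply: open_nbhs_nbhs; split.
  case=> -[P Q] /= [/nbhs_ballP[e /= e0 eP] /nbhs_ballP[d /= d0 dQ]] PQ.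
  have near_rat (t r : R) : 0 < r -> exists a b : rat, [/\ ratr a < t, t < ratr b &
      forall s, ratr a < s < ratr b -> ball t r s].
    move=> r0.
    have [a] : exists a : rat, ratr a \in `](t - r), t[ by apply: rat_in_itvoo; rewrite ltrBlDr ltrDl.
    have [b] : exists b : rat, ratr b \in `]t, (t + r)[ by apply: rat_in_itvoo; rewrite ltrDl.
    rewrite !in_itv /= => /andP[b1 b2] /andP[a1 a2]; exists a, b; split => // s /andP[s1 s2].
    by rewrite /ball /= ltr_distlC (lt_trans a1 s1) (lt_trans s2 b2).
  have [a [b [a1 b1 ab]]] := near_rat x e e0.
  have [c [d' [c1 d1 cd]]] := near_rat y d d0.
  exists (pickle ((a, b), (c, d'))); first by []. 
  rewrite pickleK; split.
    by split; rewrite /= in_itv /= ?a1 ?b1 ?c1 ?d1.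
  move=> [s t] [] /=; rewrite !in_itv /= => hs ht; apply: PQ; split; first exact/eP/ab.
  exact/dQ/cd.
apply: bigcupT_measurable => n; case: unpickle => // q.
have [h|h] := pselect (rat_box q `<=` O); last first.
  by rewrite (_ : [set _ | _] = set0) //; apply/seteqP; split => // z [].
rewrite (_ : [set _ | _] = rat_box q); last by apply/seteqP; split => // z [].
by apply: measurableX; exact: measurable_itv.
Qed.

Lemma continuous_plane_measurable (f : R * R -> R) : continuous f -> measurable_fun setT f.
Proof.
move=> /continuousP cf; apply: (measurability _ (RGenOpens.measurableE R)).
move=> _ [_ [a [b ->] <-]]; rewrite setTI; apply: open_plane_measurable.
exact/cf/interval_open.
Qed.

Lemma integral_oneDsqrV : (\int[mu]_x ((oneDsqr x)^-1)%:E = pi%:E)%E.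
Proof.
rewrite ge0_symfun_integralT.
- rewrite -set_itvcy integral0y_oneDsqr -EFinM; congr (_%:E); by field.
- by move=> x /=; rewrite invr_ge0 (le_trans ler01 (oneDsqr_ge1 x)).
- exact: continuous_oneDsqrV.
- by move=> x /=; rewrite /oneDsqr sqrrN.
Qed.

(** Conformal images of the plane have finite area: the product kernel
    [1 / ((1 + x^2) (1 + y^2))] dominates. *)
Lemma decay_integrable (f : R * R -> R) (C : R) : continuous f ->
  (forall z, `|f z| <= C / (1 + z.1 ^+ 2 + z.2 ^+ 2) ^+ 2) -> mu2.-integrable setT (EFin \o f).
Proof.
move=> cf fC.
have C0 : 0 <= C.
  have := fC (0, 0); rewrite /= expr0n !addr0 expr1n divr1; exact: le_trans.
pose h (z : R * R) : R := C * ((oneDsqr z.1)^-1 * (oneDsqr z.2)^-1).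
have ch : continuous h.
  move=> z; apply: cvgM; first exact: cvg_cst.
  apply: cvgM.
    by apply: (@continuous_comp _ _ _ fst (fun x : R => (oneDsqr x)^-1));
      [exact: cvg_fst|exact: continuous_oneDsqrV].
  by apply: (@continuous_comp _ _ _ snd (fun x : R => (oneDsqr x)^-1));
    [exact: cvg_snd|exact: continuous_oneDsqrV].
have mh := continuous_plane_measurable ch.
have h0 z : 0 <= h z by rewrite !mulr_ge0 // invr_ge0.
have ih : mu2.-integrable setT (EFin \o h).
  apply/integrableP; split; first exact/measurable_EFinP.
  have -> : (\int[mu2]_z `|(EFin \o h) z| = \int[mu2]_z (h z)%:E)%E.
    by apply: eq_integral => z _ /=; rewrite ger0_norm.
  rewrite (@fubini_tonelli1 _ _ _ _ _ mu mu (EFin \o h)); last 2 first.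
  - exact/measurable_EFinP.
  - by move=> z; rewrite lee_fin.
  rewrite /fubini_F /=.
  have mo : measurable_fun setT (fun y : R => ((oneDsqr y)^-1)%:E).
    by apply/measurable_EFinP; apply: continuous_measurable_fun; exact: continuous_oneDsqrV.
  have inner x : (\int[mu]_y (h (x, y))%:E = (C * (oneDsqr x)^-1)%:E * pi%:E)%E.
    rewrite -integral_oneDsqrV -ge0_integralZl_EFin //.
    - by apply: eq_integral => y _; rewrite /h /= mulrA EFinM.
    - by rewrite mulr_ge0 // invr_ge0 (le_trans ler01 (oneDsqr_ge1 x)).
  under eq_integral do rewrite inner.
  have -> : (\int[mu]_x ((C * (oneDsqr x)^-1)%:E * pi%:E) = (C * pi)%:E * pi%:E)%E.
    rewrite -[in RHS]integral_oneDsqrV -ge0_integralZl_EFin //.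
    - by apply: eq_integral => x _; rewrite -!EFinM mulrAC.
    - by rewrite mulr_ge0 // pi_ge0.
  by rewrite -EFinM ltry.
apply: (le_integrable _ _ _ ih) => //.
  by apply/measurable_EFinP; exact: continuous_plane_measurable.
move=> z _ /=; rewrite lee_fin (le_trans (fC z)) // ger0_norm // ler_wpM2l //.
rewrite -invfM lef_pV2 ?posrE; last 2 first.
- by rewrite exprn_gt0 // -addrA ltr_pwDl // addr_ge0 // sqr_ge0.
- by rewrite mulr_gt0 // (lt_le_trans ltr01).
rewrite /oneDsqr; have := sqr_ge0 z.1; have := sqr_ge0 z.2.
move: (z.1 ^+ 2) (z.2 ^+ 2) => a b a0 b0.
rewrite -subr_ge0 (_ : _ - _ = b ^+ 2 + a ^+ 2 + b + a + b * a); last by ring.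
by rewrite !addr_ge0 ?sqr_ge0 // mulr_ge0.
Qed.

Definition box (N : R) : set (R * R) := (`[(- N), N]%classic) `*` (`[(- N), N]%classic).

Lemma box_measurable N : measurable (box N).
Proof. by apply: measurableX; exact: measurable_itv. Qed.

Lemma boxE N z : box N z <-> (`|z.1| <= N) /\ (`|z.2| <= N).
Proof. by rewrite /box /= !in_itv /= -!ler_norml. Qed.

Lemma box_finite N : (mu2 (box N) < +oo)%E.
Proof.
rewrite product_measure1E; [|exact: measurable_itv|exact: measurable_itv].
have muE : mu `[(- N), N]%classic = (if - N < N then N - (- N) else 0)%:E.
  by rewrite lebesgue_measure_itv /= lte_fin; case: ifP.
change (mu `[(- N)%R, N]%classic * mu `[(- N)%R, N]%classic < +oo)%E.
by rewrite muE -EFinM ltry.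
Qed.

Lemma box_compact N : compact (box N).
Proof. by apply: compact_setX; exact: segment_compact. Qed.

Lemma box_integrable N (f : R * R -> R) : continuous f -> mu2.-integrable (box N) (EFin \o f).
Proof.
move=> cf; apply: measurable_bounded_integrable.
- exact: box_measurable.
- exact: box_finite.
- by apply: measurable_funTS; exact: continuous_plane_measurable.
- have [B [_ hB]] : bounded_set (f @` box N).
    apply: compact_bounded; apply: continuous_compact; last exact: box_compact.
    exact: continuous_subspaceT.
  by exists B; split => [|r Br z bz]; [exact: num_real|apply: hB => //; exists z].
Qed.

(** The symmetry that turns statements about horizontal derivatives into statements
    about vertical ones. *)
Lemma box_swap N (f : R * R -> R) : continuous f ->
  \int[mu2]_(z in box N) f z = \int[mu2]_(z in box N) f (z.2, z.1).
Proof.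
move=> cf; pose g := f \_ (box N); pose g' := (fun z => f (z.2, z.1)) \_ (box N).
have gE z : g' z = g (z.2, z.1).
  rewrite /g /g' !patchE; congr (if _ then _ else _).
  by apply/idP/idP; rewrite !inE => -[].
have cf' : continuous (fun z : R * R => f (z.2, z.1)).
  by move=> z; apply: (@continuous_comp _ _ _ (@unstable.swap R R) f); [exact: swap_continuous|exact: cf].
have ig : mu2.-integrable setT (EFin \o g).
  by rewrite -restrict_EFin; apply/integrable_restrict => //;
    [exact: box_measurable|rewrite setTI; exact: box_integrable].
have ig' : mu2.-integrable setT (EFin \o g').
  by rewrite -restrict_EFin; apply/integrable_restrict => //;
    [exact: box_measurable|rewrite setTI; exact: box_integrable].
rewrite /Rintegral; congr fine.
have restr (k : R * R -> R) : (\int[mu2]_(z in box N) (k z)%:E = \int[mu2]_z ((k \_ (box N)) z)%:E)%E.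
  by rewrite integral_mkcond; apply: eq_integral => z _; rewrite !patchE; case: ifP.
rewrite (restr f) (restr (fun z => f (z.2, z.1))) -/g -/g'.
rewrite -(integral12_prod_meas1 ig) -(integral21_prod_meas1 ig').
apply: eq_integral => x _; apply: eq_integral => y _ /=.
by rewrite gE.
Qed.

(** Fubini's theorem and the fundamental theorem of calculus on each horizontal
    line. *)
Lemma box_derive (a a1 : R * R -> R) (N c : R) : 0 < N -> continuous a1 ->
  (forall x y : R, is_derive x (1 : R) (fun t : R => a (t, y)) (a1 (x, y))) ->
  (forall y : R, `|y| <= N -> `|a (N, y) - a (- N, y)| <= c) ->
  `|\int[mu2]_(z in box N) a1 z| <= 2 * N * c.
Proof.
move=> N0 ca1 da hc.
have NN : - N < N by rewrite gtrN.
pose g := a1 \_ (box N).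
have ig : mu2.-integrable setT (EFin \o g).
  by rewrite -restrict_EFin; apply/integrable_restrict => //;
    [exact: box_measurable|rewrite setTI; exact: box_integrable].
pose b y := if `|y| <= N then a (N, y) - a (- N, y) else 0.
have ca1y y : continuous (fun x => a1 (x, y)).
  move=> x; apply: (@continuous_comp _ _ _ (fun x : R => (x, y)) a1); last exact: ca1.
  by apply: (@cvg_pair R R R (nbhs x) (nbhs x) (nbhs y) _ _ _ id (cst y)); [exact: cvg_id|exact: cvg_cst].
have inner y : (\int[mu]_x (g (x, y))%:E = (b y)%:E)%E.
  have [yN|yN] := boolP (`|y| <= N); rewrite /b ?yN ?(negbTE yN); last first.
    rewrite integral0_eq // => x _; rewrite /g patchE memNset //.
    by move=> /boxE[_ /=]; exact/negP.
  have -> : (\int[mu]_x (g (x, y))%:E = \int[mu]_(x in `[(- N)%R, N]) (a1 (x, y))%:E)%E.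
    rewrite [RHS]integral_mkcond; apply: eq_integral => x _.
    rewrite /g !patchE; case: ifPn => h1; case: ifPn => h2 //.
      by move/set_mem/boxE : h1 => -[/=]; rewrite ler_norml => xN _; move: h2; rewrite notin_setE /= in_itv /= xN.
    move: h1; rewrite notin_setE; move/set_mem: h2 => /=; rewrite in_itv /= -ler_norml => xN.
    by case; apply/boxE.
  rewrite (@continuous_FTC2 _ _ (fun x => a (x, y))) ?EFinB //.
  - exact/continuous_subspaceT/ca1y.
  - have dd x : derivable (fun t => a (t, y)) x 1 by exact: ex_derive.
    have cc x : {for x, continuous (fun t => a (t, y))}.
      exact/differentiable_continuous/derivable1_diffP.
    split => //; first by apply: cvg_at_right_filter; exact: cc.
    by apply: cvg_at_left_filter; exact: cc.
  - by move=> x _; rewrite derive1E; exact: derive_val.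
have intE : (\int[mu2]_z (g z)%:E = \int[mu]_y (b y)%:E)%E.
  by rewrite -(integral21_prod_meas1 ig) /fubini_G; apply: eq_integral => y _ /=; rewrite inner.
have restr : (\int[mu2]_(z in box N) (a1 z)%:E = \int[mu2]_z (g z)%:E)%E.
  by rewrite integral_mkcond; apply: eq_integral => z _; rewrite /g !patchE; case: ifP.
rewrite /Rintegral restr intE.
have mb : measurable_fun setT (EFin \o b).
  by apply: eq_measurable_fun (measurable_fubini_G ig) => y _; rewrite /fubini_G /= inner.
have c0 : 0 <= c.
  have := hc 0; rewrite normr0 ltW // => /(_ isT); exact: le_trans.
have fine_bound (x : \bar R) (r : R) : (`|x| <= r%:E)%E -> `|fine x| <= r.
  by case: x => [x||] //=; rewrite lee_fin.
apply: fine_bound.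
refine (le_trans (@le_abse_integral _ _ _ mu setT (EFin \o b) measurableT mb) _).
apply: (@le_trans _ _ (\int[mu]_(y in `[(- N)%R, N]) c%:E)%E).
  rewrite [leRHS]integral_mkcond; apply: ge0_le_integral => //.
  - exact: measurableT_comp.
  - by apply/(measurable_restrictT _ (measurable_itv `[(- N)%R, N])).
  move=> y _; rewrite patchE; case: ifPn => h.
    by rewrite lee_fin /b; case: ifP => [/hc //|_]; rewrite normr0.
  move: h; rewrite notin_setE /= in_itv /= -ler_norml => /negP h.
  by rewrite /b (negbTE h) normr0.
rewrite integral_cst; last exact: measurable_itv.
have muE : mu `[(- N), N]%classic = (2 * N)%:E.
  by rewrite lebesgue_measure_itv /= lte_fin NN -EFinB; congr (_%:E); ring.
change (c%:E * mu `[(- N)%R, N]%classic <= (2 * N * c)%:E)%E.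
by rewrite muE -EFinM lee_fin mulrC.
Qed.
End Plane.

(** * The flux through the unit sphere in stereographic coordinates *)

Section PlaneFunctions.
Context {R : realType}.
Local Notation mu := (@lebesgue_measure R).
Local Notation mu2 := (mu \x mu)%E.

Lemma rv2_0 (z : R * R) : rv2 z 0 0 = z.1. Proof. by rewrite mxE. Qed.
Lemma rv2_1 (z : R * R) : rv2 z 0 1 = z.2. Proof. by rewrite mxE. Qed.

Lemma sqn_rv2 (z : R * R) : sqn (rv2 z) = z.1 ^+ 2 + z.2 ^+ 2.
Proof. by rewrite /sqn sum2 rv2_0 rv2_1. Qed.

Lemma continuous_rv2 : continuous (@rv2 R).
Proof.
move=> z; apply: continuous_rV => i.
rewrite (_ : (fun y => rv2 y 0 i) = if i == 0 then fst else snd).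
  by case: (i == 0); [exact: cvg_fst|exact: cvg_snd].
by apply/funext => y; rewrite mxE; case: (i == 0).
Qed.

Lemma smooth_plane_continuous (h : 'rV[R]_2 -> R) : smooth setT h -> continuous (h \o @rv2 R).
Proof.
move=> sh z; apply: continuous_comp; first exact: continuous_rv2.
exact: (smooth_cont sh).
Qed.

Lemma is_derive_rv2_1 (h : 'rV[R]_2 -> R) (x y : R) : smooth setT h ->
  is_derive x (1 : R) (fun t : R => h (rv2 (t, y))) (pd 0 h (rv2 (x, y))).
Proof.
move=> sh.
have e t : rv2 (t, y) = t *: delta_mx 0 0 + rv2 (0, y).
  by apply/rowP; apply: ind2; rewrite !mxE /= ?mulr1 ?mulr0 ?addr0 ?add0r.
have d := @line_derive _ _ h (rv2 (0, y)) (delta_mx 0 0) x.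
rewrite -e in d; have {d} := d (((sh 1%N).2 0).1 _ I).
by rewrite (_ : (fun s => _) = fun t => h (rv2 (t, y))) //; apply/funext => t; rewrite e.
Qed.

Lemma is_derive_rv2_2 (h : 'rV[R]_2 -> R) (x y : R) : smooth setT h ->
  is_derive y (1 : R) (fun t : R => h (rv2 (x, t))) (pd 1 h (rv2 (x, y))).
Proof.
move=> sh.
have e t : rv2 (x, t) = t *: delta_mx 0 1 + rv2 (x, 0).
  by apply/rowP; apply: ind2; rewrite !mxE /= ?mulr1 ?mulr0 ?addr0 ?add0r.
have d := @line_derive _ _ h (rv2 (x, 0)) (delta_mx 0 1) y.
rewrite -e in d; have {d} := d (((sh 1%N).2 1).1 _ I).
by rewrite (_ : (fun s => _) = fun t => h (rv2 (x, t))) //; apply/funext => t; rewrite e.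
Qed.

Lemma box_pd0 (h : 'rV[R]_2 -> R) (N c : R) : 0 < N -> smooth setT h ->
  (forall x y : R, `|x| = N -> `|h (rv2 (x, y))| <= c) ->
  `|\int[mu2]_(z in box N) pd 0 h (rv2 z)| <= 4 * N * c.
Proof.
move=> N0 sh hc; rewrite (_ : 4 * N * c = 2 * N * (2 * c)); last by ring.
apply: (@box_derive _ (h \o @rv2 R) (pd 0 h \o @rv2 R)) => //.
- exact/smooth_plane_continuous/smooth_pd.
- by move=> x y; exact: is_derive_rv2_1.
move=> y _; apply: le_trans (ler_normB _ _) _; rewrite mulrDl !mul1r.
by apply: lerD; apply: hc; rewrite ?normrN gtr0_norm.
Qed.

Lemma box_pd1 (h : 'rV[R]_2 -> R) (N c : R) : 0 < N -> smooth setT h ->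
  (forall x y : R, `|y| = N -> `|h (rv2 (x, y))| <= c) ->
  `|\int[mu2]_(z in box N) pd 1 h (rv2 z)| <= 4 * N * c.
Proof.
move=> N0 sh hc; rewrite (_ : 4 * N * c = 2 * N * (2 * c)); last by ring.
rewrite box_swap; last exact/smooth_plane_continuous/smooth_pd.
apply: (@box_derive _ (fun z => h (rv2 (z.2, z.1))) (fun z => pd 1 h (rv2 (z.2, z.1)))) => //.
- move=> z; apply: (@continuous_comp _ _ _ (@unstable.swap R R) (pd 1 h \o @rv2 R)).
    exact: swap_continuous.
  exact/smooth_plane_continuous/smooth_pd.
- by move=> x y; exact: is_derive_rv2_2.
move=> y _; apply: le_trans (ler_normB _ _) _; rewrite mulrDl !mul1r.
by apply: lerD; apply: hc; rewrite ?normrN gtr0_norm.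
Qed.

(** Dominated convergence along the boxes of integral size. *)
Lemma box_exhausts (f : R * R -> R) (C : R) : continuous f -> mu2.-integrable setT (EFin \o f) ->
  (forall N : R, 0 < N -> - (C / N) <= \int[mu2]_(z in box N) f z) ->
  0 <= \int[mu2]_z f z.
Proof.
move=> cf intf hN.
have h := @dominated_cvg _ _ _ mu2 setT measurableT
  (fun n => EFin \o (f \_ (box n.+1%:R))) (EFin \o f) (fun z => `|(f z)%:E|%E).
have lim : (\int[mu2]_z ((f \_ (box n.+1%:R)) z)%:E)%E @[n --> \oo] --> (\int[mu2]_z (f z)%:E)%E.
  apply: h => //.
  - move=> n; apply/measurable_EFinP.
    apply/(measurable_restrictT _ (box_measurable n.+1%:R)); apply: measurable_funTS.
    exact: continuous_plane_measurable.
  - move=> z _; apply: cvg_near_cst.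
    exists (Num.bound (`|z.1| + `|z.2|)) => // n /= hn.
    rewrite patchE mem_set //; apply/boxE.
    have b : `|z.1| + `|z.2| <= n.+1%:R.
      apply: le_trans (ltW (archi_boundP _)) _; first by rewrite addr_ge0.
      by rewrite ler_nat ltnW.
    by split; apply: le_trans b; rewrite ?lerDl ?lerDr.
  - exact: integrable_abse.
  - by move=> n z _; rewrite /= patchE; case: ifP => // _; rewrite normr0 lee_fin.
have low : (- (C / n.+1%:R))%:E @[n --> \oo] --> (0 : \bar R).
  apply: cvg_EFin; first exact: nearW.
  rewrite -oppr0; apply: cvgN; rewrite -(mulr0 C); apply: cvgMr.
  exact: cvg_harmonic.
have : (0 <= \int[mu2]_z (f z)%:E)%E.
  apply: (lee_cvg_to low lim); apply: nearW => n.
  suff -> : (\int[mu2]_z ((f \_ (box n.+1%:R)) z)%:E = (\int[mu2]_(z in box n.+1%:R) f z)%:E)%E.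
    by rewrite lee_fin hN.
  rewrite /Rintegral fineK; last first.
    by apply: integrable_fin_num; [exact: box_measurable|exact: box_integrable].
  by rewrite [RHS]integral_mkcond; apply: eq_integral => z _; rewrite !patchE; case: ifP.
by rewrite /Rintegral; apply: fine_ge0.
Qed.
End PlaneFunctions.

Lemma ball_compact (R : realType) n (r : R) : 0 <= r -> compact [set x : 'rV[R]_n | sqn x <= r ^+ 2].
Proof.
move=> r0; have cs : continuous (@sqn R n) by move=> x; exact: (smooth_cont (smooth_sqn openT)).
apply: bounded_closed_compact; last first.
  rewrite (_ : mkset _ = @sqn R n @^-1` [set t | t <= r ^+ 2]) //.
  by apply: closed_comp => // x _; exact: cs.
exists r; split; first exact: num_real.
move=> t ht x Kx; apply: normr_le_coord => [|i j]; first by rewrite (le_trans r0) // ltW.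
rewrite (ord1 i); apply: le_trans (ltW ht).
rewrite -(@ler_pXn2r _ 2) ?nnegrE // real_normK ?num_real //; apply: le_trans Kx.
by rewrite /sqn (bigD1 j) //= lerDl sumr_ge0 // => k _; rewrite sqr_ge0.
Qed.

Section Flux.
Context {R : realType}.
Local Notation mu := (@lebesgue_measure R).
Local Notation mu2 := (mu \x mu)%E.

Definition triple (a b c : 'I_3 -> R) : R :=
  a o0 * (b o1 * c o2 - b o2 * c o1) + a o1 * (b o2 * c o0 - b o0 * c o2)
  + a o2 * (b o0 * c o1 - b o1 * c o0).

Lemma triple_bound a b c (A B C : R) : (forall k, `|a k| <= A) -> (forall k, `|b k| <= B) ->
  (forall k, `|c k| <= C) -> `|triple a b c| <= 6 * (A * B * C).
Proof.
move=> ha hb hc.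
have m (p q r : 'I_3) : `|a p * (b q * c r)| <= A * B * C.
  by rewrite !normrM -mulrA; do 2![apply: ler_pM => //; rewrite ?mulr_ge0 ?normr_ge0 //].
have d (p q r q' r' : 'I_3) : `|a p * (b q * c r - b q' * c r')| <= 2 * (A * B * C).
  rewrite mulrBr; apply: le_trans (ler_normB _ _) _.
  by rewrite mulrDl !mul1r lerD.
rewrite /triple (_ : 6 * _ = 2 * (A * B * C) + 2 * (A * B * C) + 2 * (A * B * C)); last by ring.
by do 2![apply: le_trans (ler_normD _ _) _; apply: lerD => //].
Qed.

Lemma smooth_triple n (a b c : 'I_3 -> 'rV[R]_n -> R) :
  (forall k, smooth setT (a k)) -> (forall k, smooth setT (b k)) -> (forall k, smooth setT (c k)) ->
  smooth setT (fun u => triple (a^~ u) (b^~ u) (c^~ u)).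
Proof.
move=> ha hb hc; have oT := @openT 'rV[R]_n.
have m i j : smooth setT (fun u => b i u * c j u - b j u * c i u).
  by apply: smoothD => //; [exact: smoothM|apply: smoothN => //; exact: smoothM].
have t p i k := smoothM oT (ha p) (m i k).
exact: smoothD oT (smoothD oT (t _ _ _) (t _ _ _)) (t _ _ _).
Qed.

Lemma pd_triple n (a b c : 'I_3 -> 'rV[R]_n -> R) j u :
  (forall k, smooth setT (a k)) -> (forall k, smooth setT (b k)) -> (forall k, smooth setT (c k)) ->
  pd j (fun u => triple (a^~ u) (b^~ u) (c^~ u)) u =
  triple (fun k => pd j (a k) u) (b^~ u) (c^~ u) + triple (a^~ u) (fun k => pd j (b k) u) (c^~ u)
  + triple (a^~ u) (b^~ u) (fun k => pd j (c k) u).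
Proof.
move=> ha hb hc; have oT := @openT 'rV[R]_n.
have m p q : smooth setT (fun u => b p u * c q u) by exact: smoothM.
have m2 i k : smooth setT (fun u => b i u * c k u - b k u * c i u).
  by apply: smoothD => //; apply: smoothN.
have am p i k : smooth setT (fun u => a p u * (b i u * c k u - b k u * c i u)) by exact: smoothM.
have dm i k : pd j (fun u => b i u * c k u - b k u * c i u) u =
    (pd j (b i) u * c k u + b i u * pd j (c k) u) - (pd j (b k) u * c i u + b k u * pd j (c i) u).
  by rewrite (pdD _ (m i k) (smoothN oT (m k i))) // (pdN _ (m k i)) // !(pdM _ (hb _) (hc _)).
have dam p i k : pd j (fun u => a p u * (b i u * c k u - b k u * c i u)) u =
    pd j (a p) u * (b i u * c k u - b k u * c i u) + a p u *
    ((pd j (b i) u * c k u + b i u * pd j (c k) u) - (pd j (b k) u * c i u + b k u * pd j (c i) u)).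
  by rewrite (pdM _ (ha p) (m2 i k)) // dm.
rewrite /triple (pdD _ (smoothD oT (am _ _ _) (am _ _ _)) (am _ _ _)) //.
rewrite (pdD _ (am _ _ _) (am _ _ _)) // !dam.
move: (pd j _ u) (pd j _ u) (pd j _ u) (pd j _ u) (pd j _ u) (pd j _ u) (pd j _ u) (pd j _ u) (pd j _ u).
move: (a o0 u) (a o1 u) (a o2 u) (b o0 u) (b o1 u) (b o2 u) (c o0 u) (c o1 u) (c o2 u) => *; ring.
Qed.

(** The pointwise algebra behind [flux_identity]: [s] is the point of the sphere,
    [a] and [b] its derivatives in the parameters with vector product [- J s], [w] the
    mixed second derivative, [f] the field and [D] its Jacobian matrix. *)
Lemma radial_algebra (s a b w f : 'I_3 -> R) (D : 'I_3 -> 'I_3 -> R) (r J : R) :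
  s o0 ^+ 2 + s o1 ^+ 2 + s o2 ^+ 2 = 1 ->
  a o1 * b o2 - a o2 * b o1 = - J * s o0 ->
  a o2 * b o0 - a o0 * b o2 = - J * s o1 ->
  a o0 * b o1 - a o1 * b o0 = - J * s o2 ->
  r ^+ 2 * J * (\sum_i (\sum_j D i j * s j) * s i) + 2 * r * J * (\sum_i f i * s i)
  = r ^+ 2 * J * (\sum_i D i i)
    + r * (triple a f b + triple s (fun i => \sum_j D i j * (r * a j)) b + triple s f w)
    + r * (triple b a f + triple s w f + triple s a (fun i => \sum_j D i j * (r * b j))).
Proof.
rewrite /triple !sum3.
move: (s o0) (s o1) (s o2) (w o0) (w o1) (w o2) (f o0) (f o1) (f o2) => s0 s1 s2 w0 w1 w2 f0 f1 f2.
move: (a o0) (a o1) (a o2) (b o0) (b o1) (b o2) => a0 a1 a2 b0 b1 b2.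
move: (D o0 o0) (D o0 o1) (D o0 o2) (D o1 o0) (D o1 o1) (D o1 o2)
  (D o2 o0) (D o2 o1) (D o2 o2) => d00 d01 d02 d10 d11 d12 d20 d21 d22.
move=> n c0 c1 c2.
have e0 : J * s0 = - (a1 * b2 - a2 * b1) by rewrite c0; ring.
have e1 : J * s1 = - (a2 * b0 - a0 * b2) by rewrite c1; ring.
have e2 : J * s2 = - (a0 * b1 - a1 * b0) by rewrite c2; ring.
have eJ : J = s0 * (J * s0) + s1 * (J * s1) + s2 * (J * s2).
  by rewrite -[LHS]mulr1 -n; ring.
rewrite e0 e1 e2 in eJ.
transitivity (r ^+ 2 * ((d00 * s0 + d01 * s1 + d02 * s2) * (J * s0) +
   (d10 * s0 + d11 * s1 + d12 * s2) * (J * s1) + (d20 * s0 + d21 * s1 + d22 * s2) * (J * s2))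
   + 2 * r * (f0 * (J * s0) + f1 * (J * s1) + f2 * (J * s2))); first by ring.
rewrite e0 e1 e2 eJ; ring.
Qed.

Variables (O : set 'rV[R]_3) (oO : open O) (F : 'rV[R]_3 -> 'rV[R]_3).
Hypothesis sF : forall i, smooth O (fun x => F x 0 i).
Variable rho : R.
Hypothesis ballO : forall x, sqn x <= rho ^+ 2 -> O x.

Let s (k : 'I_3) (u : 'rV[R]_2) : R := stereo true u 0 k.
Let Jw (u : 'rV[R]_2) : R := 4 / (sqn u + 1) ^+ 2.
Let Fr (r : R) (i : 'I_3) (u : 'rV[R]_2) : R := F (r *: stereo true u) 0 i.
Let G (r : R) (u : 'rV[R]_2) : R := r ^+ 2 * Jw u * \sum_i Fr r i u * s i u.
Let DF (r : R) (i j : 'I_3) (u : 'rV[R]_2) : R := pd j (fun x => F x 0 i) (r *: stereo true u).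
(* [G r] is the flux density through the sphere of radius [r] in the parameters [u];
   [A] and [B] are the components of the field tangent to that sphere. *)
Let A (r : R) (u : 'rV[R]_2) : R := r * triple (s^~ u) (Fr r ^~ u) (fun k => pd 1 (s k) u).
Let B (r : R) (u : 'rV[R]_2) : R := r * triple (s^~ u) (fun k => pd 0 (s k) u) (Fr r ^~ u).

Let ss k : smooth setT (s k). Proof. exact: smooth_stereo. Qed.

Lemma sqn_ray r (u : 'rV[R]_2) : sqn (r *: stereo true u) = r ^+ 2.
Proof. by rewrite sqnZ (stereo_sphere true u) mulr1. Qed.

Lemma ray_in r u : `|r| <= rho -> O (r *: stereo true u).
Proof.
move=> h; apply: ballO; rewrite sqn_ray -real_normK ?num_real // lerXn2r ?nnegrE //.
exact: le_trans h.
Qed.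

Lemma smooth_ray r k : smooth setT (fun u : 'rV[R]_2 => (r *: stereo true u) 0 k).
Proof.
apply: (smooth_eq openT _ (smoothM openT (smooth_cst _ r) (ss k))) => u _.
by rewrite [in RHS]mxE.
Qed.

Lemma smooth_along_ray (h : 'rV[R]_3 -> R) r : smooth O h -> `|r| <= rho ->
  smooth setT (fun u => h (r *: stereo true u)).
Proof.
move=> sh hr; apply: (smooth_comp openT oO (f := h) (g := fun u => r *: stereo true u)) => //.
  by move=> u _; exact: ray_in.
by move=> k; exact: smooth_ray.
Qed.

Lemma smooth_Fr r i : `|r| <= rho -> smooth setT (Fr r i).
Proof. exact: smooth_along_ray (sF i). Qed.

Lemma pd_Fr r i a u : `|r| <= rho -> pd a (Fr r i) u = \sum_j DF r i j u * (r * pd a (s j) u).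
Proof.
move=> hr.
rewrite (pd_smooth_comp (U := setT) (V := O) (f := fun x => F x 0 i) (g := fun u => r *: stereo true u)) //.
- apply: eq_bigr => j _; congr (_ * _).
  have -> : (fun y => (r *: stereo true y) 0 j) = fun u => r * s j u.
    by apply/funext => y; rewrite mxE.
  by rewrite (pdM _ (smooth_cst setT r) (ss j)) // pd_cst mul0r add0r.
- exact: openT.
- by move=> y _; exact: ray_in.
- by move=> k; exact: smooth_ray.
Qed.

Lemma stereo_tangents u (k : 'I_3) (a : 'I_2) : pd a (s k) u = 'J (stereo true) u a k.
Proof. by rewrite jacobianE // => i; exact: stereo_diff. Qed.

(** The radial derivative of the flux density through the sphere of radius [r]
    is the divergence of the field, up to a divergence in the parameters of
    the sphere. *)
Lemma flux_identity r u : `|r| <= rho ->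
  r ^+ 2 * Jw u * (\sum_i (\sum_j DF r i j u * s j u) * s i u) + 2 * r * Jw u * (\sum_i Fr r i u * s i u)
  = r ^+ 2 * Jw u * (\sum_i DF r i i u) + pd 0 (A r) u + pd 1 (B r) u.
Proof.
move=> hr.
have sd a k : smooth setT (pd a (s k)) by exact: smooth_pd.
have sFr k := smooth_Fr k hr.
have := stereo_cross true u; have := stereo_tangents u.
move: ('J (stereo true) u) => T tg /rowP cr.
have crk k : cross (row 0 T) (row 1 T) 0 k = - Jw u * s k u by rewrite cr mxscaleE mulN1r.
rewrite /A /B (pdM _ (smooth_cst setT r) (smooth_triple ss sFr (sd 1))) // pd_cst mul0r add0r.
rewrite (pdM _ (smooth_cst setT r) (smooth_triple ss (sd 0) sFr)) // pd_cst mul0r add0r.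
rewrite (pd_triple _ _ ss sFr (sd 1)) (pd_triple _ _ ss (sd 0) sFr).
have Fa a : (fun k => pd a (Fr r k) u) = fun i => \sum_j DF r i j u * (r * pd a (s j) u).
  by apply/funext => k; exact: pd_Fr.
have sw : (fun k => pd 1 (pd 0 (s k)) u) = fun k => pd 0 (pd 1 (s k)) u.
  by apply/funext => k; exact: (@smooth_pd_comm _ _ setT (s k) u 1 0 openT (ss k)).
have sph : s o0 u ^+ 2 + s o1 u ^+ 2 + s o2 u ^+ 2 = 1.
  by have := stereo_sphere true u; rewrite /sphere /= /sqn sum3.
move: Fa sw crk tg sph; clear; clearbody s Jw Fr DF => Fa sw crk tg sph.
move: (Fa 0) (Fa 1) sw (tg^~ 0) (tg^~ 1) => {Fa tg}; move: (@pd R 2 0) (@pd R 2 1) => p0 p1.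
move=> Fa0 Fa1 sw tg0 tg1; rewrite Fa0 Fa1 sw.
apply: (@radial_algebra (s^~ u) (fun k => p0 (s k) u) (fun k => p1 (s k) u)
  (fun k => p0 (p1 (s k)) u) (Fr r ^~ u) (fun i j => DF r i j u)).
- exact: sph.
- by rewrite -crk /cross [(\row__ _) _ _]mxE /= ![row _ _ _ _]mxE !tg0 !tg1.
- by rewrite -crk /cross [(\row__ _) _ _]mxE /= ![row _ _ _ _]mxE !tg0 !tg1.
- by rewrite -crk /cross [(\row__ _) _ _]mxE /= ![row _ _ _ _]mxE !tg0 !tg1.
Qed.

Let H (r : R) (u : 'rV[R]_2) : R := \sum_i Fr r i u * s i u.
Let dG (r : R) (u : 'rV[R]_2) : R :=
  r ^+ 2 * Jw u * (\sum_i (\sum_j DF r i j u * s j u) * s i u) + 2 * r * Jw u * H r u.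

Lemma is_derive_ray r u i : `|r| <= rho ->
  is_derive r (1 : R) (fun t : R => Fr t i u) (\sum_j DF r i j u * s j u).
Proof.
move=> hr.
have dif : differentiable (fun x => F x 0 i) (r *: stereo true u).
  exact: (smooth_diff oO (sF i) (ray_in u hr)).
have := @line_derive _ _ (fun x => F x 0 i) 0 (stereo true u) r.
have dd : derivable (fun x => F x 0 i) (r *: stereo true u) (stereo true u) by apply: diff_derivable.
rewrite (addr0 (r *: stereo true u)) => /(_ dd).
rewrite (deriveE (stereo true u) dif) (diff_pdE _ dif).
rewrite (_ : (fun t => _) = fun t => Fr t i u); last by apply/funext => t; rewrite addr0.
rewrite (_ : \sum_j _ = \sum_j DF r i j u * s j u) //.
by apply: eq_bigr => j _; rewrite mulrC.
Qed.

Lemma is_derive_flux r u : `|r| <= rho ->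
  is_derive r (1 : R) (fun t : R => G t u) (dG r u).
Proof.
move=> hr.
have dH : is_derive r (1 : R) (fun t : R => H t u) (\sum_i (\sum_j DF r i j u * s j u) * s i u).
  have d1 i : is_derive r (1 : R) (s i u \*: (fun t : R => Fr t i u)) (s i u *: (\sum_j DF r i j u * s j u)).
    by apply: is_deriveZ; exact: is_derive_ray.
  have := is_derive_sum d1.
  rewrite (_ : \sum_i (s i u \*: _) = fun t => H t u); last first.
    by apply/funext => t; rewrite fct_sumE; apply: eq_bigr => i _; rewrite mulrC.
  rewrite (_ : \sum_i _ *: _ = \sum_i (\sum_j DF r i j u * s j u) * s i u) //.
  by apply: eq_bigr => i _; rewrite mulrC.
have := @is_deriveM _ _ _ _ _ _ _ _ (is_deriveX 2 (is_derive_id r (1 : R))) (is_deriveZ (Jw u) dH).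
set f1 := (X in is_derive _ _ X _); set d1 := (X in is_derive _ _ _ X).
rewrite (_ : f1 = fun t => G t u); last first.
  by apply/funext => t; rewrite /f1 /G /H fctE exprfctE /= /GRing.scale /= mulrA.
suff -> : d1 = dG r u by [].
rewrite /d1 /dG exprfctE /= /GRing.scale /= !mulr1 expr1.
move: (\sum_i _) (H r u) (Jw u) => a b c; ring.
Qed.

Lemma smooth_Jw : smooth setT Jw.
Proof.
have oT := @openT 'rV[R]_2.
have sq : smooth setT (fun u : 'rV[R]_2 => sqn u + 1) by exact: smoothD oT (smooth_sqn oT) (smooth_cst _ _).
apply: smoothM => //; first exact: smooth_cst.
apply: smoothV => //; first by move=> x _; rewrite expf_neq0 // sqn1_neq0.
by apply: (smooth_eq oT _ (smoothM oT sq sq)) => u _; rewrite expr2.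
Qed.

Lemma smooth_H r : `|r| <= rho -> smooth setT (H r).
Proof. by move=> hr; apply: smooth_sum openT _ => i; exact: smoothM openT (smooth_Fr i hr) (ss i). Qed.

Lemma smooth_DF r i j : `|r| <= rho -> smooth setT (DF r i j).
Proof. exact: smooth_along_ray (smooth_pd j (sF i)). Qed.

Lemma smooth_G r : `|r| <= rho -> smooth setT (G r).
Proof.
move=> hr; have oT := @openT 'rV[R]_2.
exact: smoothM oT (smoothM oT (smooth_cst _ _) smooth_Jw) (smooth_H hr).
Qed.

Hypothesis rho1 : 1 < rho.

Lemma ball_bounded (h : 'rV[R]_3 -> R) : smooth O h ->
  exists C, forall x, sqn x <= rho ^+ 2 -> `|h x| <= C.
Proof.
move=> sh; have cK := @ball_compact R 3 rho (ltW (lt_trans ltr01 rho1)).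
have : bounded_set (h @` [set x | sqn x <= rho ^+ 2]).
  apply: compact_bounded; apply: continuous_compact => //.
  apply: continuous_in_subspaceT => x /set_mem Kx; apply: (smooth_cont sh); exact: ballO.
by case=> M [_ hM]; exists (M + 1) => x Kx; apply: (hM (M + 1)); [rewrite ltrDl|exists x].
Qed.

Lemma field_bounded : exists2 b, 0 <= b &
  forall x, sqn x <= rho ^+ 2 -> forall i, `|F x 0 i| <= b /\ forall j, `|pd j (fun x => F x 0 i) x| <= b.
Proof.
have [c hc] := choice (fun i => ball_bounded (sF i)).
have [d hd] := choice (fun ij : 'I_3 * 'I_3 => ball_bounded (smooth_pd ij.2 (sF ij.1))).
have z0 : sqn (0 : 'rV[R]_3) <= rho ^+ 2.
  by rewrite sqn0 sqr_ge0.
have c0 i : 0 <= c i by apply: le_trans (hc i _ z0).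
have d0 i : 0 <= d i by apply: le_trans (hd i _ z0).
exists (\sum_i c i + \sum_i d i); first by rewrite addr_ge0 // sumr_ge0.
move=> x hx i; split => [|j].
  apply: le_trans (hc i _ hx) _; rewrite (bigD1 i) //= -addrA lerDl addr_ge0 ?sumr_ge0 //.
apply: le_trans (hd (i, j) _ hx) _; rewrite addrC (bigD1 (i, j)) //= -addrA lerDl addr_ge0 ?sumr_ge0 //.
Qed.

Lemma stereo_coord_le (u : 'rV[R]_2) k : `|s k u| <= 1.
Proof.
rewrite -(@ler_pXn2r _ 2) ?nnegrE // expr1n real_normK ?num_real //.
rewrite -(stereo_sphere true u) /sqn (bigD1 k) //= lerDl sumr_ge0 // => i _; exact: sqr_ge0.
Qed.

Lemma stereo_pd_le (u : 'rV[R]_2) a k : `|pd a (s k) u| <= 2 / (sqn u + 1).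
Proof.
have p0 : 0 <= 2 / (sqn u + 1) by rewrite divr_ge0 // ltW // sqn1_gt0.
rewrite -(@ler_pXn2r _ 2) ?nnegrE // real_normK ?num_real // stereo_tangents.
have /matrixP /(_ a a) := stereoJJ true u.
move: ('J (stereo true) u) => T; rewrite !mxE eqxx mulr1n => e.
rewrite (_ : (2 / _) ^+ 2 = 4 / (sqn u + 1) ^+ 2); last by field; exact: sqn1_neq0.
rewrite -e (bigD1 k) //= [_^T _ _]mxE expr2 lerDl sumr_ge0 // => i _.
by rewrite [_^T _ _]mxE -expr2 sqr_ge0.
Qed.

Hypothesis divF : forall x, sqn x < 1 -> 0 <= \sum_i pd i (fun y => F y 0 i) x.

Let Jw_ge0 u : 0 <= Jw u.
Proof. by rewrite /Jw divr_ge0 // sqr_ge0. Qed.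

Let Jw_le4 u : Jw u <= 4.
Proof.
rewrite /Jw ler_pdivrMr ?exprn_gt0 ?sqn1_gt0 // -[leLHS]mulr1 ler_pM2l //.
by rewrite exprn_ege1 // lerDr sqn_ge0.
Qed.

(** In [flux_identity] the divergence of the field contributes with a sign.  The two
    other terms integrate to the boundary of the box, where the derivatives of the
    stereographic parametrisation are at most [2 / N ^+ 2], while the boundary has
    length proportional to [N]. *)
Lemma box_flux_derivative : exists C, forall N r, 0 < N -> 0 <= r -> r < 1 ->
  - (C / N) <= \int[mu2]_(z in box N) dG r (rv2 z).
Proof.
have [b b0 hb] := field_bounded; exists (96 * b) => N r N0 r0 r1.
(* On the boundary of the box [A r] and [B r] are at most [12 * b / N ^+ 2], by
   [triple_bound]; each pair of opposite sides contributes [2 * N] times the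
   difference of two such values, at most [48 * b / N]. *)
have rho0 : 0 < rho := lt_trans ltr01 rho1.
have hr : `|r| <= rho by rewrite ger0_norm // ltW // (lt_trans r1).
have sd a k : smooth setT (pd a (s k)) by exact: smooth_pd.
have sFr k := smooth_Fr k hr.
have oT := @openT 'rV[R]_2.
have sA : smooth setT (A r) := smoothM oT (smooth_cst _ r) (smooth_triple ss sFr (sd 1)).
have sB : smooth setT (B r) := smoothM oT (smooth_cst _ r) (smooth_triple ss (sd 0) sFr).
have Fb k u : `|Fr r k u| <= b.
  apply: (hb _ _ k).1; rewrite sqn_ray lerXn2r ?nnegrE // ?ltW //.
  by rewrite (lt_trans r1).
have far (x y : R) : `|x| = N \/ `|y| = N -> 2 / (sqn (rv2 (x, y)) + 1) <= 2 / N ^+ 2.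
  move=> xy; rewrite ler_pM2l // lef_pV2 ?posrE ?exprn_gt0 ?sqn1_gt0 // sqn_rv2 /=.
  have x2 := sqr_ge0 x; have y2 := sqr_ge0 y.
  by case: xy => <-; rewrite real_normK ?num_real //; lra.
have Ab (x y : R) : `|x| = N \/ `|y| = N -> `|A r (rv2 (x, y))| <= 12 * b / N ^+ 2.
  move=> xy; rewrite /A normrM (ger0_norm r0) -[leRHS]mul1r; apply: ler_pM => //; first exact: ltW.
  apply: le_trans (triple_bound (stereo_coord_le _) (Fb^~ _) (fun k => le_trans (stereo_pd_le _ 1 k) (far _ _ xy))) _.
  by rewrite le_eqVlt; apply/orP; left; apply/eqP; field; rewrite gt_eqF.
have Bb (x y : R) : `|x| = N \/ `|y| = N -> `|B r (rv2 (x, y))| <= 12 * b / N ^+ 2.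
  move=> xy; rewrite /B normrM (ger0_norm r0) -[leRHS]mul1r; apply: ler_pM => //; first exact: ltW.
  apply: le_trans (triple_bound (stereo_coord_le _) (fun k => le_trans (stereo_pd_le _ 0 k) (far _ _ xy)) (Fb^~ _)) _.
  by rewrite le_eqVlt; apply/orP; left; apply/eqP; field; rewrite gt_eqF.
pose D u := r ^+ 2 * Jw u * (\sum_i DF r i i u).
have sD : smooth setT D.
  apply: smoothM => //; first exact: smoothM oT (smooth_cst _ _) smooth_Jw.
  by apply: smooth_sum => // i; exact: smooth_DF.
have int h : smooth setT h -> mu2.-integrable (box N) (EFin \o (h \o @rv2 R)).
  by move=> sh; apply: box_integrable; exact: smooth_plane_continuous.
have -> : \int[mu2]_(z in box N) dG r (rv2 z) = \int[mu2]_(z in box N) D (rv2 z)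
   + \int[mu2]_(z in box N) pd 0 (A r) (rv2 z) + \int[mu2]_(z in box N) pd 1 (B r) (rv2 z).
  transitivity (\int[mu2]_(z in box N) (D (rv2 z) + pd 0 (A r) (rv2 z) + pd 1 (B r) (rv2 z))).
    by apply: eq_Rintegral => z _; exact: flux_identity.
  have s1 : smooth setT (fun u => D u + pd 0 (A r) u) := smoothD oT sD (smooth_pd 0 sA).
  rewrite (@RintegralD _ _ _ mu2 (box N) (fun z => D (rv2 z) + pd 0 (A r) (rv2 z))
    (fun z => pd 1 (B r) (rv2 z)) (box_measurable N)); last 2 first.
  - exact: int _ s1.
  - exact: int _ (smooth_pd 1 sB).
  rewrite (@RintegralD _ _ _ mu2 (box N) (D \o @rv2 R) (pd 0 (A r) \o @rv2 R) (box_measurable N)) //.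
  - exact: int _ sD.
  - exact: int _ (smooth_pd 0 sA).
have D0 : 0 <= \int[mu2]_(z in box N) D (rv2 z).
  apply: Rintegral_ge0 => z _; apply: mulr_ge0; first exact: mulr_ge0 (sqr_ge0 r) (Jw_ge0 _).
  by apply: divF; rewrite sqn_ray expr_lt1.
have hA := @box_pd0 _ (A r) N _ N0 sA (fun x y e => Ab x y (or_introl e)).
have hB := @box_pd1 _ (B r) N _ N0 sB (fun x y e => Bb x y (or_intror e)).
move: D0 hA hB; move: (\int[mu2]_(z in box N) D (rv2 z)) (\int[mu2]_(z in box N) pd 0 (A r) (rv2 z))
  (\int[mu2]_(z in box N) pd 1 (B r) (rv2 z)) => i0 i1 i2 D0.
rewrite !ler_norml => /andP[hA _] /andP[hB _].
have e : 4 * N * (12 * b / N ^+ 2) = 48 * b / N by field; rewrite gt_eqF.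
rewrite e in hA hB.
have e2 : 96 * b / N = 48 * b / N + 48 * b / N by field; rewrite gt_eqF.
rewrite e2; lra.
Qed.

(** The flux through the box of the sphere of radius [r] starts from zero at
    [r = 0], and its derivative is nonnegative up to an error that disappears
    as the box exhausts the plane. *)
Lemma sphere_flux_ge0 :
  mu2.-integrable setT (EFin \o (G 1 \o @rv2 R)) /\ 0 <= \int[mu2]_z G 1 (rv2 z).
Proof.
have [b b0 hb] := field_bounded.
have rho0 : 0 < rho := lt_trans ltr01 rho1.
have h1 : `|1 : R| <= rho by rewrite normr1 ltW.
have Fb r k u : `|r| <= rho -> `|Fr r k u| <= b.
  move=> hr; apply: (hb _ _ k).1; rewrite sqn_ray -real_normK ?num_real //.
  by rewrite lerXn2r ?nnegrE ?normr_ge0 // ltW.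
have Hb r u : `|r| <= rho -> `|H r u| <= 3 * b.
  move=> hr; rewrite /H sum3 (_ : 3 * b = b + b + b); last by ring.
  have t i : `|Fr r i u * s i u| <= b.
    by rewrite normrM -[leRHS]mulr1; apply: ler_pM => //; [exact: Fb|exact: stereo_coord_le].
  by do 2![apply: le_trans (ler_normD _ _) _; apply: lerD => //].
have cG r : `|r| <= rho -> continuous (G r \o @rv2 R).
  by move=> hr; apply: smooth_plane_continuous; exact: smooth_G.
have intG : mu2.-integrable setT (EFin \o (G 1 \o @rv2 R)).
  apply: (@decay_integrable _ _ (12 * b)); first exact: cG.
  move=> z; rewrite /= /G expr1n mul1r normrM (ger0_norm (Jw_ge0 _)).
  rewrite -addrA addrC -sqn_rv2 (_ : 12 * b / _ = Jw (rv2 z) * (3 * b)).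
    by apply: ler_wpM2l; [exact: Jw_ge0|exact: Hb].
  by rewrite /Jw; field; exact: sqn1_neq0.
split => //; have [C hC] := box_flux_derivative.
apply: (@box_exhausts _ (G 1 \o @rv2 R) C) => //; first exact: cG.
move=> N N0; pose Psi r := \int[mu2]_(z in box N) G r (rv2 z).
pose dPsi r := \int[mu2]_(z in box N) dG r (rv2 z).
have inI r : r \in `](- rho), rho[ -> `|r| <= rho.
  by rewrite in_itv /= -ltr_norml; exact: ltW.
pose bd : R := 4 * (rho ^+ 2 * (9 * b) + 2 * rho * (3 * b)).
have bd0 : 0 <= bd.
  by rewrite /bd mulr_ge0 // addr_ge0 // !mulr_ge0 // ?sqr_ge0 // ltW.
have dGb r u : `|r| <= rho -> `|dG r u| <= bd.
  move=> hr.
  have K : `|\sum_i (\sum_j DF r i j u * s j u) * s i u| <= 9 * b.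
    have ts (x : R) k c : `|x| <= c -> `|x * s k u| <= c.
      by move=> xc; rewrite normrM -[leRHS]mulr1; apply: ler_pM => //; exact: stereo_coord_le.
    have D1 i j : `|DF r i j u| <= b.
      by apply: (hb _ _ i).2; rewrite sqn_ray -real_normK ?num_real // lerXn2r ?nnegrE ?normr_ge0 // ltW.
    have D3 i : `|\sum_j DF r i j u * s j u| <= 3 * b.
      rewrite sum3 (_ : 3 * b = b + b + b); last by ring.
      by do 2![apply: le_trans (ler_normD _ _) _; apply: lerD; rewrite ?ts ?D1 //].
    rewrite sum3 (_ : 9 * b = 3 * b + 3 * b + 3 * b); last by ring.
    by do 2![apply: le_trans (ler_normD _ _) _; apply: lerD; rewrite ?ts ?D3 //].
  rewrite /dG /bd mulrDr; apply: le_trans (ler_normD _ _) _.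
  move: (Jw_le4 u) (Jw_ge0 u) (Hb r u hr) K.
  move: (Jw u) (H r u) (\sum_i _) => j h k J4 J0 hb' K.
  have r2 : r ^+ 2 <= rho ^+ 2.
    by rewrite -real_normK ?num_real // lerXn2r ?nnegrE ?normr_ge0 // ltW.
  have r2n : 0 <= r ^+ 2 := sqr_ge0 r.
  have r2' : 0 <= `|r| := normr_ge0 r.
  apply: lerD.
    rewrite normrM (normrM (r ^+ 2)) (ger0_norm J0) (ger0_norm r2n) mulrA [4 * _]mulrC.
    by apply: ler_pM => //; [exact: mulr_ge0|apply: ler_pM].
  rewrite !normrM (ger0_norm J0) (ger0_norm (ler0n _ 2)) mulrA [4 * _]mulrC.
  apply: ler_pM => //; rewrite ?mulr_ge0 //.
  by apply: ler_pM; rewrite ?mulr_ge0 // ler_wpM2l.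
have d1E r z : `|r| <= rho -> partial1of2 (fun r z => G r (rv2 z)) r z = dG r (rv2 z).
  by move=> hr; rewrite partial1of2E; have [_ ->] := is_derive_flux (rv2 z) hr.
have dP r : r \in `](- rho), rho[ -> is_derive r (1 : R) Psi (dPsi r).
  move=> hr.
  have Ir : `](- rho), rho[%classic r by [].
  have i1 t : `](- rho), rho[%classic t -> mu2.-integrable (box N) (EFin \o (fun z => G t (rv2 z))).
    by move=> /= ht; apply: box_integrable; apply: cG; exact: inI.
  have i2 t z : `](- rho), rho[%classic t -> box N z -> derivable (fun t => G t (rv2 z)) t 1.
    by move=> /= ht _; have [] := is_derive_flux (rv2 z) (inI _ ht).
  have i3 : mu2.-integrable (box N) (EFin \o (cst bd)).
    by apply: box_integrable; exact: cst_continuous.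
  have i4 t z : `](- rho), rho[%classic t -> box N z ->
      `|partial1of2 (fun r z => G r (rv2 z)) t z| <= cst bd z.
    by move=> /= ht _; rewrite d1E; [exact/dGb/inI|exact: inI].
  apply: DeriveDef.
    exact: (@derivable_under_integral R _ _ mu2 (fun r z => G r (rv2 z)) (box N) (box_measurable N)
      r (- rho) rho Ir i1 i2 (cst bd) (fun=> bd0) i3 i4).
  rewrite -derive1E (@differentiation_under_integral R _ _ mu2 (fun r z => G r (rv2 z)) (box N)
    (box_measurable N) r (- rho) rho Ir i1 i2 (cst bd) (fun=> bd0) i3 i4).
  by apply: eq_Rintegral => z _; rewrite d1E // inI.
have sub r : 0 <= r -> r <= 1 -> r \in `](- rho), rho[.
  by move=> r0 r1; rewrite in_itv /= (lt_le_trans _ r0) ?oppr_lt0 //= (le_lt_trans r1).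
have P0 : Psi 0 = 0.
  transitivity (\int[mu2]_(z in box N) (0 : R)); last by rewrite /Rintegral integral0_eq.
  by apply: eq_Rintegral => z _; rewrite /G expr0n /= !mul0r.
have dPC c : 0 < c -> c < 1 -> - (C / N) <= dPsi c.
  by move=> c0 c1; apply: hC => //; exact: ltW.
suff : - (C / N) <= Psi 1 by [].
move: Psi dPsi dP P0 dPC => P dP' dP P0 dPC.
have d01 (r : R) : r \in `](0 : R), 1[ -> is_derive r (1 : R) P (dP' r).
  by rewrite in_itv /= => /andP[r0 r1]; apply: dP; apply: sub; exact: ltW.
have c01 : {within `[(0 : R), 1], continuous P}.
  apply: derivable_within_continuous => r; rewrite in_itv /= => /andP[r0 r1].
  by have [] := dP r (sub r r0 r1).
have [c] := MVT ltr01 d01 c01.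
by rewrite in_itv /= P0 !subr0 mulr1 => /andP[c0 c1] ->; exact: dPC.
Qed.
End Flux.

(** * Integrability over the sphere *)

Section SphereBounds.
Context {R : realType}.
Local Notation mu := (@lebesgue_measure R).
Local Notation mu2 := (mu \x mu)%E.

Lemma cballE : @cball R = [set x | sqn x <= 1 ^+ 2].
Proof. by rewrite expr1n. Qed.

(** A neighbourhood of the closed unit ball contains a larger ball, since the
    scalings near [1] keep the compact ball inside. *)
Lemma cball_margin (O : set 'rV[R]_3) : open O -> cball `<=` O ->
  exists2 rho : R, 1 < rho & forall x, sqn x <= rho ^+ 2 -> O x.
Proof.
move=> oO BO; have cB : compact (@cball R) by rewrite cballE; exact: ball_compact.
have := (compact_near_coveringP (@cball R)).1 cB R (nbhs (1 : R)) (fun r x => O (r *: x)) _.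
case=> [x Bx|e /= e0 he].
  have : nbhs ((1 : R), x) (fun z : R * 'rV[R]_3 => O (z.1 *: z.2)).
    apply: scale_continuous => /=; rewrite scale1r.
    by apply: open_nbhs_nbhs; split => //; exact: BO.
  case=> -[P Q] /= [nP nQ] PQ; exists (Q, P); first by split.
  by move=> [x' i] [Qx Pi]; exact: (PQ (i, x')).
have e2 : 0 < 1 + e / 2 by rewrite addr_gt0 // divr_gt0.
exists (1 + e / 2) => [|x hx]; first by rewrite ltrDl divr_gt0.
rewrite -(scalerK (lt0r_neq0 e2) x) scalerA mulrC -scalerA.
apply: (he (1 + e / 2)).
  by rewrite /ball /= opprD addNKr normrN gtr0_norm ?divr_gt0 // ltr_pdivrMr // mulr2n mulrDr mulr1 ltrDl.
rewrite /cball /= sqnZ exprVn.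
by rewrite mulrC ler_pdivrMr ?exprn_gt0 // mul1r.
Qed.

(** Compactness of the sphere. *)
Lemma sphere_bounded (O : set 'rV[R]_3) (h : 'rV[R]_3 -> R) : (forall x, sphere x -> O x) ->
  smooth O h -> exists C, forall c u, `|h (stereo c u)| <= C.
Proof.
move=> SO sh.
have cS : compact (@sphere R).
  apply: (subclosed_compact _ (ball_compact (n := 3) ler01)); last first.
    by move=> x /= ->; rewrite expr1n.
  rewrite (_ : sphere = @sqn R 3 @^-1` [set 1]) //.
  apply: closed_comp; last exact: closed_eq.
  by move=> x _; exact: (smooth_cont (smooth_sqn openT)).
have : bounded_set (h @` (@sphere R)).
  apply: compact_bounded; apply: continuous_compact => //.
  apply: continuous_in_subspaceT => x /set_mem Kx; apply: (smooth_cont sh); exact: SO.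
case=> M [_ hM]; exists (M + 1) => c u; apply: (hM (M + 1)); first by rewrite ltrDl.
by exists (stereo c u) => //; exact: stereo_sphere.
Qed.

Lemma stereo_inversion (u : 'rV[R]_2) : u != 0 -> stereo true u = stereo false ((sqn u)^-1 *: u).
Proof.
move=> u0; have s0 : sqn u != 0 by exact: sqn_neq0.
have e : sqn ((sqn u)^-1 *: u) = (sqn u)^-1 by rewrite sqnZ; field.
have s1 := sqn1_neq0 u.
have D : (sqn u)^-1 + 1 != 0.
  by rewrite gt_eqF // ltr_wpDl // invr_ge0 sqn_ge0.
apply/rowP; apply: ind3; rewrite !stereoE /stereo_num /= e ?mxscaleE; move: s0 s1 D; move: (sqn u) => q s0 s1 D; field; rewrite ?s0 ?s1 ?(addrC 1) ?s0 ?s1 //=.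
Qed.

(** A function on the sphere is bounded because the closed unit disks of the two
    charts cover the sphere. *)
Lemma two_charts_bounded (k : bool -> 'rV[R]_2 -> R) : (forall c, smooth setT (k c)) ->
  (forall u, u != 0 -> k true u = k false ((sqn u)^-1 *: u)) ->
  exists C, forall u, `|k true u| <= C.
Proof.
move=> sk kE.
have b c : exists C, forall u, sqn u <= 1 ^+ 2 -> `|k c u| <= C.
  have : bounded_set (k c @` [set u | sqn u <= 1 ^+ 2]).
    apply: compact_bounded; apply: continuous_compact; last exact: ball_compact.
    by apply: continuous_subspaceT => x; exact: (smooth_cont (sk c)).
  case=> M [_ hM]; exists (M + 1) => u hu; apply: (hM (M + 1)); first by rewrite ltrDl.
  by exists u.
have [C1 h1] := b true; have [C2 h2] := b false; exists (Num.max C1 C2) => u.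
have [u1|u1] := leP (sqn u) (1 ^+ 2); first by rewrite le_max h1.
have u0 : u != 0.
  by apply: contraTneq u1 => ->; rewrite -leNgt sqn0 expr1n.
rewrite kE // le_max h2 ?orbT //.
rewrite expr1n in u1 *; have p := lt_trans ltr01 u1.
by rewrite sqnZ expr2 -mulrA mulVf ?gt_eqF // mulr1 invf_le1 // ltW.
Qed.

Lemma sphere_density_integrable (k q : 'rV[R]_2 -> R) (C D : R) :
  smooth setT k -> smooth setT q -> (forall u, `|k u| <= C) ->
  (forall u, 0 <= q u) -> (forall u, q u <= D * (4 / (sqn u + 1) ^+ 2)) ->
  mu2.-integrable setT (EFin \o (fun z => k (rv2 z) * q (rv2 z))).
Proof.
move=> sk sq hk q0 hq.
have C0 : 0 <= C := le_trans (normr_ge0 _) (hk 0).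
apply: (@decay_integrable _ _ (C * D * 4)).
  exact: (smooth_plane_continuous (smoothM openT sk sq)).
move=> z; rewrite normrM (ger0_norm (q0 _)).
have -> : C * D * 4 / (1 + z.1 ^+ 2 + z.2 ^+ 2) ^+ 2 = C * (D * (4 / (sqn (rv2 z) + 1) ^+ 2)).
  by rewrite sqn_rv2 -(addrA 1) (addrC 1) !mulrA.
by apply: ler_pM.
Qed.

Lemma flux_integral_ge0 (O : set 'rV[R]_3) (F : 'rV[R]_3 -> 'rV[R]_3) : open O -> cball `<=` O ->
  (forall i, smooth O (fun x => F x 0 i)) ->
  (forall x, sqn x < 1 -> 0 <= \sum_i pd i (fun y => F y 0 i) x) ->
  let Phi := fun z => (F (stereo true (rv2 z)) *m (stereo true (rv2 z))^T) 0 0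
                      * (4 / (sqn (rv2 z) + 1) ^+ 2) in
  mu2.-integrable setT (EFin \o Phi) /\ 0 <= \int[mu2]_z Phi z.
Proof.
move=> oO BO sF dF Phi; have [rho rho1 hrho] := cball_margin oO BO.
have [i1 i2] := sphere_flux_ge0 oO sF hrho rho1 dF.
have e : Phi = fun z => 1 ^+ 2 * (4 / (sqn (rv2 z) + 1) ^+ 2) *
    \sum_i F (1 *: stereo true (rv2 z)) 0 i * stereo true (rv2 z) 0 i.
  apply/funext => z; rewrite expr1n mul1r mulrC scale1r /Phi; congr (_ * _).
  by rewrite [LHS]mxE; apply: eq_bigr => i _; rewrite [_^T _ _]mxE.
by rewrite e.
Qed.
End SphereBounds.

(** * The comparison of the two energies *)

Section MeanCurvature.
Context {R : realType}.

Lemma mean_curv_eq m n (W : set 'rV[R]_m) (G : 'rV[R]_n -> 'M[R]_n) (F F' N N' : 'rV[R]_m -> 'rV[R]_n) y :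
  open W -> smooth_mx W F -> smooth_mx W N -> W y ->
  (forall z, W z -> F z = F' z) -> (forall z, W z -> N z = N' z) ->
  mean_curv G F N y = mean_curv G F' N' y.
Proof.
move=> oW sF sN Wy FF NN.
rewrite /mean_curv /second_form /Defs.induced (cov_eq G oW sF sN Wy FF NN) (J_eq oW sF Wy FF).
by rewrite (FF _ Wy).
Qed.

Lemma smooth_mean_curv_euclid m n (F N : 'rV[R]_m -> 'rV[R]_n) :
  smooth_mx setT F -> smooth_mx setT N ->
  (forall u, Defs.induced (@euclid R n) F u \in unitmx) ->
  smooth setT (mean_curv (@euclid R n) F N).
Proof.
move=> sF sN Iu; have oT := @openT 'rV[R]_m.
have sJF := smooth_J oT sF; have sJN := smooth_J oT sN.
have e u : Defs.induced (@euclid R n) F u = jacobian F u *m (jacobian F u)^T.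
  by rewrite /Defs.induced /euclid mulmx1.
have e2 u : mean_curv (@euclid R n) F N u =
    \tr (invmx (jacobian F u *m (jacobian F u)^T) *m (jacobian N u *m (jacobian F u)^T)).
  by rewrite /mean_curv e /second_form cov_const /euclid mulmx1.
have sI := smooth_mulmx oT sJF (smooth_trmx oT sJF).
have uI u : setT u -> jacobian F u *m (jacobian F u)^T \in unitmx by rewrite -e.
have sM := smooth_mulmx oT (smooth_invmx oT sI uI) (smooth_mulmx oT sJN (smooth_trmx oT sJF)).
apply: (smooth_eq oT _ (smooth_sum _ xpredT oT (fun i => sM i i))) => u _.
by rewrite e2.
Qed.

(** The mean curvature of a closed surface is bounded: it is a continuous
    function on the sphere, read in two charts. *)
Lemma embedding_curv_bounded (gam : sphere_metric R) (j N : 'rV[R]_3 -> 'rV[R]_3) :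
  isometric_embedding gam (j, N) -> (forall c u, posdef (gam c u)) ->
  (forall c, smooth setT (mean_curv (@euclid R 3) (j \o stereo c) (N \o stereo c))) /\
  exists C, forall u, `|mean_curv (@euclid R 3) (j \o stereo true) (N \o stereo true) u| <= C.
Proof.
move=> [sjN _ iso _ _] pgam.
have sj c : smooth_mx setT (j \o stereo c).
  by move=> i k; rewrite (ord1 i); exact: (sjN k).1.
have sN c : smooth_mx setT (N \o stereo c).
  by move=> i k; rewrite (ord1 i); exact: (sjN k).2.
have Iu c u : Defs.induced (@euclid R 3) (j \o stereo c) u \in unitmx.
  by rewrite iso; exact: posdef_unit.
have sk c := smooth_mean_curv_euclid (sj c) (sN c) (Iu c).
split => //; apply: two_charts_bounded sk _ => u u0.
pose psi (z : 'rV[R]_2) := (sqn z)^-1 *: z.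
pose W := [set z : 'rV[R]_2 | z != 0].
have oW : open W by exact: open_nonzero.
have sq0 z : W z -> sqn z != 0 by exact: sqn_neq0.
have spsi i : smooth W (fun z => psi z 0 i).
  apply: (smooth_eq oW _ (smoothM oW (smoothV oW sq0 (smooth_sqn oW)) (smooth_coord W i))) => z _.
  by rewrite [in RHS]mxE.
have psi0 z : W z -> W (psi z).
  by move=> z0; rewrite /W /= /psi scaler_eq0 invr_eq0 negb_or (sq0 z z0).
have psiK z : W z -> psi (psi z) = z.
  move=> z0; have q0 := sq0 z z0; rewrite /psi scalerA.
  rewrite (_ : sqn ((sqn z)^-1 *: z) = (sqn z)^-1); last by rewrite sqnZ; field.
  by rewrite invrK mulfV // scale1r.
have Ju : 'J psi u \in unitmx.
  have e := @J_comp _ _ _ _ psi psi u (fun i => smooth_diff oW (spsi i) u0)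
    (fun i => smooth_diff oW (spsi i) (psi0 u u0)).
  have s1 : smooth_mx W (id : 'rV[R]_2 -> 'rV[R]_2).
    by move=> i k; rewrite (ord1 i); exact: smooth_coord.
  have h := J_eq oW s1 u0 (F' := psi \o psi) (fun z z0 => esym (psiK z z0)).
  have := etrans (esym e) (etrans (esym h) (J_id u)).
  by move: ('J psi u) ('J psi (psi u)) => A B /mulmx1_unit[].
have sub c (F : 'rV[R]_3 -> 'rV[R]_3) : smooth_mx setT (F \o stereo c) -> smooth_mx W (F \o stereo c).
  by move=> h i k; apply: smooth_sub (h i k).
have e (F : 'rV[R]_3 -> 'rV[R]_3) z : W z -> (F \o stereo true) z = ((F \o stereo false) \o psi) z.
  by move=> z0 /=; rewrite stereo_inversion.
rewrite (mean_curv_eq (@euclid R 3) oW (sub _ _ (sj true)) (sub _ _ (sN true)) u0 (e j) (e N)).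
apply: mean_curv_reparam => //.
- by move=> i; exact: smooth_diff oW (spsi i) u0.
- by move=> i; exact: smooth_diff openT (sj false 0 i) I.
- by move=> i; exact: smooth_diff openT (sN false 0 i) I.
Qed.
End MeanCurvature.

Section Comparison.
Context {R : realType} {S : spacetime R}.
Local Notation mu := (@lebesgue_measure R).
Local Notation mu2 := (mu \x mu)%E.

Lemma spacelike_immersion_sub m (U V : set 'rV[R]_m) (X : 'rV[R]_m -> S) :
  open V -> V `<=` U -> spacelike_immersion U X -> spacelike_immersion V X.
Proof.
move=> oV VU [oU [cX sX] pX]; split => //; last by move=> x /VU; exact: pX.
split => [x /VU|i A]; first exact: cX.
by apply: smooth_sub (sX i A) => x [/VU Ux Xx].
Qed.

Lemma smooth_mx_sub m p q (U V : set 'rV[R]_m) (M : 'rV[R]_m -> 'M[R]_(p, q)) :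
  V `<=` U -> smooth_mx U M -> smooth_mx V M.
Proof. by move=> VU h i j; apply: smooth_sub (h i j). Qed.

Variables (M : set S) (X : 'rV[R]_3 -> S) (T0 : 'rV[R]_4) (L : 'M[R]_(3, 4)).
Variables (tau f u : 'rV[R]_3 -> R).

(* The data of the fill-in extend smoothly to an open set [O] around the ball. *)
Variable O : set 'rV[R]_3.
Hypothesis oO : open O.
Hypothesis BO : cball `<=` O.
Hypothesis hX : spacelike_immersion O X.
Hypotheses (sf : smooth O f) (su : smooth O u).
Hypothesis u_gt0 : forall x, O x -> 0 < u x.
Hypothesis u1 : forall x, sphere x -> u x = 1.
Hypothesis f_tau : forall x, sphere x -> f x = tau x.
Hypothesis stau : smooth_sphere tau.

Local Notation g := (ind_metric X).
Local Notation K := (ind_second X).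
Let gh := graph_metric g f.
Let gs := fun x => u x ^+ 4 *: gh x.
Hypothesis jang : forall x, cball x -> jang_lhs g K f x = 0.

Let sphere_cball (x : 'rV[R]_3) : sphere x -> cball x.
Proof. by rewrite /sphere /cball /= => ->. Qed.

(** The conormal of the square distance exists away from the origin. *)
Definition punctured : set 'rV[R]_3 := O `&` [set x | x != 0].

Lemma open_punctured : open punctured.
Proof. by apply: openI => //; exact: open_nonzero. Qed.

Lemma sphere_punctured x : sphere x -> punctured x.
Proof.
move=> Sx; split; first exact/BO/sphere_cball.
by apply/eqP => x0; move: Sx; rewrite /sphere /= x0 sqn0 => /esym/eqP; rewrite oner_eq0.
Qed.

Let V : opendom R 3 := OpenDom open_punctured (sphere_punctured (stereo_sphere true 0)).
Let VS x : sphere x -> V x. Proof. exact: sphere_punctured. Qed.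
Let V0 x : V x -> x != 0. Proof. by case. Qed.
Let VO x : V x -> O x. Proof. by case. Qed.
Let sfV : smooth V f. Proof. by apply: smooth_sub sf => x []. Qed.
Let suV : smooth V u. Proof. by apply: smooth_sub su => x []. Qed.
Let u_gt0V x : V x -> 0 < u x. Proof. by move=> /VO; exact: u_gt0. Qed.
Let jangS x : sphere x -> jang_lhs g K f x = 0. Proof. by move=> /sphere_cball; exact: jang. Qed.

Let ksf c := mean_curv gs (stereo c) (conormal gs (@sqn R 3) \o stereo c).
Let qhat c v := Num.sqrt (\det (sigma_hat X tau c v)).

Let sg : smooth_mx V g. Proof. exact: smooth_mx_sub VO (smooth_ind_metric hX). Qed.
Let pg x : V x -> posdef (g x). Proof. by move=> /VO; case: hX => _ _; apply. Qed.
Let sgs : smooth_mx V gs.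
Proof.
have h := smooth_scalemx (od_open V) (smooth_exp suV 4) (smooth_graph (od_open V) sg sfV).
exact: h.
Qed.
Let pgs x : V x -> posdef (gs x).
Proof. by move=> Vx; exact: (posdef_gs f pg u_gt0V Vx). Qed.
Let pS c v := posdef_sigma hX VS VO c v.
Let pSh c v := posdef_sigma_hat hX VS VO sfV f_tau c v.

Lemma smooth_sigma_hat c : smooth_mx setT (sigma_hat X tau c).
Proof.
have oT := @openT 'rV[R]_2.
have s : smooth_mx setT (stereo c : 'rV[R]_2 -> 'rV[R]_3).
  by move=> i k; rewrite (ord1 i); exact: smooth_stereo.
have sJ := smooth_J oT s.
have sc := smooth_mx_comp oT (od_open V) (fun y _ => VS (stereo_sphere c y)) s
  (smooth_graph (od_open V) sg sfV).
have h := smooth_mulmx oT (smooth_mulmx oT sJ sc) (smooth_trmx oT sJ).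
by apply: (smooth_mx_eq oT _ h) => v _; rewrite (sigma_hatE hX VS VO sfV f_tau).
Qed.

Lemma smooth_qhat c : smooth setT (qhat c).
Proof.
apply: smooth_sqrt openT _ (smooth_det openT (smooth_sigma_hat c)) => v _.
exact: posdef_det2.
Qed.

(** The graph metric is bounded on the compact sphere in terms of the round one, whose
    area element in the chart is [4 / (sqn v + 1) ^+ 2]. *)
Lemma qhat_decay : exists D, forall v, qhat true v <= D * (4 / (sqn v + 1) ^+ 2).
Proof.
have sgh := smooth_graph (od_open V) sg sfV.
pose h x := \det (gh x) * (x *m invmx (gh x) *m x^T) 0 0.
have sh : smooth V h.
  have sx : smooth_mx V (id : 'rV[R]_3 -> 'rV[R]_3).
    by move=> i k; rewrite (ord1 i); exact: smooth_coord.
  have oV := od_open V.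
  have ghu x : V x -> gh x \in unitmx by move=> Vx; apply/posdef_unit/posdef_graph/pg.
  have sq := smooth_mulmx oV (smooth_mulmx oV sx (smooth_invmx oV sgh ghu)) (smooth_trmx oV sx).
  exact: smoothM oV (smooth_det oV sgh) (sq 0 0).
have [C hC] := sphere_bounded (O := V) VS sh.
exists (Num.sqrt C) => v; have J0 : 0 <= 4 / (sqn v + 1) ^+ 2 by rewrite divr_ge0 // sqr_ge0.
have ghu : gh (stereo true v) \in unitmx by apply/posdef_unit/posdef_graph/pg/VS/stereo_sphere.
rewrite /qhat (sigma_hatE hX VS VO sfV f_tau) (det_surface _ ghu) stereo_cross.
have -> : \det (gh (stereo true v)) * (((-1 * (4 / (sqn v + 1) ^+ 2)) *: stereo true v)
    *m invmx (gh (stereo true v)) *m ((-1 * (4 / (sqn v + 1) ^+ 2)) *: stereo true v)^T) 0 0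
    = h (stereo true v) * (4 / (sqn v + 1) ^+ 2) ^+ 2.
  rewrite /h; move: (stereo true v) (4 / _) => p a; rewrite mulN1r.
  move: (invmx (gh p)) (\det (gh p)) => G d.
  rewrite (_ : (- a *: p)^T = - a *: p^T); last by rewrite linearZ.
  rewrite -!scalemxAl -scalemxAr !mxscaleE; ring.
rewrite sqrtrM; last first.
  have pgh := posdef_graph f (pg (VS (stereo_sphere true v))).
  apply: mulr_ge0; first exact: ltW (posdef_det3 pgh).
  exact: (posdef_ge0 (stereo true v) (posdef_inv pgh)).
rewrite sqrtr_sqr ger0_norm //; apply: ler_wpM2r => //.
by apply: ler_wsqrtr; apply: le_trans (ler_norm _) (hC true v).
Qed.

(** By [mean_curv_divg] the conformal mean curvature is the restriction of a smooth
    function defined near the sphere. *)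
Lemma ksf_bounded : smooth setT (ksf true) /\ exists C, forall v, `|ksf true v| <= C.
Proof.
have [h sh kE] : exists2 h, smooth V h & forall c v, ksf c v = h (stereo c v).
  exists (divg (sfder V) (gamA sgs (nuGu pgs)) (tomx (smooth_conormal V0 sgs pgs))).
    exact: sf_smooth.
  by move=> c v; exact: mean_curv_divg.
have kh : ksf true = h \o stereo true by apply/funext => v; exact: kE.
split; first by rewrite kh; exact: (smooth_comp openT (od_open V) (fun y _ => VS (stereo_sphere true y)) (smooth_stereo true) sh).
by have [C hC] := sphere_bounded (O := V) VS sh; exists C => v; rewrite kE.
Qed.

Lemma ksf_integrable : mu2.-integrable setT (EFin \o (fun z => ksf true (rv2 z) * qhat true (rv2 z))).
Proof.
have [sk [C hC]] := ksf_bounded; have [D hD] := qhat_decay.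
by apply: (sphere_density_integrable sk (smooth_qhat true) hC _ hD) => v; exact: sqrtr_ge0.
Qed.

Hypothesis dec : forall x, sqn x < 1 -> dominant_energy g K x.
Hypothesis u_eq : forall x, cball x -> - 8 * laplacian gh u x + scal gh x * u x = 0.

Let Phi := fun z => (volflux g K f u (stereo true (rv2 z)) *m (stereo true (rv2 z))^T) 0 0
                      * (4 / (sqn (rv2 z) + 1) ^+ 2).

(** The field is smooth on [O], and its divergence is nonnegative on the open ball,
    where the equations and the energy condition hold. *)
Lemma boundary_flux_ge0 : mu2.-integrable setT (EFin \o Phi) /\ 0 <= \int[mu2]_z Phi z.
Proof.
have gO := smooth_ind_metric hX; have KO := smooth_ind_second hX.
have KT := ind_second_sym hX.
have pO x : O x -> posdef (g x) by case: hX => _ _; apply.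
have O0 : O 0 by apply: BO; rewrite /cball /= sqn0.
pose Od : opendom R 3 := OpenDom oO O0.
apply: (flux_integral_ge0 oO BO); first exact: (@smooth_volflux _ Od).
have oB : open [set x : 'rV[R]_3 | sqn x < 1] by exact: open_unit_ball.
have B0 : sqn (0 : 'rV[R]_3) < 1 by rewrite sqn0.
pose Bd : opendom R 3 := OpenDom oB B0.
have Bc x : Bd x -> cball x by exact: ltW.
have Bo x : Bd x -> O x by move=> /Bc; exact: BO.
move=> x Bx.
apply: (@div_flux_ge0 _ Bd g K f (smooth_mx_sub Bo gO) _ (smooth_mx_sub Bo KO) _
  (smooth_sub Bo sf) u (smooth_sub Bo su)) => //.
- by move=> y /Bo; exact: pO.
- by move=> y /Bo; exact: KT.
- by move=> y /Bc; exact: jang.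
- by move=> y /Bo; exact: u_gt0.
- by move=> y /Bc; exact: u_eq.
Qed.

(** The Jang gauge competes in the definition of the canonical gauge, and the
    flux of the Schoen-Yau identity through the boundary has a sign. *)
Lemma gauge_integral_le phi : canonical_gauge X tau phi ->
  h_integral X tau phi <= \int[mu2]_z (ksf true (rv2 z) * qhat true (rv2 z)).
Proof.
move=> [_ /(_ (jphi X f) (smooth_jphi hX VS V0 VO sfV))]; move/le_trans; apply.
have [iP P0] := boundary_flux_ge0.
rewrite /h_integral /sphere_int.
have -> : \int[mu2]_z (hfun X tau (frame3 X) (frame4 X) (jphi X f) true (rv2 z) *
    Num.sqrt (\det (sigma X true (rv2 z)))) =
    \int[mu2]_z (ksf true (rv2 z) * qhat true (rv2 z) - Phi z).
  apply: eq_Rintegral => z _.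
  exact: (jang_density hX VS V0 VO sfV suV u_gt0V u1 f_tau jangS).
rewrite RintegralB //; last exact: ksf_integrable.
by rewrite lerBlDr lerDl.
Qed.

(** The slope factor of [reference_densityE] is absorbed by the area element
    ([det_graph_surface]). *)
Lemma reference_integral (j N : 'rV[R]_3 -> 'rV[R]_3) : observer T0 L ->
  the_embedding (sigma_hat X tau) = (j, N) -> isometric_embedding (sigma_hat X tau) (j, N) ->
  mu2.-integrable setT (EFin \o (fun z =>
    mean_curv (@euclid R 3) (j \o stereo true) (N \o stereo true) (rv2 z) * qhat true (rv2 z))) /\
  sphere_int (sigma X) (reference_density X T0 L tau) =
  \int[mu2]_z (mean_curv (@euclid R 3) (j \o stereo true) (N \o stereo true) (rv2 z) * qhat true (rv2 z)).
Proof.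
move=> ob eE emb; have [sk [C hC]] := embedding_curv_bounded emb pSh.
have [D hD] := qhat_decay; split.
  by apply: (sphere_density_integrable (sk true) (smooth_qhat true) hC _ hD) => v; exact: sqrtr_ge0.
case: (emb) => sjN _ iso nrm _.
have sj : smooth_mx setT (j \o stereo true) by move=> i k; rewrite (ord1 i); exact: (sjN k).1.
have sN : smooth_mx setT (N \o stereo true) by move=> i k; rewrite (ord1 i); exact: (sjN k).2.
have isoE v : jacobian (j \o stereo true) v *m (jacobian (j \o stereo true) v)^T =
    sigma X true v + (drow (tau \o stereo true) v)^T *m drow (tau \o stereo true) v.
  by have := iso true v; rewrite /Defs.induced /euclid mulmx1.
have nE v : (N \o stereo true) v *m (jacobian (j \o stereo true) v)^T = 0 by have [] := nrm true v.
apply: eq_Rintegral => z _.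
have := @reference_densityE R T0 L ob _ _ _ (sigma X true) sj sN (stau true) isoE nE (pS true) (rv2 z).
rewrite /reference_density eE /= => ->.
rewrite /qhat /sigma_hat /graph_metric (det_graph_surface _ (pS true (rv2 z))).
rewrite (mulrC (\det _)) sqrtrM; last by rewrite addr_ge0 // posdef_ge0 //; exact/posdef_inv/pS.
by rewrite mulrAC mulrC.
Qed.

(** The conformal metric and the graph metric agree on the boundary, so that both
    energies refer to the same embedding; the difference of the two integrals is the
    one estimated in [gauge_integral_le]. *)
Lemma brown_york_le_wang_yau : observer T0 L ->
  (exists e, isometric_embedding (sigma_hat X tau) e) ->
  (exists phi, canonical_gauge X tau phi) ->
  brown_york gs <= wang_yau X T0 L tau.
Proof.
move=> ob hemb hcan.
have emb : isometric_embedding (sigma_hat X tau) (the_embedding (sigma_hat X tau)).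
  by case: hemb => e he; exact: (xgetPex _ (ex_intro _ e he)).
have can : canonical_gauge X tau (the_canonical_gauge X tau).
  by case: hcan => e he; exact: (xgetPex _ (ex_intro _ e he)).
have gamE : (fun c => Defs.induced gs (stereo c)) = sigma_hat X tau.
  apply/funext => c; apply/funext => v; exact: (conformal_boundary hX VS VO sfV u1 f_tau).
case eE : (the_embedding (sigma_hat X tau)) emb => [j N] emb.
have [ik refE] := reference_integral ob eE emb.
rewrite /brown_york /wang_yau gamE eE refE /=.
apply: ler_wpM2l; first by rewrite invr_ge0 mulr_ge0 // pi_ge0.
rewrite /sphere_int.
have -> : \int[mu2]_z ((mean_curv (@euclid R 3) (j \o stereo true) (N \o stereo true) (rv2 z)
     - mean_curv gs (stereo true) (conormal gs (@sqn R 3) \o stereo true) (rv2 z)) *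
     Num.sqrt (\det (sigma_hat X tau true (rv2 z)))) =
   \int[mu2]_z (mean_curv (@euclid R 3) (j \o stereo true) (N \o stereo true) (rv2 z) * qhat true (rv2 z))
   - \int[mu2]_z (ksf true (rv2 z) * qhat true (rv2 z)).
  rewrite -(RintegralB measurableT ik ksf_integrable).
  by apply: eq_Rintegral => z _; rewrite mulrBl.
by rewrite lerB // gauge_integral_le.
Qed.
End Comparison.

Lemma open_pos (R : realType) n (W : set 'rV[R]_n) (h : 'rV[R]_n -> R) : open W -> smooth W h ->
  open (W `&` [set x | 0 < h x]).
Proof.
move=> oW sh; rewrite openE => x [Wx hx]; apply: filterI.
  by apply: open_nbhs_nbhs.
exact: (cvgr_gt _ (smooth_cont sh Wx) _ hx).
Qed.

Theorem theorem1p1 (R : realType) (S : spacetime R) (M : set S)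
    (X : 'rV[R]_3 -> S) (T0 : 'rV[R]_4) (L : 'M[R]_(3, 4))
    (tau f U : 'rV[R]_3 -> R)
    (hM : hypersurface M set0)
    (hDEC : dominant_energy_on M)
    (hOmega : ball_in M X)
    (hH : mean_curvature_spacelike X)
    (hT0 : observer T0 L)
    (hemb : forall t, admissible X t ->
       exists e, isometric_embedding (sigma_hat X t) e)
    (hcan : forall t, admissible X t -> exists phi, canonical_gauge X t phi)
    (htau : admissible X tau)
    (hmin : (wang_yau X T0 L tau)%:E =
       ereal_inf [set (wang_yau X T0 L t)%:E | t in admissible X])
    (hf : jang_solution X tau f) :
  let ghat := graph_metric (ind_metric X) f in
  forall (hUsmooth : smooth_near cball U)
    (hUpos : forall x, cball x -> 0 < U x)
    (hUeq : forall x, cball x ->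
       - 8 * laplacian ghat U x + scal ghat x * U x = 0)
    (hUbd : forall x, sphere x -> U x = 1),
  let gsf := fun x => U x ^+ 4 *: ghat x in
  (forall x, cball x -> scal gsf x = 0) /\
  brown_york gsf <= wang_yau X T0 L tau.
Proof.
move=> ghat [WU [oU BU sU]] hUpos hUeq hUbd gsf.
have [[W [BW hX]] _ XM] := hOmega; have [[Wf [oWf BWf sf]] ft jang] := hf.
have oW : open W by case: hX.
(* A common domain of the three extensions, on which the conformal factor is
   positive. *)
pose O := (W `&` Wf) `&` (WU `&` [set x | 0 < U x]).
have oO : open O by apply: openI; [exact: openI|exact: open_pos].
have BO : cball `<=` O by move=> x Bx; split; split; [exact: BW|exact: BWf|exact: BU|exact: hUpos].
have hXO : spacelike_immersion O X by apply: spacelike_immersion_sub hX => // x [[]].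
have sfO : smooth O f by apply: smooth_sub sf => x [[]].
have sUO : smooth O U by apply: smooth_sub sU => x [_ []].
have UO x : O x -> 0 < U x by case=> _ [].
have O0 : O 0 by apply: BO; rewrite /cball /= sqn0.
split.
  move=> x Bx; pose Od : opendom R 3 := OpenDom oO O0.
  have pgh y : Od y -> posdef (ghat y).
    by move=> Oy; apply: posdef_graph; case: hXO => _ _; apply.
  have sgh : smooth_mx Od ghat := smooth_graph oO (smooth_ind_metric hXO) sfO.
  by rewrite (scal_conformal sgh pgh sUO UO (BO x Bx)) hUeq // mulr0.
have [stau _ _] := htau.
apply: (brown_york_le_wang_yau oO BO hXO sfO sUO UO hUbd ft stau jang) => //.
- have oB : open [set x : 'rV[R]_3 | sqn x < 1] by exact: open_unit_ball.
  apply: hDEC; first by apply: spacelike_immersion_sub hXO => // x /ltW; exact: BO.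
  by move=> _ [x /ltW Bx <-]; apply: XM; exists x.
- exact: hemb.
- exact: hcan.
Qed.
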